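(* Let $\mathbb H=\{\tau\in\mathbb C:\operatorname{Im}\tau>0\}$ and $$ z(\tau)=9\,\frac{\eta^3(9\tau)}{\eta^3(\tau)}+1,\qquad \tau\in\mathbb H. $$ The function $$ \mathfrak u(\tau)=z(\tau)^{-\frac12}\cdot{}_2F_1\!\left(\tfrac12,\tfrac16;\tfrac76\,\Big|\,z(\tau)^{-3}\right), $$ understood by analytic continuation, is a solution of the Schwarz equation $$ [\mathfrak u,\tau]=-2\,\wp(2\mathfrak u;0,4), $$ where $\wp(\,\cdot\,;g_2,g_3)$ is the Weierstrass function satisfying $\wp'^2=4\wp^3-g_2\wp-g_3$.
   Context: For a nonconstant analytic function $f(\tau)$ (with $f_\tau\neq0$) put $$ [f,\tau]:=\frac{f_{\tau\tau\tau}}{f_\tau^{3}}-\frac32\,\frac{f_{\tau\tau}^{2}}{f_\tau^{4}}, $$ where subscripts denote derivatives with respect to $\tau$. The Dedekind eta-function is $\eta(\tau)=e^{\frac{\pi i}{12}\tau}\prod_{k\ge1}(1-e^{2\pi i k\tau})$. ${}_2F_1(\alpha,\beta;\gamma|x)$ is the Gauss hypergeometric function, given by its power series for $|x|<1$ and continued analytically. ''Understood by analytic continuation'' means: take the formula, using the power series and either branch of the square root, near a point of $\mathbb H$ where $|z(\tau)|>1$, and continue the resulting analytic germ along paths in $\mathbb H$. Any germ so obtained is meant. *)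

(* Defs.v *)
From Stdlib Require Import Reals ZArith Bool.
From Coquelicot Require Export Coquelicot.

Open Scope C_scope.

(** * Limits, finite products, exponential *)

(** Limit of a complex sequence. [Lim_seq] is total; the value is meaningful
    when the sequence converges, as all sequences used below do on the domains
    where they are evaluated. *)
Definition C_lim_seq (u : nat -> C) : C :=
  (real (Lim_seq (fun n => Re (u n))), real (Lim_seq (fun n => Im (u n)))).

(** [Cprod f n] is [f 0 * ... * f (n - 1)]. *)
Fixpoint Cprod (f : nat -> C) (n : nat) : C :=
  match n with
  | O => 1
  | S m => Cprod f m * f m
  end.

Definition Cexp (z : C) : C :=
  ((exp (Re z) * cos (Im z))%R, (exp (Re z) * sin (Im z))%R).

(** * The functions eta and z on the upper half-plane *)

Definition upper_half_plane (t : C) : Prop := (0 < Im t)%R.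

(** The factor with index [k] of the product is the one usually indexed by
    [k + 1]. *)
Definition eta (t : C) : C :=
  Cexp (PI * Ci / 12 * t) *
  C_lim_seq (Cprod (fun k => 1 - Cexp (2 * PI * Ci * INR (S k) * t))).

Definition zfun (t : C) : C := 9 * (eta (9 * t) ^ 3 / eta t ^ 3) + 1.

(** * The Gauss hypergeometric series *)

Definition pochhammer (a : C) (n : nat) : C := Cprod (fun k => a + INR k) n.

Definition hyp2F1 (a b c x : C) : C :=
  C_lim_seq (sum_n (fun n =>
    pochhammer a n * pochhammer b n / (pochhammer c n * INR (fact n)) * x ^ n)).

(** * The bracket [f, t] *)

Definition schwarz (f : C -> C) (t : C) : C :=
  let f1 := C_derive f in
  let f2 := C_derive f1 in
  let f3 := C_derive f2 in
  f3 t / f1 t ^ 3 - 3 / 2 * (f2 t ^ 2 / f1 t ^ 4).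

(** * The Weierstrass function *)

Definition lattice_point (w1 w2 : C) (m n : Z) : C := IZR m * w1 + IZR n * w2.

Definition in_lattice (w1 w2 w : C) : Prop :=
  exists m n : Z, w = lattice_point w1 w2 m n.

Definition R_independent (w1 w2 : C) : Prop :=
  forall a b : R, RtoC a * w1 + RtoC b * w2 = 0 -> a = 0%R /\ b = 0%R.

(** Sum of [f k] over the integers [k] with [-N <= k <= N]. *)
Definition sum_sym (f : Z -> C) (N : nat) : C :=
  sum_n (fun i => f (Z.of_nat i - Z.of_nat N)%Z) (2 * N).

Definition wp_term (w1 w2 z : C) (m n : Z) : C :=
  if (Z.eqb m 0 && Z.eqb n 0)%bool then 0
  else 1 / (z - lattice_point w1 w2 m n) ^ 2 - 1 / lattice_point w1 w2 m n ^ 2.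

(** The lattice series converges absolutely off the lattice, so summing over
    growing squares of indices gives its sum. *)
Definition wp (w1 w2 z : C) : C :=
  1 / z ^ 2 +
  C_lim_seq (fun N => sum_sym (fun m => sum_sym (wp_term w1 w2 z m) N) N).

(** [wp w1 w2] is the Weierstrass function with invariants [g2] and [g3]. *)
Definition wp_invariants (w1 w2 g2 g3 : C) : Prop :=
  R_independent w1 w2 /\
  forall z : C, ~ in_lattice w1 w2 z ->
    exists d : C,
      is_derive (wp w1 w2) z d /\
      d ^ 2 = 4 * wp w1 w2 z ^ 3 - g2 * wp w1 w2 z - g3.

(** * Analytic continuation *)

Definition analytic_at (f : C -> C) (t : C) : Prop :=
  exists (a : nat -> C) (r : posreal),
    forall w : C, (Cmod (w - t) < r)%R -> is_pseries a (w - t) (f w).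

Definition unit_interval (s : R) : Prop := (0 <= s <= 1)%R.

(** [F s] represents the germ at [gamma s]; only its values near [gamma s]
    matter. *)
Definition continuation_along (gamma : R -> C) (F : R -> C -> C) : Prop :=
  (forall s, unit_interval s -> analytic_at (F s) (gamma s)) /\
  (forall s, unit_interval s ->
     exists delta : posreal, forall s', unit_interval s' ->
       (Rabs (s' - s) < delta)%R ->
       locally (gamma s') (fun w => F s' w = F s w)).

(** [f] is, near [t0], given by the defining formula of the function [u], with
    [r] either branch of [z ^ (-1/2)]. *)
Definition initial_germ (f : C -> C) (t0 : C) : Prop :=
  (1 < Cmod (zfun t0))%R /\
  exists r : C -> C,
    locally t0 (fun t =>
      continuous r t /\
      r t ^ 2 = / zfun t /\
      f t = r t * hyp2F1 (1 / 2) (1 / 6) (7 / 6) (/ zfun t ^ 3)).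

(** [u] represents a germ at [t] obtained from an initial germ by analytic
    continuation along a path in the upper half-plane. *)
Definition u_germ (u : C -> C) (t : C) : Prop :=
  exists (gamma : R -> C) (F : R -> C -> C),
    continuous_on unit_interval gamma /\
    (forall s, unit_interval s -> upper_half_plane (gamma s)) /\
    continuation_along gamma F /\
    initial_germ (F 0%R) (gamma 0%R) /\
    gamma 1%R = t /\
    locally t (fun w => u w = F 1%R w).

(* Main.v *)
Require Import Defs.
From Stdlib Require Import Reals ZArith List Permutation FinFun Lia Lra Psatz Bool
  FunctionalExtensionality Arith Ring InitialRing Setoid Classical.
From Coquelicot Require Import Coquelicot.

Open Scope C_scope.

(** With [f = eta(3 tau)^4] and [kap = i sqrt(3) pi] one has [z'^2 = 4 (z^3 - 1) (kap f)^2], so that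
    [z^(-1/2) 2F1(1/2, 1/6; 7/6; z^(-3))], which integrates [dz / sqrt(4 z^3 - 4)] from infinity, is up to
    sign and an additive constant a primitive [Gfun] of [kap f] on the whole half-plane; hence [z = wp(u)].
    The bracket of such a primitive is an explicit expression in [f] and [E_2(3 tau)], equal to [-2] times
    [(z^4 + 8 z) / (4 (z^3 - 1))], which is [wp(2 u)] by the duplication formula.

    The identities between [eta(tau)], [eta(3 tau)], [eta(9 tau)] behind this are proved without modular
    forms. Van der Pol's convolution identity for the divisor sum gives Chazy's equation for [E_2]. A formal
    solution [(t, g, p)] of the differential system that [eta(9 tau)^3 / eta(tau)^3], [eta(tau)^6 / eta(3 tau)^2]
    and [E_2(3 tau)] should satisfy produces three solutions of Chazy's equation, which by uniqueness are [E_2(tau)],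
    [3 E_2(3 tau)], [9 E_2(9 tau)]; logarithmic derivatives then identify [t] and [g].

    As [wp] is only known through its lattice series and its differential equation, [wp(u) = z] and
    [wp(2 u) = (z^4 + 8 z) / (4 (z^3 - 1))] are first shown near the pole of [wp], and then carried along
    segments by uniqueness for [wp'' = 6 wp^2]. *)

(** The bracket is the Schwarzian derivative divided by the square of the first derivative, so it
    does not change when [f] changes sign or a constant is added: the left side is the same for
    every germ. The right side does depend on the constant; the constant is never computed and
    enters only through [wp(u) = z]. Two obstacles shape the rest. In place of modular
    transformations there are differential equations for series in [q], and such an equation
    determines a series up to one resonant coefficient. For the three solutions of Chazy's equation
    its index is the constant term, 1, 3 or 9; the first such coefficient is read off directly, the
    other two come from quadratic relations of weight 4. Secondly, the hypothesis on [wp] gives its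
    derivative at each point only up to sign. Darboux's theorem makes the sign locally constant, and
    [wp'' = 6 wp^2] is then obtained only where [wp'] is nonzero. As [wp'(2u)] can vanish in the
    half-plane, the propagation has to pass isolated zeros. *)

Section Van_der_Pol.
Local Open Scope Z_scope.

(** * Finite integer sums and van der Pol's identity *)

Fixpoint zsum {A : Type} (l : list A) (f : A -> Z) : Z :=
  match l with nil => 0 | x :: l' => f x + zsum l' f end.

Lemma zsum_ext_in {A} (l : list A) f g :
  (forall x, In x l -> f x = g x) -> zsum l f = zsum l g.
Proof.
  induction l as [|x l IH]; simpl; intros H; auto.
  rewrite (H x) by auto. rewrite IH; auto.
Qed.

Lemma zsum_ext {A} (l : list A) f g : (forall x, f x = g x) -> zsum l f = zsum l g.
Proof. intros; apply zsum_ext_in; auto. Qed.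

Lemma zsum_app {A} (l l' : list A) f : zsum (l ++ l') f = zsum l f + zsum l' f.
Proof. induction l; simpl; lia. Qed.

Lemma zsum_map {A B} (h : A -> B) l f : zsum (map h l) f = zsum l (fun x => f (h x)).
Proof. induction l; simpl; auto. rewrite IHl; auto. Qed.

Lemma zsum_plus {A} (l : list A) f g : zsum l (fun x => f x + g x) = zsum l f + zsum l g.
Proof. induction l; simpl; lia. Qed.

Lemma zsum_scal {A} (l : list A) c f : zsum l (fun x => c * f x) = c * zsum l f.
Proof. induction l; simpl; lia. Qed.

Lemma zsum_0 {A} (l : list A) : zsum l (fun _ => 0) = 0.
Proof. induction l; simpl; lia. Qed.

Lemma zsum_filter {A} (p : A -> bool) l f :
  zsum (filter p l) f = zsum l (fun x => if p x then f x else 0).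
Proof. induction l as [|x l IH]; simpl; auto. destruct (p x); simpl; lia. Qed.

Lemma zsum_list_prod {A B} (l : list A) (l' : list B) f :
  zsum (list_prod l l') f = zsum l (fun x => zsum l' (fun y => f (x, y))).
Proof.
  induction l; simpl; auto. rewrite zsum_app, zsum_map, IHl. reflexivity.
Qed.

Lemma zsum_swap {A B} (l : list A) (l' : list B) (f : A -> B -> Z) :
  zsum l (fun x => zsum l' (f x)) = zsum l' (fun y => zsum l (fun x => f x y)).
Proof.
  induction l; simpl. - now rewrite zsum_0. - rewrite IHl, zsum_plus; auto.
Qed.

Lemma zsum_perm {A} (l l' : list A) f : Permutation l l' -> zsum l f = zsum l' f.
Proof. induction 1; simpl; lia. Qed.

Lemma zsum_involution {A} (l : list A) (s : A -> A) f :
  NoDup l -> (forall x, In x l -> In (s x) l /\ s (s x) = x) ->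
  zsum l (fun x => f (s x)) = zsum l f.
Proof.
  intros Hn Hs. rewrite <- (zsum_map s). apply zsum_perm, NoDup_Permutation; auto.
  - apply Injective_map_NoDup_in; auto.
    intros x y Hx Hy E. rewrite <- (proj2 (Hs x Hx)), E. apply Hs; auto.
  - intros x; rewrite in_map_iff; split.
    + intros (y & <- & Hy). apply Hs; auto.
    + intros Hx. exists (s x). split; apply Hs; auto.
Qed.

Lemma zsum_single (l : list Z) k f :
  NoDup l -> In k l -> zsum l (fun j => if k =? j then f j else 0) = f k.
Proof.
  induction l as [|x l IH]; simpl; intros Hn Hk; [easy|].
  inversion Hn; subst.
  destruct (Z.eqb_spec k x) as [->|Hne].
  - rewrite (zsum_ext_in l _ (fun _ => 0)); [rewrite zsum_0; lia|].
    intros j Hj. destruct (Z.eqb_spec x j); subst; easy.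
  - destruct Hk as [->|Hk]; [easy|]. rewrite IH; auto; lia.
Qed.

Definition range (n : nat) : list Z := map Z.of_nat (seq 1 n).

Lemma in_range n k : In k (range n) <-> 1 <= k <= Z.of_nat n.
Proof.
  unfold range. rewrite in_map_iff. split.
  - intros (j & <- & Hj). apply in_seq in Hj. lia.
  - intros H. exists (Z.to_nat k). split; [lia|]. apply in_seq; lia.
Qed.

Lemma NoDup_range n : NoDup (range n).
Proof. apply Injective_map_NoDup; [intros x y; lia|apply seq_NoDup]. Qed.

Definition quads (n : nat) : list (Z * Z * Z * Z) :=
  filter (fun '(a, b, x, y) => a * x + b * y =? Z.of_nat n)
    (list_prod (list_prod (list_prod (range n) (range n)) (range n)) (range n)).

Lemma NoDup_list_prod' {A B} (l : list A) (l' : list B) :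
  NoDup l -> NoDup l' -> NoDup (list_prod l l').
Proof.
  intros H H'. induction H as [|x l Hx H IH]; simpl; [constructor|].
  apply NoDup_app; auto.
  - apply Injective_map_NoDup; auto. intros u v E; now inversion E.
  - intros [u v] Hu Hv. apply in_prod_iff in Hv. apply in_map_iff in Hu.
    destruct Hu as (w & E & _). inversion E; subst; tauto.
Qed.

Lemma NoDup_quads n : NoDup (quads n).
Proof. apply NoDup_filter. repeat apply NoDup_list_prod'; apply NoDup_range. Qed.

Lemma in_quads n a b x y : In (a, b, x, y) (quads n) <->
  (0 < a /\ 0 < b /\ 0 < x /\ 0 < y /\ a * x + b * y = Z.of_nat n).
Proof.
  unfold quads. rewrite filter_In, !in_prod_iff, !in_range, Z.eqb_eq.
  split; [lia|]. intros (?&?&?&?&?). repeat split; nia.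
Qed.

(* Found by linear algebra so that [H42 p - H42 (invol_U (invol_T p))] is 12 times the weight of van der
   Pol's identity. In the sum of [Hsum] only [a = b] survives, since [Hsum] is odd under [invol_U], which
   maps [{b < a}] to itself. *)
Definition H42 (p : Z * Z * Z * Z) : Z := let '(a, b, x, y) := p in
  b^4*y^2 - 6*a*b^3*y^2 - 8*a*b^3*x*y + 6*a^2*b^2*y^2 + 18*a^2*b^2*x*y + 6*a^2*b^2*x^2
  - 8*a^3*b*x*y - 6*a^3*b*x^2 + a^4*x^2.

(** Rests on [a x + b y = (x + y) b + x (a - b)]. Positivity of the last coordinate confines it to
    [{b < a}], whereas [invol_S] and [invol_T] act on all of [quads n]. *)
Definition invol_U (p : Z * Z * Z * Z) : Z * Z * Z * Z :=
  let '(a, b, x, y) := p in (x + y, x, b, a - b).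
Definition invol_S (p : Z * Z * Z * Z) : Z * Z * Z * Z :=
  let '(a, b, x, y) := p in (b, a, y, x).
Definition invol_T (p : Z * Z * Z * Z) : Z * Z * Z * Z :=
  let '(a, b, x, y) := p in (x, y, a, b).

Definition Hsum p := H42 p - H42 (invol_U p).

Lemma Hsum_U p : Hsum (invol_U p) = - Hsum p.
Proof. destruct p as [[[a b] x] y]. unfold Hsum, H42, invol_U. ring. Qed.

Lemma Hsum_S p : Hsum (invol_S p) = Hsum p.
Proof. destruct p as [[[a b] x] y]. unfold Hsum, H42, invol_U, invol_S. ring. Qed.

Definition vdp_weight (p : Z * Z * Z * Z) : Z := let '(a, b, x, y) := p in
  a * b * (5 * (a * x) * (b * y) - (a * x + b * y) ^ 2).

(** As [invol_T] permutes [quads n], the term [H42 (invol_U p)] may be replaced under the sum by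
    [H42 (invol_U (invol_T p))]; after that the identity holds term by term. *)
Lemma Hsum_weight n : zsum (quads n) Hsum = 12 * zsum (quads n) vdp_weight.
Proof.
  rewrite <- zsum_scal.
  transitivity (zsum (quads n) H42 + zsum (quads n) (fun p => - H42 (invol_U (invol_T p)))).
  - rewrite (zsum_involution (quads n) invol_T (fun p => - H42 (invol_U p))).
    + rewrite <- zsum_plus. apply zsum_ext; intros; unfold Hsum; ring.
    + apply NoDup_quads.
    + intros [[[a b] x] y]; unfold invol_T; rewrite !in_quads; repeat split; try tauto; nia.
  - rewrite <- zsum_plus. apply zsum_ext. intros [[[a b] x] y].
    unfold H42, vdp_weight, invol_U, invol_T. ring.
Qed.

(** The part [a < b] is the image of the part [b < a] under [invol_S], which preserves [Hsum], so
    both vanish together. *)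
Lemma Hsum_diagonal n : zsum (quads n) Hsum =
  zsum (quads n) (fun p => let '(a, b, _, _) := p in if a =? b then Hsum p else 0).
Proof.
  set (gt (p : Z * Z * Z * Z) := let '(a, b, _, _) := p in b <? a).
  assert (E : zsum (filter gt (quads n)) Hsum = 0).
  { assert (zsum (filter gt (quads n)) (fun p => Hsum (invol_U p)) =
            zsum (filter gt (quads n)) Hsum).
    { apply zsum_involution; [apply NoDup_filter, NoDup_quads|].
      intros [[[a b] x] y]. unfold gt, invol_U. rewrite !filter_In, !in_quads, !Z.ltb_lt.
      intros H; repeat split; try nia. repeat f_equal; lia. }
    rewrite (zsum_ext _ _ (fun p => (-1) * Hsum p)), zsum_scal in H; [lia|].
    intros; rewrite Hsum_U; ring. }
  rewrite zsum_filter in E.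
  assert (E' := zsum_involution (quads n) invol_S (fun x => if gt x then Hsum x else 0)).
  rewrite E in E'.
  transitivity (zsum (quads n) (fun p => (if gt p then Hsum p else 0) +
    ((if gt (invol_S p) then Hsum (invol_S p) else 0) +
      (let '(a, b, _, _) := p in if a =? b then Hsum p else 0)))).
  - apply zsum_ext. intros [[[a b] x] y]. rewrite Hsum_S. unfold gt, invol_S.
    destruct (Z.ltb_spec b a), (Z.ltb_spec a b), (Z.eqb_spec a b); lia.
  - rewrite !zsum_plus, E, E'; [lia|apply NoDup_quads|].
    intros [[[a b] x] y]; unfold invol_S; rewrite !in_quads; repeat split; try tauto; nia.
Qed.

Lemma zsum_quads n f : zsum (quads n) f =
  zsum (range n) (fun a => zsum (range n) (fun b => zsum (range n) (fun x =>
   zsum (range n) (fun y => if a * x + b * y =? Z.of_nat n then f (a, b, x, y) else 0)))).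
Proof. unfold quads. rewrite zsum_filter, !zsum_list_prod. reflexivity. Qed.

Lemma range_S n : range (S n) = range n ++ (Z.of_nat (S n) :: nil).
Proof. unfold range. rewrite seq_S, map_app. reflexivity. Qed.

Lemma zsum_range_S n f : zsum (range (S n)) f = zsum (range n) f + f (Z.of_nat (S n)).
Proof. rewrite range_S, zsum_app. cbn [zsum]. ring. Qed.

Lemma zsum_range_restrict n m f : (m <= n)%nat ->
  zsum (range n) (fun x => if x <=? Z.of_nat m then f x else 0) = zsum (range m) f.
Proof.
  induction 1 as [|n Hn IH].
  - apply zsum_ext_in. intros x Hx%in_range. destruct (Z.leb_spec x (Z.of_nat m)); lia.
  - rewrite zsum_range_S, IH; cbv beta. destruct (Z.leb_spec (Z.of_nat (S n)) (Z.of_nat m)); lia.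
Qed.

Lemma zsum_antidiagonal n m f : (1 <= m <= n)%nat ->
  zsum (range n) (fun x => zsum (range n) (fun y => if x + y =? Z.of_nat m then f x else 0))
  = zsum (range (m - 1)) f.
Proof.
  intros Hm. rewrite <- (zsum_range_restrict n (m - 1)) by lia.
  apply zsum_ext_in. intros x Hx%in_range.
  destruct (Z.leb_spec x (Z.of_nat (m - 1))).
  - transitivity (zsum (range n) (fun y => if Z.of_nat m - x =? y then f x else 0)).
    + apply zsum_ext. intros y. destruct (Z.eqb_spec (x + y) (Z.of_nat m)), (Z.eqb_spec (Z.of_nat m - x) y); lia.
    + apply (zsum_single _ _ (fun _ => f x)); [apply NoDup_range|apply in_range; lia].
  - rewrite (zsum_ext_in _ _ (fun _ => 0)); [apply zsum_0|].
    intros y Hy%in_range. destruct (Z.eqb_spec (x + y) (Z.of_nat m)); lia.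
Qed.

(** On the diagonal [a = b] the constraint is [a (x + y) = n]. Here [m] stands for [x + y], and [k]
    will be [m - 1]. *)
Lemma Hsum_inner a m k :
  zsum (range k) (fun x => a^4*m^2 - a^2 * (6*m^2*x^2 - 6*m^3*x + m^4)) =
  a^4*m^2*Z.of_nat k - a^2 * (m^2*Z.of_nat k*(Z.of_nat k+1)*(2*Z.of_nat k+1) - 3*m^3*Z.of_nat k*(Z.of_nat k+1) + m^4*Z.of_nat k).
Proof.
  induction k; [simpl; ring|]. rewrite zsum_range_S, IHk, Nat2Z.inj_succ. unfold Z.succ. ring.
Qed.

(** For [1 <= k <= N] this is the sum of the divisors of [k]; the common bound [N] lets sums for
    different [k] range over the same lists. *)
Definition sigma (N : nat) (k : Z) : Z :=
  zsum (range N) (fun a => zsum (range N) (fun x => if a * x =? k then a else 0)).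

(** Groups the pairs [(x, y)] by [m = x + y]; for fixed [m] the variable [x] then runs from 1 to
    [m - 1]. *)
Lemma zsum_sum_indicator n a f : (1 <= a) ->
  zsum (range n) (fun x => zsum (range n) (fun y =>
    if a * x + a * y =? Z.of_nat n then f x (x + y) else 0)) =
  zsum (range n) (fun m => if a * m =? Z.of_nat n then
     zsum (range (Z.to_nat m - 1)) (fun x => f x m) else 0).
Proof.
  intros Ha.
  transitivity (zsum (range n) (fun x => zsum (range n) (fun y => zsum (range n) (fun m =>
    if x + y =? m then (if a * m =? Z.of_nat n then f x m else 0) else 0)))).
  - apply zsum_ext_in; intros x Hx%in_range. apply zsum_ext_in; intros y Hy%in_range.
    destruct (Z.leb_spec (x + y) (Z.of_nat n)).
    + rewrite zsum_single; [|apply NoDup_range|apply in_range; lia].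
      replace (a * (x + y)) with (a * x + a * y) by ring. reflexivity.
    + rewrite (zsum_ext_in (range n) _ (fun _ => 0)).
      * rewrite zsum_0. destruct (Z.eqb_spec (a * x + a * y) (Z.of_nat n)); nia.
      * intros m Hm%in_range. destruct (Z.eqb_spec (x + y) m); lia.
  - rewrite (zsum_ext _ _ _ (fun x => zsum_swap (range n) (range n) _)), zsum_swap.
    apply zsum_ext_in. intros m Hm%in_range.
    destruct (Z.eqb_spec (a * m) (Z.of_nat n)).
    + rewrite <- (zsum_antidiagonal n (Z.to_nat m)) by lia. rewrite Z2Nat.id by lia. reflexivity.
    + rewrite (zsum_ext _ _ (fun _ => 0)); [apply zsum_0|]. intros x.
      rewrite (zsum_ext _ _ (fun _ => 0)); [apply zsum_0|]. intros y.
      destruct (x + y =? m); auto.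
Qed.

Lemma vdp_quads n : (1 <= n)%nat ->
  12 * zsum (quads n) vdp_weight = Z.of_nat n ^ 2 * (Z.of_nat n - 1) * sigma n (Z.of_nat n).
Proof.
  intros Hn. rewrite <- Hsum_weight, Hsum_diagonal, zsum_quads.
  transitivity (zsum (range n) (fun a => zsum (range n) (fun x => zsum (range n) (fun y =>
    if a * x + a * y =? Z.of_nat n then
      a^4*(x+y)^2 - a^2 * (6*(x+y)^2*x^2 - 6*(x+y)^3*x + (x+y)^4) else 0)))).
  { apply zsum_ext_in; intros a Ha.
    rewrite <- (zsum_single (range n) a (fun _ => zsum (range n) (fun x => zsum (range n) (fun y =>
      if a * x + a * y =? Z.of_nat n then
      a^4*(x+y)^2 - a^2 * (6*(x+y)^2*x^2 - 6*(x+y)^3*x + (x+y)^4) else 0)))); auto using NoDup_range.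
    apply zsum_ext; intros b. destruct (Z.eqb_spec a b) as [<-|Hab].
    - apply zsum_ext; intros x. apply zsum_ext; intros y.
      destruct (a * x + a * y =? Z.of_nat n); auto. unfold Hsum, H42, invol_U. ring.
    - rewrite (zsum_ext _ _ (fun _ => 0)); [apply zsum_0|]. intros x.
      rewrite (zsum_ext _ _ (fun _ => 0)); [apply zsum_0|]. intros y.
      destruct (_ =? _); auto. }
  (* The sum over [x] is [Hsum_inner] at [k = m - 1], and [a m = n] turns the factor [a^2 m^2] into
     [n^2]. *)
  transitivity (zsum (range n) (fun a => zsum (range n) (fun m => if a * m =? Z.of_nat n then
     Z.of_nat n ^ 2 * (Z.of_nat n * a - a^2 + m^2 - m) else 0))).
  { apply zsum_ext_in; intros a Ha%in_range.
    rewrite (zsum_sum_indicator n a (fun x m => a^4*m^2 - a^2 * (6*m^2*x^2 - 6*m^3*x + m^4))) by lia.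
    apply zsum_ext_in; intros m Hm%in_range. destruct (Z.eqb_spec (a * m) (Z.of_nat n)) as [<-|]; auto.
    rewrite Hsum_inner. replace (Z.of_nat (Z.to_nat m - 1)) with (m - 1) by lia. ring. }
  (* Exchanging a divisor [a] with its cofactor [m] cancels [a^2] against [m^2] and turns the sum of
     [m] into [sigma]. *)
  assert (Hsw : forall f : Z -> Z,
    zsum (range n) (fun a => zsum (range n) (fun m => if a * m =? Z.of_nat n then f m else 0)) =
    zsum (range n) (fun a => zsum (range n) (fun m => if a * m =? Z.of_nat n then f a else 0))).
  { intros f. rewrite zsum_swap. apply zsum_ext; intros a. apply zsum_ext; intros m.
    rewrite (Z.mul_comm m a). reflexivity. }
  set (A (f : Z -> Z -> Z) := zsum (range n) (fun a => zsum (range n) (fun m => if a * m =? Z.of_nat n then f a m else 0))).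
  assert (HA : forall f g, A (fun a m => f a m + g a m) = A f + A g).
  { intros f g. unfold A. rewrite <- zsum_plus. apply zsum_ext; intros a. rewrite <- zsum_plus.
    apply zsum_ext; intros m. destruct (_ =? _); lia. }
  assert (HS : forall c f, A (fun a m => c * f a m) = c * A f).
  { intros c f. unfold A. rewrite <- zsum_scal. apply zsum_ext; intros a. rewrite <- zsum_scal.
    apply zsum_ext; intros m. destruct (_ =? _); lia. }
  change (A (fun a m => Z.of_nat n ^ 2 * (Z.of_nat n * a - a^2 + m^2 - m)) =
     Z.of_nat n ^ 2 * (Z.of_nat n - 1) * A (fun a m => a)).
  rewrite HS.
  assert (E : A (fun a m => Z.of_nat n * a - a^2 + m^2 - m) =
     Z.of_nat n * A (fun a _ => a) + (-1) * A (fun a _ => a^2) + A (fun _ m => m^2) + (-1) * A (fun _ m => m)).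
  { rewrite <- !HS, <- !HA. unfold A. apply zsum_ext; intros a. apply zsum_ext; intros m.
    destruct (_ =? _); ring. }
  rewrite E. change (A (fun _ m => m^2)) with
   (zsum (range n) (fun a => zsum (range n) (fun m => if a * m =? Z.of_nat n then (fun x => x^2) m else 0))).
  change (A (fun _ m => m)) with
   (zsum (range n) (fun a => zsum (range n) (fun m => if a * m =? Z.of_nat n then (fun x => x) m else 0))).
  rewrite !Hsw. fold (A (fun a _ => a)) (A (fun a _ => a^2)). ring.
Qed.

Lemma zsum_mult {A B} (l : list A) (l' : list B) f g :
  zsum l f * zsum l' g = zsum l (fun x => zsum l' (fun y => f x * g y)).
Proof. induction l; simpl; [reflexivity|]. rewrite <- IHl, zsum_scal. ring. Qed.

(** Van der Pol's convolution identity. *)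
Theorem sigma_convolution n : (1 <= n)%nat ->
  12 * zsum (range n) (fun k => (5 * k * (Z.of_nat n - k) - Z.of_nat n ^ 2)
     * (sigma n k * sigma n (Z.of_nat n - k))) =
  Z.of_nat n ^ 2 * (Z.of_nat n - 1) * sigma n (Z.of_nat n).
Proof.
  intros Hn. rewrite <- vdp_quads by auto. f_equal. rewrite zsum_quads.
  transitivity (zsum (range n) (fun a => zsum (range n) (fun b => zsum (range n) (fun x =>
    zsum (range n) (fun y => zsum (range n) (fun k =>
     if a * x =? k then if a * x + b * y =? Z.of_nat n then vdp_weight (a, b, x, y) else 0 else 0)))))).
  - transitivity (zsum (range n) (fun k => zsum (range n) (fun a => zsum (range n) (fun b =>
      zsum (range n) (fun x => zsum (range n) (fun y =>
     if a * x =? k then if a * x + b * y =? Z.of_nat n then vdp_weight (a, b, x, y) else 0 else 0)))))).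
    + apply zsum_ext; intros k. unfold sigma. rewrite zsum_mult, <- zsum_scal.
      apply zsum_ext; intros a. rewrite <- zsum_scal. apply zsum_ext; intros b.
      rewrite zsum_mult, <- zsum_scal. apply zsum_ext; intros x.
      rewrite <- zsum_scal. apply zsum_ext; intros y.
      destruct (Z.eqb_spec (a * x) k) as [<-|]; [|ring].
      destruct (Z.eqb_spec (b * y) (Z.of_nat n - a * x)), (Z.eqb_spec (a * x + b * y) (Z.of_nat n)); try lia.
      unfold vdp_weight. replace (Z.of_nat n) with (a * x + b * y) by lia. ring.
    + rewrite zsum_swap. apply zsum_ext; intros a. rewrite zsum_swap. apply zsum_ext; intros b.
      rewrite zsum_swap. apply zsum_ext; intros x. apply zsum_swap.
  - apply zsum_ext_in; intros a Ha%in_range. apply zsum_ext_in; intros b Hb%in_range.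
    apply zsum_ext_in; intros x Hx%in_range. apply zsum_ext_in; intros y Hy%in_range.
    destruct (Z.eqb_spec (a * x + b * y) (Z.of_nat n)).
    + apply (zsum_single (range n) (a * x) (fun _ => vdp_weight (a, b, x, y))); auto using NoDup_range.
      apply in_range; nia.
    + rewrite (zsum_ext _ _ (fun _ => 0)); [apply zsum_0|]. intros k. destruct (_ =? _); auto.
Qed.
End Van_der_Pol.

(** * Finite sums of complex numbers *)

Fixpoint Csum (f : nat -> C) (n : nat) : C :=
  match n with O => 0 | S m => Csum f m + f m end.

Lemma Csum_ext (f g : nat -> C) n : (forall k, (k < n)%nat -> f k = g k) -> Csum f n = Csum g n.
Proof. induction n; simpl; intros H; auto. rewrite IHn, H; auto. Qed.

Lemma Csum_plus f g n : Csum (fun k => f k + g k) n = Csum f n + Csum g n.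
Proof. induction n; simpl; [|rewrite IHn]; ring. Qed.

Lemma Csum_scal c f n : Csum (fun k => c * f k) n = c * Csum f n.
Proof. induction n; simpl; [|rewrite IHn]; ring. Qed.

Lemma Csum_0 (f : nat -> C) n : (forall k, (k < n)%nat -> f k = 0) -> Csum f n = 0.
Proof. induction n; simpl; intros H; auto. rewrite IHn, H; auto. ring. Qed.

Lemma Csum_shift f n : Csum f (S n) = f O + Csum (fun k => f (S k)) n.
Proof. induction n; [simpl; ring|]. change (Csum f (S (S n))) with (Csum f (S n) + f (S n)).
  rewrite IHn. simpl. ring. Qed.

Lemma Csum_rev f n : Csum f (S n) = Csum (fun k => f (n - k)%nat) (S n).
Proof.
  revert f; induction n; intros f; [simpl; ring|].
  rewrite (Csum_shift (fun k => f (S n - k)%nat)), Nat.sub_0_r.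
  change (Csum f (S (S n))) with (Csum f (S n) + f (S n)). rewrite IHn.
  rewrite Cplus_comm. f_equal; auto.
Qed.

Lemma Csum_triangle (f : nat -> nat -> C) n :
  Csum (fun k => Csum (fun j => f j k) (S k)) n =
  Csum (fun j => Csum (fun i => f j (j + i)%nat) (n - j)) n.
Proof.
  induction n; [reflexivity|].
  change (Csum (fun k => Csum (fun j => f j k) (S k)) (S n)) with
    (Csum (fun k => Csum (fun j => f j k) (S k)) n + (Csum (fun j => f j n) n + f n n)).
  rewrite IHn.
  change (Csum (fun j => Csum (fun i => f j (j + i)%nat) (S n - j)) (S n)) with
   (Csum (fun j => Csum (fun i => f j (j + i)%nat) (S n - j)) n +
     Csum (fun i => f n (n + i)%nat) (S n - n)).
  replace (S n - n)%nat with 1%nat by lia. simpl (Csum (fun i => f n (n + i)%nat) 1).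
  rewrite Nat.add_0_r, Cplus_assoc, <- Csum_plus, Cplus_0_l. f_equal. apply Csum_ext. intros k Hk.
  rewrite Nat.sub_succ_l by lia. simpl. do 2 f_equal; lia.
Qed.

(** * Formal power series *)

Definition fps := nat -> C.
Declare Scope fps_scope.
Delimit Scope fps_scope with fps.
Bind Scope fps_scope with fps.

Definition fcst (c : C) : fps := fun n => match n with O => c | _ => 0 end.
Definition fadd (a b : fps) : fps := fun n => a n + b n.
Definition fopp (a : fps) : fps := fun n => - a n.
Definition fsub (a b : fps) : fps := fun n => a n - b n.
Definition fmul (a b : fps) : fps := fun n => Csum (fun k => a k * b (n - k)%nat) (S n).
Definition fZ (z : Z) : fps := fcst (IZR z).
Fixpoint fpow (a : fps) (n : nat) : fps := match n with O => fZ 1 | S m => fmul a (fpow a m) end.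

Infix "+" := fadd : fps_scope.
Infix "-" := fsub : fps_scope.
Infix "*" := fmul : fps_scope.
Notation "- a" := (fopp a) : fps_scope.
Infix "^" := fpow : fps_scope.

Lemma fps_ext (a b : fps) : (forall n, a n = b n) -> a = b.
Proof. apply functional_extensionality. Qed.

Lemma fmulC a b : fmul a b = fmul b a.
Proof.
  apply fps_ext; intros n. unfold fmul. rewrite Csum_rev. apply Csum_ext. intros k Hk.
  replace (n - (n - k))%nat with k by lia. ring.
Qed.

Lemma fmulA a b c : fmul a (fmul b c) = fmul (fmul a b) c.
Proof.
  apply fps_ext; intros n. unfold fmul. symmetry.
  rewrite (Csum_ext _ (fun k => Csum (fun j => a j * b (k - j)%nat * c (n - k)%nat) (S k))).
  2:{ intros k _. rewrite Cmult_comm, <- Csum_scal. apply Csum_ext; intros; ring. }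
  rewrite (Csum_triangle (fun j k => a j * b (k - j)%nat * c (n - k)%nat)).
  apply Csum_ext. intros j Hj. rewrite <- Csum_scal.
  replace (S n - j)%nat with (S (n - j)) by lia.
  apply Csum_ext. intros i Hi. replace (j + i - j)%nat with i by lia.
  replace (n - (j + i))%nat with (n - j - i)%nat by lia. ring.
Qed.

Lemma fcst_mul c a n : fmul (fcst c) a n = c * a n.
Proof.
  unfold fmul. rewrite Csum_shift. assert (E : Csum (fun k => fcst c (S k) * a (n - S k)%nat) n = 0).
  { apply Csum_0; intros; simpl; ring. }
  rewrite E, Nat.sub_0_r. simpl; ring.
Qed.

Lemma fps_ring : ring_theory (fZ 0) (fZ 1) fadd fmul fsub fopp eq.
Proof.
  constructor; intros.
  1-3: apply fps_ext; intros [|n]; unfold fadd, fZ, fcst; ring.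
  - apply fps_ext; intros n. unfold fZ. rewrite fcst_mul. ring.
  - apply fmulC.
  - apply fmulA.
  - apply fps_ext; intros n. unfold fmul, fadd. rewrite <- Csum_plus. apply Csum_ext; intros; ring.
  - reflexivity.
  - apply fps_ext; intros [|n]; unfold fadd, fopp, fZ, fcst; ring.
Qed.

(** Through this morphism [ring] computes with integer constants inside power series, which the
    identities with large coefficients below rely on. *)
Lemma fZ_morph : ring_morph (fZ 0) (fZ 1) fadd fmul fsub fopp eq
  0%Z 1%Z Z.add Z.mul Z.sub Z.opp Z.eqb fZ.
Proof.
  constructor; auto; intros.
  1,2,4: apply fps_ext; intros [|n]; unfold fZ, fadd, fsub, fopp, fcst;
    rewrite ?plus_IZR, ?minus_IZR, ?opp_IZR, ?RtoC_plus, ?RtoC_minus, ?RtoC_opp; ring.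
  - apply fps_ext; intros n. change (fZ x) with (fcst (IZR x)). rewrite fcst_mul. destruct n; unfold fZ, fcst.
    + rewrite mult_IZR, RtoC_mult. reflexivity.
    + ring.
  - apply Z.eqb_eq in H. now subst.
Qed.

Lemma fpow_theory : power_theory (fZ 1) fmul eq N.to_nat fpow.
Proof.
  constructor. intros r n. destruct n as [|p]; [reflexivity|].
  simpl. induction p using Pos.peano_ind.
  - simpl. rewrite fmulC. apply fps_ext; intros k. unfold fZ. rewrite fcst_mul. ring.
  - rewrite Pos2Nat.inj_succ. simpl fpow. rewrite IHp.
    symmetry. apply (pow_pos_succ (eq_equivalence (A := fps))); [|exact fmulA].
    intros ? ? -> ? ? ->. reflexivity.
Qed.

Ltac fZ_cst t := match t with fZ ?z => match isZcst z with true => z | _ => constr:(NotConstant) end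
  | _ => constr:(NotConstant) end.
Ltac fpow_cst t := match isnatcst t with true => constr:(N.of_nat t) | _ => constr:(NotConstant) end.

Add Ring fps_ring_inst : fps_ring (morphism fZ_morph, constants [fZ_cst], power_tac fpow_theory [fpow_cst]).

(** * The derivation [q d/dq], and differential equations with a resonant coefficient *)

Definition fD (a : fps) : fps := fun n => INR n * a n.
Definition fX : fps := fun n => match n with 1%nat => 1 | _ => 0 end.

Lemma fD_add a b : fD (fadd a b) = fadd (fD a) (fD b).
Proof. apply fps_ext; intros n; unfold fD, fadd; ring. Qed.
Lemma fD_sub a b : fD (fsub a b) = fsub (fD a) (fD b).
Proof. apply fps_ext; intros n; unfold fD, fsub; ring. Qed.
Lemma fD_cst c : fD (fcst c) = fZ 0.
Proof. apply fps_ext; intros [|n]; unfold fD, fZ, fcst; simpl INR; ring. Qed.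
Lemma fD_Z z : fD (fZ z) = fZ 0.
Proof. apply fD_cst. Qed.
Lemma fD_mul a b : fD (fmul a b) = fadd (fmul (fD a) b) (fmul a (fD b)).
Proof.
  apply fps_ext; intros n; unfold fD, fmul, fadd.
  rewrite <- Csum_scal, <- Csum_plus. apply Csum_ext; intros k Hk.
  replace (INR n) with (INR k + INR (n - k))%R by (rewrite <- plus_INR; f_equal; lia).
  rewrite RtoC_plus. ring.
Qed.
Lemma fD_pow a n : fD (fpow a (S n)) = fmul (fmul (fZ (Z.of_nat (S n))) (fpow a n)) (fD a).
Proof.
  induction n.
  - simpl fpow. rewrite fD_mul, fD_Z. simpl Z.of_nat. ring.
  - change (fpow a (S (S n))) with (fmul a (fpow a (S n))). rewrite fD_mul, IHn.
    rewrite (Nat2Z.inj_succ (S n)). unfold Z.succ. rewrite (morph_add fZ_morph). simpl (fpow a (S n)). ring.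
Qed.
Lemma fD_fX : fD fX = fX.
Proof. apply fps_ext; intros [|[|n]]; unfold fD, fX; simpl INR; ring. Qed.

Lemma C_eq_cancel (c x y : C) : c <> 0 -> c * x = c * y -> x = y.
Proof.
  intros Hc E. transitivity (/ c * (c * x)); [|rewrite E]; field; exact Hc.
Qed.

Lemma fps_scal_inj (c : C) a b : c <> 0 -> fmul (fcst c) a = fmul (fcst c) b -> a = b.
Proof.
  intros Hc E. apply fps_ext; intros n. apply (f_equal (fun f => f n)) in E.
  rewrite !fcst_mul in E. now apply C_eq_cancel in E.
Qed.

Lemma C_RtoC_neq (r : R) : r <> 0%R -> RtoC r <> 0.
Proof. intros H E. apply H. now apply RtoC_inj. Qed.

Lemma INR_minus_neq n k : n <> k -> (RtoC (INR n) - RtoC (INR k)) <> 0.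
Proof.
  intros H. rewrite <- RtoC_minus. apply C_RtoC_neq. intros E. apply H, INR_eq. lra.
Qed.

Lemma fmul_S (a b : fps) n : fmul a b (S n) =
  a O * b (S n) + Csum (fun k => a (S k) * b (n - k)%nat) n + a (S n) * b O.
Proof.
  unfold fmul. rewrite Csum_shift. change (Csum ?f (S n)) with (Csum f n + f n)%C.
  cbv beta. rewrite Nat.sub_diag, Nat.sub_0_r, Cplus_assoc. reflexivity.
Qed.

(** Coefficient [n] of [fD X = c X] expresses [(n - c O) X n] through lower coefficients, so every
    coefficient is forced except the resonant one, [n = k]. *)
Lemma linear_ode_unique (c X Y : fps) k : c O = INR k ->
  fD X = fmul c X -> fD Y = fmul c Y -> X k = Y k -> X = Y.
Proof.
  intros Hc HX HY Hk. apply fps_ext. intros n.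
  induction n as [n IH] using (well_founded_induction lt_wf).
  destruct (Nat.eq_dec n k) as [->|Hn]; auto.
  assert (EX := f_equal (fun f => f n) HX). assert (EY := f_equal (fun f => f n) HY).
  unfold fD in EX, EY. cbv beta in EX, EY.
  apply (C_eq_cancel (INR n - INR k)); [now apply INR_minus_neq|].
  transitivity (fmul c X n - INR k * X n); [rewrite <- EX; ring|].
  transitivity (fmul c Y n - INR k * Y n); [|rewrite <- EY; ring].
  destruct n as [|n].
  - unfold fmul; simpl. rewrite Hc. ring.
  - rewrite !fmul_S, Hc.
    rewrite (Csum_ext _ (fun j => c (S j) * Y (n - j)%nat)).
    2:{ intros j Hj. rewrite IH by lia. reflexivity. }
    rewrite (IH O) by lia. ring.
Qed.

(** The Chazy equation, satisfied by the quasimodular Eisenstein series of weight 2. *)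
Definition chazy (y : fps) : Prop :=
  (fZ 2 * fD (fD (fD y)) = fZ 2 * (y * fD (fD y)) - fZ 3 * (fD y * fD y))%fps.

(** What is left of coefficient [n + 1] of Chazy's equation once the two outer terms of each product
    are split off; only the indices 1 to [n] occur. *)
Definition chazy_mid (y : fps) n :=
  2 * Csum (fun k => y (S k) * (INR (n - k) * (INR (n - k) * y (n - k)%nat))) n
  - 3 * Csum (fun k => INR (S k) * y (S k) * (INR (n - k) * y (n - k)%nat)) n.

Lemma chazy_coef y n : chazy y ->
  2 * INR (S n) * INR (S n) * (INR (S n) - y O) * y (S n) = chazy_mid y n.
Proof.
  intros H. apply (f_equal (fun f => f (S n))) in H. unfold fsub, fZ in H. rewrite !fcst_mul in H.
  rewrite !fmul_S in H. unfold fD in H. unfold chazy_mid.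
  set (S1 := Csum _ n) in H. set (S2 := Csum _ n) in H. change (INR 0) with 0%R in H.
  transitivity (2 * (INR (S n) * (INR (S n) * (INR (S n) * y (S n)))) - 2 * y O * INR (S n) * INR (S n) * y (S n)); [ring|].
  rewrite H. unfold S1, S2. ring.
Qed.

(** The factor [n - y O] in [chazy_coef] vanishes exactly at [n = k], so that coefficient is free.
    The guard [k <= n] allows two uses: below the resonance without knowing coefficient [k], and
    everywhere once it is known. *)
Lemma chazy_unique y1 y2 k : chazy y1 -> chazy y2 -> y1 O = INR k -> y2 O = INR k ->
  forall n, ((k <= n)%nat -> y1 k = y2 k) -> y1 n = y2 n.
Proof.
  intros H1 H2 E1 E2. induction n as [n IH] using (well_founded_induction lt_wf). intros Hk.
  destruct (Nat.eq_dec n k) as [->|Hn]; auto.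
  destruct n as [|n]; [congruence|].
  assert (C1 := chazy_coef y1 n H1). assert (C2 := chazy_coef y2 n H2).
  assert (E : chazy_mid y1 n = chazy_mid y2 n).
  { unfold chazy_mid. f_equal; apply (f_equal (Cmult _)); apply Csum_ext; intros j Hj;
    rewrite (IH (S j)), (IH (n - j)%nat); auto; try lia; intros; apply Hk; lia. }
  rewrite E, <- C2, E1, E2 in C1. revert C1. apply C_eq_cancel.
  assert (Hs : RtoC (INR (S n)) <> 0) by (apply C_RtoC_neq, not_0_INR; lia).
  assert (Hm := INR_minus_neq _ _ Hn).
  repeat apply Cmult_neq_0; auto. apply (C_RtoC_neq 2); lra.
Qed.

(** * The formal solution of the differential system *)

(** The vanishing constant terms make a product gain one order of agreement ([fagree_mul]), so the
    nonlinear terms of the system at a given order depend on smaller orders only. *)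
Definition fagree n (f g : fps) : Prop :=
  f O = 0 /\ g O = 0 /\ forall k, (k < n)%nat -> f k = g k.

Lemma fagree_mul n f f' g g' : fagree n f f' -> fagree n g g' ->
  fagree (S n) (fmul f g) (fmul f' g').
Proof.
  intros (F & F' & Hf) (G & G' & Hg). split; [|split].
  1,2: unfold fmul; simpl; rewrite ?F, ?F'; ring.
  intros [|k] Hk; [unfold fmul; simpl; rewrite F, F'; ring|].
  rewrite !fmul_S, F, F', G, G'.
  rewrite (Csum_ext _ (fun j => f' (S j) * g' (k - j)%nat)); [ring|].
  intros j Hj. rewrite Hf, Hg by lia. reflexivity.
Qed.
Lemma fagree_le n f g : fagree (S n) f g -> fagree n f g.
Proof. intros (F & G & H). repeat split; auto. Qed.
Lemma fagree_add n f f' g g' : fagree n f f' -> fagree n g g' -> fagree n (fadd f g) (fadd f' g').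
Proof.
  intros (F & F' & Hf) (G & G' & Hg). unfold fadd.
  split; [|split]; intros; rewrite ?F, ?F', ?G, ?G', ?Hf, ?Hg; auto; ring.
Qed.
Lemma fagree_sub n f f' g g' : fagree n f f' -> fagree n g g' -> fagree n (fsub f g) (fsub f' g').
Proof.
  intros (F & F' & Hf) (G & G' & Hg). unfold fsub.
  split; [|split]; intros; rewrite ?F, ?F', ?G, ?G', ?Hf, ?Hg; auto; ring.
Qed.
Lemma fagree_Z n z f g : fagree n f g -> fagree n (fmul (fZ z) f) (fmul (fZ z) g).
Proof.
  intros (F & G & H). unfold fZ. split; [|split]; intros; rewrite !fcst_mul, ?F, ?G, ?H; auto; ring.
Qed.

(** [Nt], [Ng] and [Np] collect the terms of degree at least 2 of the system in [dl_t], [dl_g],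
    [dl_p], after its unknowns [g] and [p] have been written as [1 + b] and [1 + p]. *)
Definition Nt (t b : fps) : fps :=
  (b * t + fZ 9 * (t * t) + fZ 9 * (b * (t * t)) + fZ 27 * (t * (t * t)) + fZ 27 * (b * (t * (t * t))))%fps.
Definition Ng (t b p : fps) : fps :=
  (b * p - b * b - fZ 81 * (t * t) - fZ 36 * (t * b) - fZ 18 * (t * (b * b))
   - fZ 162 * (t * (t * b)) - fZ 81 * (t * (t * (b * b))))%fps.
Definition Npoly (t : fps) := (fZ 54 * (t * t) + fZ 324 * (t * (t * t)) + fZ 729 * (t * (t * (t * t))))%fps.
Definition Np (t b p : fps) : fps :=
  (p * p - b * b - Npoly t - (fZ 2 * b + b * b) * (fZ 12 * t + Npoly t))%fps.

Create HintDb fagree.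
Hint Resolve fagree_add fagree_sub fagree_Z fagree_mul : fagree.

Lemma Nt_agree n t t' b b' : fagree n t t' -> fagree n b b' -> fagree (S n) (Nt t b) (Nt t' b').
Proof.
  intros Ht Hb. assert (Htt := fagree_mul _ _ _ _ _ Ht Ht). assert (Htt' := fagree_le _ _ _ Htt).
  assert (Httt := fagree_mul _ _ _ _ _ Ht Htt'). assert (Httt' := fagree_le _ _ _ Httt).
  unfold Nt. auto 10 with fagree.
Qed.
Lemma Npoly_agree n t t' : fagree n t t' -> fagree (S n) (Npoly t) (Npoly t').
Proof.
  intros Ht. assert (Htt := fagree_mul _ _ _ _ _ Ht Ht). assert (Htt' := fagree_le _ _ _ Htt).
  assert (Httt := fagree_mul _ _ _ _ _ Ht Htt'). assert (Httt' := fagree_le _ _ _ Httt).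
  unfold Npoly. auto 10 with fagree.
Qed.
Lemma Ng_agree n t t' b b' p p' : fagree n t t' -> fagree n b b' -> fagree n p p' ->
  fagree (S n) (Ng t b p) (Ng t' b' p').
Proof.
  intros Ht Hb Hp.
  assert (Hbb := fagree_le _ _ _ (fagree_mul _ _ _ _ _ Hb Hb)).
  assert (Htb := fagree_le _ _ _ (fagree_mul _ _ _ _ _ Ht Hb)).
  assert (Htbb := fagree_le _ _ _ (fagree_mul _ _ _ _ _ Ht Hbb)).
  unfold Ng. auto 12 with fagree.
Qed.
Lemma Np_agree n t t' b b' p p' : fagree n t t' -> fagree n b b' -> fagree n p p' ->
  fagree (S n) (Np t b p) (Np t' b' p').
Proof.
  intros Ht Hb Hp.
  assert (Hbb := fagree_le _ _ _ (fagree_mul _ _ _ _ _ Hb Hb)).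
  assert (H1 := Npoly_agree _ _ _ Ht). assert (H2 := fagree_le _ _ _ H1).
  unfold Np. auto 12 with fagree.
Qed.

(** The linear part gives [(n - 1) t n = Nt n], resonant at 1; the value there is the normalisation
    [t = q + ...]. The first coefficients are written out so that they compute. *)
Definition step_t (t b : fps) : fps := fun n => match n with
  | O => 0 | 1%nat => 1 | _ => Nt t b n / (INR n - 1) end.
Definition rhs_g (t b p : fps) : fps := fun n => 1 / 2 * Ng t b p n - 9 * step_t t b n.
Definition rhs_p (t b p : fps) : fps := fun n => 1 / 4 * Np t b p n - 3 * step_t t b n.
(** For each [n] the linear part is a 2 by 2 system for [b n] and [p n] of determinant
    [(n + 1/2)(n - 1/2) + 1/4 = n^2], solved here by Cramer's rule. The values -6 and 0 at index 1
    are its solution for [t 1 = 1]. *)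
Definition step_b (t b p : fps) : fps := fun n => match n with
  | O => 0 | 1%nat => -6
  | _ => ((INR n - 1 / 2) * rhs_g t b p n + 1 / 2 * rhs_p t b p n) / (INR n * INR n) end.
Definition step_p (t b p : fps) : fps := fun n => match n with
  | O => 0 | 1%nat => 0
  | _ => ((INR n + 1 / 2) * rhs_p t b p n - 1 / 2 * rhs_g t b p n) / (INR n * INR n) end.

Lemma step_t_agree n t t' b b' : fagree n t t' -> fagree n b b' ->
  fagree (S n) (step_t t b) (step_t t' b').
Proof.
  intros Ht Hb. destruct (Nt_agree _ _ _ _ _ Ht Hb) as (_ & _ & H).
  repeat split. intros [|[|k]] Hk; auto. unfold step_t. rewrite H; auto.
Qed.
Lemma step_b_agree n t t' b b' p p' : fagree n t t' -> fagree n b b' -> fagree n p p' ->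
  fagree (S n) (step_b t b p) (step_b t' b' p').
Proof.
  intros Ht Hb Hp. destruct (step_t_agree _ _ _ _ _ Ht Hb) as (_ & _ & H).
  destruct (Ng_agree _ _ _ _ _ _ _ Ht Hb Hp) as (_ & _ & H2).
  destruct (Np_agree _ _ _ _ _ _ _ Ht Hb Hp) as (_ & _ & H3).
  repeat split. intros [|[|k]] Hk; auto. unfold step_b, rhs_g, rhs_p. rewrite H, H2, H3; auto.
Qed.
Lemma step_p_agree n t t' b b' p p' : fagree n t t' -> fagree n b b' -> fagree n p p' ->
  fagree (S n) (step_p t b p) (step_p t' b' p').
Proof.
  intros Ht Hb Hp. destruct (step_t_agree _ _ _ _ _ Ht Hb) as (_ & _ & H).
  destruct (Ng_agree _ _ _ _ _ _ _ Ht Hb Hp) as (_ & _ & H2).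
  destruct (Np_agree _ _ _ _ _ _ _ Ht Hb Hp) as (_ & _ & H3).
  repeat split. intros [|[|k]] Hk; auto. unfold step_p, rhs_g, rhs_p. rewrite H, H2, H3; auto.
Qed.

Fixpoint iter_sol (n : nat) : fps * fps * fps := match n with
  | O => (fZ 0, fZ 0, fZ 0)
  | S m => let '(t, b, p) := iter_sol m in (step_t t b, step_b t b p, step_p t b p) end.

Definition agree3 n (x y : fps * fps * fps) :=
  fagree n (fst (fst x)) (fst (fst y)) /\ fagree n (snd (fst x)) (snd (fst y)) /\ fagree n (snd x) (snd y).

Lemma iter_agree n : agree3 n (iter_sol n) (iter_sol (S n)).
Proof.
  induction n.
  - repeat split; intros; lia.
  - simpl in IHn |- *. destruct (iter_sol n) as [[t b] p]. destruct IHn as (H1 & H2 & H3).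
    simpl in H1, H2, H3.
    split; [|split]; simpl fst; simpl snd;
    [apply step_t_agree|apply step_b_agree|apply step_p_agree]; auto.
Qed.

(** Coefficient [n] no longer changes from iterate [n + 1] on. *)
Definition sol_t : fps := fun n => fst (fst (iter_sol (S n))) n.
Definition sol_b : fps := fun n => snd (fst (iter_sol (S n))) n.
Definition sol_p : fps := fun n => snd (iter_sol (S n)) n.

Lemma fagree_trans n f g h : fagree n f g -> fagree n g h -> fagree n f h.
Proof. intros (A1 & A2 & A3) (B1 & B2 & B3). repeat split; auto. intros; rewrite A3; auto. Qed.

Lemma fagree_mono n m f g : (n <= m)%nat -> fagree m f g -> fagree n f g.
Proof. intros H (A1 & A2 & A3). repeat split; auto. intros; apply A3; lia. Qed.

Lemma iter_agree_le n m : (n <= m)%nat -> agree3 n (iter_sol n) (iter_sol m).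
Proof.
  induction 1 as [|m Hm IH].
  - destruct (iter_agree n) as ((A1 & _) & (B1 & _) & (C1 & _)). repeat split; auto.
  - destruct IH as (A1 & B1 & C1). destruct (iter_agree m) as (A2 & B2 & C2).
    split; [|split]; (eapply fagree_trans; [eassumption|]); eapply fagree_mono; eauto.
Qed.

Lemma sol_agree n : agree3 n (iter_sol n) (sol_t, sol_b, sol_p).
Proof.
  destruct (iter_agree n) as ((A1 & _) & (B1 & _) & (C1 & _)).
  assert (H : forall k, (k < n)%nat -> agree3 (S k) (iter_sol (S k)) (iter_sol n))
    by (intros; apply iter_agree_le; lia).
  split; [|split]; (split; [assumption|split; [reflexivity|]]); intros k Hk;
  destruct (H k Hk) as ((_ & _ & A2) & (_ & _ & B2) & (_ & _ & C2)); simpl fst; simpl snd; symmetry;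
  [apply A2|apply B2|apply C2]; lia.
Qed.

Lemma sol_fix : step_t sol_t sol_b = sol_t /\ step_b sol_t sol_b sol_p = sol_b /\
  step_p sol_t sol_b sol_p = sol_p.
Proof.
  assert (H : forall n, agree3 (S n) (iter_sol (S n)) (step_t sol_t sol_b, step_b sol_t sol_b sol_p, step_p sol_t sol_b sol_p)).
  { intros n. destruct (sol_agree n) as (H1 & H2 & H3). simpl in H1, H2, H3. simpl.
    destruct (iter_sol n) as [[t b] p]. simpl in *.
    split; [|split]; simpl; auto using step_t_agree, step_b_agree, step_p_agree. }
  repeat split; apply fps_ext; intros n; destruct (H n) as ((_ & _ & H1) & (_ & _ & H2) & (_ & _ & H3));
  destruct (sol_agree (S n)) as ((_ & _ & A1) & (_ & _ & A2) & (_ & _ & A3)); simpl fst in *; simpl snd in *.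
  - rewrite <- H1, <- A1; auto.
  - rewrite <- H2, <- A2; auto.
  - rewrite <- H3, <- A3; auto.
Qed.

Lemma Nt_01 (t b : fps) : t O = 0 -> b O = 0 -> forall k, (k < 2)%nat -> Nt t b k = 0.
Proof.
  intros Ht Hb k Hk.
  assert (H : forall f : fps, f O = 0 -> fagree 1 f (fZ 0)).
  { intros f Hf. repeat split; auto. intros [|j] Hj; [auto|lia]. }
  destruct (Nt_agree 1 t (fZ 0) b (fZ 0) (H _ Ht) (H _ Hb)) as (_ & _ & E).
  rewrite E by auto. replace (Nt (fZ 0) (fZ 0)) with (fZ 0) by (unfold Nt; ring).
  destruct k; reflexivity.
Qed.
Lemma Ng_01 (t b p : fps) : t O = 0 -> b O = 0 -> p O = 0 -> forall k, (k < 2)%nat -> Ng t b p k = 0.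
Proof.
  intros Ht Hb Hp k Hk.
  assert (H : forall f : fps, f O = 0 -> fagree 1 f (fZ 0)).
  { intros f Hf. repeat split; auto. intros [|j] Hj; [auto|lia]. }
  destruct (Ng_agree 1 t (fZ 0) b (fZ 0) p (fZ 0) (H _ Ht) (H _ Hb) (H _ Hp)) as (_ & _ & E).
  rewrite E by auto. replace (Ng (fZ 0) (fZ 0) (fZ 0)) with (fZ 0) by (unfold Ng; ring).
  destruct k; reflexivity.
Qed.
Lemma Np_01 (t b p : fps) : t O = 0 -> b O = 0 -> p O = 0 -> forall k, (k < 2)%nat -> Np t b p k = 0.
Proof.
  intros Ht Hb Hp k Hk.
  assert (H : forall f : fps, f O = 0 -> fagree 1 f (fZ 0)).
  { intros f Hf. repeat split; auto. intros [|j] Hj; [auto|lia]. }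
  destruct (Np_agree 1 t (fZ 0) b (fZ 0) p (fZ 0) (H _ Ht) (H _ Hb) (H _ Hp)) as (_ & _ & E).
  rewrite E by auto. replace (Np (fZ 0) (fZ 0) (fZ 0)) with (fZ 0) by (unfold Np, Npoly; ring).
  destruct k; reflexivity.
Qed.

Lemma INR_SS_neq n : RtoC (INR (S (S n))) - 1 <> 0 /\ RtoC (INR (S (S n))) <> 0.
Proof.
  split; [|apply C_RtoC_neq, not_0_INR; lia].
  apply (INR_minus_neq (S (S n)) 1). lia.
Qed.

Lemma sol_t_ode : fD sol_t = fadd sol_t (Nt sol_t sol_b).
Proof.
  destruct sol_fix as (Et & _ & _).
  assert (H0 := Nt_01 sol_t sol_b eq_refl eq_refl).
  apply fps_ext; intros n. unfold fD, fadd.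
  destruct n as [|[|n]].
  - rewrite H0 by auto. change (sol_t O) with (RtoC 0). simpl INR. ring.
  - rewrite H0 by auto. simpl INR. ring.
  - assert (Et' := f_equal (fun f => f (S (S n))) Et). unfold step_t in Et'. rewrite <- Et'.
    destruct (INR_SS_neq n). field; auto.
Qed.

Lemma sol_b_ode : (fZ 2 * fD sol_b = sol_p - sol_b - fZ 18 * sol_t + Ng sol_t sol_b sol_p)%fps.
Proof.
  destruct sol_fix as (Et & Eb & Ep).
  assert (H0 := Ng_01 sol_t sol_b sol_p eq_refl eq_refl eq_refl).
  apply fps_ext; intros n. unfold fadd, fsub, fZ. rewrite !fcst_mul. unfold fD.
  destruct n as [|[|n]].
  - rewrite H0 by auto. change (sol_t O) with (RtoC 0).
    change (sol_b O) with (RtoC 0). change (sol_p O) with (RtoC 0). simpl INR. ring.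
  - rewrite H0 by auto. change (sol_t 1%nat) with (RtoC 1).
    change (sol_b 1%nat) with (RtoC (-6)). change (sol_p 1%nat) with (RtoC 0). simpl INR. ring.
  - assert (Eb' := f_equal (fun f => f (S (S n))) Eb). assert (Ep' := f_equal (fun f => f (S (S n))) Ep).
    unfold step_b, step_p, rhs_g, rhs_p in Eb', Ep'. rewrite Et in Eb', Ep'. rewrite <- Eb', <- Ep'.
    destruct (INR_SS_neq n). field; auto.
Qed.

Lemma sol_p_ode : (fZ 4 * fD sol_p = fZ 2 * sol_p - fZ 2 * sol_b - fZ 12 * sol_t + Np sol_t sol_b sol_p)%fps.
Proof.
  destruct sol_fix as (Et & Eb & Ep).
  assert (H0 := Np_01 sol_t sol_b sol_p eq_refl eq_refl eq_refl).
  apply fps_ext; intros n. unfold fadd, fsub, fZ. rewrite !fcst_mul. unfold fD.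
  destruct n as [|[|n]].
  - rewrite H0 by auto. change (sol_t O) with (RtoC 0).
    change (sol_b O) with (RtoC 0). change (sol_p O) with (RtoC 0). simpl INR. ring.
  - rewrite H0 by auto. change (sol_t 1%nat) with (RtoC 1).
    change (sol_b 1%nat) with (RtoC (-6)). change (sol_p 1%nat) with (RtoC 0). simpl INR. ring.
  - assert (Eb' := f_equal (fun f => f (S (S n))) Eb). assert (Ep' := f_equal (fun f => f (S (S n))) Ep).
    unfold step_b, step_p, rhs_g, rhs_p in Eb', Ep'. rewrite Et in Eb', Ep'. rewrite <- Eb', <- Ep'.
    destruct (INR_SS_neq n). field; auto.
Qed.

(** * The system in [t], [g], [p] and its three solutions of Chazy's equation *)

Definition dl (a : fps) : fps := fmul (fZ 4) (fD a).
Lemma dl_add a b : dl (fadd a b) = fadd (dl a) (dl b).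
Proof. unfold dl. rewrite fD_add. ring. Qed.
Lemma dl_sub a b : dl (fsub a b) = fsub (dl a) (dl b).
Proof. unfold dl. rewrite fD_sub. ring. Qed.
Lemma dl_mul a b : dl (fmul a b) = fadd (fmul (dl a) b) (fmul a (dl b)).
Proof. unfold dl. rewrite fD_mul. ring. Qed.
Lemma dl_Z z : dl (fZ z) = fZ 0.
Proof. unfold dl. rewrite fD_Z. ring. Qed.
Lemma dl_pow a n : dl (fpow a (S n)) = fmul (fmul (fZ (Z.of_nat (S n))) (fpow a n)) (dl a).
Proof. unfold dl. rewrite fD_pow. ring. Qed.

Definition sol_g : fps := fadd (fZ 1) sol_b.
Definition sol_P : fps := fadd (fZ 1) sol_p.

Section System.
Let t := sol_t.
Let g := sol_g.
Let p := sol_P.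
Local Open Scope fps_scope.

(** The equations for [t] and [g] are the logarithmic derivatives expected of the two eta quotients,
    the one for [p] is Ramanujan's equation for [E_2(3 tau)]. The factor 4 in [dl] keeps the
    coefficients integral. *)
Lemma dl_t : dl t = fZ 4 * g * t * (fZ 1 + fZ 9 * t + fZ 27 * t^2).
Proof. unfold dl, t, g, sol_g. rewrite sol_t_ode. unfold Nt. ring. Qed.
Lemma dl_g : dl g = fZ 2 * g * (p - (fZ 1 + fZ 9 * t)^2 * g).
Proof.
  unfold dl, t, g, p, sol_g, sol_P. rewrite fD_add, fD_Z.
  transitivity (fZ 2 * (fZ 2 * fD sol_b)); [ring|]. rewrite sol_b_ode. unfold Ng. ring.
Qed.
Lemma dl_p : dl p = p^2 - g^2 * (fZ 1 + fZ 12 * t + fZ 54 * t^2 + fZ 324 * t^3 + fZ 729 * t^4).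
Proof.
  unfold dl, t, g, p, sol_g, sol_P. rewrite fD_add, fD_Z.
  transitivity (fZ 4 * fD sol_p); [ring|]. rewrite sol_p_ode. unfold Np, Npoly. ring.
Qed.

Ltac dl_simp := repeat rewrite ?dl_add, ?dl_sub, ?dl_mul, ?dl_pow, ?dl_Z, ?dl_t, ?dl_g, ?dl_p;
  simpl Z.of_nat.

Lemma chazy_dl y : dl (dl (dl y)) = fZ 4 * y * dl (dl y) - fZ 6 * (dl y)^2 -> chazy y.
Proof.
  assert (Hs : forall z a, fD (fZ z * a) = fZ z * fD a) by (intros; rewrite fD_mul, fD_Z; ring).
  unfold dl. rewrite !Hs. intros H. unfold chazy.
  apply (fps_scal_inj (IZR 32)); [apply C_RtoC_neq; lra|]. change (fcst (IZR 32)) with (fZ 32).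
  etransitivity; [|etransitivity; [exact H|]]; ring.
Qed.

(** The logarithmic derivatives of [t] and [g] under [q d/dq] should be
    [(9 E_2(9 tau) - E_2(tau)) / 8] and [(E_2(tau) - E_2(3 tau)) / 4]; solving for [E_2(tau)] and
    [9 E_2(9 tau)] gives these combinations. *)
Definition sol_y1 := fZ 3 * p - fZ 2 * (fZ 1 + fZ 9 * t)^2 * g.
Definition sol_y3 := fZ 3 * p.
Definition sol_y9 := sol_y1 + fZ 8 * g * (fZ 1 + fZ 9 * t + fZ 27 * t^2).

Lemma dl_y1 : dl sol_y1 = fZ (3)*p^2 + fZ (-4)*g*p + fZ (1)*g^2 + fZ (-72)*t*g*p + fZ (-36)*t*g^2 + fZ (-324)*t^2*g*p + fZ (-810)*t^2*g^2 + fZ (-4860)*t^3*g^2 + fZ (-10935)*t^4*g^2.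
Proof. unfold sol_y9, sol_y3, sol_y1. dl_simp. ring. Qed.
Lemma dl_dl_y1 : dl (dl sol_y1) = fZ (6)*p^3 + fZ (-12)*g*p^2 + fZ (6)*g^2*p + fZ (-216)*t*g*p^2 + fZ (-216)*t*g^2*p + fZ (48)*t*g^3 + fZ (-972)*t^2*g*p^2 + fZ (-4860)*t^2*g^2*p + fZ (-864)*t^2*g^3 + fZ (-29160)*t^3*g^2*p + fZ (-22032)*t^3*g^3 + fZ (-65610)*t^4*g^2*p + fZ (-174960)*t^4*g^3 + fZ (-629856)*t^5*g^3 + fZ (-944784)*t^6*g^3.
Proof. rewrite dl_y1. dl_simp. ring. Qed.
Lemma chazy_y1 : chazy sol_y1.
Proof.
  apply chazy_dl. rewrite dl_dl_y1, dl_y1. unfold sol_y9, sol_y3, sol_y1. dl_simp. ring.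
Qed.

Lemma dl_y3 : dl sol_y3 = fZ (3)*p^2 + fZ (-3)*g^2 + fZ (-36)*t*g^2 + fZ (-162)*t^2*g^2 + fZ (-972)*t^3*g^2 + fZ (-2187)*t^4*g^2.
Proof. unfold sol_y9, sol_y3, sol_y1. dl_simp. ring. Qed.
Lemma dl_dl_y3 : dl (dl sol_y3) = fZ (6)*p^3 + fZ (-18)*g^2*p + fZ (12)*g^3 + fZ (-216)*t*g^2*p + fZ (216)*t*g^3 + fZ (-972)*t^2*g^2*p + fZ (1620)*t^2*g^3 + fZ (-5832)*t^3*g^2*p + fZ (-13122)*t^4*g^2*p + fZ (-43740)*t^4*g^3 + fZ (-157464)*t^5*g^3 + fZ (-236196)*t^6*g^3.
Proof. rewrite dl_y3. dl_simp. ring. Qed.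
Lemma chazy_y3 : chazy sol_y3.
Proof.
  apply chazy_dl. rewrite dl_dl_y3, dl_y3. unfold sol_y9, sol_y3, sol_y1. dl_simp. ring.
Qed.

Lemma dl_y9 : dl sol_y9 = fZ (3)*p^2 + fZ (12)*g*p + fZ (-15)*g^2 + fZ (72)*t*g*p + fZ (-180)*t*g^2 + fZ (108)*t^2*g*p + fZ (-810)*t^2*g^2 + fZ (-972)*t^3*g^2 + fZ (729)*t^4*g^2.
Proof. unfold sol_y9, sol_y3, sol_y1. dl_simp. ring. Qed.
Lemma dl_dl_y9 : dl (dl sol_y9) = fZ (6)*p^3 + fZ (36)*g*p^2 + fZ (-90)*g^2*p + fZ (48)*g^3 + fZ (216)*t*g*p^2 + fZ (-1080)*t*g^2*p + fZ (864)*t*g^3 + fZ (324)*t^2*g*p^2 + fZ (-4860)*t^2*g^2*p + fZ (6480)*t^2*g^3 + fZ (-5832)*t^3*g^2*p + fZ (22032)*t^3*g^3 + fZ (4374)*t^4*g^2*p + fZ (23328)*t^4*g^3 + fZ (-34992)*t^5*g^3.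
Proof. rewrite dl_y9. dl_simp. ring. Qed.
Lemma chazy_y9 : chazy sol_y9.
Proof.
  apply chazy_dl. rewrite dl_dl_y9, dl_y9. unfold sol_y9, sol_y3, sol_y1. dl_simp. ring.
Qed.

(** By Ramanujan's [12 D E_2 = E_2^2 - E_4] the left side is meant to be [E_4(tau) + 9 E_4(3 tau)],
    and [(1 + 9 t)^2 g] to be [(3 E_2(3 tau) - E_2(tau)) / 2]. Unlike Chazy's equation, this
    determines coefficient 3 of [p]. *)
Lemma level3_relation : sol_y1^2 - fZ 3 * dl sol_y1 + fZ 9 * (p^2 - dl p) =
  fZ 10 * ((fZ 1 + fZ 9 * t)^2 * g)^2.
Proof. rewrite dl_y1, dl_p. unfold sol_y1. ring. Qed.

(** The level 3 relation at [3 tau], rescaled. It determines coefficient 9 of [sol_y9], which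
    Chazy's equation leaves free. *)
Lemma level9_relation : fZ 18 * (p^2 - dl p) + fZ 2 * sol_y9^2 - fZ 6 * dl sol_y9 =
  fZ 5 * (sol_y9 - fZ 3 * p)^2.
Proof. rewrite dl_y9, dl_p. unfold sol_y9, sol_y1. ring. Qed.
End System.

(** * Chazy's equation for the Eisenstein series *)

Lemma sigma_stable N k : (1 <= k <= N)%nat -> sigma N (Z.of_nat k) = sigma k (Z.of_nat k).
Proof.
  intros [Hk H]. induction H as [|N HN IH]; auto. rewrite <- IH. unfold sigma.
  rewrite zsum_range_S.
  rewrite (zsum_ext_in (range (S N)) _ (fun _ => 0%Z)), zsum_0.
  2:{ intros x Hx%in_range. destruct (Z.eqb_spec (Z.of_nat (S N) * x) (Z.of_nat k)); nia. }
  rewrite Z.add_0_r. apply zsum_ext_in. intros a Ha%in_range. rewrite zsum_range_S.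
  destruct (Z.eqb_spec (a * Z.of_nat (S N)) (Z.of_nat k)); nia.
Qed.

Lemma sigma_zero N : sigma N 0 = 0%Z.
Proof.
  unfold sigma. rewrite (zsum_ext_in _ _ (fun _ => 0%Z)); [apply zsum_0|]. intros a Ha%in_range.
  rewrite (zsum_ext_in _ _ (fun _ => 0%Z)); [apply zsum_0|]. intros x Hx%in_range.
  destruct (Z.eqb_spec (a * x) 0); nia.
Qed.

Lemma zsum_Csum n f : RtoC (IZR (zsum (range n) f)) = Csum (fun k => IZR (f (Z.of_nat (S k)))) n.
Proof.
  induction n; [reflexivity|]. rewrite zsum_range_S, plus_IZR, RtoC_plus, IHn. reflexivity.
Qed.

Definition csigma (n : nat) : C := IZR (sigma n (Z.of_nat n)).

Lemma csigma_convolution n : (1 <= n)%nat ->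
  12 * Csum (fun k => (5 * INR (S k) * (INR n - INR (S k)) - INR n * INR n)
     * (csigma (S k) * csigma (n - S k))) (n - 1) =
  INR n * INR n * (INR n - 1) * csigma n.
Proof.
  intros Hn. assert (H := sigma_convolution n Hn).
  apply (f_equal (fun z => RtoC (IZR z))) in H. rewrite mult_IZR, RtoC_mult, zsum_Csum in H.
  assert (EI : forall m, IZR (Z.of_nat m) = INR m) by (intros; symmetry; apply INR_IZR_INZ).
  transitivity (12 * Csum (fun k : nat =>
     IZR ((5 * Z.of_nat (S k) * (Z.of_nat n - Z.of_nat (S k)) - Z.of_nat n ^ 2) *
         (sigma n (Z.of_nat (S k)) * sigma n (Z.of_nat n - Z.of_nat (S k))))) n).
  - f_equal. destruct n as [|n]; [lia|]. replace (S n - 1)%nat with n by lia.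
    cbn [Csum]. rewrite (Z.sub_diag (Z.of_nat (S n))), sigma_zero, !Z.mul_0_r, Cplus_0_r.
    apply Csum_ext. intros k Hk.
    rewrite <- Nat2Z.inj_sub by lia.
    rewrite (sigma_stable _ (S k)), (sigma_stable _ (S n - S k)) by lia.
    rewrite !mult_IZR, !minus_IZR, !mult_IZR, Nat2Z.inj_sub, minus_IZR, (Z.pow_2_r (Z.of_nat (S n))), mult_IZR, !EI by lia.
    rewrite !RtoC_mult, !RtoC_minus, !RtoC_mult, !RtoC_minus, <- ?Nat2Z.inj_sub by lia. reflexivity.
  - rewrite H, !mult_IZR, minus_IZR, Z.pow_2_r, mult_IZR, !EI, !RtoC_mult, RtoC_minus. reflexivity.
Qed.

(** The Eisenstein series of weight 2. *)
Definition fP : fps := fun n => match n with O => 1 | _ => -24 * csigma n end.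

Lemma chazy_fP : chazy fP.
Proof.
  apply fps_ext. intros [|n].
  - unfold fsub, fZ. rewrite !fcst_mul. unfold fmul, fD; simpl. ring.
  - unfold fsub, fZ. rewrite !fcst_mul, !fmul_S. unfold fD.
    set (S1 := Csum _ n). set (S2 := Csum _ n).
    assert (H := csigma_convolution (S n) ltac:(lia)).
    replace (S n - 1)%nat with n in H by lia.
    assert (E1 : S1 = 576 * Csum (fun k => (INR n - INR k) * (INR n - INR k) * (csigma (S k) * csigma (n - k))) n).
    { unfold S1. rewrite <- Csum_scal. apply Csum_ext. intros k Hk.
      rewrite minus_INR, RtoC_minus by lia. unfold fP.
      replace (n - k)%nat with (S (n - S k)) by lia. ring. }
    (* The same convolution read backwards. With [j = k + 1] and [N = n + 1], adding both forms uses
       [j^2 + (N - j)^2 = N^2 - 2 j (N - j)], so [3 S2 - 2 S1] acquires van der Pol's weight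
       [5 j (N - j) - N^2]. *)
    assert (E1' : S1 = 576 * Csum (fun k => INR (S k) * INR (S k) * (csigma (S k) * csigma (n - k))) n).
    { rewrite E1. destruct n as [|n]; [reflexivity|]. f_equal. rewrite Csum_rev. apply Csum_ext. intros k Hk.
      rewrite minus_INR, RtoC_minus, !S_INR, !RtoC_plus by lia.
      replace (S n - (n - k))%nat with (S k) by lia. replace (S (n - k))%nat with (S n - k)%nat by lia. ring. }
    assert (E2 : S2 = 576 * Csum (fun k => INR (S k) * (INR (S n) - INR (S k)) * (csigma (S k) * csigma (n - k))) n).
    { unfold S2. rewrite <- Csum_scal. apply Csum_ext. intros k Hk.
      rewrite minus_INR, !S_INR, RtoC_minus, !RtoC_plus by lia. unfold fP.
      replace (n - k)%nat with (S (n - S k)) by lia. ring. }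
    assert (EH : 12 * 576 * Csum (fun k => (5 * INR (S k) * (INR (S n) - INR (S k)) - INR (S n) * INR (S n))
     * (csigma (S k) * csigma (S n - S k))) n = 12 * (3 * S2 - 2 * S1)).
    { transitivity (12 * (3 * S2 - (S1 + S1))); [|ring]. rewrite E1 at 1. rewrite E1', E2.
      transitivity (12 * (Csum (fun k => 3 * (576 * (INR (S k) * (INR (S n) - INR (S k)) * (csigma (S k) * csigma (n - k)))) +
       (-1) * (576 * ((INR n - INR k) * (INR n - INR k) * (csigma (S k) * csigma (n - k))) +
          576 * (INR (S k) * INR (S k) * (csigma (S k) * csigma (n - k))))) n)).
      - rewrite <- Cmult_assoc. f_equal. rewrite <- Csum_scal. apply Csum_ext. intros k Hk.
        rewrite !S_INR, !RtoC_plus. simpl (S n - S k)%nat. ring.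
      - f_equal. rewrite Csum_plus, !Csum_scal, Csum_plus, !Csum_scal. ring. }
    apply (C_eq_cancel 12); [apply C_RtoC_neq; lra|].
    transitivity (12 * (2 * (fP O * (INR (S n) * (INR (S n) * fP (S n))))) - 12 * (3 * S2 - 2 * S1)).
    + rewrite <- EH, (Cmult_comm 12 576), <- Cmult_assoc, H. unfold fP. ring.
    + unfold fP. simpl INR. ring.
Qed.

(** * Euler's product *)

Definition fmono (k : nat) : fps := fun n => if Nat.eqb n k then 1 else 0.

Lemma fmono_mul k (a : fps) n :
  fmul (fmono k) a n = if Nat.leb k n then a (n - k)%nat else 0.
Proof.
  unfold fmul. destruct (Nat.leb_spec k n) as [H|H].
  - replace (S n) with (k + S (n - k))%nat by lia.
    assert (E : forall m, Csum (fun j => fmono k j * a (n - j)%nat) (k + S m) = a (n - k)%nat).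
    { induction m.
      - rewrite Nat.add_1_r. cbn [Csum]. rewrite Csum_0.
        + unfold fmono. rewrite Nat.eqb_refl. ring.
        + intros j Hj. unfold fmono. destruct (Nat.eqb_spec j k); [lia|ring].
      - rewrite Nat.add_succ_r. cbn [Csum]. rewrite IHm. unfold fmono.
        destruct (Nat.eqb_spec (k + S m) k); [lia|ring]. }
    apply E.
  - apply Csum_0. intros j Hj. unfold fmono. destruct (Nat.eqb_spec j k); [lia|ring].
Qed.

Lemma fD_fmono k : fD (fmono k) = fmul (fcst (INR k)) (fmono k).
Proof.
  apply fps_ext; intros n. rewrite fcst_mul. unfold fD, fmono.
  destruct (Nat.eqb_spec n k); subst; ring.
Qed.

(** The expansion of [q^k / (1 - q^k)]. *)
Definition fgeom (k : nat) : fps := fun n => match n with O => 0 | _ => if Nat.eqb (n mod k) 0 then 1 else 0 end.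

Lemma fgeom_mul k : (1 <= k)%nat -> fmul (fZ 1 - fmono k)%fps (fgeom k) = fmono k.
Proof.
  intros Hk. transitivity (fgeom k - fmono k * fgeom k)%fps; [ring|].
  apply fps_ext; intros n. unfold fsub. rewrite fmono_mul. unfold fmono.
  destruct (Nat.leb_spec k n).
  - assert (E : ((n - k) mod k = n mod k)%nat).
    { replace n with (n - k + 1 * k)%nat at 2 by lia. now rewrite Nat.Div0.mod_add. }
    unfold fgeom. rewrite E. destruct n; [lia|].
    destruct (Nat.eqb_spec (S n) k) as [<-|].
    + rewrite Nat.sub_diag, Nat.Div0.mod_same. simpl. ring.
    + destruct (S n - k)%nat eqn:E'; [lia|]. ring.
  - destruct (Nat.eqb_spec n k); [lia|]. unfold fgeom. destruct n; [ring|].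
    rewrite Nat.mod_small by lia. simpl. ring.
Qed.

Fixpoint fprod (N : nat) : fps := match N with
  | O => fZ 1 | S m => (fprod m * (fZ 1 - fmono (S m)))%fps end.

(** A truncated Lambert series: minus the logarithmic derivative of [fprod N]. *)
Fixpoint flambert (N : nat) : fps := match N with
  | O => fZ 0 | S m => (flambert m + fcst (INR (S m)) * fgeom (S m))%fps end.

Lemma fD_fprod N : fD (fprod N) = (- (fprod N * flambert N))%fps.
Proof.
  induction N as [|N IH].
  - simpl. rewrite fD_Z. ring.
  - cbn [fprod flambert]. rewrite fD_mul, fD_sub, fD_Z, fD_fmono, IH.
    transitivity (- (fprod N * flambert N * (fZ 1 - fmono (S N)))
      - fprod N * fcst (INR (S N)) * fmono (S N))%fps; [ring|].
    rewrite <- (fgeom_mul (S N)) at 2 by lia. ring.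
Qed.

Lemma fprod_stable n N : (n <= N)%nat -> fprod N n = fprod n n.
Proof.
  induction 1 as [|N HN IH]; auto. cbn [fprod].
  transitivity ((fprod N - fmono (S N) * fprod N)%fps n).
  - apply (f_equal (fun f : fps => f n)). ring.
  - unfold fsub. rewrite fmono_mul. destruct (Nat.leb_spec (S N) n); [lia|]. rewrite IH. ring.
Qed.

(** Coefficient [n] of the finite products is constant from the [n]-th product on, so the diagonal
    is the infinite product. *)
Definition fE1 : fps := fun n => fprod n n.

Lemma flambert_coef N n : (1 <= n <= N)%nat -> flambert N n = csigma n.
Proof.
  intros Hn. unfold csigma. rewrite <- (sigma_stable N) by lia. unfold sigma.
  rewrite zsum_Csum.
  assert (E : forall M, flambert M n = Csum (fun k => INR (S k) * fgeom (S k) n) M).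
  { induction M; [destruct n; reflexivity|]. cbn [flambert Csum]. unfold fadd. rewrite fcst_mul, IHM. reflexivity. }
  rewrite E. apply Csum_ext. intros k Hk.
  unfold fgeom. destruct n as [|n]; [lia|].
  destruct (Nat.eqb_spec (S n mod S k) 0) as [H|H].
  - apply Nat.Div0.mod_divides in H. destruct H as [c Hc].
    rewrite (zsum_ext _ _ (fun x => if (Z.of_nat c =? x)%Z then Z.of_nat (S k) else 0%Z)).
    + rewrite (zsum_single (range N) (Z.of_nat c) (fun _ => Z.of_nat (S k))).
      * rewrite <- INR_IZR_INZ. ring.
      * apply NoDup_range.
      * apply in_range. nia.
    + intros x. destruct (Z.eqb_spec (Z.of_nat (S k) * x) (Z.of_nat (S n))), (Z.eqb_spec (Z.of_nat c) x); nia.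
  - rewrite (zsum_ext_in _ _ (fun _ => 0%Z)); [rewrite zsum_0; ring|].
    intros x Hx%in_range. destruct (Z.eqb_spec (Z.of_nat (S k) * x) (Z.of_nat (S n))) as [E'|]; auto.
    exfalso. apply H. apply Nat.Div0.mod_divides. exists (Z.to_nat x). nia.
Qed.

Lemma fD_fE1 : (fZ 24 * fD fE1 = (fP - fZ 1) * fE1)%fps.
Proof.
  apply fps_ext; intros n. unfold fZ at 1. rewrite fcst_mul.
  transitivity (24 * fD (fprod n) n).
  { reflexivity. }
  rewrite fD_fprod. rewrite fmulC. unfold fopp, fmul.
  transitivity (Csum (fun k => (-24) * (flambert n k * fprod n (n - k)%nat)) (S n)).
  { rewrite Csum_scal. ring. }
  apply Csum_ext. intros k Hk. unfold fE1. rewrite (fprod_stable (n - k) n) by lia.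
  unfold fsub. destruct k as [|k].
  - assert (E : flambert n O = 0).
    { clear. induction n; [reflexivity|]. cbn [flambert]. unfold fadd. rewrite IHn, fcst_mul. simpl. ring. }
    rewrite E. unfold fP, fZ, fcst. ring.
  - rewrite flambert_coef by lia. unfold fP, fZ, fcst. ring.
Qed.

(** * Substitution of [q^k] for [q] *)

Definition fsubst (k : nat) (a : fps) : fps :=
  fun n => if Nat.eqb (n mod k) 0 then a (n / k)%nat else 0.

Lemma fsubst_mult k a m : (1 <= k)%nat -> fsubst k a (k * m)%nat = a m.
Proof.
  intros Hk. unfold fsubst. rewrite (Nat.mul_comm k), Nat.Div0.mod_mul, Nat.div_mul by lia. reflexivity.
Qed.

Lemma fsubst_other k a n : (forall m, n <> (k * m)%nat) -> fsubst k a n = 0.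
Proof.
  intros H. unfold fsubst. destruct (Nat.eqb_spec (n mod k) 0) as [E|]; auto.
  apply Nat.Div0.mod_divides in E. destruct E as [c Hc]. now apply H in Hc.
Qed.

Lemma multiple_dec k n : (1 <= k)%nat -> {m | n = (k * m)%nat} + {forall m, n <> (k * m)%nat}.
Proof.
  intros Hk. destruct (Nat.eq_dec (n mod k) 0) as [E|E].
  - left. exists (n / k)%nat. rewrite (Nat.div_mod_eq n k) at 1. lia.
  - right. intros m ->. apply E. rewrite Nat.mul_comm. apply Nat.Div0.mod_mul.
Qed.

Lemma Csum_multiples k (f : nat -> C) m : (1 <= k)%nat ->
  (forall n, (forall j, n <> (k * j)%nat) -> f n = 0) ->
  Csum f (S (k * m)) = Csum (fun j => f (k * j)%nat) (S m).
Proof.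
  intros Hk Hf. induction m as [|m IH].
  - rewrite Nat.mul_0_r. simpl. rewrite Nat.mul_0_r. reflexivity.
  - change (Csum (fun j => f (k * j)%nat) (S (S m))) with
      (Csum (fun j => f (k * j)%nat) (S m) + f (k * S m)%nat).
    rewrite <- IH.
    assert (E : forall i, (i < k)%nat -> Csum f (S (k * m) + i) = Csum f (S (k * m))).
    { induction i; intros Hi; [now rewrite Nat.add_0_r|].
      rewrite Nat.add_succ_r.
      change (Csum f (S (S (k * m) + i))) with (Csum f (S (k * m) + i) + f (S (k * m) + i)%nat).
      rewrite (IHi ltac:(lia)), (Hf (S (k * m) + i)%nat); [ring|].
      intros j Hj. destruct (Nat.le_gt_cases j m); nia. }
    replace (S (k * S m)) with (S (S (k * m) + (k - 1)))%nat by lia.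
    change (Csum f (S (S (k * m) + (k - 1)))) with
      (Csum f (S (k * m) + (k - 1)) + f (S (k * m) + (k - 1))%nat).
    rewrite E by lia. do 2 f_equal. lia.
Qed.

Lemma fsubst_mul k a b : (1 <= k)%nat -> fsubst k (fmul a b) = fmul (fsubst k a) (fsubst k b).
Proof.
  intros Hk. apply fps_ext; intros n. destruct (multiple_dec k n Hk) as [[m ->]|Hn].
  - rewrite fsubst_mult by auto. unfold fmul at 2. rewrite Csum_multiples; auto.
    + apply Csum_ext. intros j Hj. rewrite fsubst_mult, <- Nat.mul_sub_distr_l, fsubst_mult; auto.
    + intros i Hi. rewrite (fsubst_other k a i) by auto. ring.
  - rewrite fsubst_other by auto. symmetry. apply Csum_0. intros j Hj.
    destruct (multiple_dec k j Hk) as [[i ->]|Hj']; [|rewrite (fsubst_other k a j); auto; ring].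
    rewrite (fsubst_other k b (n - k * i)); [ring|]. intros l Hl. apply (Hn (i + l)%nat). nia.
Qed.

Lemma fsubst_sub k a b : fsubst k (fsub a b) = fsub (fsubst k a) (fsubst k b).
Proof. apply fps_ext; intros n. unfold fsubst, fsub. destruct (Nat.eqb _ _); ring. Qed.
Lemma fsubst_Z k z : (1 <= k)%nat -> fsubst k (fZ z) = fZ z.
Proof.
  intros Hk. apply fps_ext; intros n. destruct (multiple_dec k n Hk) as [[m ->]|Hn].
  - rewrite fsubst_mult by auto. destruct m; [rewrite Nat.mul_0_r; auto|].
    destruct (k * S m)%nat eqn:E; [nia|]. reflexivity.
  - rewrite fsubst_other by auto. destruct n; [|reflexivity]. exfalso; apply (Hn O); lia.
Qed.
Lemma fD_fsubst k a : (1 <= k)%nat -> fD (fsubst k a) = fmul (fZ (Z.of_nat k)) (fsubst k (fD a)).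
Proof.
  intros Hk. apply fps_ext; intros n. unfold fZ. rewrite fcst_mul. unfold fD at 1.
  destruct (multiple_dec k n Hk) as [[m ->]|Hn].
  - rewrite !fsubst_mult by auto. unfold fD. rewrite mult_INR, RtoC_mult, <- INR_IZR_INZ. ring.
  - rewrite !fsubst_other by auto. ring.
Qed.

(** If [y] and each derivation have weight 1, every term of Chazy's equation has weight 4. Replacing
    [q] by [q^k] multiplies the derivation by [k], and the factor [k] in front of [y] restores the
    balance. *)
Lemma chazy_fsubst k y : (1 <= k)%nat -> chazy y -> chazy (fZ (Z.of_nat k) * fsubst k y)%fps.
Proof.
  intros Hk H. unfold chazy in *. set (c := fZ (Z.of_nat k)).
  assert (Hs : forall a, (fD (c * a) = c * fD a)%fps) by (intros; unfold c; rewrite fD_mul, fD_Z; ring).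
  assert (HD : forall a, (fD (fsubst k a) = c * fsubst k (fD a))%fps) by (intros; now apply fD_fsubst).
  repeat rewrite ?Hs, ?HD.
  apply (f_equal (fsubst k)) in H. rewrite fsubst_sub, !fsubst_mul, !fsubst_Z in H by auto.
  transitivity (c^4 * (fZ 2 * fsubst k (fD (fD (fD y)))))%fps; [ring|]. rewrite H. ring.
Qed.

(** * Identification of the formal solution *)

Lemma fmul_at0 (a b : fps) : fmul a b 0%nat = a 0%nat * b 0%nat.
Proof. unfold fmul; cbn [Csum Nat.sub]. ring. Qed.
Lemma fmul_at1 (a b : fps) : fmul a b 1%nat = a 0%nat * b 1%nat + a 1%nat * b 0%nat.
Proof. unfold fmul; cbn [Csum Nat.sub]. ring. Qed.
Lemma fmul_at3 (a b : fps) : fmul a b 3%nat = a 0%nat * b 3%nat + a 1%nat * b 2%nat + a 2%nat * b 1%nat + a 3%nat * b 0%nat.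
Proof. unfold fmul; cbn [Csum Nat.sub]. ring. Qed.
Lemma fmul_at9 (a b : fps) : fmul a b 9%nat = a 0%nat * b 9%nat + a 1%nat * b 8%nat + a 2%nat * b 7%nat + a 3%nat * b 6%nat + a 4%nat * b 5%nat + a 5%nat * b 4%nat + a 6%nat * b 3%nat + a 7%nat * b 2%nat + a 8%nat * b 1%nat + a 9%nat * b 0%nat.
Proof. unfold fmul; cbn [Csum Nat.sub]. ring. Qed.

Lemma fadd_at a b n : fadd a b n = a n + b n.
Proof. reflexivity. Qed.
Lemma fsub_at a b n : fsub a b n = a n - b n.
Proof. reflexivity. Qed.
Lemma fD_at a n : fD a n = INR n * a n.
Proof. reflexivity. Qed.
Lemma fpow2 a : fpow a 2 = fmul a a.
Proof. ring. Qed.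
Lemma fZ_mul_at z a n : fmul (fZ z) a n = IZR z * a n.
Proof. apply fcst_mul. Qed.

Ltac coef := repeat rewrite ?fpow2, ?fadd_at, ?fsub_at, ?fD_at, ?fZ_mul_at, ?fmul_at0, ?fmul_at1, ?fmul_at3, ?fmul_at9.

Lemma INR_3 : RtoC (INR 3) = 3.
Proof. apply f_equal. simpl; lra. Qed.
Lemma INR_9 : RtoC (INR 9) = 9.
Proof. apply f_equal. simpl; lra. Qed.

Lemma sol_y1_fP : sol_y1 = fP.
Proof.
  apply fps_ext. intros n.
  (* The constant term 1 puts the resonance at index 1, where the coefficient is
     [-2 (18 - 6) = -24]. *)
  assert (H : forall n, (1 <= n)%nat -> sol_y1 1%nat = fP 1%nat).
  { intros _ _. unfold sol_y1, sol_P, sol_g. rewrite <- (fmulA (fZ 2)). coef.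
    change (sol_t 1%nat) with (RtoC 1). change (sol_t 0%nat) with (RtoC 0).
    change (sol_b 1%nat) with (RtoC (-6)). change (sol_b 0%nat) with (RtoC 0).
    change (sol_p 1%nat) with (RtoC 0). unfold fP. unfold csigma.
    replace (sigma 1 (Z.of_nat 1)) with 1%Z by reflexivity. unfold fZ, fcst. ring. }
  apply (chazy_unique _ _ 1 chazy_y1 chazy_fP); [|reflexivity|apply H].
  - unfold sol_y1, sol_P, sol_g. rewrite <- (fmulA (fZ 2)). coef. unfold fZ, fcst.
    change (sol_t 0%nat) with (RtoC 0). change (sol_b 0%nat) with (RtoC 0). change (sol_p 0%nat) with (RtoC 0).
    simpl INR. ring.
Qed.

Lemma fP_values : fP O = 1 /\ fP 1%nat = -24 /\ fP 2%nat = -72 /\ fP 3%nat = -96.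
Proof.
  unfold fP, csigma. replace (sigma 1 (Z.of_nat 1)) with 1%Z by reflexivity.
  replace (sigma 2 (Z.of_nat 2)) with 3%Z by reflexivity.
  replace (sigma 3 (Z.of_nat 3)) with 4%Z by reflexivity.
  repeat split; rewrite <- ?RtoC_mult, <- ?RtoC_opp; apply f_equal; lra.
Qed.

Definition fP3 := fsubst 3 fP.
Definition fP9 := fsubst 9 fP.

Lemma fP3_values : fP3 O = 1 /\ fP3 1%nat = 0 /\ fP3 2%nat = 0 /\ fP3 3%nat = -24 /\ fP3 4%nat = 0
  /\ fP3 5%nat = 0 /\ fP3 6%nat = -72 /\ fP3 7%nat = 0 /\ fP3 8%nat = 0 /\ fP3 9%nat = -96.
Proof.
  destruct fP_values as (E0 & E1 & E2 & E3). rewrite <- E0, <- E1, <- E2, <- E3. repeat split.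
Qed.

Lemma sol_P_low : sol_P O = 1 /\ sol_P 1%nat = 0 /\ sol_P 2%nat = 0.
Proof.
  assert (H0 : sol_P O = 1) by (unfold sol_P, fadd, fZ, fcst; change (sol_p O) with (RtoC 0); ring).
  destruct fP3_values as (V0 & V1 & V2 & _).
  assert (H : forall n, (n < 3)%nat -> sol_P n = fP3 n).
  { intros n Hn. assert (E : sol_y3 n = (fZ 3 * fP3)%fps n).
    { apply (chazy_unique _ _ 3 chazy_y3); [|unfold sol_y3, fZ; rewrite fcst_mul, H0|unfold fZ; rewrite fcst_mul, V0|lia].
      - apply (chazy_fsubst 3); [lia|apply chazy_fP].
      - rewrite INR_3. ring.
      - simpl INR. rewrite <- RtoC_mult. apply f_equal; lra. }
    unfold sol_y3, fZ in E. rewrite !fcst_mul in E. apply C_eq_cancel in E; auto.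
    apply C_RtoC_neq. lra. }
  rewrite !H by lia. auto.
Qed.

Lemma sol_P_3 : sol_P 3%nat = -24.
Proof.
  assert (R := level3_relation).
  assert (R' : (fZ 2 * sol_y1^2 - fZ 6 * (fZ 4 * fD sol_y1) + fZ 18 * (sol_P^2 - (fZ 4 * fD sol_P)) =
     fZ 5 * (fZ 3 * sol_P - sol_y1)^2)%fps).
  { transitivity (fZ 2 * (sol_y1 ^ 2 - fZ 3 * dl sol_y1 + fZ 9 * (sol_P ^ 2 - dl sol_P)))%fps; [unfold dl; ring|].
    rewrite R. unfold sol_y1. ring. }
  rewrite sol_y1_fP in R'. apply (f_equal (fun f : fps => f 3%nat)) in R'.
  destruct fP_values as (V0 & V1 & V2 & V3). destruct sol_P_low as (P0 & P1 & P2).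
  revert R'. coef. rewrite V0, V1, V2, V3, P0, P1, P2. unfold fZ, fcst. simpl INR; rewrite ?RtoC_plus. intros R'.
  (* Coefficient 3 of the relation is linear in [sol_P 3]: the left side contributes [18 (2 - 12)],
     the right side [5 * 2 * 2 * 3], and the difference is 240. *)
  apply (C_eq_cancel (240)); [apply C_RtoC_neq; lra|].
  match type of R' with ?l = ?r => transitivity (-5760 + (r - l)) end; [ring|rewrite R'; ring].
Qed.

Lemma sol_P_fP3 : sol_P = fP3.
Proof.
  apply (fps_scal_inj (IZR 3)); [apply C_RtoC_neq; lra|].
  change (sol_y3 = (fZ 3 * fP3)%fps). apply fps_ext. intros n.
  destruct fP3_values as (V0 & _ & _ & V3 & _). destruct sol_P_low as (P0 & _).
  apply (chazy_unique _ _ 3 chazy_y3).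
  - apply (chazy_fsubst 3); [lia|apply chazy_fP].
  - unfold sol_y3. rewrite fZ_mul_at, P0, INR_3. ring.
  - rewrite fZ_mul_at, V0, INR_3. ring.
  - intros _. unfold sol_y3. rewrite !fZ_mul_at, V3, sol_P_3. reflexivity.
Qed.

Lemma fP9_low n : (n < 9)%nat -> fP9 n = match n with O => 1 | _ => 0 end.
Proof. intros H. do 9 (destruct n as [|n]; [reflexivity|]). lia. Qed.

Lemma sol_y9_0 : sol_y9 O = INR 9.
Proof.
  unfold sol_y9. rewrite sol_y1_fP, <- (fmulA (fZ 8)). unfold sol_g. coef. unfold fZ, fcst, fP.
  change (sol_t 0%nat) with (RtoC 0). change (sol_b 0%nat) with (RtoC 0). rewrite INR_9. ring.
Qed.

Lemma sol_y9_low n : (n < 9)%nat -> sol_y9 n = (fZ 9 * fP9)%fps n.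
Proof.
  intros Hn. apply (chazy_unique _ _ 9 chazy_y9); [| |rewrite fZ_mul_at, fP9_low by lia|lia].
  - apply (chazy_fsubst 9); [lia|apply chazy_fP].
  - apply sol_y9_0.
  - rewrite INR_9. ring.
Qed.

Lemma sol_y9_9 : sol_y9 9%nat = -216.
Proof.
  assert (R := level9_relation).
  assert (R' : (fZ 18 * (sol_P^2 - fZ 4 * fD sol_P) + fZ 2 * sol_y9^2 - fZ 6 * (fZ 4 * fD sol_y9) =
     fZ 5 * (sol_y9 - fZ 3 * sol_P)^2)%fps) by exact R.
  rewrite sol_P_fP3 in R'. apply (f_equal (fun f : fps => f 9%nat)) in R'.
  destruct fP3_values as (V0 & V1 & V2 & V3 & V4 & V5 & V6 & V7 & V8 & V9).
  assert (Y : forall n, (n < 9)%nat -> sol_y9 n = 9 * match n with O => 1 | _ => 0 end).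
  { intros n Hn. rewrite sol_y9_low, fZ_mul_at, fP9_low by auto. reflexivity. }
  revert R'. coef. rewrite V0, V1, V2, V3, V4, V5, V6, V7, V8, V9.
  rewrite (Y 0%nat), (Y 1%nat), (Y 2%nat), (Y 3%nat), (Y 4%nat), (Y 5%nat), (Y 6%nat), (Y 7%nat), (Y 8%nat) by lia.
  simpl INR; rewrite ?RtoC_plus. intros R'.
  (* Again the unknown enters linearly, with [2 * 18 - 6 * 36] on the left and [5 * 12] on the
     right. *)
  apply (C_eq_cancel (240)); [apply C_RtoC_neq; lra|].
  match type of R' with ?l = ?r => transitivity (-51840 + (r - l)) end; [ring|rewrite R'; ring].
Qed.

Lemma sol_y9_fP9 : sol_y9 = (fZ 9 * fP9)%fps.
Proof.
  apply fps_ext. intros n. apply (chazy_unique _ _ 9 chazy_y9).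
  - apply (chazy_fsubst 9); [lia|apply chazy_fP].
  - apply sol_y9_0.
  - rewrite fZ_mul_at, fP9_low, INR_9 by lia. ring.
  - intros _. rewrite sol_y9_9, fZ_mul_at. unfold fP9, fsubst. simpl (Nat.eqb _ _).
    destruct fP_values as (_ & E1 & _). simpl (9 / 9)%nat. rewrite E1. ring.
Qed.

Definition fE3 := fsubst 3 fE1.
Definition fE9 := fsubst 9 fE1.

Lemma fD_fE3 : (fZ 8 * fD fE3 = (fP3 - fZ 1) * fE3)%fps.
Proof.
  unfold fE3, fP3. rewrite fD_fsubst by lia. simpl Z.of_nat.
  assert (H := f_equal (fsubst 3) fD_fE1). rewrite !fsubst_mul, fsubst_sub, !fsubst_Z in H by lia.
  rewrite <- H. ring.
Qed.
Lemma fD_fE9 : (fZ 24 * fD fE9 = fZ 9 * (fP9 - fZ 1) * fE9)%fps.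
Proof.
  unfold fE9, fP9. rewrite fD_fsubst by lia. simpl Z.of_nat.
  assert (H := f_equal (fsubst 9) fD_fE1). rewrite !fsubst_mul, fsubst_sub, !fsubst_Z in H by lia.
  transitivity (fZ 9 * (fZ 24 * fsubst 9 (fD fE1)))%fps; [ring|]. rewrite H. ring.
Qed.

(* The scaling by [m] clears the denominators of the logarithmic derivative [c / m]. *)
Lemma scaled_ode_unique m (c X Y : fps) k : (0 < m)%Z -> c O = IZR m * INR k ->
  (fZ m * fD X = c * X)%fps -> (fZ m * fD Y = c * Y)%fps -> X k = Y k -> X = Y.
Proof.
  intros Hm Hc HX HY Hk.
  assert (Hm' : RtoC (IZR m) <> 0) by (apply C_RtoC_neq, eq_IZR_contrapositive; lia).
  assert (E : (fcst (/ IZR m) * fZ m = fZ 1)%fps).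
  { apply fps_ext; intros n. rewrite fcst_mul. unfold fZ, fcst. destruct n; [field; auto|ring]. }
  apply (linear_ode_unique (fcst (/ IZR m) * c)%fps X Y k); auto.
  - rewrite fcst_mul, Hc. field; auto.
  - rewrite <- fmulA, <- HX, fmulA, E. ring.
  - rewrite <- fmulA, <- HY, fmulA, E. ring.
Qed.

(** * Eta quotients and the polynomial identities between them *)

Definition fV : fps := (fE1 ^ 3)%fps.
Definition fT : fps := (fX * fE9 ^ 3)%fps.

Lemma fpow_0 (a : fps) n : a O = 1 -> (fpow a n) O = 1.
Proof. intros H. induction n; [reflexivity|]. simpl fpow. rewrite fmul_at0, H, IHn. ring. Qed.

Lemma fX_mul_1 (a : fps) : (fX * a)%fps 1%nat = a O.
Proof. rewrite fmul_at1. unfold fX. ring. Qed.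
Lemma fmul_1_O (a b : fps) : a O = 0 -> (a * b)%fps 1%nat = a 1%nat * b O.
Proof. intros H. rewrite fmul_at1, H. ring. Qed.

Lemma fD_t : fD sol_t = (sol_g * sol_t * (fZ 1 + fZ 9 * sol_t + fZ 27 * sol_t^2))%fps.
Proof.
  apply (fps_scal_inj (IZR 4)); [apply C_RtoC_neq; lra|]. change (fcst (IZR 4)) with (fZ 4).
  change (dl sol_t = fZ 4 * (sol_g * sol_t * (fZ 1 + fZ 9 * sol_t + fZ 27 * sol_t^2)))%fps. rewrite dl_t. ring.
Qed.

Section Eta_quotients.
Local Open Scope fps_scope.

Lemma fD_g : fZ 4 * fD sol_g = sol_g * (fP - fP3).
Proof.
  change (dl sol_g = sol_g * (fP - fP3)). rewrite dl_g, <- sol_y1_fP, <- sol_P_fP3.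
  unfold sol_y1. ring.
Qed.

Lemma sol_y9_y1 : fZ 8 * sol_g * (fZ 1 + fZ 9 * sol_t + fZ 27 * sol_t^2) = fZ 9 * fP9 - fP.
Proof. rewrite <- sol_y9_fP9, <- sol_y1_fP. unfold sol_y9. ring. Qed.

Lemma sol_A : fZ 2 * (fZ 1 + fZ 9 * sol_t)^2 * sol_g = fZ 3 * fP3 - fP.
Proof. rewrite <- sol_y1_fP, <- sol_P_fP3. unfold sol_y1. ring. Qed.

(** Both sides have the logarithmic derivative [(9 E_2(9 tau) - 1) / 8], of constant term 1, so
    comparing the coefficients of [q] suffices. *)
Lemma sol_t_V : sol_t * fV = fT.
Proof.
  apply (scaled_ode_unique 24 (fZ 3 * (fZ 9 * fP9 - fZ 1)) _ _ 1); [lia| | | |].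
  - rewrite fZ_mul_at, fsub_at, fZ_mul_at, fP9_low by lia. unfold fZ, fcst. simpl INR. ring.
  - unfold fV. rewrite fD_mul, (fD_pow fE1 2), fD_t. simpl Z.of_nat.
    transitivity (fZ 3 * (fZ 8 * sol_g * (fZ 1 + fZ 9 * sol_t + fZ 27 * sol_t ^ 2)) * sol_t * fE1 ^ 3
      + fZ 3 * sol_t * fE1^2 * (fZ 24 * fD fE1)); [ring|].
    rewrite sol_y9_y1, fD_fE1. ring.
  - unfold fT. rewrite fD_mul, (fD_pow fE9 2), fD_fX. simpl Z.of_nat.
    transitivity (fZ 24 * fX * fE9 ^ 3 + fZ 3 * fX * fE9^2 * (fZ 24 * fD fE9)); [ring|].
    rewrite fD_fE9. ring.
  - rewrite fmul_1_O by reflexivity. unfold fT. rewrite fX_mul_1. unfold fV.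
    rewrite !fpow_0 by reflexivity. change (sol_t 1%nat) with (RtoC 1). ring.
Qed.

Lemma sol_g_E3 : sol_g * fE3^2 = fV^2.
Proof.
  apply (scaled_ode_unique 24 (fZ 6 * (fP - fZ 1)) _ _ 0); [lia| | | |].
  - rewrite fZ_mul_at, fsub_at. unfold fZ, fcst, fP. simpl INR. ring.
  - rewrite fD_mul, (fD_pow fE3 1). simpl Z.of_nat.
    transitivity (fZ 6 * (fZ 4 * fD sol_g) * fE3 ^ 2 + fZ 6 * sol_g * fE3 * (fZ 8 * fD fE3)); [ring|].
    rewrite fD_g, fD_fE3. ring.
  - unfold fV. rewrite (fD_pow (fE1^3) 1), (fD_pow fE1 2). simpl Z.of_nat.
    transitivity (fZ 6 * fE1^5 * (fZ 24 * fD fE1)); [ring|]. rewrite fD_fE1. ring.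
  - rewrite fmul_at0, !fpow_0 by (reflexivity || (apply fpow_0; reflexivity)).
    change (sol_g O) with (RtoC 1 + 0)%C. ring.
Qed.

(** Both sides have the logarithmic derivative [E_2(3 tau)]; the right side is the expansion of
    [eta(3 tau)^8]. *)
Lemma sol_disc : sol_g^2 * (sol_t * (fZ 1 + fZ 9 * sol_t + fZ 27 * sol_t^2)) = fX * fE3^8.
Proof.
  apply (scaled_ode_unique 24 (fZ 24 * fP3) _ _ 1); [lia| | | |].
  - rewrite fZ_mul_at. change (fP3 O) with (RtoC 1). simpl INR. ring.
  - rewrite !fD_mul, !fD_add, !fD_mul, !fD_Z, (fD_pow sol_g 1), (fD_pow sol_t 1), fD_t. simpl Z.of_nat.
    set (w := fZ 1 + fZ 9 * sol_t + fZ 27 * sol_t ^ 2).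
    transitivity (fZ 12 * sol_g * (fZ 4 * fD sol_g) * (sol_t * w)
     + fZ 12 * sol_g^2 * sol_t * w * (fZ 2 * (fZ 1 + fZ 9 * sol_t) ^ 2 * sol_g)); [unfold w; ring|].
    rewrite fD_g, sol_A. ring.
  - rewrite fD_mul, (fD_pow fE3 7), fD_fX. simpl Z.of_nat.
    transitivity (fZ 24 * fX * fE3 ^ 8 + fZ 24 * fX * fE3^7 * (fZ 8 * fD fE3)); [ring|].
    rewrite fD_fE3. ring.
  - rewrite fX_mul_1, fpow_0 by reflexivity.
    replace (sol_g ^ 2 * (sol_t * (fZ 1 + fZ 9 * sol_t + fZ 27 * sol_t ^ 2)))
      with (sol_t * (sol_g^2 * (fZ 1 + fZ 9 * sol_t + fZ 27 * sol_t ^ 2))) by ring.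
    rewrite fmul_1_O by reflexivity. rewrite fmul_at0, fpow_0 by (change (sol_g O) with (RtoC 1 + 0)%C; ring).
    coef. change (sol_t 0%nat) with (RtoC 0). change (sol_t 1%nat) with (RtoC 1). unfold fZ, fcst. ring.
Qed.

(* With V = E(q)^3 and T = q E(q^9)^3, the function z is (V + 9 T) / V. *)
Lemma eta_cubic : fV * (fT * fV^2 + fZ 9 * fT^2 * fV + fZ 27 * fT^3) = fX * fE3^12.
Proof.
  rewrite <- sol_t_V.
  transitivity ((fV^2)^2 * (sol_t * (fZ 1 + fZ 9 * sol_t + fZ 27 * sol_t^2))); [ring|].
  rewrite <- sol_g_E3.
  transitivity (fE3^4 * (sol_g^2 * (sol_t * (fZ 1 + fZ 9 * sol_t + fZ 27 * sol_t^2)))); [ring|].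
  rewrite sol_disc. ring.
Qed.

(** The left side is the numerator of the derivative of [T / V], hence essentially that of [z']. *)
Lemma eta_wronskian : fV * fD fT - fT * fD fV = fX * fE3^10.
Proof.
  rewrite <- sol_t_V. rewrite fD_mul, fD_t.
  transitivity (fV^2 * (sol_g * sol_t * (fZ 1 + fZ 9 * sol_t + fZ 27 * sol_t^2))); [ring|].
  rewrite <- sol_g_E3.
  transitivity (fE3^2 * (sol_g^2 * (sol_t * (fZ 1 + fZ 9 * sol_t + fZ 27 * sol_t^2)))); [ring|].
  rewrite sol_disc. ring.
Qed.

(** The first factor is [E_4(3 tau)]. With [z = 1 + 9 T / V] the right side is
    [V^4 (z^4 + 8 z) / 9]: this is how the numerator of the duplication formula enters. *)
Lemma eta_quartic : (fP3^2 - fZ 4 * fD fP3) * fE3^4 =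
  (fV + fZ 9 * fT) * (fV^3 + fZ 3 * fT * fV^2 + fZ 27 * fT^2 * fV + fZ 81 * fT^3).
Proof.
  assert (E : fZ 4 * fD fP3 = dl sol_P) by (rewrite <- sol_P_fP3; reflexivity).
  rewrite E, dl_p, sol_P_fP3, <- sol_t_V.
  transitivity ((sol_g * fE3^2)^2 * (fZ 1 + fZ 12 * sol_t + fZ 54 * sol_t^2 + fZ 324 * sol_t^3 + fZ 729 * sol_t^4)); [ring|].
  rewrite sol_g_E3. ring.
Qed.
End Eta_quotients.

(** * Complex sequences and series *)

(** [C_lim_seq] is total and carries no proof of convergence; its values are reached through this
    relation and [C_lim_seq_unique]. *)
Definition Clim (u : nat -> C) (l : C) : Prop :=
  forall eps : R, (0 < eps)%R -> exists N, forall n, (N <= n)%nat -> (Cmod (u n - l) < eps)%R.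

Lemma Re_minus a b : Re (a - b) = (Re a - Re b)%R.
Proof. reflexivity. Qed.
Lemma Im_minus a b : Im (a - b) = (Im a - Im b)%R.
Proof. reflexivity. Qed.

Lemma im_le_Cmod c : (Rabs (Im c) <= Cmod c)%R.
Proof. eapply Rle_trans; [apply Rmax_r|apply Rmax_Cmod]. Qed.

Lemma Clim_Re u l : Clim u l -> is_lim_seq (fun n => Re (u n)) (Re l).
Proof.
  intros H. apply is_lim_seq_spec. intros eps. destruct (H eps (cond_pos eps)) as [N HN].
  exists N. intros n Hn. eapply Rle_lt_trans; [|apply (HN n Hn)].
  rewrite <- Re_minus. apply re_le_Cmod.
Qed.
Lemma Clim_Im u l : Clim u l -> is_lim_seq (fun n => Im (u n)) (Im l).
Proof.
  intros H. apply is_lim_seq_spec. intros eps. destruct (H eps (cond_pos eps)) as [N HN].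
  exists N. intros n Hn. eapply Rle_lt_trans; [|apply (HN n Hn)].
  rewrite <- Im_minus. apply im_le_Cmod.
Qed.

Lemma C_lim_seq_unique u l : Clim u l -> C_lim_seq u = l.
Proof.
  intros H. unfold C_lim_seq. rewrite (is_lim_seq_unique _ _ (Clim_Re _ _ H)).
  rewrite (is_lim_seq_unique _ _ (Clim_Im _ _ H)). destruct l; reflexivity.
Qed.

Lemma Clim_unique u l l' : Clim u l -> Clim u l' -> l = l'.
Proof. intros H H'. rewrite <- (C_lim_seq_unique _ _ H). now apply C_lim_seq_unique. Qed.

Lemma Cmod_le_Re_Im c : (Cmod c <= Rabs (Re c) + Rabs (Im c))%R.
Proof.
  destruct c as [x y]. simpl. replace (x, y) with (RtoC x + Ci * RtoC y).
  - eapply Rle_trans; [apply Cmod_triangle|]. rewrite Cmod_mult, !Cmod_R, Cmod_Ci. lra.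
  - unfold Ci, RtoC, Cplus, Cmult; simpl. f_equal; ring.
Qed.

Lemma Clim_of_Re_Im u l :
  is_lim_seq (fun n => Re (u n)) (Re l) -> is_lim_seq (fun n => Im (u n)) (Im l) -> Clim u l.
Proof.
  intros H1 H2 eps He. apply is_lim_seq_spec in H1. apply is_lim_seq_spec in H2.
  destruct (H1 (pos_div_2 (mkposreal eps He))) as [N1 HN1].
  destruct (H2 (pos_div_2 (mkposreal eps He))) as [N2 HN2]. simpl in *.
  exists (N1 + N2)%nat. intros n Hn.
  eapply Rle_lt_trans; [apply Cmod_le_Re_Im|].
  specialize (HN1 n ltac:(lia)). specialize (HN2 n ltac:(lia)). simpl in *.
  replace (fst (u n) + - fst l)%R with (Re (u n) - Re l)%R by (unfold Re; ring).
  replace (snd (u n) + - snd l)%R with (Im (u n) - Im l)%R by (unfold Im; ring). lra.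
Qed.

Lemma Clim_ext u v l : (forall n, u n = v n) -> Clim u l -> Clim v l.
Proof. intros E H eps He. destruct (H eps He) as [N HN]. exists N. intros n Hn. rewrite <- E; auto. Qed.

Lemma Clim_const c : Clim (fun _ => c) c.
Proof.
  intros eps He. exists O. intros n _. replace (c - c) with (RtoC 0) by ring. rewrite Cmod_0. lra.
Qed.

Lemma Clim_scal c u l : Clim u l -> Clim (fun n => c * u n) (c * l).
Proof.
  intros H eps He. assert (Hc := Cmod_ge_0 c).
  destruct (H (eps / (Cmod c + 1))%R) as [N HN]; [apply Rdiv_lt_0_compat; lra|].
  exists N. intros n Hn. replace (c * u n - c * l) with (c * (u n - l)) by ring.
  rewrite Cmod_mult. specialize (HN n Hn). assert (Hu := Cmod_ge_0 (u n - l)).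
  apply Rle_lt_trans with ((Cmod c + 1) * Cmod (u n - l))%R; [nra|].
  apply Rmult_lt_compat_l with (r := (Cmod c + 1)%R) in HN; [|lra].
  replace ((Cmod c + 1) * (eps / (Cmod c + 1)))%R with eps in HN by (field; lra). lra.
Qed.

Lemma Clim_plus u v l m : Clim u l -> Clim v m -> Clim (fun n => u n + v n) (l + m).
Proof.
  intros H1 H2 eps He. destruct (H1 (eps / 2)%R) as [N1 HN1]; [lra|].
  destruct (H2 (eps / 2)%R) as [N2 HN2]; [lra|]. exists (N1 + N2)%nat. intros n Hn.
  replace (u n + v n - (l + m)) with ((u n - l) + (v n - m)) by ring.
  eapply Rle_lt_trans; [apply Cmod_triangle|].
  specialize (HN1 n ltac:(lia)). specialize (HN2 n ltac:(lia)). lra.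
Qed.

Lemma Clim_bound u l B : (forall n, (Cmod (u n) <= B)%R) -> Clim u l -> (Cmod l <= B)%R.
Proof.
  intros HB H. apply Rnot_lt_le. intros Hlt. destruct (H (Cmod l - B)%R) as [N HN]; [lra|].
  specialize (HN N (le_n _)). specialize (HB N).
  assert (Hm := Cmod_triangle (u N) (- (u N - l))). rewrite Cmod_opp in Hm.
  replace (u N + - (u N - l)) with l in Hm by ring. lra.
Qed.

Lemma Clim_shift u l k : Clim u l -> Clim (fun n => u (n + k)%nat) l.
Proof. intros H eps He. destruct (H eps He) as [N HN]. exists N. intros n Hn. apply HN; lia. Qed.

Lemma Clim_unshift u l k : Clim (fun n => u (n + k)%nat) l -> Clim u l.
Proof.
  intros H eps He. destruct (H eps He) as [N HN]. exists (N + k)%nat. intros n Hn.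
  replace n with (n - k + k)%nat by lia. apply HN; lia.
Qed.

Fixpoint Rsum (M : nat -> R) (n : nat) : R := match n with O => 0%R | S m => (Rsum M m + M m)%R end.

Definition summable (M : nat -> R) : Prop :=
  (forall n, 0 <= M n)%R /\ exists S, forall N, (Rsum M N <= S)%R.

Lemma Rsum_le M M' n : (forall k, M k <= M' k)%R -> (Rsum M n <= Rsum M' n)%R.
Proof. intros H. induction n; simpl; [lra|]. specialize (H n). lra. Qed.
Lemma Rsum_scal c M n : Rsum (fun k => c * M k)%R n = (c * Rsum M n)%R.
Proof. induction n; simpl; [|rewrite IHn]; ring. Qed.
Lemma Rsum_plus M M' n : Rsum (fun k => M k + M' k)%R n = (Rsum M n + Rsum M' n)%R.
Proof. induction n; simpl; [|rewrite IHn]; ring. Qed.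

Lemma Rsum_mono M n m : (forall k, 0 <= M k)%R -> (n <= m)%nat -> (Rsum M n <= Rsum M m)%R.
Proof. intros H. induction 1; simpl; [lra|]. specialize (H m). lra. Qed.

Lemma summable_le M M' : (forall n, 0 <= M n <= M' n)%R -> summable M' -> summable M.
Proof.
  intros H [_ [S HS]]. split; [apply H|]. exists S. intros N.
  eapply Rle_trans; [apply Rsum_le|apply HS]. apply H.
Qed.
Lemma summable_scal c M : (0 <= c)%R -> summable M -> summable (fun n => c * M n)%R.
Proof.
  intros Hc [H [S HS]]. split; [intros; apply Rmult_le_pos; auto|]. exists (c * S)%R. intros N.
  rewrite Rsum_scal. apply Rmult_le_compat_l; auto.
Qed.

Lemma summable_sup M : summable M -> exists S, (forall N, Rsum M N <= S)%R /\
  forall eps, (0 < eps)%R -> exists N, forall n, (N <= n)%nat -> (S - eps < Rsum M n)%R.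
Proof.
  intros [HM [S HS]].
  destruct (completeness (fun x => exists N, x = Rsum M N)) as [s [Hs1 Hs2]].
  - exists S. intros x [N ->]. apply HS.
  - exists 0%R, O. reflexivity.
  - exists s. split.
    + intros N. apply Hs1. now exists N.
    + intros eps He. apply NNPP. intros Hn.
      assert (s <= s - eps)%R; [|lra]. apply Hs2. intros x [N ->].
      apply Rnot_lt_le. intros Hlt. apply Hn. exists N. intros n Hle.
      eapply Rlt_le_trans; [exact Hlt|]. now apply Rsum_mono.
Qed.

Lemma Csum_bound f M n : (forall k, (Cmod (f k) <= M k)%R) -> (Cmod (Csum f n) <= Rsum M n)%R.
Proof.
  intros H. induction n; simpl; [rewrite Cmod_0; lra|].
  eapply Rle_trans; [apply Cmod_triangle|]. specialize (H n). lra.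
Qed.

Lemma Csum_diff_bound f M n m : (forall k, (Cmod (f k) <= M k)%R) -> (n <= m)%nat ->
  (Cmod (Csum f m - Csum f n) <= Rsum M m - Rsum M n)%R.
Proof.
  intros H. induction 1 as [|m Hm IH].
  - replace (Csum f n - Csum f n) with (RtoC 0) by ring. rewrite Cmod_0. lra.
  - simpl. replace (Csum f m + f m - Csum f n) with ((Csum f m - Csum f n) + f m) by ring.
    eapply Rle_trans; [apply Cmod_triangle|]. specialize (H m). lra.
Qed.

Definition Cser (a : nat -> C) (s : C) : Prop := Clim (Csum a) s.

Lemma ex_Cser a M : summable M -> (forall n, (Cmod (a n) <= M n)%R) -> exists s, Cser a s.
Proof.
  intros HM Ha. destruct (summable_sup M HM) as [S [HS1 HS2]].
  assert (HC : forall eps, (0 < eps)%R -> exists N, forall n m, (N <= n)%nat -> (N <= m)%nat ->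
    (Cmod (Csum a n - Csum a m) < eps)%R).
  { intros eps He. destruct (HS2 eps He) as [N HN]. exists N.
    assert (forall n m, (N <= n)%nat -> (n <= m)%nat -> (Cmod (Csum a m - Csum a n) < eps)%R).
    { intros n m Hn Hm. eapply Rle_lt_trans; [apply (Csum_diff_bound a M); auto|].
      specialize (HN n Hn). specialize (HS1 m). lra. }
    intros n m Hn Hm. destruct (Nat.le_ge_cases n m).
    - rewrite <- Cmod_opp. replace (- (Csum a n - Csum a m)) with (Csum a m - Csum a n) by ring. auto.
    - auto. }
  assert (HRe : ex_finite_lim_seq (fun n => Re (Csum a n))).
  { apply ex_lim_seq_cauchy_corr. intros eps. destruct (HC eps (cond_pos eps)) as [N HN]. exists N.
    intros n m Hn Hm. eapply Rle_lt_trans; [|apply (HN n m Hn Hm)].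
    rewrite <- Re_minus.
    apply re_le_Cmod. }
  assert (HIm : ex_finite_lim_seq (fun n => Im (Csum a n))).
  { apply ex_lim_seq_cauchy_corr. intros eps. destruct (HC eps (cond_pos eps)) as [N HN]. exists N.
    intros n m Hn Hm. eapply Rle_lt_trans; [|apply (HN n m Hn Hm)].
    rewrite <- Im_minus.
    apply im_le_Cmod. }
  destruct HRe as [x Hx], HIm as [y Hy]. exists (x, y). now apply Clim_of_Re_Im.
Qed.

Lemma Cser_tail a M S s N : (forall n, (Cmod (a n) <= M n)%R) -> (forall n, Rsum M n <= S)%R ->
  Cser a s -> (Cmod (s - Csum a N) <= S - Rsum M N)%R.
Proof.
  intros Ha HS H.
  assert (Hl : Clim (fun n => Csum a (n + N)%nat + (- Csum a N)) (s + - Csum a N)).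
  { apply Clim_plus; [apply Clim_shift, H|apply Clim_const]. }
  refine (Clim_bound _ _ _ _ Hl). intros n. simpl.
  eapply Rle_trans; [apply (Csum_diff_bound a M); auto; lia|]. specialize (HS (n + N)%nat). lra.
Qed.

Lemma Csum_Clim (f : nat -> nat -> C) g N : (forall n, Clim (fun k => f k n) (g n)) ->
  Clim (fun k => Csum (f k) N) (Csum g N).
Proof.
  intros H. induction N; simpl; [apply Clim_const|]. now apply Clim_plus.
Qed.

(** Dominated convergence for series: a common majorant makes all tails small at once, and finitely
    many terms converge. It serves the Cauchy product, Euler's product and the rearrangement in
    [exp_series_analytic]. *)
Lemma tannery (f : nat -> nat -> C) (g : nat -> C) (M : nat -> R) (F : nat -> C) (G : C) :
  summable M -> (forall k n, (Cmod (f k n) <= M n)%R) ->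
  (forall n, Clim (fun k => f k n) (g n)) ->
  (forall k, Cser (f k) (F k)) -> Cser g G -> Clim F G.
Proof.
  intros HM Hf Hg HF HG eps He.
  destruct (summable_sup M HM) as [S [HS1 HS2]].
  destruct (HS2 (eps / 3)%R) as [N HN]; [lra|]. specialize (HN N (le_n _)).
  assert (Hg' : forall n, (Cmod (g n) <= M n)%R).
  { intros n. apply (Clim_bound (fun k => f k n)); auto. }
  destruct (Csum_Clim f g N Hg (eps / 3)%R) as [K HK]; [lra|].
  exists K. intros k Hk. specialize (HK k Hk).
  replace (F k - G) with ((F k - Csum (f k) N) + ((Csum (f k) N - Csum g N) + - (G - Csum g N))) by ring.
  eapply Rle_lt_trans; [apply Cmod_triangle|].
  assert (H1 := Cser_tail _ M S _ N (Hf k) HS1 (HF k)).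
  assert (H2 := Cser_tail _ M S _ N Hg' HS1 HG).
  assert (H3 := Cmod_triangle (Csum (f k) N - Csum g N) (- (G - Csum g N))). rewrite Cmod_opp in H3. lra.
Qed.

Lemma Cser_finite (a : nat -> C) N : (forall n, (N <= n)%nat -> a n = 0) -> Cser a (Csum a N).
Proof.
  intros H eps He. exists N. intros n Hn.
  replace (Csum a n) with (Csum a N).
  - replace (Csum a N - Csum a N) with (RtoC 0) by ring. rewrite Cmod_0. lra.
  - induction Hn as [|m Hm IH]; auto. simpl. rewrite <- IH, H by auto. ring.
Qed.

Lemma Cser_plus a b s t : Cser a s -> Cser b t -> Cser (fun n => a n + b n) (s + t).
Proof.
  intros Ha Hb. apply (Clim_ext (fun n => Csum a n + Csum b n)).
  - intros n. now rewrite Csum_plus.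
  - now apply Clim_plus.
Qed.
Lemma Cser_scal c a s : Cser a s -> Cser (fun n => c * a n) (c * s).
Proof.
  intros Ha. apply (Clim_ext (fun n => c * Csum a n)).
  - intros n. now rewrite Csum_scal.
  - now apply Clim_scal.
Qed.
Lemma Cser_ext a b s : (forall n, a n = b n) -> Cser a s -> Cser b s.
Proof. intros H. apply Clim_ext. intros n. apply Csum_ext; auto. Qed.
Lemma Cser_unique a s t : Cser a s -> Cser a t -> s = t.
Proof. apply Clim_unique. Qed.
Lemma Cser_bound a M s S : (forall n, (Cmod (a n) <= M n)%R) -> (forall n, Rsum M n <= S)%R ->
  Cser a s -> (Cmod s <= S)%R.
Proof.
  intros Ha HS H. refine (Clim_bound _ _ _ _ H). intros n.
  eapply Rle_trans; [apply Csum_bound, Ha|apply HS].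
Qed.

(* The Cauchy product: its partial sums are [sum_j a_j (b_0 + ... + b_(k-1-j))]. *)
Lemma Cser_mult (a b : nat -> C) (M M' : nat -> R) s t :
  summable M -> summable M' -> (forall n, (Cmod (a n) <= M n)%R) -> (forall n, (Cmod (b n) <= M' n)%R) ->
  Cser a s -> Cser b t ->
  Cser (fun n => Csum (fun k => a k * b (n - k)%nat) (S n)) (s * t).
Proof.
  intros HM HM' Ha Hb Hs Ht. destruct (summable_sup M' HM') as [S' [HS' _]].
  assert (HS0 : (0 <= S')%R) by (specialize (HS' O); simpl in HS'; lra).
  set (f k n := if Nat.ltb n k then a n * Csum b (k - n) else RtoC 0).
  apply (tannery f (fun n => a n * t) (fun n => S' * M n)%R).
  - now apply summable_scal.
  - intros k n. unfold f. destruct (Nat.ltb n k).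
    + rewrite Cmod_mult, Rmult_comm. apply Rmult_le_compat; auto using Cmod_ge_0.
      eapply Rle_trans; [apply Csum_bound, Hb|apply HS'].
    + rewrite Cmod_0. apply Rmult_le_pos; auto. apply HM.
  - intros n. apply Clim_unshift with (k := S n).
    apply (Clim_ext (fun k => a n * Csum b (k + 1))).
    + intros k. unfold f. destruct (Nat.ltb_spec n (k + S n)); [|lia]. do 2 f_equal. lia.
    + apply Clim_scal, Clim_shift, Ht.
  - intros k.
    replace (Csum (fun n => Csum (fun k0 => a k0 * b (n - k0)%nat) (S n)) k) with (Csum (f k) k).
    + apply Cser_finite. intros n Hn. unfold f. destruct (Nat.ltb_spec n k); auto; lia.
    + rewrite (Csum_triangle (fun j n => a j * b (n - j)%nat)). apply Csum_ext. intros j Hj.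
      unfold f. destruct (Nat.ltb_spec j k); [|lia]. rewrite <- Csum_scal. apply Csum_ext.
      intros i Hi. do 2 f_equal. lia.
  - rewrite Cmult_comm. apply (Cser_ext (fun n => t * a n)); [intros; ring|]. now apply Cser_scal.
Qed.

(** * Continuity and complex differentiability *)

Definition Ccont (f : C -> C) (z : C) : Prop :=
  forall eps : R, (0 < eps)%R -> exists d : R, (0 < d)%R /\
    forall w, (Cmod (w - z) < d)%R -> (Cmod (f w - f z) < eps)%R.

(* Carathéodory's formulation of the derivative. *)
Definition Cdiff (f : C -> C) (z l : C) : Prop :=
  exists phi, Ccont phi z /\ phi z = l /\ forall w, f w = f z + phi w * (w - z).

Lemma Cmod_sub_sym (a b : C) : Cmod (a - b) = Cmod (b - a).
Proof. rewrite <- Cmod_opp. f_equal. ring. Qed.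

Lemma Cmod_sub_0 (a : C) : Cmod (a - a) = 0%R.
Proof. replace (a - a) with (RtoC 0) by ring. apply Cmod_0. Qed.

Lemma Cmod_pos (a : C) : a <> 0 -> (0 < Cmod a)%R.
Proof. apply Cmod_gt_0. Qed.

Lemma C_sub_neq (a b : C) : a <> b -> a - b <> 0.
Proof. intros H E. apply H. replace a with (a - b + b) by ring. rewrite E. ring. Qed.

Lemma Ccont_ext_loc (f g : C -> C) z d : (0 < d)%R -> (forall w, (Cmod (w - z) < d)%R -> f w = g w) ->
  Ccont f z -> Ccont g z.
Proof.
  intros Hd E H eps He. destruct (H eps He) as (d' & Hd' & H').
  exists (Rmin d d'). split; [now apply Rmin_glb_lt|]. intros w Hw.
  rewrite <- !E; [apply H'| |]; try (eapply Rlt_le_trans; [exact Hw|]).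
  - apply Rmin_r.
  - rewrite Cmod_sub_0; auto.
  - apply Rmin_l.
Qed.
Lemma Ccont_ext (f g : C -> C) z : (forall w, f w = g w) -> Ccont f z -> Ccont g z.
Proof. intros E. apply (Ccont_ext_loc f g z 1); [lra|auto]. Qed.

Lemma Ccont_const c z : Ccont (fun _ => c) z.
Proof. intros eps He. exists 1%R. split; [lra|]. intros. rewrite Cmod_sub_0; auto. Qed.
Lemma Ccont_id z : Ccont (fun w => w) z.
Proof. intros eps He. exists eps. auto. Qed.
Lemma Ccont_plus f g z : Ccont f z -> Ccont g z -> Ccont (fun w => f w + g w) z.
Proof.
  intros Hf Hg eps He. destruct (Hf (eps/2)%R) as (d1 & Hd1 & H1); [lra|].
  destruct (Hg (eps/2)%R) as (d2 & Hd2 & H2); [lra|].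
  exists (Rmin d1 d2). split; [now apply Rmin_glb_lt|]. intros w Hw.
  specialize (H1 w (Rlt_le_trans _ _ _ Hw (Rmin_l _ _))).
  specialize (H2 w (Rlt_le_trans _ _ _ Hw (Rmin_r _ _))).
  replace (f w + g w - (f z + g z)) with ((f w - f z) + (g w - g z)) by ring.
  eapply Rle_lt_trans; [apply Cmod_triangle|]. lra.
Qed.
Lemma Ccont_mult f g z : Ccont f z -> Ccont g z -> Ccont (fun w => f w * g w) z.
Proof.
  intros Hf Hg eps He.
  assert (A1 := Cmod_ge_0 (f z)). assert (A2 := Cmod_ge_0 (g z)).
  set (K := (Cmod (f z) + Cmod (g z) + 1)%R).
  assert (HK : (0 < K)%R) by (unfold K; lra).
  set (e := Rmin 1 (eps / K)).
  assert (He0 : (0 < e)%R) by (unfold e; apply Rmin_glb_lt; [lra|]; now apply Rdiv_lt_0_compat).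
  assert (He1 : (e <= 1)%R) by apply Rmin_l.
  assert (HeK : (K * e <= eps)%R).
  { apply Rle_trans with (K * (eps / K))%R; [apply Rmult_le_compat_l; [lra|apply Rmin_r]|].
    right. field. lra. }
  destruct (Hf e He0) as (d1 & Hd1 & H1). destruct (Hg e He0) as (d2 & Hd2 & H2).
  exists (Rmin d1 d2). split; [now apply Rmin_glb_lt|]. intros w Hw.
  specialize (H1 w (Rlt_le_trans _ _ _ Hw (Rmin_l _ _))).
  specialize (H2 w (Rlt_le_trans _ _ _ Hw (Rmin_r _ _))).
  replace (f w * g w - f z * g z) with ((f w - f z) * (g w - g z) + ((f w - f z) * g z + f z * (g w - g z))) by ring.
  eapply Rle_lt_trans; [apply Cmod_triangle|].
  assert (H3 := Cmod_triangle ((f w - f z) * g z) (f z * (g w - g z))). rewrite !Cmod_mult in *.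
  assert (B1 := Cmod_ge_0 (f w - f z)). assert (B2 := Cmod_ge_0 (g w - g z)). unfold K in HeK. nra.
Qed.
Lemma Ccont_comp f g z : Ccont g z -> Ccont f (g z) -> Ccont (fun w => f (g w)) z.
Proof.
  intros Hg Hf eps He. destruct (Hf eps He) as (d1 & Hd1 & H1). destruct (Hg d1 Hd1) as (d2 & Hd2 & H2).
  exists d2. auto.
Qed.
Lemma Ccont_inv (z : C) : z <> 0 -> Ccont (fun w => / w) z.
Proof.
  intros Hz eps He. assert (Hm := Cmod_pos z Hz). set (m := Cmod z) in *.
  exists (Rmin (m / 2) (eps * (m * m / 2))). split.
  { apply Rmin_glb_lt; [lra|]. apply Rmult_lt_0_compat; auto. nra. }
  intros w Hw. assert (Hw1 := Rlt_le_trans _ _ _ Hw (Rmin_l _ _)). assert (Hw2 := Rlt_le_trans _ _ _ Hw (Rmin_r _ _)).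
  assert (Hwm : (m / 2 < Cmod w)%R).
  { assert (H3 := Cmod_triangle w (- (w - z))). rewrite Cmod_opp in H3.
    replace (w + - (w - z)) with z in H3 by ring. fold m in H3. lra. }
  assert (Hw0 : w <> 0) by (intros ->; rewrite Cmod_0 in Hwm; lra).
  replace (/ w - / z) with (- (w - z) / (w * z)) by (field; auto).
  rewrite Cmod_div by (now apply Cmod_gt_0; rewrite Cmod_mult; fold m; nra). rewrite Cmod_opp, Cmod_mult. fold m.
  apply Rmult_lt_reg_r with (Cmod w * m)%R; [nra|].
  replace (Cmod (w - z) / (Cmod w * m) * (Cmod w * m))%R with (Cmod (w - z)) by (field; split; lra).
  apply Rlt_le_trans with (1 := Hw2). apply Rmult_le_compat_l; nra.
Qed.

Lemma Cdiff_eps (f : C -> C) z l :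
  (forall eps, (0 < eps)%R -> exists d, (0 < d)%R /\ forall w, (Cmod (w - z) < d)%R ->
     (Cmod (f w - f z - l * (w - z)) <= eps * Cmod (w - z))%R) <-> Cdiff f z l.
Proof.
  split.
  - intros H.
    exists (fun w => if Ceq_dec w z then l else (f w - f z) / (w - z)).
    split; [|split].
    + intros eps He. destruct (H (eps / 2)%R) as (d & Hd & H'); [lra|]. exists d. split; auto.
      intros w Hw. destruct (Ceq_dec z z) as [_|]; [|easy].
      destruct (Ceq_dec w z) as [->|Hwz]; [rewrite Cmod_sub_0; auto|].
      assert (Hn := C_sub_neq _ _ Hwz). assert (Hp := Cmod_pos _ Hn).
      replace ((f w - f z) / (w - z) - l) with ((f w - f z - l * (w - z)) / (w - z)) by (field; auto).
      rewrite Cmod_div by auto. specialize (H' w Hw).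
      apply Rle_lt_trans with (eps / 2)%R; [|lra].
      apply Rmult_le_reg_r with (Cmod (w - z)); auto.
      unfold Rdiv. rewrite Rmult_assoc, Rinv_l by lra. lra.
    + destruct (Ceq_dec z z); easy.
    + intros w. destruct (Ceq_dec w z) as [->|Hwz]; [ring|].
      field. now apply C_sub_neq.
  - intros (phi & Hc & <- & Hf) eps He. destruct (Hc eps He) as (d & Hd & H). exists d. split; auto.
    intros w Hw. rewrite Hf. replace (f z + phi w * (w - z) - f z - phi z * (w - z)) with ((phi w - phi z) * (w - z)) by ring.
    rewrite Cmod_mult. apply Rmult_le_compat_r; [apply Cmod_ge_0|]. left; auto.
Qed.

Lemma Cdiff_cont f z l : Cdiff f z l -> Ccont f z.
Proof.
  intros (phi & Hc & _ & Hf). apply (Ccont_ext (fun w => f z + phi w * (w + - z))); [intros; now rewrite (Hf w)|].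
  apply Ccont_plus; [apply Ccont_const|]. apply Ccont_mult; auto.
  apply Ccont_plus; [apply Ccont_id|apply Ccont_const].
Qed.
Lemma Cdiff_ext_loc (f g : C -> C) z l (d : R) : (0 < d)%R -> (forall w, (Cmod (w - z) < d)%R -> f w = g w) ->
  Cdiff f z l -> Cdiff g z l.
Proof.
  intros Hd E H. apply Cdiff_eps. rewrite <- Cdiff_eps in H. intros eps He.
  destruct (H eps He) as (d' & Hd' & H').
  exists (Rmin d d'). split; [now apply Rmin_glb_lt|]. intros w Hw.
  rewrite <- !E; [apply H'| |]; try (eapply Rlt_le_trans; [exact Hw|]).
  - apply Rmin_r.
  - rewrite Cmod_sub_0; auto.
  - apply Rmin_l.
Qed.
Lemma Cdiff_ext (f g : C -> C) z l : (forall w, f w = g w) -> Cdiff f z l -> Cdiff g z l.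
Proof. intros E. apply (Cdiff_ext_loc f g z l 1); [lra|auto]. Qed.
Lemma Cdiff_eq f z l l' : l = l' -> Cdiff f z l -> Cdiff f z l'.
Proof. now intros ->. Qed.
Lemma Cdiff_const c z : Cdiff (fun _ => c) z 0.
Proof. exists (fun _ => 0). repeat split; [apply Ccont_const|intros; ring]. Qed.
Lemma Cdiff_id z : Cdiff (fun w => w) z 1.
Proof. exists (fun _ => 1). repeat split; [apply Ccont_const|intros; ring]. Qed.
Lemma Cdiff_plus f g z l m : Cdiff f z l -> Cdiff g z m -> Cdiff (fun w => f w + g w) z (l + m).
Proof.
  intros (p & Hp & <- & Hf) (q & Hq & <- & Hg). exists (fun w => p w + q w).
  split; [now apply Ccont_plus|split; auto]. intros w. rewrite (Hf w), (Hg w). ring.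
Qed.
Lemma Cdiff_mult f g z l m : Cdiff f z l -> Cdiff g z m -> Cdiff (fun w => f w * g w) z (l * g z + f z * m).
Proof.
  intros Hf' Hg'. assert (Hc := Cdiff_cont _ _ _ Hg'). revert Hf' Hg'.
  intros (p & Hp & <- & Hf) (q & Hq & <- & Hg).
  exists (fun w => p w * g w + f z * q w).
  split; [|split; auto].
  - apply Ccont_plus; apply Ccont_mult; auto using Ccont_const.
  - intros w. rewrite (Hf w). transitivity (f z * g w + p w * g w * (w - z)); [ring|]. rewrite (Hg w) at 1. ring.
Qed.
Lemma Cdiff_scal c f z l : Cdiff f z l -> Cdiff (fun w => c * f w) z (c * l).
Proof.
  intros H. eapply Cdiff_eq; [|apply (Cdiff_mult (fun _ => c) f z 0 l); auto using Cdiff_const]. ring.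
Qed.
Lemma Cdiff_minus f g z l m : Cdiff f z l -> Cdiff g z m -> Cdiff (fun w => f w - g w) z (l - m).
Proof.
  intros Hf Hg. apply (Cdiff_ext (fun w => f w + (-1) * g w)); [intros; ring|].
  apply (Cdiff_eq _ _ (l + (-1) * m)); [ring|]. apply Cdiff_plus; auto. now apply Cdiff_scal.
Qed.
Lemma Cdiff_comp f g z l m : Cdiff g z m -> Cdiff f (g z) l -> Cdiff (fun w => f (g w)) z (l * m).
Proof.
  intros Hg' Hf'. assert (Hc := Cdiff_cont _ _ _ Hg'). revert Hf' Hg'.
  intros (p & Hp & <- & Hf) (q & Hq & <- & Hg).
  exists (fun w => p (g w) * q w). split; [|split; auto].
  - apply Ccont_mult; auto. now apply Ccont_comp.
  - intros w. rewrite (Hf (g w)). rewrite (Hg w) at 2. ring.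
Qed.
Lemma Cdiff_inv (z : C) : z <> 0 -> Cdiff (fun w => / w) z (- / (z * z)).
Proof.
  intros Hz. assert (Hm := Cmod_pos z Hz).
  apply (Cdiff_ext_loc (fun w => / z + (- / z * / w) * (w - z)) _ _ _ (Cmod z)); auto.
  - intros w Hw. assert (w <> 0).
    { intros ->. rewrite Cmod_sub_sym in Hw. replace (z - 0) with z in Hw by ring. lra. }
    field; auto.
  - exists (fun w => - / z * / w). split; [|split].
    + apply Ccont_mult; [apply Ccont_const|now apply Ccont_inv].
    + field; auto.
    + intros w. ring.
Qed.
Lemma Cdiff_pow f z l n : Cdiff f z l -> Cdiff (fun w => f w ^ S n) z (INR (S n) * f z ^ n * l).
Proof.
  intros H. induction n.
  - apply (Cdiff_ext f); [intros; simpl; ring|]. eapply Cdiff_eq; [|exact H]. simpl. ring.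
  - apply (Cdiff_ext (fun w => f w * f w ^ S n)); [reflexivity|].
    eapply Cdiff_eq; [|apply Cdiff_mult; [exact H|exact IHn]].
    rewrite (S_INR (S n)), RtoC_plus. simpl (f z ^ S n). ring.
Qed.
Lemma Cdiff_div (f g : C -> C) z l m : g z <> 0 -> Cdiff f z l -> Cdiff g z m ->
  Cdiff (fun w => f w / g w) z ((l * g z - f z * m) / g z ^ 2).
Proof.
  intros Hn Hf Hg.
  apply (Cdiff_eq _ _ (l * / g z + f z * (- / (g z * g z) * m))).
  - field; auto.
  - apply (Cdiff_mult f (fun w => / g w)); auto.
    apply (Cdiff_comp (fun w => / w) g); auto. now apply Cdiff_inv.
Qed.
Lemma Cdiff_unique f z l l' : Cdiff f z l -> Cdiff f z l' -> l = l'.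
Proof.
  intros H1 H2. apply NNPP. intros Hn. apply C_sub_neq, Cmod_pos in Hn.
  rewrite <- Cdiff_eps in H1. rewrite <- Cdiff_eps in H2. set (e := Cmod (l - l')) in *.
  destruct (H1 (e/4)%R) as (d1 & Hd1 & K1); [lra|]. destruct (H2 (e/4)%R) as (d2 & Hd2 & K2); [lra|].
  set (d := (Rmin d1 d2 / 2)%R). assert (Hd : (0 < d)%R) by (unfold d; assert (0 < Rmin d1 d2)%R by (now apply Rmin_glb_lt); lra).
  assert (Hd1' := Rmin_l d1 d2). assert (Hd2' := Rmin_r d1 d2).
  set (w := z + RtoC d). assert (E : w - z = RtoC d) by (unfold w; ring).
  assert (Ew : Cmod (w - z) = d) by (rewrite E, Cmod_R, Rabs_pos_eq; lra).
  specialize (K1 w). specialize (K2 w). rewrite Ew in K1, K2.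
  specialize (K1 ltac:(unfold d in *; lra)). specialize (K2 ltac:(unfold d in *; lra)).
  assert (H3 := Cmod_triangle (f w - f z - l' * (w - z)) (- (f w - f z - l * (w - z)))).
  rewrite Cmod_opp in H3.
  replace (f w - f z - l' * (w - z) + - (f w - f z - l * (w - z))) with ((l - l') * (w - z)) in H3 by ring.
  rewrite Cmod_mult, Ew in H3. fold e in H3. nra.
Qed.

Lemma Cdiff_is_derive f z l : Cdiff f z l <-> is_derive f z l.
Proof.
  rewrite <- Cdiff_eps. split.
  - intros H. split.
    + apply (is_linear_scal_l (K := C_AbsRing) (V := C_NormedModule) l).
    + intros x Hx. assert (x = z) as ->.
      { symmetry. apply (is_filter_lim_locally_unique (V := AbsRing_NormedModule C_AbsRing) z x Hx). }
      intros eps. destruct (H eps (cond_pos eps)) as (d & Hd & H').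
      exists (mkposreal d Hd). intros w Hw.
      specialize (H' w Hw). unfold minus at 1, plus at 1, opp at 1. simpl.
      change (norm (minus w z)) with (Cmod (w - z)).
      change (scal (minus w z) l) with ((w - z) * l).
      change (norm (?a)) with (Cmod a).
      eapply Rle_trans; [right|exact H']. apply f_equal. unfold minus, plus, opp; simpl; ring.
  - intros [_ H] eps He. specialize (H z ltac:(now intros P HP)).
    destruct (H (mkposreal eps He)) as [d Hd].
    exists d. split; [apply cond_pos|]. intros w Hw. specialize (Hd w Hw). simpl in Hd.
    replace (f w - f z - l * (w - z)) with (minus (minus (f w) (f z)) (scal (minus w z) l)).
    exact Hd. unfold minus, plus, opp, scal, mult; simpl. unfold scal, mult; simpl. ring.
Qed.

(** * Evaluation of power series in the unit disc *)

(* The radius of convergence is at least 1. *)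
Definition rad1 (a : fps) : Prop := forall r, (0 < r < 1)%R -> exists M, forall n, (Cmod (a n) * r ^ n <= M)%R.

(** Bernoulli's inequality for the powers of [1 / x]. Together with the intermediate radius
    [(1 + r) / 2] it absorbs the polynomial factors that products and derivatives bring into
    [rad1]. *)
Lemma poly_geom_bound x : (0 < x < 1)%R -> exists K, (0 < K)%R /\ forall n, ((INR n + 1) * x ^ n <= K)%R.
Proof.
  intros Hx. set (h := (/ x - 1)%R).
  assert (Hh : (0 < h)%R). { unfold h. assert (1 < / x)%R; [rewrite <- Rinv_1; apply Rinv_lt_contravar; lra|lra]. }
  exists (1 + / h)%R. assert (Hi := Rinv_0_lt_compat h Hh). split; [lra|]. intros n.
  assert (Hb : (1 + INR n * h <= (1 + h) ^ n)%R) by (apply poly; lra).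
  assert (Hp : (0 < x ^ n)%R) by (apply pow_lt; lra).
  assert (E : (x ^ n * (1 + h) ^ n = 1)%R).
  { rewrite <- Rpow_mult_distr. unfold h. replace (x * (1 + (/ x - 1)))%R with 1%R by (field; lra). apply pow1. }
  assert (Hn := pos_INR n).
  assert (K1 : (INR n + 1 <= (1 + / h) * (1 + INR n * h))%R).
  { replace ((1 + / h) * (1 + INR n * h))%R with (1 + / h + INR n * h + INR n)%R by (field; lra). nra. }
  apply Rle_trans with ((1 + / h) * (1 + h) ^ n * x ^ n)%R.
  - apply Rmult_le_compat_r; [lra|]. apply Rle_trans with (1 := K1). apply Rmult_le_compat_l; lra.
  - rewrite Rmult_assoc, (Rmult_comm ((1 + h) ^ n)), E. lra.
Qed.

Lemma between r : (0 < r < 1)%R -> (0 < (1 + r) / 2 < 1)%R /\ (0 < r / ((1 + r) / 2) < 1)%R.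
Proof.
  intros Hr. split; [lra|]. split; [apply Rdiv_lt_0_compat; lra|].
  apply Rmult_lt_reg_r with ((1 + r) / 2)%R; [lra|]. unfold Rdiv at 1. rewrite Rmult_assoc, Rinv_l; lra.
Qed.

Lemma pow_split r n : (0 < r)%R -> (r ^ n = ((1 + r) / 2) ^ n * (r / ((1 + r) / 2)) ^ n)%R.
Proof. intros Hr. rewrite <- Rpow_mult_distr. f_equal. field; lra. Qed.

Lemma rad1_le (a : fps) (b : fps) : (forall n, (Cmod (a n) <= Cmod (b n))%R) -> rad1 b -> rad1 a.
Proof.
  intros H Hb r Hr. destruct (Hb r Hr) as [M HM]. exists M. intros n.
  eapply Rle_trans; [|apply HM]. apply Rmult_le_compat_r; auto. apply pow_le; lra.
Qed.
Lemma rad1_add a b : rad1 a -> rad1 b -> rad1 (fadd a b).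
Proof.
  intros Ha Hb r Hr. destruct (Ha r Hr) as [M HM], (Hb r Hr) as [M' HM']. exists (M + M')%R. intros n.
  unfold fadd. assert (Hp : (0 <= r ^ n)%R) by (apply pow_le; lra).
  specialize (HM n). specialize (HM' n). assert (H3 := Cmod_triangle (a n) (b n)). nra.
Qed.
Lemma rad1_scal_n (a : fps) : rad1 a -> rad1 (fun n => (INR n + 1) * a n).
Proof.
  intros Ha r Hr. destruct (between r Hr) as [H1 H2].
  destruct (Ha _ H1) as [M HM]. destruct (poly_geom_bound _ H2) as (K & HK & HK').
  exists (M * K)%R. intros n. rewrite (pow_split r n) by lra. specialize (HM n). specialize (HK' n).
  rewrite Cmod_mult, <- RtoC_plus, Cmod_R, Rabs_pos_eq by (assert (Hn := pos_INR n); lra).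
  apply Rle_trans with ((Cmod (a n) * ((1 + r) / 2) ^ n) * ((INR n + 1) * (r / ((1 + r) / 2)) ^ n))%R; [right; ring|].
  apply Rmult_le_compat; auto.
  - apply Rmult_le_pos; [apply Cmod_ge_0|apply pow_le; lra].
  - apply Rmult_le_pos; [assert (Hn := pos_INR n); lra|apply pow_le; lra].
Qed.
Lemma rad1_mul a b : rad1 a -> rad1 b -> rad1 (fmul a b).
Proof.
  intros Ha Hb r Hr. destruct (between r Hr) as [H1 H2].
  destruct (Ha _ H1) as [M HM], (Hb _ H1) as [M' HM']. destruct (poly_geom_bound _ H2) as (K & HK & HK').
  exists (M * M' * K)%R. intros n. rewrite (pow_split r n) by lra. set (s := ((1 + r) / 2)%R) in *.
  assert (E : (Cmod (fmul a b n) * s ^ n <= (INR n + 1) * (M * M'))%R).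
  { unfold fmul. apply Rle_trans with (Rsum (fun k => if Nat.leb k n then M * M' else 0)%R (S n)).
    - apply Rle_trans with (Cmod (s ^ n * Csum (fun k => a k * b (n - k)%nat) (S n))).
      { rewrite Cmod_mult, <- RtoC_pow, Cmod_R, Rabs_pos_eq by (apply pow_le; lra). right; ring. }
      rewrite <- Csum_scal.
      rewrite (Csum_ext _ (fun k => if Nat.leb k n then s ^ n * (a k * b (n - k)%nat) else 0)).
      2:{ intros k Hk. destruct (Nat.leb_spec k n); [auto|lia]. }
      apply Csum_bound. intros k. destruct (Nat.leb_spec k n) as [Hk|]; [|rewrite Cmod_0; lra].
      rewrite !Cmod_mult, <- RtoC_pow, Cmod_R, Rabs_pos_eq by (apply pow_le; lra).
      replace (s ^ n)%R with (s ^ k * s ^ (n - k))%R by (rewrite <- pow_add; f_equal; lia).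
      apply Rle_trans with ((Cmod (a k) * s ^ k) * (Cmod (b (n - k)%nat) * s ^ (n - k)))%R; [right; ring|].
      apply Rmult_le_compat; auto; apply Rmult_le_pos; try apply Cmod_ge_0; apply pow_le; lra.
    - assert (Em : forall m, (m <= S n)%nat -> Rsum (fun k => if Nat.leb k n then M * M' else 0)%R m = (INR m * (M * M'))%R).
      { induction m; intros Hm; [simpl; ring|]. rewrite S_INR. cbn [Rsum]. rewrite IHm by lia.
        destruct (Nat.leb_spec m n); [ring|lia]. }
      rewrite Em, S_INR by lia. lra. }
  assert (HMM : (0 <= M * M')%R).
  { specialize (HM O). specialize (HM' O). simpl in HM, HM'. assert (A1 := Cmod_ge_0 (a O)). assert (A2 := Cmod_ge_0 (b O)).
    apply Rmult_le_pos; lra. }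
  rewrite <- Rmult_assoc. apply Rle_trans with ((INR n + 1) * (M * M') * (r / s) ^ n)%R.
  - apply Rmult_le_compat_r; auto. apply pow_le; lra.
  - specialize (HK' n). nra.
Qed.
Lemma rad1_cst c : rad1 (fcst c).
Proof.
  intros r Hr. exists (Cmod c). intros [|n]; simpl; [lra|]. rewrite Cmod_0, Rmult_0_l. apply Cmod_ge_0.
Qed.
Lemma rad1_sub a b : rad1 a -> rad1 b -> rad1 (fsub a b).
Proof.
  intros Ha Hb. replace (fsub a b) with (a + fZ (-1) * b)%fps by ring.
  apply rad1_add, rad1_mul; auto. apply rad1_cst.
Qed.
Lemma rad1_Z z : rad1 (fZ z).
Proof. apply rad1_cst. Qed.
Lemma rad1_pow a n : rad1 a -> rad1 (fpow a n).
Proof. intros Ha. induction n; [apply rad1_Z|]. now apply rad1_mul. Qed.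
Lemma rad1_fD a : rad1 a -> rad1 (fD a).
Proof.
  intros Ha. refine (rad1_le _ _ _ (rad1_scal_n a Ha)). intros n. unfold fD. assert (Hn := pos_INR n).
  rewrite !Cmod_mult, <- RtoC_plus, !Cmod_R, !Rabs_pos_eq by lra.
  apply Rmult_le_compat_r; [apply Cmod_ge_0|lra].
Qed.
Lemma rad1_bounded (a : fps) B : (forall n, (Cmod (a n) <= B)%R) -> rad1 a.
Proof.
  intros H r Hr. exists B. intros n. specialize (H n). assert (H1 := Cmod_ge_0 (a n)).
  assert (0 <= r ^ n <= 1)%R. { split; [apply pow_le; lra|]. rewrite <- (pow1 n). apply pow_incr. lra. }
  nra.
Qed.
Lemma rad1_fX : rad1 fX.
Proof.
  apply (rad1_bounded _ 1). intros [|[|n]]; simpl; rewrite ?Cmod_0, ?Cmod_1; lra.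
Qed.
Lemma rad1_fsubst k a : (1 <= k)%nat -> rad1 a -> rad1 (fsubst k a).
Proof.
  intros Hk Ha r Hr.
  assert (Hrk : (0 < r ^ k < 1)%R).
  { split; [apply pow_lt; lra|]. apply pow_lt_1_compat; [lra|lia]. }
  destruct (Ha _ Hrk) as [M HM]. exists M. intros n.
  destruct (multiple_dec k n Hk) as [[m ->]|Hn].
  - rewrite fsubst_mult, pow_mult by auto. apply HM.
  - rewrite fsubst_other, Cmod_0, Rmult_0_l by auto. specialize (HM O). assert (A1 := Cmod_ge_0 (a O)). simpl in HM. lra.
Qed.

Lemma rad1_summable (a : fps) r : rad1 a -> (0 <= r < 1)%R -> summable (fun n => Cmod (a n) * r ^ n)%R.
Proof.
  intros Ha Hr. split; [intros; apply Rmult_le_pos; [apply Cmod_ge_0|apply pow_le; lra]|].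
  destruct (Req_dec r 0) as [->|Hr0].
  - exists (Cmod (a O)). intros [|N]; [simpl; apply Cmod_ge_0|]. right.
    induction N; [simpl; ring|]. change (Rsum ?f (S (S N))) with (Rsum f (S N) + f (S N))%R. cbv beta.
    rewrite IHN. simpl. ring.
  - destruct (between r ltac:(lra)) as [H1 H2]. destruct (Ha _ H1) as [M HM].
    set (s := ((1 + r) / 2)%R) in *. set (x := (r / s)%R) in *.
    assert (HM0 : (0 <= M)%R). { specialize (HM O). simpl in HM. assert (A1 := Cmod_ge_0 (a O)). lra. }
    exists (M * / (1 - x))%R. intros N.
    apply Rle_trans with (Rsum (fun n => M * x ^ n)%R N).
    + apply Rsum_le. intros n. rewrite (pow_split r n) by lra. fold s x.
      rewrite <- Rmult_assoc. apply Rmult_le_compat_r; auto. apply pow_le; lra.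
    + rewrite Rsum_scal. apply Rmult_le_compat_l; auto.
      assert (E : (Rsum (fun n => x ^ n) N * (1 - x) = 1 - x ^ N)%R) by (induction N; simpl; [ring|rewrite Rmult_plus_distr_r, IHN; ring]).
      apply Rmult_le_reg_r with (1 - x)%R; [lra|]. change (Rsum (pow x) N) with (Rsum (fun n => x ^ n)%R N). rewrite E, Rinv_l by lra.
      assert (0 <= x ^ N)%R by (apply pow_le; lra). lra.
Qed.

Definition ev (a : fps) (q : C) : C := C_lim_seq (Csum (fun n => a n * q ^ n)).

Lemma ev_Cser a q : rad1 a -> (Cmod q < 1)%R -> Cser (fun n => a n * q ^ n) (ev a q).
Proof.
  intros Ha Hq. destruct (ex_Cser (fun n => a n * q ^ n) (fun n => Cmod (a n) * Cmod q ^ n)%R) as [s Hs].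
  - apply rad1_summable; auto. split; auto. apply Cmod_ge_0.
  - intros n. rewrite Cmod_mult, Cmod_pow. lra.
  - unfold ev. now rewrite (C_lim_seq_unique _ _ Hs).
Qed.

Lemma ev_add a b q : rad1 a -> rad1 b -> (Cmod q < 1)%R -> ev (fadd a b) q = ev a q + ev b q.
Proof.
  intros Ha Hb Hq. apply (Cser_unique (fun n => fadd a b n * q ^ n)).
  - apply ev_Cser; auto. now apply rad1_add.
  - eapply Cser_ext; [|apply Cser_plus; apply ev_Cser; eauto]. intros; unfold fadd; simpl; ring.
Qed.
Lemma ev_mul a b q : rad1 a -> rad1 b -> (Cmod q < 1)%R -> ev (fmul a b) q = ev a q * ev b q.
Proof.
  intros Ha Hb Hq. apply (Cser_unique (fun n => fmul a b n * q ^ n)).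
  - apply ev_Cser; auto. now apply rad1_mul.
  - assert (Hs : forall a, rad1 a -> summable (fun n => Cmod (a n) * Cmod q ^ n)%R).
    { intros; apply rad1_summable; auto. split; auto. apply Cmod_ge_0. }
    assert (H := Cser_mult (fun n => a n * q ^ n) (fun n => b n * q ^ n) _ _ (ev a q) (ev b q) (Hs a Ha) (Hs b Hb)).
    refine (Cser_ext _ _ _ _ (H _ _ (ev_Cser _ _ Ha Hq) (ev_Cser _ _ Hb Hq))).
    + intros n. unfold fmul. rewrite Cmult_comm, <- Csum_scal. apply Csum_ext. intros k Hk.
      replace (q ^ n) with (q ^ k * q ^ (n - k)) by (rewrite <- Cpow_add_r; f_equal; lia). ring.
    + intros n. rewrite Cmod_mult, Cmod_pow. lra.
    + intros n. rewrite Cmod_mult, Cmod_pow. lra.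
Qed.
Lemma ev_finite (a : fps) q N s : (forall n, (N <= n)%nat -> a n = 0) ->
  Csum (fun n => a n * q ^ n) N = s -> ev a q = s.
Proof.
  intros Ha <-. apply C_lim_seq_unique, Cser_finite. intros n Hn. rewrite Ha by auto. ring.
Qed.
Lemma ev_cst c q : ev (fcst c) q = c.
Proof.
  apply (ev_finite _ _ 1); [intros [|n] Hn; [lia|reflexivity]|simpl; ring].
Qed.
Lemma ev_Z z q : ev (fZ z) q = IZR z.
Proof. apply ev_cst. Qed.
Lemma ev_sub a b q : rad1 a -> rad1 b -> (Cmod q < 1)%R -> ev (fsub a b) q = ev a q - ev b q.
Proof.
  intros Ha Hb Hq. replace (fsub a b) with (a + fZ (-1) * b)%fps by ring.
  rewrite ev_add, ev_mul, ev_Z; auto using rad1_mul, rad1_Z. ring.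
Qed.
Lemma ev_pow a n q : rad1 a -> (Cmod q < 1)%R -> ev (fpow a n) q = ev a q ^ n.
Proof.
  intros Ha Hq. induction n; [apply ev_Z|]. simpl fpow. rewrite ev_mul, IHn by auto using rad1_pow. reflexivity.
Qed.
Lemma ev_fX q : ev fX q = q.
Proof.
  apply (ev_finite _ _ 2); [intros [|[|n]] Hn; try lia; reflexivity|simpl; ring].
Qed.
Lemma ev_0 a : rad1 a -> ev a 0 = a O.
Proof.
  intros Ha. apply (Cser_unique (fun n => a n * 0 ^ n)).
  - apply ev_Cser; auto. rewrite Cmod_0. lra.
  - replace (a O) with (Csum (fun n => a n * 0 ^ n) 1) by (simpl; ring).
    apply Cser_finite. intros [|n] Hn; [lia|]. simpl. ring.
Qed.

Lemma pow_disc q k : (1 <= k)%nat -> (Cmod q < 1)%R -> (Cmod (q ^ k) < 1)%R.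
Proof.
  intros Hk Hq. rewrite Cmod_pow. apply pow_lt_1_compat; [split; auto; apply Cmod_ge_0|lia].
Qed.

Lemma ev_fsubst k a q : (1 <= k)%nat -> rad1 a -> (Cmod q < 1)%R -> ev (fsubst k a) q = ev a (q ^ k).
Proof.
  intros Hk Ha Hq. apply (Clim_unique (fun m => Csum (fun n => fsubst k a n * q ^ n) (S (k * m)))).
  - assert (H := ev_Cser _ _ (rad1_fsubst k a Hk Ha) Hq). intros eps He. destruct (H eps He) as [N HN].
    exists N. intros n Hn. apply HN. nia.
  - apply (Clim_ext (fun m => Csum (fun n => a n * (q ^ k) ^ n) (m + 1))).
    + intros m. rewrite Nat.add_1_r, Csum_multiples; auto.
      * apply Csum_ext. intros j Hj. rewrite fsubst_mult, Cpow_mult_r by auto. reflexivity.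
      * intros n Hn. rewrite fsubst_other by auto. ring.
    + apply Clim_shift. apply ev_Cser; auto. now apply pow_disc.
Qed.

(* Multiplying by [R^2] avoids the exponent [n - 2]. *)
Lemma pow_taylor (q w : C) R n : (Cmod q <= R)%R -> (Cmod w <= R)%R ->
  (R * R * Cmod (w ^ n - q ^ n - INR n * q ^ pred n * (w - q)) <= INR n * INR n * R ^ n * (Cmod (w - q) * Cmod (w - q)))%R.
Proof.
  intros Hq Hw. assert (HR : (0 <= R)%R) by (eapply Rle_trans; [apply Cmod_ge_0|exact Hq]).
  induction n.
  - simpl. replace (1 - 1 - 0 * 1 * (w - q)) with (RtoC 0) by ring. rewrite Cmod_0. lra.
  - set (e := w ^ n - q ^ n - INR n * q ^ pred n * (w - q)) in *.
    assert (E : w ^ S n - q ^ S n - INR (S n) * q ^ pred (S n) * (w - q) =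
      w * e + INR n * q ^ pred n * ((w - q) * (w - q))).
    { unfold e. simpl pred. rewrite S_INR, RtoC_plus. simpl (_ ^ S n). destruct n as [|n]; [simpl; ring|].
      simpl pred. simpl (_ ^ S n). ring. }
    rewrite E. set (h := Cmod (w - q)) in *.
    assert (T := Cmod_triangle (w * e) (INR n * q ^ pred n * ((w - q) * (w - q)))).
    rewrite !Cmod_mult, Cmod_R, Rabs_pos_eq, Cmod_pow in T by apply pos_INR. fold h in T.
    assert (Hn := pos_INR n). assert (He := Cmod_ge_0 e). assert (Hh : (0 <= h)%R) by apply Cmod_ge_0.
    assert (P1 : (R * R * (INR n * Cmod q ^ pred n) <= INR n * R ^ S n)%R).
    { destruct n as [|n]; [simpl; lra|]. simpl pred.
      assert (Cmod q ^ n <= R ^ n)%R by (apply pow_incr; split; auto using Cmod_ge_0).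
      simpl (R ^ S (S n))%R. assert (0 <= R * R)%R by nra. assert (0 <= INR (S n))%R by lra.
      assert (0 <= (INR (S n) * (R * R)) * (R ^ n - Cmod q ^ n))%R by (apply Rmult_le_pos; [nra|lra]). nra. }
    assert (P2 : (R * R * (Cmod w * Cmod e) <= R * (INR n * INR n * R ^ n * (h * h)))%R).
    { assert (Cmod w * (R * R * Cmod e) <= R * (INR n * INR n * R ^ n * (h * h)))%R; [|lra].
      apply Rmult_le_compat; auto using Cmod_ge_0. repeat apply Rmult_le_pos; auto. }
    rewrite S_INR. apply Rle_trans with (R * R * (Cmod w * Cmod e) + R * R * (INR n * Cmod q ^ pred n) * (h * h))%R.
    { assert (0 <= R * R)%R by nra. nra. }
    assert (HRn : (0 <= R ^ S n)%R) by (apply pow_le; auto).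
    assert (P3 : (R * R * (INR n * Cmod q ^ pred n) * (h * h) <= INR n * R ^ S n * (h * h))%R) by (apply Rmult_le_compat_r; nra).
    simpl (R ^ S n)%R in *. assert (0 <= (INR n + 1) * (R * R ^ n) * (h * h))%R by (apply Rmult_le_pos; [apply Rmult_le_pos; [lra|exact HRn]|nra]). nra.
Qed.

Definition fderiv (a : fps) : fps := fun n => INR (S n) * a (S n).

Lemma rad1_fderiv a : rad1 a -> rad1 (fderiv a).
Proof.
  intros Ha r Hr. destruct (rad1_fD a Ha r Hr) as [M HM]. exists (M / r)%R. intros n.
  specialize (HM (S n)). unfold fD in HM. unfold fderiv. simpl pow in HM.
  apply Rmult_le_reg_r with r; [lra|]. unfold Rdiv. rewrite (Rmult_assoc M), Rinv_l by lra. lra.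
Qed.

Lemma ev_fderiv_Cser a q : rad1 a -> (Cmod q < 1)%R ->
  Cser (fun n => INR n * a n * q ^ pred n) (ev (fderiv a) q).
Proof.
  intros Ha Hq. apply (Clim_unshift _ _ 1).
  apply (Clim_ext (Csum (fun n => fderiv a n * q ^ n))).
  - intros n. rewrite Nat.add_1_r, Csum_shift. simpl pred. unfold fderiv. simpl INR at 2. ring.
  - apply ev_Cser; auto. now apply rad1_fderiv.
Qed.

Lemma ev_fD a q : rad1 a -> (Cmod q < 1)%R -> ev (fD a) q = q * ev (fderiv a) q.
Proof.
  intros Ha Hq. apply (Cser_unique (fun n => fD a n * q ^ n)).
  - apply ev_Cser; auto using rad1_fD.
  - apply (Cser_ext (fun n => q * (INR n * a n * q ^ pred n))).
    + intros [|n]; unfold fD; simpl pred; [simpl; ring|]. simpl (q ^ S n). ring.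
    + apply Cser_scal, ev_fderiv_Cser; auto.
Qed.

(** [pow_taylor] bounds the remainder of each power. The coefficients [n^2 a n] of [fD (fD a)] are
    still summable at a radius between [Cmod q] and 1, so the total remainder is quadratic in
    [w - q]. *)
Lemma ev_diff a q : rad1 a -> (Cmod q < 1)%R -> Cdiff (ev a) q (ev (fderiv a) q).
Proof.
  intros Ha Hq. apply Cdiff_eps. intros eps He.
  assert (Hq0 := Cmod_ge_0 q).
  set (R := ((1 + Cmod q) / 2)%R). assert (HR : (0 < R < 1)%R) by (unfold R; lra).
  assert (HM : summable (fun n => Cmod (fD (fD a) n) * R ^ n)%R) by (apply rad1_summable; auto using rad1_fD; lra).
  assert (HM' : summable (fun n => / (R * R) * (Cmod (fD (fD a) n) * R ^ n))%R).
  { apply summable_scal; auto. left. apply Rinv_0_lt_compat. nra. }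
  destruct (summable_sup _ HM') as [S [HS _]].
  assert (HS0 := HS O). simpl in HS0.
  exists (Rmin (R - Cmod q) (eps / (S + 1)))%R. split.
  { apply Rmin_glb_lt; [unfold R; lra|]. apply Rdiv_lt_0_compat; lra. }
  intros w Hw. assert (Hw1 := Rlt_le_trans _ _ _ Hw (Rmin_l _ _)). assert (Hw2 := Rlt_le_trans _ _ _ Hw (Rmin_r _ _)).
  assert (HwR : (Cmod w <= R)%R).
  { assert (T := Cmod_triangle q (w - q)). replace (q + (w - q)) with w in T by ring. lra. }
  assert (Hw' : (Cmod w < 1)%R) by lra. set (h := Cmod (w - q)) in *.
  assert (Hh : (0 <= h)%R) by apply Cmod_ge_0.
  assert (HC : Cser (fun n => a n * w ^ n + ((-1) * (a n * q ^ n) + (- (w - q)) * (INR n * a n * q ^ pred n)))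
     (ev a w + ((-1) * ev a q + (- (w - q)) * ev (fderiv a) q))).
  { apply Cser_plus; [apply ev_Cser; auto|]. apply Cser_plus; apply Cser_scal; [apply ev_Cser; auto|].
    apply ev_fderiv_Cser; auto. }
  replace (ev a w - ev a q - ev (fderiv a) q * (w - q)) with
    (ev a w + ((-1) * ev a q + (- (w - q)) * ev (fderiv a) q)) by ring.
  apply Rle_trans with ((h * h) * S)%R.
  - refine (Cser_bound _ (fun n => (h * h) * (/ (R * R) * (Cmod (fD (fD a) n) * R ^ n)))%R _ _ _ _ HC).
    + intros n. replace (a n * w ^ n + ((-1) * (a n * q ^ n) + - (w - q) * (INR n * a n * q ^ pred n)))
        with (a n * (w ^ n - q ^ n - INR n * q ^ pred n * (w - q))) by ring.
      rewrite Cmod_mult. assert (T := pow_taylor q w R n ltac:(unfold R; lra) HwR). fold h in T.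
      unfold fD. rewrite !Cmod_mult, Cmod_R, Rabs_pos_eq by apply pos_INR.
      apply Rmult_le_reg_l with (R * R)%R; [nra|].
      replace (R * R * (h * h * (/ (R * R) * (INR n * (INR n * Cmod (a n)) * R ^ n))))%R
        with (Cmod (a n) * (INR n * INR n * R ^ n * (h * h)))%R by (field; lra).
      rewrite (Rmult_comm (Cmod (a n)) (Cmod _)), <- Rmult_assoc, Rmult_comm.
      apply Rmult_le_compat_l; auto using Cmod_ge_0.
    + intros N. rewrite Rsum_scal. apply Rmult_le_compat_l; [nra|]. apply HS.
  - apply Rle_trans with (h * (eps / (S + 1) * S))%R.
    + rewrite Rmult_assoc. apply Rmult_le_compat_l; auto. apply Rmult_le_compat_r; lra.
    + rewrite Rmult_comm. apply Rmult_le_compat_r; auto.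
      apply Rmult_le_reg_r with (S + 1)%R; [lra|].
      replace (eps / (S + 1) * S * (S + 1))%R with (eps * S)%R by (field; lra). nra.
Qed.

(** * Mean value inequality and Darboux property *)

Definition seg (a b : C) (s : R) : C := a + RtoC s * (b - a).

Lemma seg_0 a b : seg a b 0 = a.
Proof. unfold seg. ring. Qed.
Lemma seg_1 a b : seg a b 1 = b.
Proof. unfold seg. ring. Qed.
Lemma seg_dist a b s t : Cmod (seg a b s - seg a b t) = (Rabs (s - t) * Cmod (b - a))%R.
Proof.
  unfold seg. replace (a + s * (b - a) - (a + t * (b - a))) with (RtoC (s - t) * (b - a)) by (rewrite RtoC_minus; ring).
  now rewrite Cmod_mult, Cmod_R.
Qed.
Lemma seg_convex z r a b s : (0 <= s <= 1)%R -> (Cmod (a - z) < r)%R -> (Cmod (b - z) < r)%R ->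
  (Cmod (seg a b s - z) < r)%R.
Proof.
  intros Hs Ha Hb. unfold seg.
  replace (a + s * (b - a) - z) with (RtoC (1 - s) * (a - z) + RtoC s * (b - z)) by (rewrite RtoC_minus; ring).
  eapply Rle_lt_trans; [apply Cmod_triangle|]. rewrite !Cmod_mult, !Cmod_R, !Rabs_pos_eq by lra.
  destruct (Req_dec s 0) as [->|Hs0]; [lra|]. nra.
Qed.

Lemma Re_mult_real (k : C) (x : R) : Re (k * RtoC x) = (Re k * x)%R.
Proof. unfold Re, Cmult, RtoC; simpl. ring. Qed.

Lemma Cdiff_seg (f : C -> C) a b t l k : Cdiff f (seg a b t) l ->
  derivable_pt_lim (fun s => Re (k * f (seg a b s))) t (Re (k * (l * (b - a)))).
Proof.
  intros H eps He. rewrite <- Cdiff_eps in H.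
  set (K := (Cmod k * Cmod (b - a) + 1)%R).
  assert (HK : (0 < K)%R). { unfold K. assert (A1 := Cmod_ge_0 k). assert (A2 := Cmod_ge_0 (b - a)). nra. }
  destruct (H (eps / 2 / K)%R) as (d & Hd & H'); [apply Rdiv_lt_0_compat; lra|].
  assert (HD : (0 < d / (Cmod (b - a) + 1))%R) by (assert (A2 := Cmod_ge_0 (b - a)); apply Rdiv_lt_0_compat; lra).
  exists (mkposreal _ HD). intros h Hh Hhd. simpl in Hhd.
  assert (Hah := Rabs_pos_lt h Hh). assert (A2 := Cmod_ge_0 (b - a)). assert (A1 := Cmod_ge_0 k).
  assert (Hdist : Cmod (seg a b (t + h) - seg a b t) = (Rabs h * Cmod (b - a))%R).
  { rewrite seg_dist. do 2 f_equal. ring. }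
  assert (Hlt : (Rabs h * Cmod (b - a) < d)%R).
  { apply Rle_lt_trans with (Rabs h * (Cmod (b - a) + 1))%R; [nra|].
    apply Rmult_lt_compat_r with (r := (Cmod (b - a) + 1)%R) in Hhd; [|lra].
    replace (d / (Cmod (b - a) + 1) * (Cmod (b - a) + 1))%R with d in Hhd by (field; lra). lra. }
  specialize (H' (seg a b (t + h))). rewrite Hdist in H'. specialize (H' Hlt).
  set (e := f (seg a b (t + h)) - f (seg a b t) - l * (seg a b (t + h) - seg a b t)) in *.
  replace ((Re (k * f (seg a b (t + h))) - Re (k * f (seg a b t))) / h - Re (k * (l * (b - a))))%R
    with (Re (k * e) / h)%R.
  - unfold Rdiv. rewrite Rabs_mult, Rabs_inv. apply Rmult_lt_reg_r with (Rabs h); auto.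
    rewrite Rmult_assoc, Rinv_l, Rmult_1_r by lra.
    apply Rle_lt_trans with (Cmod (k * e)); [apply re_le_Cmod|]. rewrite Cmod_mult.
    apply Rle_lt_trans with (Cmod k * (eps / 2 / K * (Rabs h * Cmod (b - a))))%R; [now apply Rmult_le_compat_l|].
    replace (Cmod k * (eps / 2 / K * (Rabs h * Cmod (b - a))))%R with ((eps / 2 * Rabs h) * (Cmod k * Cmod (b - a) / K))%R by (field; lra).
    assert (Cmod k * Cmod (b - a) / K <= 1)%R.
    { apply Rmult_le_reg_r with K; auto. unfold Rdiv. rewrite Rmult_assoc, Rinv_l by lra. unfold K. lra. }
    assert (0 < eps / 2 * Rabs h)%R by nra. nra.
  - replace (Re (k * e)) with (Re (k * f (seg a b (t + h))) - Re (k * f (seg a b t)) - Re (k * (l * (b - a))) * h)%R.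
    + field; auto.
    + rewrite <- Re_mult_real, <- !Re_minus. f_equal. unfold e, seg. rewrite RtoC_plus. ring.
Qed.

(** The real mean value theorem, applied along the segment to [Re (conj w * f)] with
    [w = f b - f a], whose increment is [Cmod w ^ 2]. *)
Lemma mean_value (f : C -> C) (df : C -> C) a b K : (0 <= K)%R ->
  (forall s, (0 <= s <= 1)%R -> Cdiff f (seg a b s) (df (seg a b s)) /\ (Cmod (df (seg a b s)) <= K)%R) ->
  (Cmod (f b - f a) <= K * Cmod (b - a))%R.
Proof.
  intros HK H. set (w := f b - f a). assert (Hw := Cmod_ge_0 w).
  destruct (Req_dec (Cmod w) 0) as [E|E].
  { rewrite E. apply Rmult_le_pos; auto using Cmod_ge_0. }
  destruct (MVT_cor2 (fun s => Re (Cconj w * f (seg a b s))) (fun s => Re (Cconj w * (df (seg a b s) * (b - a)))) 0 1)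
    as (c & Hc & Hc'); [lra| |].
  - intros s Hs. apply Cdiff_seg, H, Hs.
  - rewrite seg_0, seg_1 in Hc. rewrite <- Re_minus in Hc.
    replace (Cconj w * f b - Cconj w * f a) with (w * Cconj w) in Hc by (unfold w; ring).
    rewrite <- Cmod2_conj in Hc. change (Re (RtoC (Cmod w ^ 2))) with (Cmod w ^ 2)%R in Hc.
    destruct (H c) as [_ Hd]; [lra|].
    assert (T := re_le_Cmod (Cconj w * (df (seg a b c) * (b - a)))).
    rewrite !Cmod_mult, Cmod_conj in T.
    assert (T2 := Rle_abs (Re (Cconj w * (df (seg a b c) * (b - a))))).
    assert (Hba := Cmod_ge_0 (b - a)).
    apply Rmult_le_reg_l with (Cmod w); [lra|].
    apply Rle_trans with (Cmod w * (Cmod (df (seg a b c)) * Cmod (b - a)))%R; [lra|].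
    apply Rmult_le_compat_l; auto. now apply Rmult_le_compat_r.
Qed.

Lemma zero_derivative (f : C -> C) a b :
  (forall s, (0 <= s <= 1)%R -> Cdiff f (seg a b s) 0) -> f b = f a.
Proof.
  intros H. assert (T := mean_value f (fun _ => 0) a b 0 (Rle_refl 0)).
  rewrite Rmult_0_l in T. assert (A1 := Cmod_ge_0 (f b - f a)).
  assert (E : f b - f a = 0). { apply Cmod_eq_0. apply Rle_antisym; auto. apply T. intros s Hs. split; auto. rewrite Cmod_0. lra. }
  replace (f b) with (f b - f a + f a) by ring. rewrite E. ring.
Qed.

Lemma derivable_pt_lim_max f f' a b c : (a < c < b)%R ->
  (forall t, (a <= t <= b)%R -> (f t <= f c)%R) -> derivable_pt_lim f c f' -> f' = 0%R.
Proof.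
  intros Hc Hmax Hd. apply Rle_antisym; apply Rnot_lt_le; intros Hlt.
  - destruct (Hd f' Hlt) as [d Hd']. set (h := (Rmin d (b - c) / 2)%R).
    assert (Hp := cond_pos d). assert (Hm1 := Rmin_l d (b - c)). assert (Hm2 := Rmin_r d (b - c)).
    assert (Hm : (0 < Rmin d (b - c))%R) by (apply Rmin_glb_lt; lra).
    assert (Hh : (0 < h)%R) by (unfold h; lra).
    specialize (Hd' h ltac:(lra) ltac:(rewrite Rabs_pos_eq; unfold h in *; lra)).
    apply Rabs_def2 in Hd'. specialize (Hmax (c + h)%R ltac:(unfold h in *; lra)).
    assert (0 < (f (c + h) - f c) / h)%R by lra.
    apply Rmult_lt_compat_r with (r := h) in H; auto. unfold Rdiv in H.
    rewrite Rmult_assoc, Rinv_l in H by lra. lra.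
  - destruct (Hd (- f')%R ltac:(lra)) as [d Hd']. set (h := (Rmin d (c - a) / 2)%R).
    assert (Hp := cond_pos d). assert (Hm1 := Rmin_l d (c - a)). assert (Hm2 := Rmin_r d (c - a)).
    assert (Hm : (0 < Rmin d (c - a))%R) by (apply Rmin_glb_lt; lra).
    assert (Hh : (0 < h)%R) by (unfold h; lra).
    specialize (Hd' (- h)%R ltac:(lra) ltac:(rewrite Rabs_Ropp, Rabs_pos_eq; unfold h in *; lra)).
    apply Rabs_def2 in Hd'. specialize (Hmax (c + - h)%R ltac:(unfold h in *; lra)).
    assert ((f (c + - h) - f c) / - h < 0)%R by lra.
    apply Rmult_lt_compat_r with (r := h) in H; auto.
    replace ((f (c + - h) - f c) / - h * h)%R with (f c - f (c + - h))%R in H by (field; lra). lra.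
Qed.

(** The signs at the ends push the maximum into the interior, where the derivative vanishes. This
    stands in for the continuity of derivatives, which below is either unknown or the very thing to
    be shown. *)
Lemma darboux (f f' : R -> R) a b : (a < b)%R ->
  (forall t, (a <= t <= b)%R -> derivable_pt_lim f t (f' t)) ->
  (0 < f' a)%R -> (f' b < 0)%R -> exists c, (a < c < b)%R /\ f' c = 0%R.
Proof.
  intros Hab Hd Ha Hb.
  destruct (continuity_ab_maj f a b) as (c & Hmax & Hc); [lra| |].
  { intros t Ht. apply derivable_continuous_pt. exists (f' t). now apply Hd. }
  assert (Hca : c <> a).
  { intros ->. destruct (Hd a ltac:(lra) (f' a) Ha) as [d Hd']. set (h := (Rmin d (b - a) / 2)%R).
    assert (Hp := cond_pos d). assert (Hm1 := Rmin_l d (b - a)). assert (Hm2 := Rmin_r d (b - a)).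
    assert (Hm : (0 < Rmin d (b - a))%R) by (apply Rmin_glb_lt; lra).
    assert (Hh : (0 < h)%R) by (unfold h; lra).
    specialize (Hd' h ltac:(lra) ltac:(rewrite Rabs_pos_eq; unfold h in *; lra)).
    apply Rabs_def2 in Hd'. specialize (Hmax (a + h)%R ltac:(unfold h in *; lra)).
    assert (0 < (f (a + h) - f a) / h)%R by lra.
    apply Rmult_lt_compat_r with (r := h) in H; auto. unfold Rdiv in H.
    rewrite Rmult_assoc, Rinv_l in H by lra. lra. }
  assert (Hcb : c <> b).
  { intros ->. destruct (Hd b ltac:(lra) (- f' b)%R ltac:(lra)) as [d Hd']. set (h := (Rmin d (b - a) / 2)%R).
    assert (Hp := cond_pos d). assert (Hm1 := Rmin_l d (b - a)). assert (Hm2 := Rmin_r d (b - a)).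
    assert (Hm : (0 < Rmin d (b - a))%R) by (apply Rmin_glb_lt; lra).
    assert (Hh : (0 < h)%R) by (unfold h; lra).
    specialize (Hd' (- h)%R ltac:(lra) ltac:(rewrite Rabs_Ropp, Rabs_pos_eq; unfold h in *; lra)).
    apply Rabs_def2 in Hd'. specialize (Hmax (b + - h)%R ltac:(unfold h in *; lra)).
    assert ((f (b + - h) - f b) / - h < 0)%R by lra.
    apply Rmult_lt_compat_r with (r := h) in H; auto.
    replace ((f (b + - h) - f b) / - h * h)%R with (f b - f (b + - h))%R in H by (field; lra). lra. }
  exists c. split; [lra|].
  apply (derivable_pt_lim_max f _ a b c); [lra|exact Hmax|apply Hd; lra].
Qed.

(** * The complex exponential *)

Lemma Cexp_plus z w : Cexp (z + w) = Cexp z * Cexp w.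
Proof.
  unfold Cexp, Re, Im, Cplus, Cmult; simpl. rewrite exp_plus, cos_plus, sin_plus. f_equal; ring.
Qed.
Lemma Cexp_0 : Cexp 0 = 1.
Proof. unfold Cexp, RtoC; simpl. rewrite exp_0, cos_0, sin_0. f_equal; ring. Qed.
Lemma Cexp_neq_0 z : Cexp z <> 0.
Proof.
  intros E. assert (H := Cexp_plus z (- z)). rewrite E in H. replace (z + - z) with (RtoC 0) in H by ring.
  rewrite Cexp_0 in H. apply (C_RtoC_neq 1); [lra|]. rewrite H. ring.
Qed.
Lemma Cexp_pow z n : Cexp (INR n * z) = Cexp z ^ n.
Proof.
  induction n; [simpl; rewrite Cmult_0_l; apply Cexp_0|].
  rewrite S_INR, RtoC_plus. replace ((INR n + 1) * z) with (z + INR n * z) by ring.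
  now rewrite Cexp_plus, IHn.
Qed.
Lemma Cmod_Cexp z : Cmod (Cexp z) = exp (Re z).
Proof.
  assert (Hp := exp_pos (Re z)). unfold Cmod, Cexp; simpl.
  replace (exp (Re z) * cos (Im z) * (exp (Re z) * cos (Im z) * 1) + exp (Re z) * sin (Im z) * (exp (Re z) * sin (Im z) * 1))%R
    with ((exp (Re z) * exp (Re z)) * (Rsqr (sin (Im z)) + Rsqr (cos (Im z))))%R by (unfold Rsqr; ring).
  rewrite sin2_cos2, Rmult_1_r. apply sqrt_square. lra.
Qed.

Lemma Cdiff_Cexp_0 : Cdiff Cexp 0 1.
Proof.
  apply Cdiff_eps. intros eps He.
  set (e := Rmin 1 (eps / 8)). assert (He0 : (0 < e)%R) by (apply Rmin_glb_lt; lra).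
  assert (He1 : (e <= 1)%R) by apply Rmin_l. assert (He8 : (8 * e <= eps)%R) by (assert (H := Rmin_r 1 (eps / 8)); fold e in H; lra).
  clearbody e.
  assert (D : forall f l, derivable_pt_lim f 0 l -> exists d, (0 < d)%R /\ forall h, (Rabs h < d)%R -> (Rabs (f h - f 0 - l * h) <= e * Rabs h)%R).
  { intros f l Hf. destruct (Hf e He0) as [d Hd]. exists d. split; [apply cond_pos|]. intros h Hh.
    destruct (Req_dec h 0) as [->|Hn]; [right; rewrite !Rmult_0_r, Rabs_R0, Rminus_0_r, Rminus_diag, Rabs_R0, Rmult_0_r; auto|].
    specialize (Hd h Hn Hh). rewrite Rplus_0_l in Hd.
    replace (f h - f 0 - l * h)%R with (((f h - f 0) / h - l) * h)%R by (field; auto).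
    rewrite Rabs_mult. apply Rmult_le_compat_r; [apply Rabs_pos|lra]. }
  destruct (D exp 1%R) as (d1 & Hd1 & H1). { assert (T := derivable_pt_lim_exp 0). now rewrite exp_0 in T. }
  destruct (D cos 0%R) as (d2 & Hd2 & H2). { assert (T := derivable_pt_lim_cos 0). now rewrite sin_0, Ropp_0 in T. }
  destruct (D sin 1%R) as (d3 & Hd3 & H3). { assert (T := derivable_pt_lim_sin 0). now rewrite cos_0 in T. }
  exists (Rmin e (Rmin d1 (Rmin d2 d3))). split; [repeat apply Rmin_glb_lt; auto|].
  intros w Hw. replace (w - 0) with w in * by ring.
  assert (Hwe : (Cmod w < e)%R) by (eapply Rlt_le_trans; [exact Hw|apply Rmin_l]).
  assert (Hw' : (Cmod w < Rmin d1 (Rmin d2 d3))%R) by (eapply Rlt_le_trans; [exact Hw|apply Rmin_r]).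
  assert (Hwd1 : (Cmod w < d1)%R) by (eapply Rlt_le_trans; [exact Hw'|apply Rmin_l]).
  assert (Hw'' : (Cmod w < Rmin d2 d3)%R) by (eapply Rlt_le_trans; [exact Hw'|apply Rmin_r]).
  assert (Hwd2 : (Cmod w < d2)%R) by (eapply Rlt_le_trans; [exact Hw''|apply Rmin_l]).
  assert (Hwd3 : (Cmod w < d3)%R) by (eapply Rlt_le_trans; [exact Hw''|apply Rmin_r]).
  assert (Rx := re_le_Cmod w). assert (Ry := im_le_Cmod w). set (m := Cmod w) in *.
  destruct w as [x y]. simpl in Rx, Ry. rewrite Cexp_0.
  specialize (H1 x ltac:(lra)). specialize (H2 y ltac:(lra)). specialize (H3 y ltac:(lra)).
  rewrite exp_0 in H1. rewrite cos_0 in H2. rewrite sin_0 in H3.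
  assert (Hm0 : (0 <= m)%R) by apply Cmod_ge_0.
  eapply Rle_trans; [apply Cmod_le_Re_Im|].
  replace (Re (Cexp (x, y) - 1 - 1 * (x, y)))%R with ((exp x - 1 - 1 * x) * cos y + (1 + x) * (cos y - 1 - 0 * y))%R
    by (unfold Cexp, Re, Im, Cminus, Cplus, Copp, Cmult, RtoC; simpl; ring).
  replace (Im (Cexp (x, y) - 1 - 1 * (x, y)))%R with ((exp x - 1 - 1 * x) * sin y + x * sin y + (sin y - 0 - 1 * y))%R
    by (unfold Cexp, Re, Im, Cminus, Cplus, Copp, Cmult, RtoC; simpl; ring).
  assert (Hc := COS_bound y). assert (Hs := SIN_bound y).
  assert (Hc' : (Rabs (cos y) <= 1)%R) by (apply Rabs_le; lra).
  assert (Hs' : (Rabs (sin y) <= 1)%R) by (apply Rabs_le; lra).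
  assert (Hsy : (Rabs (sin y) <= 2 * Rabs y)%R).
  { replace (sin y) with ((sin y - 0 - 1 * y) + y)%R at 1 by ring. eapply Rle_trans; [apply Rabs_triang|]. assert (0 <= Rabs y)%R by apply Rabs_pos. nra. }
  assert (Px := Rabs_pos x). assert (Py := Rabs_pos y).
  assert (G1 : (Rabs ((exp x - 1 - 1 * x) * cos y) <= e * m)%R).
  { rewrite Rabs_mult. assert (A1 := Rabs_pos (exp x - 1 - 1 * x)). nra. }
  assert (G2 : (Rabs ((1 + x) * (cos y - 1 - 0 * y)) <= 2 * e * m)%R).
  { rewrite Rabs_mult. assert (Rabs (1 + x) <= 2)%R by (eapply Rle_trans; [apply Rabs_triang|]; rewrite Rabs_R1; lra).
    assert (A1 := Rabs_pos (cos y - 1 - 0 * y)). assert (A2 := Rabs_pos (1 + x)).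
    apply Rle_trans with (2 * (e * Rabs y))%R; [apply Rmult_le_compat; lra|]. nra. }
  assert (G3 : (Rabs ((exp x - 1 - 1 * x) * sin y) <= e * m)%R).
  { rewrite Rabs_mult. assert (A1 := Rabs_pos (exp x - 1 - 1 * x)). nra. }
  assert (G4 : (Rabs (x * sin y) <= 2 * e * m)%R).
  { rewrite Rabs_mult. assert (A1 := Rabs_pos (sin y)). apply Rle_trans with (e * (2 * Rabs y))%R; [apply Rmult_le_compat; lra|]. nra. }
  assert (G5 : (Rabs (sin y - 0 - 1 * y) <= e * m)%R) by nra.
  assert (T1 := Rabs_triang ((exp x - 1 - 1 * x) * cos y) ((1 + x) * (cos y - 1 - 0 * y))).
  assert (T2 := Rabs_triang ((exp x - 1 - 1 * x) * sin y + x * sin y) (sin y - 0 - 1 * y)).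
  assert (T3 := Rabs_triang ((exp x - 1 - 1 * x) * sin y) (x * sin y)). nra.
Qed.

Lemma Cdiff_Cexp z : Cdiff Cexp z (Cexp z).
Proof.
  apply (Cdiff_ext (fun w => Cexp z * Cexp (w - z))).
  - intros w. rewrite <- Cexp_plus. f_equal. ring.
  - apply (Cdiff_eq _ _ (Cexp z * (1 * (1 - 0)))); [ring|]. apply Cdiff_scal.
    apply (Cdiff_comp Cexp (fun w => w - z)).
    + apply Cdiff_minus; [apply Cdiff_id|apply Cdiff_const].
    + replace (z - z) with (RtoC 0) by ring. apply Cdiff_Cexp_0.
Qed.

Lemma Cdiff_Cexp_scal c z : Cdiff (fun w => Cexp (c * w)) z (c * Cexp (c * z)).
Proof.
  apply (Cdiff_eq _ _ (Cexp (c * z) * (c * 1))); [ring|].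
  apply (Cdiff_comp Cexp (fun w => c * w)); [apply Cdiff_scal, Cdiff_id|apply Cdiff_Cexp].
Qed.

(** * The eta function *)

Lemma Rsum_nonneg M n : (forall k, 0 <= M k)%R -> (0 <= Rsum M n)%R.
Proof. intros H. induction n; simpl; [lra|]. specialize (H n). lra. Qed.

Lemma Rsum_shift_le (g : nat -> R) k m : (forall j, 0 <= g j)%R ->
  (Rsum (fun j => if Nat.leb k j then g (j - k)%nat else 0) m <= Rsum g m)%R.
Proof.
  intros Hg. apply Rle_trans with (Rsum g (m - k)%nat).
  - induction m; [simpl; lra|]. cbn [Rsum]. destruct (Nat.leb_spec k m).
    + replace (S m - k)%nat with (S (m - k)) by lia. simpl. lra.
    + replace (S m - k)%nat with O by lia. replace (m - k)%nat with O in IHm by lia. lra.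
  - apply Rsum_mono; auto. lia.
Qed.

Fixpoint Rprod (f : nat -> R) (n : nat) : R := match n with O => 1%R | S m => (Rprod f m * f m)%R end.

(** The norm [sum |a j| r^j] is submultiplicative and [1 - q^k] has norm [1 + r^k]. Being bounded
    uniformly in [N], the estimate yields both the radius of convergence of the limit and the
    majorant for Euler's product. *)
Lemma fprod_norm r N m : (0 < r < 1)%R ->
  (Rsum (fun j => Cmod (fprod N j) * r ^ j) m <= Rprod (fun k => 1 + r ^ S k) N)%R.
Proof.
  intros Hr. induction N as [|N IH].
  - simpl. destruct m; [simpl; lra|]. right. induction m.
    + simpl. rewrite Cmod_1. ring.
    + change (Rsum ?f (S (S m))) with (Rsum f (S m) + f (S m))%R. rewrite IHm. simpl. rewrite Cmod_0. ring.
  - cbn [fprod Rprod].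
    apply Rle_trans with (Rsum (fun j => Cmod (fprod N j) * r ^ j + r ^ S N *
      (if Nat.leb (S N) j then Cmod (fprod N (j - S N)%nat) * r ^ (j - S N) else 0))%R m).
    + apply Rsum_le. intros j.
      replace (fprod N * (fZ 1 - fmono (S N)))%fps with (fprod N - fmono (S N) * fprod N)%fps by ring.
      unfold fsub. rewrite fmono_mul. assert (Hp : (0 <= r ^ j)%R) by (apply pow_le; lra).
      destruct (Nat.leb_spec (S N) j) as [Hj|Hj].
      * replace (r ^ j)%R with (r ^ S N * r ^ (j - S N))%R in * by (rewrite <- pow_add; f_equal; lia).
        assert (T := Cmod_triangle (fprod N j) (- fprod N (j - S N)%nat)). rewrite Cmod_opp in T.
        unfold Cminus. nra.
      * replace (fprod N j - 0) with (fprod N j) by ring. lra.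
    + rewrite Rsum_plus, Rsum_scal.
      assert (T := Rsum_shift_le (fun j => Cmod (fprod N j) * r ^ j)%R (S N) m). cbv beta in T.
      assert (Hp : (0 <= r ^ S N)%R) by (apply pow_le; lra).
      assert (T' : (r ^ S N * Rsum (fun k => if Nat.leb (S N) k then Cmod (fprod N (k - S N)%nat) * r ^ (k - S N) else 0) m
        <= r ^ S N * Rsum (fun j => Cmod (fprod N j) * r ^ j) m)%R).
      { apply Rmult_le_compat_l; auto. apply T. intros; apply Rmult_le_pos; [apply Cmod_ge_0|apply pow_le; lra]. }
      nra.
Qed.

Lemma geom_sum_le r N : (0 < r < 1)%R -> (Rsum (fun k => r ^ S k) N <= r / (1 - r))%R.
Proof.
  intros Hr. assert (E : (Rsum (fun k => r ^ S k) N * (1 - r) = r - r ^ S N)%R).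
  { induction N; [simpl; ring|]. cbn [Rsum]. rewrite Rmult_plus_distr_r, IHN. simpl. ring. }
  assert (0 <= r ^ S N)%R by (apply pow_le; lra).
  apply Rmult_le_reg_r with (1 - r)%R; [lra|]. rewrite E. unfold Rdiv. rewrite Rmult_assoc, Rinv_l; lra.
Qed.

Lemma Rprod_exp r N : (0 < r < 1)%R -> (Rprod (fun k => 1 + r ^ S k) N <= exp (Rsum (fun k => r ^ S k) N))%R.
Proof.
  intros Hr. induction N; [simpl; rewrite exp_0; lra|]. cbn [Rprod Rsum]. rewrite exp_plus.
  assert (0 < r ^ S N)%R by (apply pow_lt; lra).
  apply Rmult_le_compat; [| lra | exact IHN | left; apply exp_ineq1; lra].
  clear IHN. induction N; [simpl; lra|]. cbn [Rprod]. assert (0 < r ^ S N)%R by (apply pow_lt; lra).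
  apply Rmult_le_pos; [apply IHN; apply pow_lt; lra|lra].
Qed.

Lemma fprod_bound r : (0 < r < 1)%R -> exists K, forall N n, (Cmod (fprod N n) * r ^ n <= K)%R.
Proof.
  intros Hr. exists (exp (r / (1 - r))). intros N n.
  apply Rle_trans with (Rsum (fun j => Cmod (fprod N j) * r ^ j)%R (S n)).
  - cbn [Rsum]. assert (0 <= Rsum (fun j => Cmod (fprod N j) * r ^ j)%R n)%R; [|lra].
    apply Rsum_nonneg. intros k. apply Rmult_le_pos; [apply Cmod_ge_0|apply pow_le; lra].
  - eapply Rle_trans; [now apply fprod_norm|]. eapply Rle_trans; [now apply Rprod_exp|].
    destruct (Rle_lt_or_eq_dec _ _ (geom_sum_le r N Hr)) as [Hl|Hl]; [left; now apply exp_increasing|rewrite Hl; lra].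
Qed.

Lemma rad1_fE1 : rad1 fE1.
Proof. intros r Hr. destruct (fprod_bound r Hr) as [K HK]. exists K. intros n. apply HK. Qed.

Lemma rad1_fprod N : rad1 (fprod N).
Proof. intros r Hr. destruct (fprod_bound r Hr) as [K HK]. exists K. intros n. apply HK. Qed.

Lemma rad1_fP : rad1 fP.
Proof.
  (* Comparison with [24 n^2]: the divisor sum of [n] has at most [n] terms, each at most [n]. *)
  set (b := (fcst 1 + fcst 24 * fD (fD (fun _ => 1)))%fps).
  apply (rad1_le _ b).
  - intros n. unfold b, fadd. rewrite fcst_mul. unfold fD, fP. destruct n as [|n].
    + simpl. replace (1 + 24 * (0 * (0 * 1))) with (RtoC 1) by ring. lra.
    + assert (E : forall M, flambert M (S n) = Csum (fun k => INR (S k) * fgeom (S k) (S n)) M).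
      { induction M; [reflexivity|]. cbn [flambert Csum]. unfold fadd. rewrite fcst_mul, IHM. reflexivity. }
      rewrite <- (flambert_coef (S n)) by lia. rewrite E. unfold fcst at 1.
      replace (0 + 24 * (INR (S n) * (INR (S n) * 1))) with (RtoC (24 * (INR (S n) * INR (S n)))) by (rewrite !RtoC_mult; ring).
      rewrite Cmod_mult, !Cmod_R. assert (Hn := pos_INR (S n)).
      rewrite (Rabs_left (-24)), Rabs_pos_eq by nra. replace (- (-24))%R with 24%R by ring. apply Rmult_le_compat_l; [lra|].
      assert (B : forall m, (m <= S n)%nat -> (Cmod (Csum (fun k => INR (S k) * fgeom (S k) (S n))%C m) <= INR m * INR (S n))%R).
      { induction m; intros Hm; [simpl; rewrite Cmod_0; lra|].
        change (Csum ?f (S m)) with (Csum f m + f m). cbv beta. eapply Rle_trans; [apply Cmod_triangle|].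
        rewrite (S_INR m), Rmult_plus_distr_r. apply Rplus_le_compat; [apply IHm; lia|].
        rewrite <- S_INR, Cmod_mult, Cmod_R, Rabs_pos_eq by apply pos_INR.
        assert (Hle : (INR (S m) <= INR (S n))%R) by (apply le_INR; lia).
        assert (Hg : (0 <= Cmod (fgeom (S m) (S n)) <= 1)%R).
        { split; [apply Cmod_ge_0|]. unfold fgeom. destruct (Nat.eqb _ _); [rewrite Cmod_1|rewrite Cmod_0]; lra. }
        assert (Hm0 := pos_INR (S m)). nra. }
      apply B; auto.
  - apply rad1_add; [apply rad1_cst|]. apply rad1_mul; [apply rad1_cst|]. do 2 apply rad1_fD.
    apply (rad1_bounded _ 1). intros; rewrite Cmod_1; lra.
Qed.

Lemma ev_fmono k q : ev (fmono k) q = q ^ k.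
Proof.
  apply (ev_finite _ _ (S k)).
  - intros n Hn. unfold fmono. destruct (Nat.eqb_spec n k); [lia|auto].
  - cbn [Csum]. rewrite Csum_0.
    + unfold fmono. rewrite Nat.eqb_refl. ring.
    + intros j Hj. unfold fmono. destruct (Nat.eqb_spec j k); [lia|ring].
Qed.

Lemma rad1_fmono k : rad1 (fmono k).
Proof.
  apply (rad1_bounded _ 1). intros n. unfold fmono. destruct (Nat.eqb n k); [rewrite Cmod_1|rewrite Cmod_0]; lra.
Qed.

Lemma ev_fprod N q : (Cmod q < 1)%R -> ev (fprod N) q = Cprod (fun k => 1 - q ^ S k) N.
Proof.
  intros Hq. induction N; [apply ev_Z|]. cbn [fprod Cprod].
  rewrite ev_mul, ev_sub, ev_Z, ev_fmono, IHN; auto using rad1_fprod, rad1_Z, rad1_fmono, rad1_sub.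
Qed.

Lemma euler_product q : (Cmod q < 1)%R -> Clim (Cprod (fun k => 1 - q ^ S k)) (ev fE1 q).
Proof.
  intros Hq. set (r := ((1 + Cmod q) / 2)%R). assert (Hq0 := Cmod_ge_0 q).
  assert (Hr : (0 < r < 1)%R) by (unfold r; lra).
  destruct (fprod_bound r Hr) as [K HK].
  assert (HK0 : (0 <= K)%R). { specialize (HK O O). simpl in HK. rewrite Cmod_1 in HK. lra. }
  set (x := (Cmod q / r)%R).
  assert (Hx : (0 <= x < 1)%R).
  { unfold x. split; [apply Rdiv_le_0_compat; lra|]. apply Rmult_lt_reg_r with r; [lra|].
    unfold Rdiv. rewrite Rmult_assoc, Rinv_l; unfold r in *; lra. }
  apply (tannery (fun N n => fprod N n * q ^ n) (fun n => fE1 n * q ^ n) (fun n => K * x ^ n)%R).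
  - apply summable_scal; auto.
    refine (summable_le _ _ _ (rad1_summable (fun _ => 1) x _ Hx)).
    + intros n. rewrite Cmod_1. assert (0 <= x ^ n)%R by (apply pow_le; lra). lra.
    + apply (rad1_bounded _ 1). intros; rewrite Cmod_1; lra.
  - intros N n. rewrite Cmod_mult, Cmod_pow. replace (Cmod q) with (r * x)%R by (unfold x; field; lra).
    rewrite Rpow_mult_distr, <- Rmult_assoc. apply Rmult_le_compat_r; [apply pow_le; lra|apply HK].
  - intros n. apply (Clim_unshift _ _ n). apply (Clim_ext (fun _ => fE1 n * q ^ n)); [|apply Clim_const].
    intros k. unfold fE1. rewrite (fprod_stable n (k + n)) by lia. reflexivity.
  - intros N. rewrite <- ev_fprod by auto. apply ev_Cser; auto using rad1_fprod.
  - apply ev_Cser; auto using rad1_fE1.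
Qed.

Lemma Cprod_add f n m : Cprod f (n + m) = Cprod f n * Cprod (fun k => f (n + k)%nat) m.
Proof.
  induction m; [rewrite Nat.add_0_r; simpl; ring|]. rewrite Nat.add_succ_r. simpl. rewrite IHm. ring.
Qed.

(** Take [N] with [r^N < (1 - r) / 2]. By the product form of the union bound, all partial products
    of the factors from [N] on have modulus at least 1/2, and the first [N] factors are nonzero. *)
Lemma ev_fE1_neq_0 q : (Cmod q < 1)%R -> ev fE1 q <> 0.
Proof.
  intros Hq E0. set (r := ((1 + Cmod q) / 2)%R). assert (Hq0 := Cmod_ge_0 q).
  assert (Hr : (0 < r < 1)%R) by (unfold r; lra).
  assert (Hqr : forall k, (Cmod (q ^ k) <= r ^ k)%R) by (intros; rewrite Cmod_pow; apply pow_incr; unfold r; lra).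
  destruct (pow_lt_1_zero r ltac:(rewrite Rabs_pos_eq; lra) ((1 - r) / 2)%R ltac:(lra)) as [N HN].
  specialize (HN N (le_n _)). rewrite Rabs_pos_eq in HN by (apply pow_le; lra).
  assert (H1 : forall m, (1 - Rsum (fun k => r ^ N * r ^ S k)%R m <= Cmod (Cprod (fun k => 1 - q ^ S (N + k))%C m))%R).
  { assert (Hb : forall k, (1 - r ^ N * r ^ S k <= Cmod (1 - q ^ S (N + k)))%R).
    { intros k. assert (T := Cmod_triangle (1 - q ^ S (N + k)) (q ^ S (N + k))).
      replace (1 - q ^ S (N + k) + q ^ S (N + k)) with (RtoC 1) in T by ring. rewrite Cmod_1 in T.
      specialize (Hqr (S (N + k))). rewrite <- Nat.add_succ_r, pow_add in Hqr. rewrite <- Nat.add_succ_r in *. lra. }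
    assert (Hp : forall k, (0 <= r ^ N * r ^ S k < 1)%R).
    { intros k. rewrite <- pow_add. split; [apply pow_le; lra|]. apply pow_lt_1_compat; [lra|lia]. }
    assert (Hs : forall m, (0 <= Rsum (fun k => r ^ N * r ^ S k)%R m)%R) by (intros; apply Rsum_nonneg; apply Hp).
    induction m; [simpl; rewrite Cmod_1; lra|]. cbn [Cprod Rsum]. rewrite Cmod_mult.
    specialize (Hb m). specialize (Hp m). specialize (Hs m). set (p := (r ^ N * r ^ S m)%R) in *.
    set (s := Rsum _ m) in *. set (A := Cmod (Cprod _ m)) in *. set (Bm := Cmod (1 - q ^ S (N + m))) in *.
    assert (A1 : (0 <= A)%R) by apply Cmod_ge_0.
    apply Rle_trans with (A * (1 - p))%R; [nra|]. apply Rmult_le_compat_l; auto. }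
  assert (H2 : forall m, (/ 2 <= Cmod (Cprod (fun k => 1 - q ^ S (N + k))%C m))%R).
  { intros m. eapply Rle_trans; [|apply H1]. rewrite Rsum_scal. assert (G := geom_sum_le r m Hr).
    assert (Hp : (0 <= r ^ N)%R) by (apply pow_le; lra).
    assert (r ^ N * Rsum (fun k => r ^ S k) m <= (1 - r) / 2 * (r / (1 - r)))%R.
    { apply Rmult_le_compat; auto; [|lra]. apply Rsum_nonneg. intros; apply pow_le; lra. }
    replace ((1 - r) / 2 * (r / (1 - r)))%R with (r / 2)%R in H by (field; lra). lra. }
  assert (HPN : forall n, Cprod (fun k => 1 - q ^ S k) n <> 0).
  { induction n; simpl; [apply C_RtoC_neq; lra|]. apply Cmult_neq_0; auto.
    intros E. assert (E' : q * q ^ n = 1) by (replace (q * q ^ n) with (1 - (1 - q * q ^ n)) by ring; rewrite E; ring).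
    assert (T := pow_disc q (S n) ltac:(lia) Hq). simpl in T. rewrite E', Cmod_1 in T. lra. }
  assert (Hpos := Cmod_pos _ (HPN N)).
  destruct (euler_product q Hq (/ 2 * Cmod (Cprod (fun k => 1 - q ^ S k)%C N))%R) as [M HM]; [lra|].
  specialize (HM (N + M)%nat ltac:(lia)). rewrite E0, Cprod_add in HM.
  replace (Cprod (fun k => 1 - q ^ S k) N * Cprod (fun k => 1 - q ^ S (N + k)) M - 0)
   with (Cprod (fun k => 1 - q ^ S k) N * Cprod (fun k => 1 - q ^ S (N + k)) M) in HM by ring.
  rewrite Cmod_mult in HM. specialize (H2 M). nra.
Qed.

Definition nome (t : C) : C := Cexp (2 * PI * Ci * t).

Lemma nome_disc t : upper_half_plane t -> (Cmod (nome t) < 1)%R.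
Proof.
  intros H. unfold nome. rewrite Cmod_Cexp, <- exp_0. apply exp_increasing.
  unfold upper_half_plane in H. destruct t as [x y]. simpl in H |- *.
  assert (Hp := PI_RGT_0). unfold Re, Im in *; simpl in *. nra.
Qed.

Lemma nome_neq_0 t : nome t <> 0.
Proof. apply Cexp_neq_0. Qed.

Lemma nome_mult k t : nome (INR k * t) = nome t ^ k.
Proof. unfold nome. rewrite <- Cexp_pow. f_equal. ring. Qed.

Lemma eta_ev t : upper_half_plane t -> eta t = Cexp (PI * Ci / 12 * t) * ev fE1 (nome t).
Proof.
  intros H. unfold eta. f_equal. apply C_lim_seq_unique.
  refine (Clim_ext _ _ _ _ (euler_product _ (nome_disc t H))). intros n.
  induction n; [reflexivity|]. cbn [Cprod]. rewrite IHn. f_equal. f_equal.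
  rewrite <- nome_mult. unfold nome. f_equal. ring.
Qed.

Definition EV (a : fps) (t : C) : C := ev a (nome t).

Lemma EV_diff a t : rad1 a -> upper_half_plane t -> Cdiff (EV a) t (2 * PI * Ci * EV (fD a) t).
Proof.
  intros Ha Ht. assert (Hq := nome_disc t Ht). unfold EV. rewrite ev_fD by auto.
  apply (Cdiff_eq _ _ (ev (fderiv a) (nome t) * (2 * PI * Ci * nome t))); [ring|].
  apply (Cdiff_comp (ev a) nome); [apply Cdiff_Cexp_scal|now apply ev_diff].
Qed.

Lemma rad1_fE3 : rad1 fE3.
Proof. apply rad1_fsubst; [lia|apply rad1_fE1]. Qed.
Lemma rad1_fE9 : rad1 fE9.
Proof. apply rad1_fsubst; [lia|apply rad1_fE1]. Qed.
Lemma rad1_fP3 : rad1 fP3.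
Proof. apply rad1_fsubst; [lia|apply rad1_fP]. Qed.
Lemma rad1_fV : rad1 fV.
Proof. apply rad1_pow, rad1_fE1. Qed.
Lemma rad1_fT : rad1 fT.
Proof. apply rad1_mul; [apply rad1_fX|apply rad1_pow, rad1_fE9]. Qed.

Lemma scale_half_plane k t : (0 < k)%R -> upper_half_plane t -> upper_half_plane (RtoC k * t).
Proof.
  unfold upper_half_plane. intros Hk H. destruct t as [x y]. unfold Im, Cmult, RtoC in *; simpl in *. nra.
Qed.

Lemma EV_fV_neq_0 t : upper_half_plane t -> EV fV t <> 0.
Proof.
  intros H. assert (Hq := nome_disc t H). unfold EV, fV. rewrite ev_pow by auto using rad1_fE1.
  apply Cpow_nz. now apply ev_fE1_neq_0.
Qed.
Lemma EV_fE3_neq_0 t : upper_half_plane t -> EV fE3 t <> 0.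
Proof.
  intros H. assert (Hq := nome_disc t H). unfold EV, fE3. rewrite ev_fsubst by (lia || auto using rad1_fE1).
  apply ev_fE1_neq_0, pow_disc; [lia|auto].
Qed.

Lemma zfun_EV t : upper_half_plane t -> zfun t = (EV fV t + 9 * EV fT t) / EV fV t.
Proof.
  intros H. assert (Hq := nome_disc t H). unfold zfun. rewrite !eta_ev; auto.
  2:{ apply (scale_half_plane 9); auto. lra. }
  assert (HV := EV_fV_neq_0 t H). revert HV. unfold EV, fT, fV, fE9.
  assert (R9 : rad1 (fsubst 9 fE1)) by apply rad1_fE9.
  rewrite ev_mul, !ev_pow, ev_fX, ev_fsubst by (lia || auto using rad1_fX, rad1_pow, rad1_fE1).
  replace (nome (9 * t)) with (nome t ^ 9).
  2:{ rewrite <- nome_mult. do 2 f_equal. rewrite INR_9. reflexivity. }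
  set (e1 := ev fE1 (nome t)). set (e9 := ev fE1 (nome t ^ 9)). intros HV.
  assert (He : e1 <> 0) by (intros E; apply HV; rewrite E; ring).
  (* [27/24 - 3/24 = 1]: the prefactors of the two cubes differ by exactly one power of [q]. *)
  assert (Hx : Cexp (PI * Ci / 12 * (9 * t)) ^ 3 = nome t * Cexp (PI * Ci / 12 * t) ^ 3).
  { unfold nome. rewrite <- !Cexp_pow, <- Cexp_plus. f_equal. rewrite INR_3. field. }
  transitivity (9 * (Cexp (PI * Ci / 12 * (9 * t)) ^ 3 * e9 ^ 3 / (Cexp (PI * Ci / 12 * t) * e1) ^ 3) + 1).
  { do 3 f_equal. ring. }
  rewrite Hx. assert (Hc := Cexp_neq_0 (PI * Ci / 12 * t)). field. auto.
Qed.

(** * Exponential series *)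

Definition exp_coef (c : C) : fps := fun n => c ^ n / INR (fact n).

Lemma INR_fact_C n : RtoC (INR (fact n)) <> 0.
Proof. apply C_RtoC_neq, INR_fact_neq_0. Qed.

Lemma Rsum_sum_f_R0 f n : sum_f_R0 f n = Rsum f (S n).
Proof. induction n; [simpl; ring|]. simpl in *. now rewrite IHn. Qed.

Lemma exp_partial x n : (0 <= x)%R -> (Rsum (fun k => x ^ k / INR (fact k)) n <= exp x)%R.
Proof.
  intros Hx. destruct n; [simpl; left; apply exp_pos|]. rewrite <- Rsum_sum_f_R0. now apply exp_ge_taylor.
Qed.

Lemma Cmod_exp_coef c n : Cmod (exp_coef c n) = (Cmod c ^ n / INR (fact n))%R.
Proof.
  unfold exp_coef. rewrite Cmod_div by apply INR_fact_C. rewrite Cmod_pow, Cmod_R, Rabs_pos_eq; auto. apply pos_INR.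
Qed.

Lemma exp_term_nonneg x n : (0 <= x)%R -> (0 <= x ^ n / INR (fact n))%R.
Proof. intros. apply Rdiv_le_0_compat; [now apply pow_le|apply INR_fact_lt_0]. Qed.

Lemma exp_term_le x n : (0 <= x)%R -> (x ^ n / INR (fact n) <= exp x)%R.
Proof.
  intros Hx. eapply Rle_trans; [|apply (exp_partial x (S n) Hx)]. cbn [Rsum].
  assert (0 <= Rsum (fun k => x ^ k / INR (fact k)) n)%R; [|lra].
  apply Rsum_nonneg. intros; now apply exp_term_nonneg.
Qed.

Lemma rad1_exp_coef c : rad1 (exp_coef c).
Proof.
  apply (rad1_bounded _ (exp (Cmod c))). intros n. rewrite Cmod_exp_coef. apply exp_term_le, Cmod_ge_0.
Qed.

(** [Cexp] is built from real functions, so its series is found from the differential equation: the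
    series times [Cexp (- c * q)] has derivative zero. *)
Lemma ev_exp_coef c q : (Cmod q < 1)%R -> ev (exp_coef c) q = Cexp (c * q).
Proof.
  intros Hq.
  set (h := fun q => ev (exp_coef c) q * Cexp (- c * q)).
  assert (E : h q = h 0).
  { apply (zero_derivative h). intros s Hs.
    assert (Hd : (Cmod (seg 0 q s) < 1)%R).
    { replace (seg 0 q s) with (seg 0 q s - 0) by ring. apply seg_convex; auto.
      - rewrite Cmod_sub_0. lra.
      - now replace (q - 0) with q by ring. }
    assert (Hf : fderiv (exp_coef c) = (fcst c * exp_coef c)%fps).
    { apply fps_ext. intros n. rewrite fcst_mul. unfold fderiv, exp_coef.
      rewrite fact_simpl, mult_INR, RtoC_mult. assert (H1 := INR_fact_C n).
      assert (H2 : RtoC (INR (S n)) <> 0) by (apply C_RtoC_neq, not_0_INR; lia).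
      simpl (c ^ S n). field; auto. }
    unfold h. eapply Cdiff_eq; [|apply Cdiff_mult; [apply ev_diff; auto using rad1_exp_coef|apply Cdiff_Cexp_scal]].
    rewrite Hf, ev_mul, ev_cst by auto using rad1_cst, rad1_exp_coef. ring. }
  unfold h in E. rewrite ev_0 in E by apply rad1_exp_coef.
  replace (- c * 0) with (RtoC 0) in E by ring. rewrite Cexp_0 in E. unfold exp_coef at 2 in E.
  assert (E1 := Cexp_plus (c * q) (- c * q)). replace (c * q + - c * q) with (RtoC 0) in E1 by ring.
  rewrite Cexp_0 in E1.
  assert (Hn := Cexp_neq_0 (- c * q)). apply (C_eq_cancel (Cexp (- c * q))); auto.
  rewrite (Cmult_comm _ (ev _ _)), E, (Cmult_comm _ (Cexp (c * q))), <- E1. simpl. field.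
Qed.

Lemma Cexp_Cser w : Cser (fun k => w ^ k / INR (fact k)) (Cexp w).
Proof.
  set (R := (Cmod w + 1)%R). assert (Hw := Cmod_ge_0 w). assert (HR : RtoC R <> 0) by (apply C_RtoC_neq; unfold R; lra).
  assert (Hq : (Cmod (w / RtoC R) < 1)%R).
  { rewrite Cmod_div by auto. rewrite Cmod_R, Rabs_pos_eq by (unfold R; lra).
    apply Rmult_lt_reg_r with R; [unfold R; lra|]. unfold Rdiv. rewrite Rmult_assoc, Rinv_l; unfold R; lra. }
  replace (Cexp w) with (ev (exp_coef R) (w / RtoC R)).
  - refine (Cser_ext _ _ _ _ (ev_Cser _ _ (rad1_exp_coef R) Hq)). intros n. unfold exp_coef.
    replace (w ^ n) with ((R * (w / R)) ^ n) by (f_equal; field; auto).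
    rewrite Cpow_mult_l. field. apply INR_fact_C.
  - rewrite ev_exp_coef by auto. f_equal. field; auto.
Qed.

(** * Analytic germs *)

Lemma sum_n_Csum (f : nat -> C) n : sum_n f n = Csum f (S n).
Proof.
  induction n; [rewrite sum_O; simpl; ring|]. rewrite sum_Sn, IHn. reflexivity.
Qed.

Lemma Cser_is_series (a : nat -> C) (s : C) : @is_series C_AbsRing C_NormedModule a s <-> Cser a s.
Proof.
  split.
  - intros H eps He.
    assert (HP : locally s (fun y => (Cmod (y - s) < eps)%R)).
    { apply locally_C. exists (mkposreal eps He). intros y Hy. exact Hy. }
    destruct (H _ HP) as [N HN]. exists (S N). intros n Hn. destruct n as [|n]; [lia|].
    rewrite <- sum_n_Csum. apply HN. lia.
  - intros H P HP. apply locally_C in HP. destruct HP as [e He].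
    destruct (H e (cond_pos e)) as [N HN]. exists N. intros n Hn. apply He.
    rewrite sum_n_Csum. apply HN. lia.
Qed.

Lemma analytic_at_Cser f t : analytic_at f t <->
  exists (a : nat -> C) (r : R), (0 < r)%R /\
    forall w, (Cmod (w - t) < r)%R -> Cser (fun k => a k * (w - t) ^ k) (f w).
Proof.
  assert (E : forall (a : nat -> C) (x l : C), is_pseries a x l <-> Cser (fun k => a k * x ^ k) l).
  { intros a x l. unfold is_pseries. rewrite <- Cser_is_series.
    split; apply is_series_ext; intros n; [change (x ^ n * a n = a n * x ^ n)|change (a n * x ^ n = x ^ n * a n)]; ring. }
  split.
  - intros (a & r & H). exists a, r. split; [apply cond_pos|]. intros w Hw. apply E, H, Hw.
  - intros (a & r & Hr & H). exists a, (mkposreal r Hr). intros w Hw. apply E, H, Hw.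
Qed.

Lemma Cser_bounded a s : Cser a s -> exists B, forall n, (Cmod (a n) <= B)%R.
Proof.
  intros H. destruct (H 1%R ltac:(lra)) as [N HN].
  assert (Hb : exists B, forall n, (n < N)%nat -> (Cmod (a n) <= B)%R).
  { clear HN. induction N; [exists 0%R; intros; lia|]. destruct IHN as [B HB]. exists (Rmax B (Cmod (a N))).
    intros n Hn. destruct (Nat.eq_dec n N) as [->|]; [apply Rmax_r|].
    eapply Rle_trans; [apply HB; lia|apply Rmax_l]. }
  destruct Hb as [B HB]. exists (Rmax B 2). intros n. destruct (Nat.lt_ge_cases n N) as [Hn|Hn].
  - eapply Rle_trans; [now apply HB|apply Rmax_l].
  - eapply Rle_trans; [|apply Rmax_r]. assert (H1 := HN n Hn). assert (H2 := HN (S n) ltac:(lia)). simpl in H2.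
    assert (T := Cmod_triangle (Csum a n + a n - s) (- (Csum a n - s))). rewrite Cmod_opp in T.
    replace (Csum a n + a n - s + - (Csum a n - s)) with (a n) in T by ring. lra.
Qed.

(* Rescaling a disc of convergence to the unit disc. *)
Lemma analytic_at_ev f t : analytic_at f t ->
  exists r b, (0 < r)%R /\ rad1 b /\ forall q, (Cmod q < 1)%R -> f (t + RtoC r * q) = ev b q.
Proof.
  intros H. apply analytic_at_Cser in H. destruct H as (a & r & Hr & H).
  exists (r / 2)%R, (fun n => a n * (r / 2)%R ^ n). split; [lra|].
  assert (Hb : rad1 (fun n => a n * (r / 2)%R ^ n)).
  { destruct (Cser_bounded _ _ (H (t + (r / 2)%R) ltac:(replace (t + (r / 2)%R - t) with (RtoC (r/2)) by ring; rewrite Cmod_R, Rabs_pos_eq; lra))) as [B HB].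
    apply (rad1_bounded _ B). intros n. specialize (HB n). replace (t + (r / 2)%R - t) with (RtoC (r/2)) in HB by ring. exact HB. }
  split; auto. intros q Hq.
  apply (Cser_unique (fun k => a k * (t + (r/2)%R * q - t) ^ k)).
  - apply H. replace (t + (r/2)%R * q - t) with ((r/2)%R * q) by ring.
    rewrite Cmod_mult, Cmod_R, Rabs_pos_eq by lra. assert (A1 := Cmod_ge_0 q). nra.
  - refine (Cser_ext _ _ _ _ (ev_Cser _ _ Hb Hq)). intros n.
    replace (t + (r/2)%R * q - t) with ((r/2)%R * q) by ring. rewrite Cpow_mult_l. ring.
Qed.

Lemma ev_shift (b : fps) q : rad1 b -> (Cmod q < 1)%R ->
  rad1 (fun n => b (S n)) /\ ev b q = b O + q * ev (fun n => b (S n)) q.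
Proof.
  intros Hb Hq. assert (Hs : rad1 (fun n => b (S n))).
  { intros r Hr. destruct (Hb r Hr) as [M HM]. exists (M / r)%R. intros n. specialize (HM (S n)).
    simpl pow in HM. apply Rmult_le_reg_r with r; [lra|].
    replace (M / r * r)%R with M by (field; lra). lra. }
  split; auto. apply (Cser_unique (fun n => b n * q ^ n)); [now apply ev_Cser|].
  apply (Clim_unshift _ _ 1). apply (Clim_ext (fun n => b O + q * Csum (fun n => b (S n) * q ^ n) n)).
  - intros n. rewrite Nat.add_1_r, Csum_shift, <- Csum_scal. simpl (q ^ 0). f_equal; [ring|].
    apply Csum_ext. intros; simpl; ring.
  - apply Clim_plus; [apply Clim_const|]. apply Clim_scal, ev_Cser; auto.
Qed.

(** The constant term vanishes by continuity. Dividing by [q] shifts the coefficients and keeps the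
    nonzero zeros, so the argument repeats. *)
Lemma ev_zeros_cluster (b : fps) : rad1 b ->
  (forall d, (0 < d)%R -> exists q : C, q <> 0 /\ (Cmod q < d)%R /\ ev b q = 0) -> forall n, b n = 0.
Proof.
  intros Hb Hz n. revert b Hb Hz.
  assert (H0 : forall b : fps, rad1 b ->
    (forall d, (0 < d)%R -> exists q : C, q <> 0 /\ (Cmod q < d)%R /\ ev b q = 0) -> b O = 0).
  { intros b Hb Hz. apply NNPP. intros Hn.
    assert (Hc : Ccont (ev b) 0) by (eapply Cdiff_cont, ev_diff; auto; rewrite Cmod_0; lra).
    destruct (Hc (Cmod (b O)) (Cmod_pos _ Hn)) as (d & Hd & H).
    destruct (Hz d Hd) as (q & _ & Hq & Hq0). specialize (H q).
    replace (q - 0) with q in H by ring. specialize (H Hq). rewrite Hq0, ev_0 in H by auto.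
    rewrite Cmod_sub_sym in H. replace (b O - 0) with (b O) in H by ring. lra. }
  induction n as [|n IH]; intros b Hb Hz; [now apply H0|].
  apply (IH (fun n => b (S n))).
  - apply (ev_shift b 0); auto. rewrite Cmod_0. lra.
  - intros d Hd. destruct (Hz (Rmin d 1)) as (q & Hq & Hqd & Hq0); [apply Rmin_glb_lt; lra|].
    assert (Hq1 : (Cmod q < 1)%R) by (eapply Rlt_le_trans; [exact Hqd|apply Rmin_r]).
    exists q. repeat split; auto; [eapply Rlt_le_trans; [exact Hqd|apply Rmin_l]|].
    rewrite (proj2 (ev_shift b q Hb Hq1)), (H0 b Hb Hz) in Hq0.
    apply (C_eq_cancel q); auto. rewrite Cmult_0_r, <- Hq0. ring.
Qed.

Lemma ev_small_radius (b : fps) s q : (0 < s <= 1)%R -> rad1 b -> (Cmod q < 1)%R ->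
  rad1 (fun n => b n * s ^ n) /\ ev (fun n => b n * s ^ n) q = ev b (s * q).
Proof.
  intros Hs Hb Hq. assert (Hr : rad1 (fun n => b n * s ^ n)).
  { refine (rad1_le _ _ _ Hb). intros n. rewrite Cmod_mult, Cmod_pow, Cmod_R, Rabs_pos_eq by lra.
    assert (0 <= s ^ n <= 1)%R. { split; [apply pow_le; lra|]. rewrite <- (pow1 n). apply pow_incr. lra. }
    assert (A1 := Cmod_ge_0 (b n)). nra. }
  split; auto. apply (Cser_unique (fun n => b n * s ^ n * q ^ n)); [apply (ev_Cser _ _ Hr Hq)|].
  assert (Hsq : (Cmod (s * q) < 1)%R).
  { rewrite Cmod_mult, Cmod_R, Rabs_pos_eq by lra. assert (A1 := Cmod_ge_0 q). nra. }
  refine (Cser_ext _ _ _ _ (ev_Cser _ _ Hb Hsq)). intros n. rewrite Cpow_mult_l. ring.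
Qed.

(** Agreement is asked at one point of each punctured disc only, since a path supplies no more than
    that. *)
Lemma analytic_identity f g t : analytic_at f t -> analytic_at g t ->
  (forall d, (0 < d)%R -> exists w, w <> t /\ (Cmod (w - t) < d)%R /\ f w = g w) ->
  exists d, (0 < d)%R /\ forall w, (Cmod (w - t) < d)%R -> f w = g w.
Proof.
  intros Hf Hg Hz. apply analytic_at_ev in Hf. apply analytic_at_ev in Hg.
  destruct Hf as (r1 & b1 & Hr1 & Hb1 & H1), Hg as (r2 & b2 & Hr2 & Hb2 & H2).
  set (r := Rmin r1 r2). assert (Hr : (0 < r)%R) by (now apply Rmin_glb_lt).
  assert (Hle1 : (r <= r1)%R) by apply Rmin_l. assert (Hle2 : (r <= r2)%R) by apply Rmin_r.
  assert (Hs1 : (0 < r / r1 <= 1)%R).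
  { split; [now apply Rdiv_lt_0_compat|]. apply Rmult_le_reg_r with r1; auto. unfold Rdiv. rewrite Rmult_assoc, Rinv_l; lra. }
  assert (Hs2 : (0 < r / r2 <= 1)%R).
  { split; [now apply Rdiv_lt_0_compat|]. apply Rmult_le_reg_r with r2; auto. unfold Rdiv. rewrite Rmult_assoc, Rinv_l; lra. }
  set (c1 := fun n => b1 n * (r / r1)%R ^ n). set (c2 := fun n => b2 n * (r / r2)%R ^ n).
  assert (R1 : rad1 c1) by (apply (ev_small_radius b1 (r / r1) 0 Hs1 Hb1); rewrite Cmod_0; lra).
  assert (R2 : rad1 c2) by (apply (ev_small_radius b2 (r / r2) 0 Hs2 Hb2); rewrite Cmod_0; lra).
  assert (E1 : forall q, (Cmod q < 1)%R -> f (t + r * q) = ev c1 q).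
  { intros q Hq. unfold c1. rewrite (proj2 (ev_small_radius b1 (r / r1) q Hs1 Hb1 Hq)), <- H1.
    - f_equal. rewrite RtoC_div by lra. field. apply C_RtoC_neq; lra.
    - rewrite Cmod_mult, Cmod_R, Rabs_pos_eq by lra. assert (A1 := Cmod_ge_0 q). nra. }
  assert (E2 : forall q, (Cmod q < 1)%R -> g (t + r * q) = ev c2 q).
  { intros q Hq. unfold c2. rewrite (proj2 (ev_small_radius b2 (r / r2) q Hs2 Hb2 Hq)), <- H2.
    - f_equal. rewrite RtoC_div by lra. field. apply C_RtoC_neq; lra.
    - rewrite Cmod_mult, Cmod_R, Rabs_pos_eq by lra. assert (A1 := Cmod_ge_0 q). nra. }
  assert (Hr0 : RtoC r <> 0) by (apply C_RtoC_neq; lra).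
  assert (Hq : forall w, (Cmod (w - t) < r)%R -> (Cmod ((w - t) / r) < 1)%R).
  { intros w Hw. rewrite Cmod_div, Cmod_R, Rabs_pos_eq by (auto || lra).
    apply Rmult_lt_reg_r with r; auto. unfold Rdiv. rewrite Rmult_assoc, Rinv_l; lra. }
  assert (Hw : forall w, w = t + r * ((w - t) / r)) by (intros; field; auto).
  assert (HN : forall n, fsub c1 c2 n = 0).
  { apply ev_zeros_cluster; [now apply rad1_sub|]. intros d Hd.
    destruct (Hz (Rmin r (d * r))) as (w & Hwt & Hwd & Hfg).
    { apply Rmin_glb_lt; auto. nra. }
    assert (Hwr : (Cmod (w - t) < r)%R) by (eapply Rlt_le_trans; [exact Hwd|apply Rmin_l]).
    exists ((w - t) / r). split; [|split].
    - intros E. apply Hwt. rewrite (Hw w), E. ring.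
    - rewrite Cmod_div, Cmod_R, Rabs_pos_eq by (auto || lra). apply Rmult_lt_reg_r with r; auto.
      unfold Rdiv. rewrite Rmult_assoc, Rinv_l, Rmult_1_r by lra.
      eapply Rlt_le_trans; [exact Hwd|apply Rmin_r].
    - rewrite ev_sub by auto. rewrite <- E1, <- E2 by auto. rewrite <- Hw, Hfg. ring. }
  exists r. split; auto. intros w Hwr. rewrite (Hw w), E1, E2 by auto.
  replace (ev c1 ((w - t) / r)) with (ev (fsub c1 c2) ((w - t) / r) + ev c2 ((w - t) / r)) by (rewrite ev_sub by auto; ring).
  rewrite (ev_finite (fsub c1 c2) _ 0 0); [ring| |reflexivity]. intros n _. apply HN.
Qed.

(** * The function [z] on the upper half-plane *)

(** The exponential is [q^(1/2)]: four eta functions at [3 tau] contribute [12/24]. *)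
Definition etaf (t : C) : C := Cexp (PI * Ci * t) * EV fE3 t ^ 4.
Definition dzfun (t : C) : C := 2 * PI * Ci * (9 * (nome t * EV fE3 t ^ 10) / EV fV t ^ 2).

Lemma C2PI_neq : PI * Ci <> 0.
Proof.
  intros E. apply (f_equal Im) in E. unfold Im, Cmult, Ci, RtoC in E; simpl in E.
  assert (H := PI_RGT_0). lra.
Qed.

Lemma Ci2 : Ci * Ci = -1.
Proof. unfold Ci, Cmult, RtoC; simpl. f_equal; ring. Qed.

Lemma Cinv_neq_0 (a : C) : a <> 0 -> / a <> 0.
Proof.
  intros Ha E. apply (C_RtoC_neq 1); [lra|]. transitivity (a * / a); [field; auto|]. rewrite E. ring.
Qed.

Section HalfPlane.
Variable t : C.
Hypothesis Ht : upper_half_plane t.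
Let Hq := nome_disc t Ht.

Lemma EV_wronskian : EV fV t * EV (fD fT) t - EV fT t * EV (fD fV) t = nome t * EV fE3 t ^ 10.
Proof.
  assert (H := f_equal (fun a => ev a (nome t)) eta_wronskian). cbv beta in H.
  rewrite ev_sub, !ev_mul, ev_fX, ev_pow in H; auto using rad1_fV, rad1_fT, rad1_fD, rad1_fX, rad1_fE3, rad1_mul, rad1_pow.
Qed.

Lemma EV_cubic : EV fV t * (EV fT t * EV fV t ^ 2 + 9 * EV fT t ^ 2 * EV fV t + 27 * EV fT t ^ 3) = nome t * EV fE3 t ^ 12.
Proof.
  assert (H := f_equal (fun a => ev a (nome t)) eta_cubic). cbv beta in H.
  assert (RV := rad1_fV). assert (RT := rad1_fT).
  assert (R3 := rad1_fE3). assert (RX := rad1_fX).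
  rewrite !ev_mul, !ev_add, !ev_mul, ev_fX, !ev_pow, !ev_Z in H;
    auto 10 using rad1_mul, rad1_pow, rad1_Z, rad1_add.
Qed.

Lemma EV_quartic : (EV fP3 t ^ 2 - 4 * EV (fD fP3) t) * EV fE3 t ^ 4 =
  (EV fV t + 9 * EV fT t) * (EV fV t ^ 3 + 3 * EV fT t * EV fV t ^ 2 + 27 * EV fT t ^ 2 * EV fV t + 81 * EV fT t ^ 3).
Proof.
  assert (H := f_equal (fun a => ev a (nome t)) eta_quartic). cbv beta in H.
  assert (RV := rad1_fV). assert (RT := rad1_fT). assert (RP := rad1_fP3). assert (RDP := rad1_fD _ RP).
  assert (R3 := rad1_fE3). assert (RX := rad1_fX).
  repeat (rewrite ?ev_sub, ?ev_add, ?ev_mul, ?ev_pow, ?ev_Z in H by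
    auto 15 using rad1_mul, rad1_pow, rad1_Z, rad1_add, rad1_sub). exact H.
Qed.

Lemma EV_E3_log : 8 * EV (fD fE3) t = (EV fP3 t - 1) * EV fE3 t.
Proof.
  assert (H := f_equal (fun a => ev a (nome t)) fD_fE3). cbv beta in H.
  rewrite !ev_mul, ev_sub, !ev_Z in H; auto using rad1_fE3, rad1_fP3, rad1_fD, rad1_Z, rad1_sub.
Qed.

(** For [z = 1 + 9 x] one has [z^3 - 1 = 27 x (1 + 9 x + 27 x^2)], which [EV_cubic] evaluates. The
    product form shows that [z] omits the cube roots of unity. *)
Lemma zfun_cube : zfun t ^ 3 - 1 = 27 * (nome t * EV fE3 t ^ 12) / EV fV t ^ 4.
Proof.
  rewrite zfun_EV by auto. rewrite <- EV_cubic. assert (HV := EV_fV_neq_0 t Ht). field. auto.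
Qed.

Lemma zfun_cube_neq : zfun t ^ 3 - 1 <> 0.
Proof.
  rewrite zfun_cube. assert (HV := EV_fV_neq_0 t Ht). assert (H3 := EV_fE3_neq_0 t Ht).
  assert (Hn := nome_neq_0 t). unfold Cdiv.
  apply Cmult_neq_0; [apply Cmult_neq_0; [|apply Cmult_neq_0]|apply Cinv_neq_0]; auto using Cpow_nz.
  apply C_RtoC_neq; lra.
Qed.

Lemma zfun_diff : Cdiff zfun t (dzfun t).
Proof.
  assert (HV := EV_fV_neq_0 t Ht).
  set (d := (Im t)%R). assert (Hd : (0 < d)%R) by exact Ht.
  apply (Cdiff_ext_loc (fun w => (EV fV w + 9 * EV fT w) / EV fV w) _ _ _ d); auto.
  - intros w Hw. symmetry. apply zfun_EV. unfold upper_half_plane.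
    assert (T2 := Rle_abs (- (Im w - d))). rewrite Rabs_Ropp in T2. assert (T3 := im_le_Cmod (w - t)). rewrite Im_minus in T3. fold d in T3. lra.
  - eapply Cdiff_eq; [|apply Cdiff_div; [exact HV| |]].
    2:{ apply Cdiff_plus; [|apply Cdiff_scal]; apply EV_diff; auto using rad1_fV, rad1_fT. }
    2:{ apply EV_diff; auto using rad1_fV. }
    unfold dzfun. rewrite <- EV_wronskian. field. auto.
Qed.

Lemma etaf_neq_0 : etaf t <> 0.
Proof.
  apply Cmult_neq_0; [apply Cexp_neq_0|]. apply Cpow_nz, EV_fE3_neq_0, Ht.
Qed.

Lemma etaf_sq : etaf t ^ 2 = nome t * EV fE3 t ^ 8.
Proof.
  unfold etaf, nome. replace (2 * PI * Ci * t) with (PI * Ci * t + PI * Ci * t) by ring.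
  rewrite Cexp_plus. ring.
Qed.

Lemma etaf_diff : Cdiff etaf t (PI * Ci * EV fP3 t * etaf t).
Proof.
  eapply Cdiff_eq; [|apply Cdiff_mult; [apply Cdiff_Cexp_scal|apply (Cdiff_pow (EV fE3) t (2 * PI * Ci * EV (fD fE3) t) 3), EV_diff; auto using rad1_fE3]].
  assert (H := EV_E3_log). unfold etaf.
  replace (RtoC (INR 4)) with (RtoC 4) by (apply f_equal; simpl; lra).
  transitivity (PI * Ci * Cexp (PI * Ci * t) * EV fE3 t ^ 3 * (EV fE3 t + 8 * EV (fD fE3) t)); [ring|].
  rewrite H. ring.
Qed.

Definition d2etaf (t : C) := PI * Ci * (PI * Ci) * (2 * EV (fD fP3) t + EV fP3 t ^ 2) * etaf t.

Lemma detaf_diff : Cdiff (fun w => PI * Ci * EV fP3 w * etaf w) t (d2etaf t).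
Proof.
  eapply Cdiff_eq; [|apply Cdiff_mult; [apply Cdiff_scal, EV_diff; auto using rad1_fP3|apply etaf_diff]].
  unfold d2etaf. ring.
Qed.
End HalfPlane.

(** * The differential equation of [z] and the value of the bracket *)

Definition kap : C := sqrt 3 * PI * Ci.

Lemma sqrt3_sq : RtoC (sqrt 3) * RtoC (sqrt 3) = 3.
Proof. rewrite <- RtoC_mult, sqrt_sqrt by lra. reflexivity. Qed.

(** The constant is forced by [dzfun_sq]: [(2 pi i * 9)^2 / (4 * 27) = -3 pi^2]. *)
Lemma kap_sq : kap ^ 2 = -3 * PI ^ 2.
Proof.
  unfold kap. transitivity ((sqrt 3 * sqrt 3) * (Ci * Ci) * PI ^ 2); [ring|]. rewrite sqrt3_sq, Ci2. ring.
Qed.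

Lemma kap_neq_0 : kap <> 0.
Proof.
  unfold kap. replace (sqrt 3 * PI * Ci) with (sqrt 3 * (PI * Ci)) by ring.
  apply Cmult_neq_0; [|apply C2PI_neq]. apply C_RtoC_neq. assert (H := sqrt_lt_R0 3 ltac:(lra)). lra.
Qed.

Lemma dzfun_sq t : upper_half_plane t -> dzfun t ^ 2 = 4 * (zfun t ^ 3 - 1) * (kap * etaf t) ^ 2.
Proof.
  intros Ht. rewrite (zfun_cube t Ht). assert (HV := EV_fV_neq_0 t Ht).
  transitivity (4 * (27 * (nome t * EV fE3 t ^ 12) / EV fV t ^ 4) * (kap ^ 2 * etaf t ^ 2)); [|ring].
  rewrite kap_sq, etaf_sq. unfold dzfun.
  transitivity ((Ci * Ci) * (2 * PI * (9 * (nome t * EV fE3 t ^ 10) / EV fV t ^ 2)) ^ 2); [ring|].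
  rewrite Ci2. field. auto.
Qed.

(** The duplication formula [wp (2 x) = dup (wp x)] when [wp' ^ 2 = 4 wp ^ 3 - 4]. *)
Definition dup (z : C) : C := (z ^ 4 + 8 * z) / (4 * (z ^ 3 - 1)).

(** The left side is the bracket of a primitive of [kap * etaf]. The terms in [E_2(3 tau)] combine
    to [- E_4(3 tau) / (6 eta(3 tau)^8)], and [EV_quartic] with [zfun_cube] rewrites this in [z]. *)
Lemma schwarz_value t : upper_half_plane t ->
  d2etaf t / (kap ^ 2 * etaf t ^ 3) - 3 / 2 * ((PI * Ci * EV fP3 t * etaf t) ^ 2 / (kap ^ 2 * etaf t ^ 4)) =
  - 2 * dup (zfun t).
Proof.
  intros Ht. assert (HV := EV_fV_neq_0 t Ht). assert (H3 := EV_fE3_neq_0 t Ht). assert (Hn := nome_neq_0 t).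
  assert (Hf := etaf_neq_0 t Ht). assert (Hk := kap_neq_0).
  assert (Hz := zfun_cube t Ht). assert (Hz0 := zfun_cube_neq t Ht).
  assert (HP : RtoC PI <> 0) by (apply C_RtoC_neq, PI_neq0).
  transitivity ((PI * Ci) * (PI * Ci) * (2 * EV (fD fP3) t + EV fP3 t ^ 2 - 3 / 2 * EV fP3 t ^ 2) / (kap ^ 2 * etaf t ^ 2)).
  { unfold d2etaf. field. auto. }
  rewrite kap_sq, etaf_sq by auto.
  transitivity ((Ci * Ci) * / 6 * (EV fP3 t ^ 2 - 4 * EV (fD fP3) t) / (nome t * EV fE3 t ^ 8)).
  { field. auto. }
  rewrite Ci2. unfold dup. rewrite Hz.
  assert (HQ := EV_quartic t Ht).
  transitivity (- / 6 * ((EV fP3 t ^ 2 - 4 * EV (fD fP3) t) * EV fE3 t ^ 4) / (nome t * EV fE3 t ^ 12)); [field; auto|].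
  rewrite HQ, (zfun_EV t Ht). field. auto.
Qed.

(** * A primitive of [etaf] *)

(** Termwise integration of [q^(1/2) E(q^3)^4]. The exponents [n + 1/2] never vanish, so no
    logarithm appears and [Gfun] is a single function on the whole half-plane. *)
Definition prim : fps := fun n => (fE3 ^ 4)%fps n / (INR n + / 2).
Definition Gfun (t : C) : C := sqrt 3 / 2 * (Cexp (PI * Ci * t) * EV prim t).

Lemma half_int_neq n : RtoC (INR n) + / 2 <> 0.
Proof.
  replace (/ 2) with (RtoC (/ 2)) by (apply RtoC_inv; lra). rewrite <- RtoC_plus.
  apply C_RtoC_neq. assert (H := pos_INR n). lra.
Qed.

Lemma rad1_prim : rad1 prim.
Proof.
  apply (rad1_le _ (fcst 2 * (fE3 ^ 4))%fps).
  - intros n. rewrite fcst_mul. unfold prim. rewrite Cmod_div, Cmod_mult by apply half_int_neq.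
    replace (INR n + / 2) with (RtoC (INR n + / 2)) by (rewrite RtoC_plus, RtoC_inv by lra; reflexivity).
    rewrite !Cmod_R, !Rabs_pos_eq by (assert (H := pos_INR n); lra).
    unfold Rdiv. rewrite Rmult_comm. apply Rmult_le_compat_r; [apply Cmod_ge_0|].
    assert (H := pos_INR n). rewrite <- (Rinv_inv 2) at 2. apply Rinv_le_contravar; lra.
  - apply rad1_mul; [apply rad1_cst|]. apply rad1_pow, rad1_fE3.
Qed.

Lemma prim_eq : (fD prim + fcst (/ 2) * prim = fE3 ^ 4)%fps.
Proof.
  apply fps_ext. intros n. unfold fadd. rewrite fcst_mul. unfold fD, prim.
  assert (H := half_int_neq n). unfold Cdiv. rewrite (Cmult_assoc (INR n)), (Cmult_assoc (/ 2)).
  transitivity ((fE3 ^ 4)%fps n * ((INR n + / 2) * / (INR n + / 2))); [ring|].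
  rewrite Cinv_r by auto. ring.
Qed.

Lemma Gfun_diff t : upper_half_plane t -> Cdiff Gfun t (kap * etaf t).
Proof.
  intros Ht. assert (Hq := nome_disc t Ht).
  eapply Cdiff_eq; [|apply Cdiff_scal, Cdiff_mult; [apply Cdiff_Cexp_scal|apply EV_diff; auto using rad1_prim]].
  assert (H := f_equal (fun a => ev a (nome t)) prim_eq). cbv beta in H.
  rewrite ev_add, ev_mul, ev_cst, ev_pow in H; auto using rad1_fD, rad1_prim, rad1_mul, rad1_cst, rad1_fE3.
  unfold kap, etaf. change (EV fE3 t) with (ev fE3 (nome t)). rewrite <- H. unfold EV. field.
Qed.

Lemma exp_le x y : (x <= y)%R -> (exp x <= exp y)%R.
Proof. intros [H|H]; [left; now apply exp_increasing|rewrite H; lra]. Qed.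

Lemma exp_INR_mult n x : exp (INR n * x) = (exp x ^ n)%R.
Proof.
  induction n; [simpl; rewrite Rmult_0_l; apply exp_0|].
  rewrite S_INR, Rmult_plus_distr_r, Rmult_1_l, exp_plus, IHn. simpl. ring.
Qed.

(* Taylor expansion at [t] of [sum_n A_n exp (mu_n w)], exchanging the two summations. *)
Lemma exp_series_analytic (A mu : nat -> C) (r : R) (f : C -> C) (t : C) : (0 < r)%R ->
  summable (fun n => Cmod (A n) * exp (Cmod (mu n) * r))%R ->
  (forall w, (Cmod w < r)%R -> Cser (fun n => A n * Cexp (mu n * w)) (f (t + w))) ->
  analytic_at f t.
Proof.
  intros Hr HM Hf. set (M := fun n => (Cmod (A n) * exp (Cmod (mu n) * r))%R) in *.
  assert (Hc : forall k, exists s, Cser (fun n => A n * (mu n ^ k / INR (fact k))) s).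
  { intros k. apply (ex_Cser _ (fun n => / r ^ k * M n)%R).
    - apply summable_scal; auto. left. now apply Rinv_0_lt_compat, pow_lt.
    - intros n. rewrite Cmod_mult, Cmod_div, Cmod_pow, Cmod_R, Rabs_pos_eq by (apply INR_fact_C || apply pos_INR).
      assert (T := exp_term_le (Cmod (mu n) * r) k). rewrite Rpow_mult_distr in T.
      assert (Hk : (0 < r ^ k)%R) by now apply pow_lt.
      apply Rmult_le_reg_l with (r ^ k)%R; auto. unfold M.
      replace (r ^ k * (/ r ^ k * (Cmod (A n) * exp (Cmod (mu n) * r))))%R with (Cmod (A n) * exp (Cmod (mu n) * r))%R by (field; lra).
      replace (r ^ k * (Cmod (A n) * (Cmod (mu n) ^ k / INR (fact k))))%R with (Cmod (A n) * (Cmod (mu n) ^ k * r ^ k / INR (fact k)))%R by (field; apply INR_fact_neq_0).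
      apply Rmult_le_compat_l; [apply Cmod_ge_0|]. apply T. apply Rmult_le_pos; [apply Cmod_ge_0|lra]. }
  set (c := fun k => C_lim_seq (Csum (fun n => A n * (mu n ^ k / INR (fact k))))).
  assert (Hc' : forall k, Cser (fun n => A n * (mu n ^ k / INR (fact k))) (c k)).
  { intros k. destruct (Hc k) as [s Hs]. unfold c. now rewrite (C_lim_seq_unique _ _ Hs). }
  apply analytic_at_Cser. exists c, r. split; auto. intros w Hw. set (h := w - t) in *.
  apply (tannery (fun K n => A n * Csum (fun k => (mu n * h) ^ k / INR (fact k)) K)
     (fun n => A n * Cexp (mu n * h)) M); auto.
  - intros K n. rewrite Cmod_mult. unfold M. apply Rmult_le_compat_l; [apply Cmod_ge_0|].
    eapply Rle_trans; [apply Csum_bound with (M := fun k => (Cmod (mu n * h) ^ k / INR (fact k))%R)|].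
    + intros k. rewrite Cmod_div, Cmod_pow, Cmod_R, Rabs_pos_eq by (apply INR_fact_C || apply pos_INR). lra.
    + eapply Rle_trans; [apply exp_partial, Cmod_ge_0|]. apply exp_le. rewrite Cmod_mult.
      apply Rmult_le_compat_l; [apply Cmod_ge_0|lra].
  - intros n. apply Clim_scal, Cexp_Cser.
  - intros K. induction K as [|K IH].
    + apply (Cser_ext (fun _ => 0)); [intros; simpl; ring|]. apply (Cser_finite (fun _ => 0) O). auto.
    + cbn [Csum]. apply (Cser_ext (fun n => A n * Csum (fun k => (mu n * h) ^ k / INR (fact k)) K + h ^ K * (A n * (mu n ^ K / INR (fact K))))).
      * intros n. rewrite Cpow_mult_l. unfold Cdiv. ring.
      * apply Cser_plus; auto. rewrite (Cmult_comm (c K)). now apply Cser_scal.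
  - replace w with (t + h) by (unfold h; ring). now apply Hf.
Qed.

(** [Gfun] is a series in [exp (pi i (2 n + 1) t)]. On the disc of radius [y / 2] the growth of each
    term uses up at most half of its decay at [t], and the rest lies below a geometric series. *)
Lemma Gfun_analytic t : upper_half_plane t -> analytic_at Gfun t.
Proof.
  intros Ht. set (y := Im t). assert (Hy : (0 < y)%R) by exact Ht.
  assert (HPI := PI_RGT_0).
  set (mu := fun n => PI * Ci * (2 * INR n + 1)).
  assert (Hmu : forall n, mu n = RtoC (PI * (2 * INR n + 1)) * Ci).
  { intros n. unfold mu. rewrite RtoC_mult, RtoC_plus, RtoC_mult. ring. }
  apply (exp_series_analytic (fun n => sqrt 3 / 2 * (prim n * Cexp (mu n * t))) mu (y / 2)); [lra| |].
  - set (rho := exp (- (PI * y))).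
    assert (Hrho : (0 <= rho < 1)%R).
    { unfold rho. split; [left; apply exp_pos|]. rewrite <- exp_0. apply exp_increasing. nra. }
    refine (summable_le _ _ _ (summable_scal (Cmod (sqrt 3 / 2)) _ (Cmod_ge_0 _) (rad1_summable prim rho rad1_prim Hrho))).
    intros n. split; [apply Rmult_le_pos; [apply Cmod_ge_0|left; apply exp_pos]|].
    rewrite !Cmod_mult, Cmod_Cexp, Hmu, !Cmod_mult, Cmod_Ci, Cmod_R, Rmult_1_r.
    assert (Hn := pos_INR n). rewrite Rabs_pos_eq by nra.
    rewrite !Rmult_assoc. apply Rmult_le_compat_l; [apply Cmod_ge_0|]. apply Rmult_le_compat_l; [apply Cmod_ge_0|].
    rewrite <- exp_plus. unfold rho. rewrite <- exp_INR_mult. apply exp_le.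
    replace (Re (RtoC (PI * (2 * INR n + 1)) * Ci * t)) with (- (PI * (2 * INR n + 1) * y))%R.
    + nra.
    + unfold y, Re, Im, Cmult, RtoC, Ci; simpl. ring.
  - intros w Hw.
    assert (Htw : upper_half_plane (t + w)).
    { unfold upper_half_plane. assert (T := im_le_Cmod w). assert (T2 := Rle_abs (- Im w)). rewrite Rabs_Ropp in T2.
      replace (Im (t + w)) with (y + Im w)%R by reflexivity. lra. }
    assert (H := Cser_scal (sqrt 3 / 2 * Cexp (PI * Ci * (t + w))) _ _ (ev_Cser prim _ rad1_prim (nome_disc _ Htw))).
    replace (Gfun (t + w)) with (sqrt 3 / 2 * Cexp (PI * Ci * (t + w)) * ev prim (nome (t + w))) by (unfold Gfun, EV; ring).
    refine (Cser_ext _ _ _ _ H). intros n.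
    assert (E : Cexp (mu n * t) * Cexp (mu n * w) = Cexp (PI * Ci * (t + w)) * nome (t + w) ^ n).
    { unfold nome. rewrite <- Cexp_pow, <- !Cexp_plus. f_equal. unfold mu. ring. }
    transitivity (sqrt 3 / 2 * prim n * (Cexp (PI * Ci * (t + w)) * nome (t + w) ^ n)); [ring|].
    rewrite <- E. ring.
Qed.

Lemma analytic_affine (f : C -> C) (e c t : C) : analytic_at f t -> analytic_at (fun w => e * f w + c) t.
Proof.
  intros H. apply analytic_at_Cser in H. destruct H as (a & r & Hr & H).
  apply analytic_at_Cser. exists (fcst c + fcst e * a)%fps, r. split; auto. intros w Hw.
  rewrite Cplus_comm.
  apply (Cser_ext (fun k => fcst c k * (w - t) ^ k + e * (a k * (w - t) ^ k))).
  - intros k. unfold fadd. rewrite fcst_mul. ring.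
  - apply Cser_plus; [|now apply Cser_scal, H].
    assert (E : Csum (fun k => fcst c k * (w - t) ^ k) 1 = c) by (simpl; ring).
    assert (T : Cser (fun k => fcst c k * (w - t) ^ k) (Csum (fun k => fcst c k * (w - t) ^ k) 1)).
    { apply Cser_finite. intros [|n] Hn; [lia|]. simpl. ring. }
    rewrite E in T. exact T.
Qed.

(** * Continuation along a path *)

Lemma locally_C_ball (z : C) (P : C -> Prop) :
  locally z P <-> exists d, (0 < d)%R /\ forall w, (Cmod (w - z) < d)%R -> P w.
Proof.
  rewrite locally_C. split.
  - intros [d Hd]. exists d. split; [apply cond_pos|]. intros w Hw. apply Hd. exact Hw.
  - intros (d & Hd & H). exists (mkposreal d Hd). intros w Hw. apply H. exact Hw.
Qed.

(** A supremum argument on [[0, 1]]. It serves the germs along a path and, later, [matches] along a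
    segment. *)
Lemma real_induction (Q : R -> Prop) : Q 0%R ->
  (forall s, (0 < s <= 1)%R -> (forall x, (0 <= x < s)%R -> Q x) -> Q s) ->
  (forall s, (0 <= s < 1)%R -> (forall x, (0 <= x <= s)%R -> Q x) -> exists d, (0 < d)%R /\ forall x, (s <= x < s + d)%R -> (x <= 1)%R -> Q x) ->
  Q 1%R.
Proof.
  intros H0 Hcl Hop.
  set (E s := (0 <= s <= 1)%R /\ forall x, (0 <= x <= s)%R -> Q x).
  assert (E0 : E 0%R). { split; [lra|]. intros x Hx. replace x with 0%R by lra. auto. }
  destruct (completeness E) as [m [Hm1 Hm2]].
  { exists 1%R. intros s [Hs _]. lra. }
  { now exists 0%R. }
  assert (Hm0 : (0 <= m)%R) by now apply Hm1.
  assert (Hm1' : (m <= 1)%R). { apply Hm2. intros s [Hs _]. lra. }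
  assert (Hlt : forall x, (0 <= x < m)%R -> Q x).
  { intros x Hx. apply NNPP. intros Hn. assert (m <= x)%R; [|lra]. apply Hm2. intros s [Hs Hs'].
    apply Rnot_lt_le. intros Hlt. apply Hn, Hs'. lra. }
  assert (HQm : Q m). { destruct (Req_dec m 0) as [->|]; auto. apply Hcl; auto. lra. }
  assert (Hall : forall x, (0 <= x <= m)%R -> Q x).
  { intros x Hx. destruct (Req_dec x m) as [->|]; auto. apply Hlt. lra. }
  destruct (Req_dec m 1) as [E1|Hne]; [rewrite <- E1; auto|].
  destruct (Hop m ltac:(lra) Hall) as (d & Hd & Hd').
  set (s := Rmin 1 (m + d / 2)). assert (s <= m)%R.
  { apply Hm1. assert (A1 := Rmin_l 1 (m + d / 2)). assert (A2 := Rmin_r 1 (m + d / 2)). fold s in A1, A2.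
    split. { split; auto. apply Rmin_glb; lra. }
    intros x Hx. destruct (Rle_lt_dec x m); [apply Hall; lra|]. apply Hd'; lra. }
  unfold s in H. destruct (Rle_lt_dec 1 (m + d / 2)); [rewrite Rmin_left in H by lra|rewrite Rmin_right in H by lra]; lra.
Qed.

Lemma continuous_on_path (gamma : R -> C) s : continuous_on unit_interval gamma -> unit_interval s ->
  forall eps, (0 < eps)%R -> exists d, (0 < d)%R /\ forall x, unit_interval x -> (Rabs (x - s) < d)%R ->
    (Cmod (gamma x - gamma s) < eps)%R.
Proof.
  intros H Hs eps He. assert (HP : locally (gamma s) (fun w => (Cmod (w - gamma s) < eps)%R)).
  { apply locally_C_ball. exists eps. auto. }
  destruct (H s Hs _ HP) as [d Hd]. exists d. split; [apply cond_pos|]. intros x Hx Hxd. now apply Hd.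
Qed.

Lemma germ_is_affine_Gfun (gamma : R -> C) (F : R -> C -> C) (e c : C) :
  continuous_on unit_interval gamma -> (forall s, unit_interval s -> upper_half_plane (gamma s)) ->
  continuation_along gamma F ->
  locally (gamma 0%R) (fun w => F 0%R w = e * Gfun w + c) ->
  locally (gamma 1%R) (fun w => F 1%R w = e * Gfun w + c).
Proof.
  intros Hg HH [Han Hloc] H0.
  apply (real_induction (fun s => locally (gamma s) (fun w => F s w = e * Gfun w + c))); auto.
  - intros s Hs Hlt. assert (Us : unit_interval s) by (unfold unit_interval; lra).
    destruct (Hloc s Us) as [d Hd].
    (* The path may pause or return. If it was at [gamma s] at a slightly earlier time, the two
       germs coincide. Otherwise points [gamma x] different from [gamma s] accumulate there, and the
       identity theorem applies. *)
    destruct (classic (exists x, (0 <= x < s)%R /\ (Rabs (x - s) < d)%R /\ gamma x = gamma s)) as [(x & Hx & Hxd & Ex)|Hne].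
    + assert (Ux : unit_interval x) by (unfold unit_interval; lra).
      assert (L1 := Hd x Ux Hxd). assert (L2 := Hlt x Hx). rewrite Ex in L1, L2.
      apply locally_C_ball in L1. apply locally_C_ball in L2. apply locally_C_ball.
      destruct L1 as (d1 & Hd1 & L1), L2 as (d2 & Hd2 & L2). exists (Rmin d1 d2). split; [now apply Rmin_glb_lt|].
      intros w Hw. rewrite <- L1, L2; auto; eapply Rlt_le_trans; try exact Hw; [apply Rmin_r|apply Rmin_l].
    + assert (Hz : forall dd, (0 < dd)%R -> exists w, w <> gamma s /\ (Cmod (w - gamma s) < dd)%R /\ F s w = e * Gfun w + c).
      { intros dd Hdd. destruct (continuous_on_path gamma s Hg Us dd Hdd) as (d' & Hd' & Hc).
        set (m := Rmin s (Rmin d d')). assert (Hm : (0 < m)%R) by (repeat apply Rmin_glb_lt; try lra; apply cond_pos).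
        assert (M1 : (m <= s)%R) by apply Rmin_l.
        assert (M2 : (m <= d)%R) by (eapply Rle_trans; [apply Rmin_r|apply Rmin_l]).
        assert (M3 : (m <= d')%R) by (eapply Rle_trans; [apply Rmin_r|apply Rmin_r]).
        assert (Hab : Rabs (s - m / 2 - s) = (m / 2)%R) by (rewrite Rabs_left; lra).
        assert (Ux : unit_interval (s - m / 2)) by (unfold unit_interval; lra).
        exists (gamma (s - m / 2)%R). split; [|split].
        - intros Ex. apply Hne. exists (s - m / 2)%R. repeat split; auto; lra.
        - apply Hc; auto. lra.
        - assert (L1 := Hd (s - m / 2)%R Ux ltac:(lra)). assert (L2 := Hlt (s - m / 2)%R ltac:(lra)).
          rewrite <- (locally_singleton _ _ L1). apply (locally_singleton _ _ L2). }
      destruct (analytic_identity (F s) (fun w => e * Gfun w + c) (gamma s)) as (d' & Hd' & Heq); auto.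
      * apply analytic_affine, Gfun_analytic, HH, Us.
      * apply locally_C_ball. now exists d'.
  - intros s Hs Hle. assert (Us : unit_interval s) by (unfold unit_interval; lra).
    destruct (Hloc s Us) as [d Hd]. assert (L := Hle s ltac:(lra)).
    apply locally_C_ball in L. destruct L as (d1 & Hd1 & L).
    destruct (continuous_on_path gamma s Hg Us (d1 / 2)%R ltac:(lra)) as (d' & Hd' & Hc).
    exists (Rmin d d'). split; [apply Rmin_glb_lt; auto; apply cond_pos|].
    intros x Hx Hx1. assert (Ux : unit_interval x) by (unfold unit_interval; lra).
    assert (A1 := Rmin_l d d'). assert (A2 := Rmin_r d d').
    assert (Hab : (Rabs (x - s) < Rmin d d')%R) by (rewrite Rabs_pos_eq; lra).
    assert (L1 := Hd x Ux ltac:(lra)). apply locally_C_ball in L1. destruct L1 as (d2 & Hd2 & L1).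
    apply locally_C_ball. exists (Rmin d2 (d1 / 2)). split; [apply Rmin_glb_lt; lra|]. intros w Hw.
    assert (Hw1 := Rlt_le_trans _ _ _ Hw (Rmin_l _ _)). assert (Hw2 := Rlt_le_trans _ _ _ Hw (Rmin_r _ _)).
    rewrite L1 by auto. apply L.
    replace (w - gamma s) with ((w - gamma x) + (gamma x - gamma s)) by ring.
    eapply Rle_lt_trans; [apply Cmod_triangle|]. specialize (Hc x Ux ltac:(lra)). lra.
Qed.

(** * Symmetric sums *)

Definition Rsym (f : Z -> R) (N : nat) : R := Rsum (fun i => f (Z.of_nat i - Z.of_nat N)%Z) (2 * N + 1).

Lemma sum_sym_Csum f N : sum_sym f N = Csum (fun i => f (Z.of_nat i - Z.of_nat N)%Z) (2 * N + 1).
Proof. unfold sum_sym. rewrite sum_n_Csum. now rewrite Nat.add_1_r. Qed.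

Lemma sum_sym_0 f : sum_sym f 0 = f 0%Z.
Proof. rewrite sum_sym_Csum. simpl. ring. Qed.

Lemma sum_sym_S f N : sum_sym f (S N) = sum_sym f N + (f (Z.of_nat (S N)) + f (- Z.of_nat (S N))%Z).
Proof.
  rewrite !sum_sym_Csum. replace (2 * S N + 1)%nat with (S (S (2 * N + 1))) by lia.
  rewrite Csum_shift. cbn [Csum].
  rewrite (Csum_ext (fun k => f (Z.of_nat (S k) - Z.of_nat (S N))%Z) (fun i => f (Z.of_nat i - Z.of_nat N)%Z)).
  2:{ intros k _. f_equal. lia. }
  replace (Z.of_nat (S (2 * N + 1)) - Z.of_nat (S N))%Z with (Z.of_nat (S N)) by lia.
  replace (Z.of_nat 0 - Z.of_nat (S N))%Z with (- Z.of_nat (S N))%Z by lia. ring.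
Qed.

Lemma Rsum_shift (f : nat -> R) n : Rsum f (S n) = (f O + Rsum (fun k => f (S k)) n)%R.
Proof. induction n; [simpl; ring|]. change (Rsum f (S (S n))) with (Rsum f (S n) + f (S n))%R. rewrite IHn. simpl. ring. Qed.

Lemma Rsym_S f N : Rsym f (S N) = (Rsym f N + (f (Z.of_nat (S N)) + f (- Z.of_nat (S N))%Z))%R.
Proof.
  unfold Rsym. replace (2 * S N + 1)%nat with (S (S (2 * N + 1))) by lia.
  rewrite Rsum_shift. cbn [Rsum].
  replace (Rsum (fun k => f (Z.of_nat (S k) - Z.of_nat (S N))%Z) (2 * N + 1)) with (Rsum (fun i => f (Z.of_nat i - Z.of_nat N)%Z) (2 * N + 1)).
  2:{ f_equal. apply functional_extensionality. intros k. f_equal. lia. }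
  replace (Z.of_nat (S (2 * N + 1)) - Z.of_nat (S N))%Z with (Z.of_nat (S N)) by lia.
  replace (Z.of_nat 0 - Z.of_nat (S N))%Z with (- Z.of_nat (S N))%Z by lia. ring.
Qed.

Lemma sum_sym_ext f g N : (forall m, f m = g m) -> sum_sym f N = sum_sym g N.
Proof. intros H. rewrite !sum_sym_Csum. apply Csum_ext. auto. Qed.
Lemma sum_sym_plus f g N : sum_sym (fun m => f m + g m) N = sum_sym f N + sum_sym g N.
Proof. rewrite !sum_sym_Csum. apply Csum_plus. Qed.
Lemma sum_sym_minus f g N : sum_sym (fun m => f m - g m) N = sum_sym f N - sum_sym g N.
Proof.
  rewrite (sum_sym_ext _ (fun m => f m + (-1) * g m)) by (intros; ring).
  rewrite sum_sym_plus, !sum_sym_Csum, Csum_scal. ring.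
Qed.
Lemma sum_sym_telescope f N : sum_sym (fun m => f (m - 1)%Z - f m) N = f (- Z.of_nat N - 1)%Z - f (Z.of_nat N).
Proof.
  induction N; [rewrite sum_sym_0; reflexivity|]. rewrite sum_sym_S, IHN.
  replace (Z.of_nat (S N) - 1)%Z with (Z.of_nat N) by lia.
  replace (- Z.of_nat N - 1)%Z with (- Z.of_nat (S N))%Z by lia. ring.
Qed.
Lemma sum_sym_bound f g N : (forall m, (Z.abs m <= Z.of_nat N)%Z -> (Cmod (f m) <= g m)%R) -> (Cmod (sum_sym f N) <= Rsym g N)%R.
Proof.
  intros H. induction N.
  - rewrite sum_sym_0. unfold Rsym; simpl. specialize (H 0%Z ltac:(lia)). simpl in H. lra.
  - rewrite sum_sym_S, Rsym_S. eapply Rle_trans; [apply Cmod_triangle|].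
    apply Rplus_le_compat; [apply IHN; intros; apply H; lia|].
    eapply Rle_trans; [apply Cmod_triangle|]. apply Rplus_le_compat; apply H; lia.
Qed.
Lemma Rsym_const c N : Rsym (fun _ => c) N = (INR (2 * N + 1) * c)%R.
Proof. unfold Rsym. generalize (2 * N + 1)%nat. induction n; [simpl; ring|]. rewrite S_INR. simpl. rewrite IHn. ring. Qed.
Lemma Rsym_scal c f N : Rsym (fun m => c * f m)%R N = (c * Rsym f N)%R.
Proof. apply Rsum_scal. Qed.
Lemma Rsym_plus f g N : Rsym (fun m => f m + g m)%R N = (Rsym f N + Rsym g N)%R.
Proof. apply Rsum_plus. Qed.

Definition sum_sq (f : Z -> Z -> C) (N : nat) : C := sum_sym (fun m => sum_sym (f m) N) N.
Definition Rsq (g : Z -> Z -> R) (N : nat) : R := Rsym (fun m => Rsym (g m) N) N.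

(** The frame between two consecutive squares. Summing frames turns the double sum into a single
    series, to which the comparison test applies. *)
Lemma sum_sq_S f N : let M := Z.of_nat (S N) in sum_sq f (S N) - sum_sq f N =
  sum_sym (fun m => f m M + f m (- M)%Z) N + (sum_sym (f M) (S N) + sum_sym (f (- M)%Z) (S N)).
Proof.
  intros M. unfold sum_sq. rewrite sum_sym_S.
  rewrite (sum_sym_ext _ (fun m => sum_sym (f m) N + (f m M + f m (- M)%Z))).
  2:{ intros m. apply sum_sym_S. }
  rewrite sum_sym_plus. unfold M. ring.
Qed.
Lemma Rsq_S g N : let M := Z.of_nat (S N) in (Rsq g (S N) - Rsq g N =
  Rsym (fun m => g m M + g m (- M)%Z) N + (Rsym (g M) (S N) + Rsym (g (- M)%Z) (S N)))%R.
Proof.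
  intros M. unfold Rsq. rewrite Rsym_S.
  replace (Rsym (fun m => Rsym (g m) (S N)) N) with (Rsym (fun m => Rsym (g m) N + (g m M + g m (- M)%Z))%R N).
  2:{ f_equal. apply functional_extensionality. intros m. symmetry. apply Rsym_S. }
  rewrite Rsym_plus. unfold M. ring.
Qed.

Lemma sum_sq_step_bound f g N : (forall m n, (Cmod (f m n) <= g m n)%R) ->
  (Cmod (sum_sq f (S N) - sum_sq f N) <= Rsq g (S N) - Rsq g N)%R.
Proof.
  intros H. rewrite sum_sq_S, Rsq_S.
  eapply Rle_trans; [apply Cmod_triangle|]. apply Rplus_le_compat.
  - apply sum_sym_bound. intros m _. eapply Rle_trans; [apply Cmod_triangle|]. apply Rplus_le_compat; auto.
  - eapply Rle_trans; [apply Cmod_triangle|]. apply Rplus_le_compat; apply sum_sym_bound; auto.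
Qed.

Lemma sum_sq_bound f g N : (forall m n, (Cmod (f m n) <= g m n)%R) -> (Cmod (sum_sq f N) <= Rsq g N)%R.
Proof. intros H. apply sum_sym_bound. intros m _. apply sum_sym_bound. auto. Qed.

(* The weights [(1 + |m|)^(-3/2)], whose products dominate the lattice series. *)
Definition weight (m : Z) : R := (/ ((1 + IZR (Z.abs m)) * sqrt (1 + IZR (Z.abs m))))%R.

Lemma weight_base m : (1 <= 1 + IZR (Z.abs m))%R.
Proof. assert (0 <= IZR (Z.abs m))%R by (apply IZR_le; lia). lra. Qed.

Lemma weight_pos m : (0 < weight m)%R.
Proof.
  assert (H := weight_base m). apply Rinv_0_lt_compat, Rmult_lt_0_compat; [lra|]. apply sqrt_lt_R0. lra.
Qed.

(** The comparison of [x^(-3/2)] with its integral, in telescoping form. *)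
Lemma weight_telescope x : (0 < x)%R -> (/ ((x + 1) * sqrt (x + 1)) <= 2 * (/ sqrt x - / sqrt (x + 1)))%R.
Proof.
  intros Hx. set (a := sqrt x). set (b := sqrt (x + 1)).
  assert (Ha : (0 < a)%R) by now apply sqrt_lt_R0. assert (Hb : (0 < b)%R) by (apply sqrt_lt_R0; lra).
  assert (Ea : (a * a = x)%R) by (apply sqrt_sqrt; lra). assert (Eb : (b * b = x + 1)%R) by (apply sqrt_sqrt; lra).
  assert (Hab : (a <= b)%R) by (apply sqrt_le_1_alt; lra).
  rewrite <- Eb. replace (2 * (/ a - / b))%R with (2 * (b - a) / (a * b))%R by (field; lra).
  apply Rmult_le_reg_r with (b * b * b * a)%R; [repeat apply Rmult_lt_0_compat; auto|].
  replace (/ (b * b * b) * (b * b * b * a))%R with a by (field; lra).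
  replace (2 * (b - a) / (a * b) * (b * b * b * a))%R with (2 * (b * b) * (b - a))%R by (field; lra).
  assert (H1 : ((b - a) * (b + a) = 1)%R) by nra. nra.
Qed.

Lemma Rsym_weight N : (Rsym weight N <= 5)%R.
Proof.
  assert (H : (Rsym weight N <= 5 - 4 * / sqrt (INR N + 1))%R).
  { induction N.
    - unfold Rsym, weight; simpl. rewrite ?Rplus_0_l, ?Rplus_0_r, sqrt_1, ?Rmult_1_r, Rinv_1. lra.
    - rewrite Rsym_S. unfold weight at 2 3. rewrite Z.abs_opp, Z.abs_eq by lia. rewrite <- INR_IZR_INZ, S_INR.
      replace (1 + (INR N + 1))%R with (INR N + 1 + 1)%R by ring.
      assert (T := weight_telescope (INR N + 1) ltac:(assert (A1 := pos_INR N); lra)). lra. }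
  assert (0 < / sqrt (INR N + 1))%R; [|lra]. apply Rinv_0_lt_compat, sqrt_lt_R0. assert (A1 := pos_INR N). lra.
Qed.

Lemma Rsym_nonneg g N : (forall m, 0 <= g m)%R -> (0 <= Rsym g N)%R.
Proof. intros H. unfold Rsym. induction (2 * N + 1)%nat; simpl; [lra|]. specialize (H (Z.of_nat n - Z.of_nat N)%Z). lra. Qed.

Lemma Rsq_weight K N : Rsq (fun m n => K * (weight m * weight n))%R N = (K * (Rsym weight N * Rsym weight N))%R.
Proof.
  unfold Rsq. transitivity (Rsym (fun m => K * Rsym weight N * weight m)%R N).
  - f_equal. apply functional_extensionality. intros m.
    transitivity (Rsym (fun n => K * weight m * weight n)%R N).
    + f_equal. apply functional_extensionality. intros n. ring.
    + rewrite Rsym_scal. ring.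
  - rewrite Rsym_scal. ring.
Qed.

Lemma Rsq_weight_le K N : (0 <= K)%R -> (Rsq (fun m n => K * (weight m * weight n)) N <= K * 25)%R.
Proof.
  intros HK. rewrite Rsq_weight. apply Rmult_le_compat_l; auto.
  assert (H := Rsym_weight N). assert (H0 : (0 <= Rsym weight N)%R) by (apply Rsym_nonneg; intros; left; apply weight_pos). nra.
Qed.

Lemma sum_sq_converges f K : (0 <= K)%R -> (forall m n, (Cmod (f m n) <= K * (weight m * weight n))%R) ->
  exists l, Clim (sum_sq f) l.
Proof.
  intros HK Hf. set (g := fun m n => (K * (weight m * weight n))%R).
  assert (Hstep : forall N, (Cmod (sum_sq f (S N) - sum_sq f N) <= Rsq g (S N) - Rsq g N)%R) by (intros; now apply sum_sq_step_bound).
  destruct (ex_Cser (fun N => sum_sq f (S N) - sum_sq f N) (fun N => Rsq g (S N) - Rsq g N)%R) as [s Hs]; auto.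
  - split.
    + intros N. eapply Rle_trans; [apply Cmod_ge_0|apply Hstep].
    + exists (K * 25)%R. intros N.
      assert (E : Rsum (fun N => Rsq g (S N) - Rsq g N)%R N = (Rsq g N - Rsq g 0)%R) by (induction N; simpl; [ring|rewrite IHN; ring]).
      rewrite E. assert (H1 := Rsq_weight_le K N HK). fold g in H1.
      assert (0 <= Rsq g 0)%R; [|lra]. unfold Rsq, Rsym, g; simpl.
      assert (W := weight_pos 0). assert (0 <= K * (weight 0 * weight 0))%R by (apply Rmult_le_pos; nra). lra.
  - exists (sum_sq f 0 + s). apply (Clim_ext (fun N => sum_sq f 0 + Csum (fun N => sum_sq f (S N) - sum_sq f N) N)).
    + intros N. induction N; simpl; [ring|]. rewrite Cplus_assoc, IHN. ring.
    + apply Clim_plus; [apply Clim_const|exact Hs].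
Qed.

(** * The Weierstrass function *)

Lemma RtoC_IZR_plus a b : RtoC (IZR (a + b)) = IZR a + IZR b.
Proof. rewrite plus_IZR. apply RtoC_plus. Qed.

Section Lattice.
Variables w1 w2 : C.
Hypothesis Hind : R_independent w1 w2.
Notation L := (lattice_point w1 w2).
Notation inL := (in_lattice w1 w2).
Notation wp := (wp w1 w2).

Definition lat_det : R := (Re w1 * Im w2 - Im w1 * Re w2)%R.

Lemma C_eq_parts (a b : C) : Re a = Re b -> Im a = Im b -> a = b.
Proof. destruct a, b; simpl. now intros -> ->. Qed.

Lemma lat_det_neq : lat_det <> 0%R.
Proof.
  unfold lat_det. intros E.
  assert (H1 : Re w2 = 0%R /\ (- Re w1)%R = 0%R).
  { apply Hind. apply C_eq_parts; unfold Re, Im, Cmult, Cplus, RtoC in *; simpl; nra. }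
  assert (H2 : Im w2 = 0%R /\ (- Im w1)%R = 0%R).
  { apply Hind. apply C_eq_parts; unfold Re, Im, Cmult, Cplus, RtoC in *; simpl; nra. }
  destruct (Hind 1 1) as [H3 _]; [|lra].
  apply C_eq_parts; unfold Re, Im, Cmult, Cplus, RtoC in *; simpl; lra.
Qed.

(** Cramer's rule recovers [m] and [n] from the lattice point, with the nonzero determinant
    [lat_det]. *)
Lemma lattice_lower : exists c, (0 < c)%R /\ forall m n, (c * IZR (Z.abs m + Z.abs n) <= Cmod (L m n))%R.
Proof.
  assert (Hd := Rabs_pos_lt _ lat_det_neq).
  set (K := (2 * (Cmod w1 + Cmod w2) + 1)%R). assert (A1 := Cmod_ge_0 w1). assert (A2 := Cmod_ge_0 w2).
  exists (Rabs lat_det / K)%R. split; [apply Rdiv_lt_0_compat; unfold K; lra|].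
  intros m n. set (l := L m n).
  assert (Em : (IZR m * lat_det = Re l * Im w2 - Im l * Re w2)%R).
  { unfold l, lattice_point, lat_det, Re, Im, Cmult, Cplus, RtoC; simpl. ring. }
  assert (En : (IZR n * lat_det = Im l * Re w1 - Re l * Im w1)%R).
  { unfold l, lattice_point, lat_det, Re, Im, Cmult, Cplus, RtoC; simpl. ring. }
  assert (B : forall w, (Rabs (Re l * Im w - Im l * Re w) <= 2 * Cmod l * Cmod w)%R).
  { intros w. unfold Rminus. eapply Rle_trans; [apply Rabs_triang|]. rewrite Rabs_Ropp, !Rabs_mult.
    assert (R1 := re_le_Cmod l). assert (R2 := im_le_Cmod l). assert (R3 := re_le_Cmod w). assert (R4 := im_le_Cmod w).
    assert (P1 := Rabs_pos (Re l)). assert (P2 := Rabs_pos (Im l)). assert (P3 := Rabs_pos (Re w)). assert (P4 := Rabs_pos (Im w)).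
    assert (Rabs (Re l) * Rabs (Im w) <= Cmod l * Cmod w)%R by (apply Rmult_le_compat; auto).
    assert (Rabs (Im l) * Rabs (Re w) <= Cmod l * Cmod w)%R by (apply Rmult_le_compat; auto). lra. }
  assert (Hm : (IZR (Z.abs m) * Rabs lat_det <= 2 * Cmod l * Cmod w2)%R).
  { rewrite <- Rabs_Zabs, <- Rabs_mult, Em. apply B. }
  assert (Hn : (IZR (Z.abs n) * Rabs lat_det <= 2 * Cmod l * Cmod w1)%R).
  { rewrite <- Rabs_Zabs, <- Rabs_mult, En, Rabs_minus_sym. apply B. }
  rewrite plus_IZR. assert (Hl := Cmod_ge_0 l).
  apply Rmult_le_reg_r with K; [unfold K; lra|].
  replace (Rabs lat_det / K * (IZR (Z.abs m) + IZR (Z.abs n)) * K)%R with (IZR (Z.abs m) * Rabs lat_det + IZR (Z.abs n) * Rabs lat_det)%R by (field; unfold K; lra).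
  unfold K. nra.
Qed.

(** With [s = |m| + |n| >= 1] both [1 + |m|] and [1 + |n|] are at most [2 s], so the product of
    their powers of exponent 3/2 is at most [(2 s)^3]. The gain is a majorant that factors. *)
Lemma inv_cube_weight m n : (1 <= Z.abs m + Z.abs n)%Z ->
  (/ (IZR (Z.abs m + Z.abs n) * IZR (Z.abs m + Z.abs n) * IZR (Z.abs m + Z.abs n)) <= 8 * (weight m * weight n))%R.
Proof.
  intros H. set (x := (1 + IZR (Z.abs m))%R). set (y := (1 + IZR (Z.abs n))%R). set (s := IZR (Z.abs m + Z.abs n)).
  assert (Hs : (1 <= s)%R) by (apply IZR_le; lia).
  assert (Hx : (1 <= x)%R) by apply weight_base. assert (Hy : (1 <= y)%R) by apply weight_base.
  assert (Hxs : (x <= 2 * s)%R). { unfold x, s. assert (0 <= IZR (Z.abs n))%R by (apply IZR_le; lia). rewrite plus_IZR. unfold s in Hs. rewrite plus_IZR in Hs. lra. }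
  assert (Hys : (y <= 2 * s)%R). { unfold y, s. assert (0 <= IZR (Z.abs m))%R by (apply IZR_le; lia). rewrite plus_IZR. unfold s in Hs. rewrite plus_IZR in Hs. lra. }
  unfold weight. fold x y. rewrite <- Rinv_mult.
  assert (Hq : (sqrt x * sqrt y <= 2 * s)%R).
  { rewrite <- sqrt_mult by lra. rewrite <- (sqrt_square (2 * s)) by lra. apply sqrt_le_1_alt; nra. }
  assert (Sx : (0 < sqrt x)%R) by (apply sqrt_lt_R0; lra). assert (Sy : (0 < sqrt y)%R) by (apply sqrt_lt_R0; lra).
  apply Rmult_le_reg_r with (s * s * s * (x * sqrt x * (y * sqrt y)))%R; [repeat apply Rmult_lt_0_compat; lra|].
  replace (/ (s * s * s) * (s * s * s * (x * sqrt x * (y * sqrt y))))%R with ((x * y) * (sqrt x * sqrt y))%R by (field; lra).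
  replace (8 * / (x * sqrt x * (y * sqrt y)) * (s * s * s * (x * sqrt x * (y * sqrt y))))%R with ((2 * s * (2 * s)) * (2 * s))%R by (field; lra).
  apply Rmult_le_compat; try nra.
Qed.

(** The constant is [(5/2) * 4], from [Cmod (2 * l - z) <= 5 / 2 * Cmod l] and
    [Cmod (z - l) >= Cmod l / 2]. *)
Lemma term_estimate (z l : C) : (2 * Cmod z <= Cmod l)%R -> l <> 0 ->
  (Cmod (1 / (z - l) ^ 2 - 1 / l ^ 2) <= 10 * Cmod z * / (Cmod l * Cmod l * Cmod l))%R.
Proof.
  intros Hz Hl. assert (Hlp := Cmod_pos l Hl). assert (Hz0 := Cmod_ge_0 z).
  assert (Hd : (Cmod l / 2 <= Cmod (z - l))%R).
  { assert (T := Cmod_triangle (z - l) (- z)). rewrite Cmod_opp in T. replace (z - l + - z) with (- l) in T by ring. rewrite Cmod_opp in T. lra. }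
  assert (Hd0 : z - l <> 0) by (intros E; rewrite E, Cmod_0 in Hd; lra).
  replace (1 / (z - l) ^ 2 - 1 / l ^ 2) with (z * (2 * l - z) / ((z - l) ^ 2 * l ^ 2)) by (field; auto).
  assert (Hp : (z - l) ^ 2 * l ^ 2 <> 0) by (apply Cmult_neq_0; now apply Cpow_nz).
  rewrite Cmod_div, !Cmod_mult, !Cmod_pow by auto. set (a := Cmod l) in *. set (b := Cmod (z - l)) in *. set (x := Cmod z) in *.
  assert (Hn : (Cmod (2 * l - z) <= 5 / 2 * a)%R).
  { assert (T := Cmod_triangle (2 * l) (- z)). rewrite Cmod_opp, Cmod_mult, Cmod_R, Rabs_pos_eq in T by lra. fold a x in T.
    unfold Cminus. lra. }
  assert (Hn0 := Cmod_ge_0 (2 * l - z)).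
  assert (Hb : (0 < b)%R) by lra.
  apply Rmult_le_reg_r with (b ^ 2 * a ^ 2)%R; [apply Rmult_lt_0_compat; apply pow_lt; lra|].
  unfold Rdiv. rewrite (Rmult_assoc _ (/ (b ^ 2 * a ^ 2))), Rinv_l, Rmult_1_r by (apply Rgt_not_eq, Rmult_lt_0_compat; apply pow_lt; lra).
  replace (10 * x * / (a * a * a) * (b ^ 2 * a ^ 2))%R with (x * (10 * (b * b) / a))%R by (field; lra).
  apply Rmult_le_compat_l; auto. apply Rle_trans with (1 := Hn).
  apply Rmult_le_reg_r with a; auto. replace (10 * (b * b) / a * a)%R with (10 * (b * b))%R by (field; lra). nra.
Qed.

Lemma lattice_zero m n : (Z.eqb m 0 && Z.eqb n 0)%bool = true -> L m n = 0.
Proof.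
  intros H. apply andb_prop in H. destruct H as [->%Z.eqb_eq ->%Z.eqb_eq]. unfold lattice_point. ring.
Qed.

Lemma eqb_false_abs m n : (Z.eqb m 0 && Z.eqb n 0)%bool = false -> (1 <= Z.abs m + Z.abs n)%Z.
Proof. destruct (Z.eqb_spec m 0), (Z.eqb_spec n 0); simpl; intros; try lia; discriminate. Qed.

Lemma term_weight : exists c K, (0 < c)%R /\ (0 <= K)%R /\ forall z m n,
  (1 <= Z.abs m + Z.abs n)%Z -> (2 * Cmod z <= c * IZR (Z.abs m + Z.abs n))%R ->
  (Cmod (wp_term w1 w2 z m n) <= Cmod z * K * (weight m * weight n))%R /\
  (c / 2 * IZR (Z.abs m + Z.abs n) <= Cmod (z - L m n))%R.
Proof.
  destruct lattice_lower as (c & Hc & Hl). exists c, (80 / (c * c * c))%R.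
  split; [auto|split; [apply Rdiv_le_0_compat; [lra|repeat apply Rmult_lt_0_compat; lra]|]].
  intros z m n Hmn Hz. specialize (Hl m n). set (s := IZR (Z.abs m + Z.abs n)) in *.
  assert (Hs : (1 <= s)%R) by (apply IZR_le; lia).
  assert (Hlp : (0 < c * s)%R) by nra.
  assert (HL : L m n <> 0) by (intros E; rewrite E, Cmod_0 in Hl; lra).
  split.
  - unfold wp_term. destruct (Z.eqb m 0 && Z.eqb n 0)%bool eqn:E; [apply lattice_zero in E; easy|].
    eapply Rle_trans; [apply term_estimate; auto; lra|].
    assert (W := inv_cube_weight m n Hmn). fold s in W.
    apply Rle_trans with (10 * Cmod z * / (c * s * (c * s) * (c * s)))%R.
    + apply Rmult_le_compat_l; [assert (A1 := Cmod_ge_0 z); lra|]. apply Rinv_le_contravar; [assert (0 < c * s * (c * s))%R by nra; nra|].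
      apply Rmult_le_compat; [nra|lra|apply Rmult_le_compat; lra|exact Hl].
    + replace (10 * Cmod z * / (c * s * (c * s) * (c * s)))%R with (10 * Cmod z / (c * c * c) * / (s * s * s))%R by (field; lra).
      replace (Cmod z * (80 / (c * c * c)) * (weight m * weight n))%R with (10 * Cmod z / (c * c * c) * (8 * (weight m * weight n)))%R by (field; lra).
      apply Rmult_le_compat_l; auto. apply Rdiv_le_0_compat; [assert (A1 := Cmod_ge_0 z); lra|repeat apply Rmult_lt_0_compat; auto].
  - assert (T := Cmod_triangle (z - L m n) (- z)). rewrite Cmod_opp in T.
    replace (z - L m n + - z) with (- L m n) in T by ring. rewrite Cmod_opp in T. lra.
Qed.

Lemma box_bound (g : Z -> Z -> R) (R0 : Z) : exists B, (0 <= B)%R /\ forall m n, (Z.abs m + Z.abs n <= R0)%Z -> (g m n <= B)%R.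
Proof.
  assert (H : forall l : list (Z * Z), exists B, (0 <= B)%R /\ forall p, In p l -> (g (fst p) (snd p) <= B)%R).
  { induction l as [|p l [B [HB IH]]]; [exists 0%R; split; [lra|easy]|].
    exists (Rmax B (g (fst p) (snd p))). split; [eapply Rle_trans; [exact HB|apply Rmax_l]|].
    intros q [<-|Hq]; [apply Rmax_r|]. eapply Rle_trans; [now apply IH|apply Rmax_l]. }
  set (l := map (fun i => (Z.of_nat i - Z.abs R0)%Z) (seq 0 (Z.to_nat (2 * Z.abs R0 + 1)))).
  destruct (H (list_prod l l)) as (B & HB & HB'). exists B. split; auto. intros m n Hmn.
  apply (HB' (m, n)). apply in_prod_iff. unfold l. rewrite !in_map_iff. split.
  - exists (Z.to_nat (m + Z.abs R0)). split; [lia|]. apply in_seq. lia.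
  - exists (Z.to_nat (n + Z.abs R0)). split; [lia|]. apply in_seq. lia.
Qed.

(** The finitely many near terms are bounded by [box_bound], the others by [term_weight]. If [z] is
    a lattice point, one near term holds the default value of a division by zero, which is bounded
    like any other. *)
Lemma term_dominated z : exists K, (0 <= K)%R /\ forall m n, (Cmod (wp_term w1 w2 z m n) <= K * (weight m * weight n))%R.
Proof.
  destruct term_weight as (c & K & Hc & HK & H).
  destruct (archimed (2 * Cmod z / c)) as [Har _]. set (R0 := up (2 * Cmod z / c)) in *.
  destruct (box_bound (fun m n => Cmod (wp_term w1 w2 z m n) * / (weight m * weight n))%R R0) as (B & HB & HB').
  exists (B + Cmod z * K)%R. assert (A1 := Cmod_ge_0 z). split; [nra|]. intros m n.
  assert (W1 := weight_pos m). assert (W2 := weight_pos n). assert (W : (0 < weight m * weight n)%R) by nra.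
  destruct (Z_le_gt_dec (Z.abs m + Z.abs n) R0) as [Hle|Hgt].
  - specialize (HB' m n Hle). apply Rmult_le_compat_r with (r := (weight m * weight n)%R) in HB'; [|lra].
    rewrite Rmult_assoc, Rinv_l, Rmult_1_r in HB' by lra.
    assert (0 <= Cmod z * K * (weight m * weight n))%R by (apply Rmult_le_pos; nra). nra.
  - assert (Hs : (2 * Cmod z <= c * IZR (Z.abs m + Z.abs n))%R).
    { assert (IZR R0 <= IZR (Z.abs m + Z.abs n))%R by (apply IZR_le; lia).
      apply Rmult_le_reg_r with (/ c)%R; [now apply Rinv_0_lt_compat|].
      replace (c * IZR (Z.abs m + Z.abs n) * / c)%R with (IZR (Z.abs m + Z.abs n)) by (field; lra). unfold Rdiv in Har. lra. }
    assert (Hpos : (1 <= Z.abs m + Z.abs n)%Z).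
    { assert (0 <= 2 * Cmod z / c)%R by (apply Rdiv_le_0_compat; lra).
      assert (0 < IZR R0)%R by lra. apply lt_IZR in H1. lia. }
    destruct (H z m n Hpos Hs) as [H1 _]. assert (0 <= B * (weight m * weight n))%R by nra. nra.
Qed.

Lemma wp_Clim z : Clim (fun N => 1 / z ^ 2 + sum_sq (wp_term w1 w2 z) N) (wp z).
Proof.
  destruct (term_dominated z) as (K & HK & H). destruct (sum_sq_converges _ K HK H) as [l Hl].
  unfold Defs.wp. rewrite (C_lim_seq_unique (fun N => sum_sym (fun m => sum_sym (wp_term w1 w2 z m) N) N) l Hl).
  apply Clim_plus; [apply Clim_const|exact Hl].
Qed.

(** Opposite lattice points are not paired, hence an error of order 1 in [z] only; what is used
    later is the leading term of the pole. *)
Lemma wp_near_0 : exists d K, (0 < d)%R /\ (0 <= K)%R /\ forall z : C, z <> 0 -> (Cmod z < d)%R ->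
  ~ inL z /\ (Cmod (wp z - 1 / z ^ 2) <= K * Cmod z)%R.
Proof.
  destruct term_weight as (c & K & Hc & HK & H). exists (c / 2)%R, (K * 25)%R.
  split; [lra|split; [lra|]]. intros z Hz0 Hz.
  assert (A1 := Cmod_ge_0 z).
  assert (Hall : forall m n, (1 <= Z.abs m + Z.abs n)%Z -> (2 * Cmod z <= c * IZR (Z.abs m + Z.abs n))%R).
  { intros m n Hmn. assert (1 <= IZR (Z.abs m + Z.abs n))%R by (apply IZR_le; lia). nra. }
  split.
  - intros (m & n & E). destruct (Z.eqb m 0 && Z.eqb n 0)%bool eqn:Eb.
    + apply lattice_zero in Eb. now rewrite E, Eb in Hz0.
    + apply eqb_false_abs in Eb. destruct (H z m n Eb (Hall m n Eb)) as [_ H2].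
      rewrite <- E, Cmod_sub_0 in H2. assert (1 <= IZR (Z.abs m + Z.abs n))%R by (apply IZR_le; lia). nra.
  - assert (Hl : Clim (fun N => 1 / z ^ 2 + sum_sq (wp_term w1 w2 z) N + - (1 / z ^ 2)) (wp z + - (1 / z ^ 2))).
    { apply Clim_plus; [apply wp_Clim|apply Clim_const]. }
    refine (Clim_bound _ _ _ _ Hl). intros N.
    replace (1 / z ^ 2 + sum_sq (wp_term w1 w2 z) N + - (1 / z ^ 2)) with (sum_sq (wp_term w1 w2 z) N) by ring.
    eapply Rle_trans; [apply (sum_sq_bound _ (fun m n => (Cmod z * K) * (weight m * weight n))%R)|].
    + intros m n. destruct (Z.eqb m 0 && Z.eqb n 0)%bool eqn:Eb.
      * unfold wp_term. rewrite Eb, Cmod_0. assert (W1 := weight_pos m). assert (W2 := weight_pos n).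
        apply Rmult_le_pos; nra.
      * apply eqb_false_abs in Eb. now apply H, Hall.
    + eapply Rle_trans; [apply Rsq_weight_le; nra|]. lra.
Qed.

Lemma lattice_add m n m' n' : L (m + m') (n + n') = L m n + L m' n'.
Proof. unfold lattice_point. rewrite !RtoC_IZR_plus. ring. Qed.

Lemma inL_sub z m n : inL (z - L m n) -> inL z.
Proof.
  intros (m' & n' & E). exists (m' + m)%Z, (n' + n)%Z. rewrite lattice_add, <- E. ring.
Qed.
Lemma inL_add z m n : inL (z + L m n) -> inL z.
Proof.
  intros H. apply (inL_sub z (- m) (- n)).
  replace (L (- m) (- n)) with (- L m n) by (unfold lattice_point; rewrite !opp_IZR, !RtoC_opp; ring).
  now replace (z - - L m n) with (z + L m n) by ring.
Qed.

Lemma edge_bound z : exists K N0, (0 <= K)%R /\ (1 <= N0)%nat /\ forall (N : nat) m n, (N0 <= N)%nat ->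
  (Z.of_nat N <= Z.abs m + Z.abs n)%Z -> (Cmod (1 / (z - L m n) ^ 2) <= K / (INR N * INR N))%R.
Proof.
  destruct term_weight as (c & K' & Hc & _ & H).
  destruct (archimed (2 * Cmod z / c)) as [Har _]. set (R0 := up (2 * Cmod z / c)) in *.
  assert (A1 := Cmod_ge_0 z).
  exists (4 / (c * c))%R, (S (Z.to_nat R0)). split; [apply Rdiv_le_0_compat; nra|split; [lia|]].
  intros N m n HN Hmn.
  assert (HN1 : (1 <= INR N)%R) by (apply (le_INR 1); lia).
  assert (Hs : (INR N <= IZR (Z.abs m + Z.abs n))%R) by (rewrite INR_IZR_INZ; now apply IZR_le).
  assert (HR : (2 * Cmod z / c <= INR N)%R).
  { apply Rle_trans with (IZR R0); [lra|]. rewrite INR_IZR_INZ. apply IZR_le. lia. }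
  assert (Hz : (2 * Cmod z <= c * IZR (Z.abs m + Z.abs n))%R).
  { apply Rmult_le_reg_r with (/ c)%R; [now apply Rinv_0_lt_compat|].
    replace (c * IZR (Z.abs m + Z.abs n) * / c)%R with (IZR (Z.abs m + Z.abs n)) by (field; lra). unfold Rdiv in HR. lra. }
  destruct (H z m n ltac:(lia) Hz) as [_ H2].
  assert (Hb : (c / 2 * INR N <= Cmod (z - L m n))%R) by nra.
  assert (Hp : (0 < c / 2 * INR N)%R) by nra.
  assert (Hne : z - L m n <> 0) by (intros E; rewrite E, Cmod_0 in Hb; lra).
  rewrite Cmod_div, Cmod_1, Cmod_pow by now apply Cpow_nz.
  replace (4 / (c * c) / (INR N * INR N))%R with (1 / (c / 2 * INR N) ^ 2)%R by (field; lra).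
  unfold Rdiv. apply Rmult_le_compat_l; [lra|]. apply Rinv_le_contravar; [now apply pow_lt|].
  apply pow_incr. lra.
Qed.

Lemma edge_to_0 K N0 (u : nat -> C) : (0 <= K)%R -> (1 <= N0)%nat ->
  (forall N, (N0 <= N)%nat -> (Cmod (u N) <= INR (2 * N + 1) * (2 * (K / (INR N * INR N))))%R) -> Clim u 0.
Proof.
  intros HK HN0 Hu eps He.
  destruct (archimed (6 * K / eps)) as [Har _]. set (M := up (6 * K / eps)) in *.
  exists (N0 + Z.to_nat M)%nat. intros n Hn.
  replace (u n - 0) with (u n) by ring. eapply Rle_lt_trans; [apply Hu; lia|].
  assert (Hn1 : (1 <= INR n)%R) by (apply (le_INR 1); lia).
  assert (HnM : (6 * K / eps < INR n)%R).
  { apply Rlt_le_trans with (IZR M); [lra|]. rewrite INR_IZR_INZ. apply IZR_le. lia. }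
  rewrite plus_INR, mult_INR. simpl (INR 2). simpl (INR 1).
  assert (Hlt : (6 * K < eps * INR n)%R).
  { apply Rmult_lt_compat_l with (r := eps) in HnM; auto. replace (eps * (6 * K / eps))%R with (6 * K)%R in HnM by (field; lra). lra. }
  apply Rle_lt_trans with (6 * K / INR n)%R.
  - apply Rmult_le_reg_r with (INR n * INR n)%R; [nra|].
    replace (((1 + 1) * INR n + 1) * (2 * (K / (INR n * INR n))) * (INR n * INR n))%R with ((2 * INR n + 1) * (2 * K))%R by (field; lra).
    replace (6 * K / INR n * (INR n * INR n))%R with (6 * K * INR n)%R by (field; lra). nra.
  - apply Rmult_lt_reg_r with (INR n); [lra|]. replace (6 * K / INR n * INR n)%R with (6 * K)%R by (field; lra). lra.
Qed.

Lemma sum_sym_delta c N : sum_sym (fun m => if Z.eqb m 0 then c else 0) N = c.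
Proof.
  induction N; [now rewrite sum_sym_0|]. rewrite sum_sym_S, IHN.
  destruct (Z.eqb_spec (Z.of_nat (S N)) 0), (Z.eqb_spec (- Z.of_nat (S N)) 0); try lia. ring.
Qed.

(* With the principal term, the partial sum is [sum 1 / (z - L)^2] minus a quantity independent of [z]. *)
Definition full_term (z : C) (m n : Z) : C :=
  1 / (z - L m n) ^ 2 - (if (Z.eqb m 0 && Z.eqb n 0)%bool then 0 else 1 / L m n ^ 2).

Lemma wp_partial_full z N : 1 / z ^ 2 + sum_sq (wp_term w1 w2 z) N = sum_sq (full_term z) N.
Proof.
  assert (E : sum_sq (fun m n => if Z.eqb m 0 then (if Z.eqb n 0 then 1 / z ^ 2 else 0) else 0) N = 1 / z ^ 2).
  { unfold sum_sq. transitivity (sum_sym (fun m => if Z.eqb m 0 then 1 / z ^ 2 else 0) N); [|apply sum_sym_delta].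
    apply sum_sym_ext. intros m. destruct (Z.eqb m 0); [apply sum_sym_delta|].
    transitivity (sum_sym (fun n => if Z.eqb n 0 then 0 else 0) N); [|apply sum_sym_delta].
    apply sum_sym_ext. intros n. destruct (Z.eqb n 0); auto. }
  transitivity (sum_sq (fun m n => if Z.eqb m 0 then (if Z.eqb n 0 then 1 / z ^ 2 else 0) else 0) N
    + sum_sq (wp_term w1 w2 z) N); [now rewrite E|].
  unfold sum_sq. rewrite <- sum_sym_plus. apply sum_sym_ext. intros m.
  rewrite <- sum_sym_plus. apply sum_sym_ext. intros n. unfold wp_term, full_term.
  destruct (Z.eqb_spec m 0) as [->|]; [destruct (Z.eqb_spec n 0) as [->|]|]; simpl; try ring.
  replace (L 0 0) with (RtoC 0) by (unfold lattice_point; ring). replace (z - 0) with z by ring. ring.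
Qed.

Lemma wp_periodic_aux z z' (e : nat -> C) :
  (forall N, sum_sq (full_term z') N - sum_sq (full_term z) N = e N) -> Clim e 0 -> wp z' = wp z.
Proof.
  intros He H.
  assert (Hz := wp_Clim z). assert (Hz' := wp_Clim z').
  apply (Clim_unique (fun N => 1 / z' ^ 2 + sum_sq (wp_term w1 w2 z') N)); auto.
  replace (wp z) with (wp z + 0) by ring.
  apply (Clim_ext (fun N => (1 / z ^ 2 + sum_sq (wp_term w1 w2 z) N) + e N)).
  - intros N. rewrite !wp_partial_full, <- He. ring.
  - now apply Clim_plus.
Qed.

(** Shifting by a period moves the summation square by one row. The difference consists of two rows
    of [2 N + 1] terms, each of order [1 / N^2]. *)
Lemma wp_periodic_1 z : wp (z + w1) = wp z.
Proof.
  set (h m N := sum_sym (fun n => 1 / (z - L m n) ^ 2) N).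
  destruct (edge_bound z) as (K & N0 & HK & HN0 & Hb).
  apply (wp_periodic_aux z (z + w1) (fun N => h (- Z.of_nat N - 1)%Z N - h (Z.of_nat N) N)).
  - intros N. rewrite <- (sum_sym_telescope (fun m => h m N)). unfold sum_sq. rewrite <- sum_sym_minus.
    apply sum_sym_ext. intros m. unfold h. rewrite <- !sum_sym_minus. apply sum_sym_ext. intros n.
    unfold full_term. replace (z + w1 - L m n) with (z - L (m - 1) n).
    + ring.
    + unfold lattice_point. rewrite minus_IZR, RtoC_minus. ring.
  - apply (edge_to_0 K N0); auto. intros N HN.
    apply Rle_trans with (Rsym (fun _ => K / (INR N * INR N)) N + Rsym (fun _ => K / (INR N * INR N)) N)%R.
    + unfold Cminus. eapply Rle_trans; [apply Cmod_triangle|]. rewrite Cmod_opp.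
      apply Rplus_le_compat; apply sum_sym_bound; intros n _; apply Hb; auto; lia.
    + rewrite Rsym_const. lra.
Qed.

Lemma wp_periodic_2 z : wp (z + w2) = wp z.
Proof.
  destruct (edge_bound z) as (K & N0 & HK & HN0 & Hb).
  apply (wp_periodic_aux z (z + w2) (fun N => sum_sym (fun m => 1 / (z - L m (- Z.of_nat N - 1)%Z) ^ 2 - 1 / (z - L m (Z.of_nat N)) ^ 2) N)).
  - intros N. unfold sum_sq. rewrite <- sum_sym_minus.
    apply sum_sym_ext. intros m. rewrite <- (sum_sym_telescope (fun n => 1 / (z - L m n) ^ 2)).
    rewrite <- !sum_sym_minus. apply sum_sym_ext. intros n.
    unfold full_term. replace (z + w2 - L m n) with (z - L m (n - 1)).
    + ring.
    + unfold lattice_point. rewrite minus_IZR, RtoC_minus. ring.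
  - apply (edge_to_0 K N0); auto. intros N HN.
    apply Rle_trans with (Rsym (fun _ => 2 * (K / (INR N * INR N)))%R N); [|rewrite Rsym_const; lra].
    apply sum_sym_bound. intros m _. unfold Cminus. eapply Rle_trans; [apply Cmod_triangle|]. rewrite Cmod_opp.
    assert (B1 := Hb N m (- Z.of_nat N - 1)%Z HN ltac:(lia)). assert (B2 := Hb N m (Z.of_nat N) HN ltac:(lia)).
    eapply Rle_trans; [apply Rplus_le_compat; [exact B1|exact B2]|]. right; ring.
Qed.

Lemma wp_periodic z m n : wp (z + L m n) = wp z.
Proof.
  assert (H1 : forall (k : nat) z, wp (z + INR k * w1) = wp z).
  { induction k; intros x; [f_equal; simpl; ring|]. rewrite <- (IHk x), <- (wp_periodic_1 (x + INR k * w1)).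
    f_equal. rewrite S_INR, RtoC_plus. ring. }
  assert (H2 : forall (k : nat) z, wp (z + INR k * w2) = wp z).
  { induction k; intros x; [f_equal; simpl; ring|]. rewrite <- (IHk x), <- (wp_periodic_2 (x + INR k * w2)).
    f_equal. rewrite S_INR, RtoC_plus. ring. }
  assert (E1 : forall (w : C), (forall (k : nat) z, wp (z + INR k * w) = wp z) -> forall k z, wp (z + IZR k * w) = wp z).
  { intros w H k x. destruct (Z_le_gt_dec 0 k).
    - rewrite <- (Z2Nat.id k) by lia. rewrite <- INR_IZR_INZ. apply H.
    - rewrite <- (H (Z.to_nat (- k)) (x + IZR k * w)). f_equal.
      rewrite INR_IZR_INZ, Z2Nat.id, opp_IZR, RtoC_opp by lia. ring. }
  unfold lattice_point. rewrite Cplus_assoc. rewrite (E1 w2 H2), (E1 w1 H1). reflexivity.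
Qed.

Lemma wp_pole z B : inL z -> exists d, (0 < d)%R /\ forall w, w <> z -> (Cmod (w - z) < d)%R -> (B < Cmod (wp w))%R.
Proof.
  intros (m & n & ->). destruct wp_near_0 as (d & K & Hd & HK & H).
  set (Bp := (Rabs B + K + 1)%R). assert (HBp : (1 <= Bp)%R) by (unfold Bp; assert (A1 := Rabs_pos B); lra).
  exists (Rmin (Rmin d 1) (/ Bp)). assert (HiB := Rinv_0_lt_compat Bp ltac:(lra)).
  split; [repeat apply Rmin_glb_lt; lra|]. intros w Hw Hwd.
  assert (W1 := Rlt_le_trans _ _ _ Hwd (Rmin_l _ _)). assert (W2 := Rlt_le_trans _ _ _ Hwd (Rmin_r _ _)).
  assert (W3 := Rlt_le_trans _ _ _ W1 (Rmin_l _ _)). assert (W4 := Rlt_le_trans _ _ _ W1 (Rmin_r _ _)).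
  set (x := w - L m n) in *. assert (Hx : x <> 0) by now apply C_sub_neq.
  replace w with (x + L m n) by (unfold x; ring). rewrite wp_periodic.
  destruct (H x Hx W3) as [_ Hwp]. assert (Hxp := Cmod_pos x Hx). set (s := Cmod x) in *.
  assert (T := Cmod_triangle (wp x) (- (wp x - 1 / x ^ 2))). rewrite Cmod_opp in T.
  replace (wp x + - (wp x - 1 / x ^ 2)) with (1 / x ^ 2) in T by ring.
  rewrite Cmod_div, Cmod_1, Cmod_pow in T by now apply Cpow_nz. fold s in T.
  assert (Hs2 : (Bp < 1 / s ^ 2)%R).
  { apply Rmult_lt_reg_r with (s ^ 2)%R; [now apply pow_lt|]. replace (1 / s ^ 2 * s ^ 2)%R with 1%R by (field; lra).
    assert (Bp * s < 1)%R. { apply Rmult_lt_reg_l with (/ Bp)%R; auto. rewrite <- Rmult_assoc, Rinv_l by lra. lra. }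
    simpl. nra. }
  assert (Rabs B < Bp - K)%R by (unfold Bp; lra). assert (A2 := Rle_abs B). nra.
Qed.

End Lattice.

(** * Square roots of continuous functions that are derivatives *)

Lemma near_pm1 (x : C) : (Cmod (x * x - 1) < / 4)%R -> (Cmod (x - 1) < / 2)%R \/ (Cmod (x + 1) < / 2)%R.
Proof.
  intros H. replace (x * x - 1) with ((x - 1) * (x + 1)) in H by ring. rewrite Cmod_mult in H.
  destruct (Rlt_le_dec (Cmod (x - 1)) (/ 2)); auto. right.
  apply Rnot_le_lt. intros Hle. assert (H1 := Cmod_ge_0 (x + 1)). nra.
Qed.

Lemma Re_near_1 x : (Cmod (x - 1) < / 2)%R -> (/ 2 < Re x)%R.
Proof.
  intros H. assert (T := re_le_Cmod (x - 1)). rewrite Re_minus in T. change (Re 1) with 1%R in T.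
  assert (T2 := Rle_abs (- (Re x - 1))). rewrite Rabs_Ropp in T2. lra.
Qed.
Lemma Re_near_m1 x : (Cmod (x + 1) < / 2)%R -> (Re x < - / 2)%R.
Proof.
  intros H. assert (T := re_le_Cmod (x + 1)). change (Re (x + 1)) with (Re x + 1)%R in T.
  assert (T2 := Rle_abs (Re x + 1)). lra.
Qed.

(* A complex derivative has the Darboux property on segments, so it cannot jump between the two
   square roots of a continuous function. *)
Lemma derivative_sqrt_cont (f d : C -> C) v0 r : (0 < r)%R ->
  (forall v, (Cmod (v - v0) < r)%R -> Cdiff f v (d v)) ->
  Ccont (fun v => d v * d v) v0 -> d v0 <> 0 -> Ccont d v0.
Proof.
  intros Hr Hf Hc Hd0. set (d0 := d v0) in *. assert (Hp := Cmod_pos d0 Hd0). set (a := Cmod d0) in *.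
  intros eps He.
  destruct (Hc (Rmin (a * a / 4) (eps * a))) as (e & Hepos & Hee).
  { apply Rmin_glb_lt; [nra|]. now apply Rmult_lt_0_compat. }
  exists (Rmin r e). split; [now apply Rmin_glb_lt|]. intros v Hv.
  assert (X : forall w, (Cmod (w - v0) < Rmin r e)%R ->
     (Cmod (d w / d0 * (d w / d0) - 1) < / 4)%R /\ (Cmod (d w / d0 * (d w / d0) - 1) < eps / a)%R).
  { intros w Hw. specialize (Hee w (Rlt_le_trans _ _ _ Hw (Rmin_r _ _))).
    replace (d w / d0 * (d w / d0) - 1) with ((d w * d w - d0 * d0) / (d0 * d0)) by (field; auto).
    rewrite Cmod_div by (now apply Cmult_neq_0). rewrite (Cmod_mult d0 d0). fold a.
    assert (H1 := Rlt_le_trans _ _ _ Hee (Rmin_l _ _)). assert (H2 := Rlt_le_trans _ _ _ Hee (Rmin_r _ _)).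
    fold d0 in H1, H2.
    split; apply Rmult_lt_reg_r with (a * a)%R; try nra; unfold Rdiv at 1; rewrite Rmult_assoc, Rinv_l by nra.
    - lra.
    - replace (eps / a * (a * a))%R with (eps * a)%R by (field; lra). lra. }
  destruct (classic (v = v0)) as [->|Hne]; [rewrite Cmod_sub_0; auto|].
  assert (Hvv : v - v0 <> 0) by now apply C_sub_neq.
  assert (Hseg : forall s, (0 <= s <= 1)%R -> (Cmod (seg v0 v s - v0) < Rmin r e)%R).
  { intros s Hs. apply seg_convex; auto. rewrite Cmod_sub_0. now apply Rmin_glb_lt. }
  assert (Hk : forall w, / (d0 * (v - v0)) * (d w * (v - v0)) = d w / d0) by (intros; field; auto).
  destruct (X v Hv) as [X1 X2]. destruct (near_pm1 _ X1) as [Hv1|Hv1].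
  - assert (T := Cmod_triangle (d v / d0 + 1) (- (d v / d0 - 1))). rewrite Cmod_opp in T.
    replace (d v / d0 + 1 + - (d v / d0 - 1)) with (RtoC 2) in T by ring. rewrite Cmod_R, Rabs_pos_eq in T by lra.
    replace (d v / d0 * (d v / d0) - 1) with ((d v / d0 - 1) * (d v / d0 + 1)) in X2 by ring. rewrite Cmod_mult in X2.
    fold d0. replace (d v - d0) with (d0 * (d v / d0 - 1)) by (field; auto). rewrite Cmod_mult. fold a.
    assert (H0 := Cmod_ge_0 (d v / d0 - 1)).
    assert (Cmod (d v / d0 - 1) < eps / a)%R by nra.
    apply Rmult_lt_compat_l with (r := a) in H; auto. replace (a * (eps / a))%R with eps in H by (field; lra). lra.
  - exfalso.
    destruct (darboux (fun s => Re (/ (d0 * (v - v0)) * f (seg v0 v s))) (fun s => Re (d (seg v0 v s) / d0)) 0 1) as (c & Hc1 & Hc2).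
    + lra.
    + intros s Hs. rewrite <- Hk. apply Cdiff_seg, Hf. eapply Rlt_le_trans; [apply Hseg; lra|apply Rmin_l].
    + rewrite seg_0. fold d0. replace (d0 / d0) with (RtoC 1) by (field; auto). simpl. lra.
    + rewrite seg_1. assert (Y := Re_near_m1 _ Hv1). lra.
    + destruct (X _ (Hseg c ltac:(lra))) as [Y1 _]. destruct (near_pm1 _ Y1) as [Y2|Y2];
      [apply Re_near_1 in Y2|apply Re_near_m1 in Y2]; lra.
Qed.

Lemma Ccont_div (f g : C -> C) z : g z <> 0 -> Ccont f z -> Ccont g z -> Ccont (fun w => f w / g w) z.
Proof.
  intros Hn Hf Hg. unfold Cdiv. apply Ccont_mult; auto. apply (Ccont_comp (fun w => / w) g); auto. now apply Ccont_inv.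
Qed.

Lemma Ccont_neq (f : C -> C) z : Ccont f z -> f z <> 0 -> exists r, (0 < r)%R /\ forall w, (Cmod (w - z) < r)%R -> f w <> 0.
Proof.
  intros H Hn. destruct (H _ (Cmod_pos _ Hn)) as (r & Hr & H'). exists r. split; auto. intros w Hw E.
  specialize (H' w Hw). rewrite E, Cmod_sub_sym in H'. replace (f z - 0) with (f z) in H' by ring. lra.
Qed.

(** The slope of [d] is the slope of its square divided by [d v + d v0], which stays away from 0
    near [v0] by continuity. *)
Lemma Cdiff_sqrt (d : C -> C) v0 l : Ccont d v0 -> d v0 <> 0 ->
  Cdiff (fun v => d v * d v) v0 l -> Cdiff d v0 (l / (2 * d v0)).
Proof.
  intros Hc Hn (phi & Hphi & <- & E).
  assert (H2 : d v0 + d v0 <> 0).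
  { replace (d v0 + d v0) with (2 * d v0) by ring. apply Cmult_neq_0; auto. apply C_RtoC_neq; lra. }
  assert (Hs : Ccont (fun v => d v + d v0) v0) by (apply Ccont_plus; auto using Ccont_const).
  destruct (Ccont_neq _ _ Hs H2) as (r & Hr & Hr').
  apply (Cdiff_ext_loc (fun v => d v0 + phi v / (d v + d v0) * (v - v0)) _ _ _ r); auto.
  - intros v Hv. specialize (Hr' v Hv). apply (C_eq_cancel (d v + d v0)); auto.
    transitivity (d v0 * d v0 + phi v * (v - v0) + d v * d v0); [field; auto|]. rewrite <- E. ring.
  - exists (fun v => phi v / (d v + d v0)). split; [now apply Ccont_div|split].
    + replace (d v0 + d v0) with (2 * d v0) by ring. reflexivity.
    + intros w. ring.
Qed.

Lemma iterate_to_zero x M : (0 <= x)%R -> (forall n, (x <= M * (/ 2) ^ n)%R) -> x = 0%R.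
Proof.
  intros Hx H. apply Rle_antisym; auto. apply Rnot_lt_le. intros Hlt.
  assert (HM : (0 < M)%R). { specialize (H O). simpl in H. lra. }
  destruct (pow_lt_1_zero (/ 2)%R ltac:(rewrite Rabs_pos_eq; lra) (x / M)%R ltac:(now apply Rdiv_lt_0_compat)) as [N HN].
  specialize (HN N (le_n _)). rewrite Rabs_pos_eq in HN by (apply pow_le; lra). specialize (H N).
  apply Rmult_lt_compat_l with (r := M) in HN; auto. replace (M * (x / M))%R with x in HN by (field; lra). lra.
Qed.

(* Picard iteration. *)
Lemma linear_system_zero (f1 f2 df1 df2 : C -> C) t0 r K M : (0 < r)%R -> (0 <= K)%R -> (0 <= M)%R -> (K * r <= / 2)%R ->
  f1 t0 = 0 -> f2 t0 = 0 ->
  (forall t, (Cmod (t - t0) < r)%R -> Cdiff f1 t (df1 t) /\ Cdiff f2 t (df2 t) /\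
     (Cmod (df1 t) <= K * Cmod (f2 t))%R /\ (Cmod (df2 t) <= K * Cmod (f1 t))%R /\
     (Cmod (f1 t) <= M)%R /\ (Cmod (f2 t) <= M)%R) ->
  forall t, (Cmod (t - t0) < r)%R -> f1 t = 0 /\ f2 t = 0.
Proof.
  intros Hr HK HM HKr E1 E2 H.
  assert (B : forall n t, (Cmod (t - t0) < r)%R -> (Cmod (f1 t) <= M * (/ 2) ^ n)%R /\ (Cmod (f2 t) <= M * (/ 2) ^ n)%R).
  { induction n as [|n IH]; intros t Ht.
    - simpl. rewrite Rmult_1_r. split; apply H; auto.
    - assert (Hseg : forall s, (0 <= s <= 1)%R -> (Cmod (seg t0 t s - t0) < r)%R).
      { intros s Hs. apply seg_convex; auto. rewrite Cmod_sub_0; auto. }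
      assert (Hpw : (0 <= (/ 2) ^ n)%R) by (apply pow_le; lra).
      assert (HK' : (0 <= K * (M * (/ 2) ^ n))%R) by (repeat apply Rmult_le_pos; auto).
      assert (Fin : (K * (M * (/ 2) ^ n) * Cmod (t - t0) <= M * (/ 2) ^ S n)%R).
      { simpl. assert (A1 := Cmod_ge_0 (t - t0)). assert (K * Cmod (t - t0) <= / 2)%R by nra.
        replace (K * (M * (/ 2) ^ n) * Cmod (t - t0))%R with ((K * Cmod (t - t0)) * (M * (/ 2) ^ n))%R by ring.
        replace (M * (/ 2 * (/ 2) ^ n))%R with (/ 2 * (M * (/ 2) ^ n))%R by ring.
        apply Rmult_le_compat_r; auto. now apply Rmult_le_pos. }
      split; (eapply Rle_trans; [|exact Fin]).
      + assert (T := mean_value f1 df1 t0 t _ HK'). rewrite E1 in T. replace (f1 t - 0) with (f1 t) in T by ring.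
        apply T. intros s Hs. destruct (H _ (Hseg s Hs)) as (D1 & D2 & B1 & B2 & _). split; auto.
        eapply Rle_trans; [exact B1|]. apply Rmult_le_compat_l; auto. apply IH, Hseg, Hs.
      + assert (T := mean_value f2 df2 t0 t _ HK'). rewrite E2 in T. replace (f2 t - 0) with (f2 t) in T by ring.
        apply T. intros s Hs. destruct (H _ (Hseg s Hs)) as (D1 & D2 & B1 & B2 & _). split; auto.
        eapply Rle_trans; [exact B2|]. apply Rmult_le_compat_l; auto. apply IH, Hseg, Hs. }
  intros t Ht. split; apply Cmod_eq_0, (iterate_to_zero _ M); auto using Cmod_ge_0; intros n; now apply B.
Qed.

(** * Solutions of the Weierstrass equation *)

Section Weierstrass.
Variables w1 w2 : C.
Hypothesis Hw : wp_invariants w1 w2 0 4.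
Notation inL := (in_lattice w1 w2).
Notation wp := (wp w1 w2).

(** The hypothesis yields at each point some derivative with a prescribed square. Its continuity and
    differentiability have to be proved. *)
Definition wpd (v : C) : C := C_derive wp v.
Let Hind : R_independent w1 w2 := proj1 Hw.

Lemma wp_diff v : ~ inL v -> Cdiff wp v (wpd v) /\ wpd v * wpd v = 4 * wp v ^ 3 - 4.
Proof.
  intros Hv. destruct (proj2 Hw v Hv) as (d & Hd & E). unfold wpd. rewrite (is_C_derive_unique _ _ _ Hd).
  split; [now apply Cdiff_is_derive|]. transitivity (d ^ 2); [ring|]. rewrite E. ring.
Qed.

Lemma inL_open v : ~ inL v -> exists r, (0 < r)%R /\ forall w, (Cmod (w - v) < r)%R -> ~ inL w.
Proof.
  intros Hv. destruct (wp_near_0 w1 w2 Hind) as (d & K & Hd & _ & H).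
  destruct (classic (exists l, inL l /\ (Cmod (l - v) < d / 2)%R)) as [(l & Hl & Hld)|Hne].
  - assert (Hlv : l <> v) by (intros ->; auto).
    exists (Rmin (d / 2) (Cmod (l - v))). split; [apply Rmin_glb_lt; [lra|]; now apply Cmod_pos, C_sub_neq|].
    intros w Hwv Hin. assert (W1 := Rlt_le_trans _ _ _ Hwv (Rmin_l _ _)). assert (W2 := Rlt_le_trans _ _ _ Hwv (Rmin_r _ _)).
    destruct (classic (w = l)) as [->|Hwl]; [lra|].
    destruct Hl as (m & n & ->). destruct (H (w - lattice_point w1 w2 m n)) as [Hn _].
    + now apply C_sub_neq.
    + replace (w - lattice_point w1 w2 m n) with ((w - v) + - (lattice_point w1 w2 m n - v)) by ring.
      eapply Rle_lt_trans; [apply Cmod_triangle|]. rewrite Cmod_opp. lra.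
    + apply Hn, (inL_add w1 w2 _ m n). now replace (w - lattice_point w1 w2 m n + lattice_point w1 w2 m n) with w by ring.
  - exists (d / 2)%R. split; [lra|]. intros w Hwv Hin. apply Hne. now exists w.
Qed.

Lemma wp_cont v : ~ inL v -> Ccont wp v.
Proof. intros Hv. eapply Cdiff_cont, wp_diff, Hv. Qed.

Lemma wpd_sq_diff v : ~ inL v -> Cdiff (fun w => wpd w * wpd w) v (12 * wp v ^ 2 * wpd v).
Proof.
  intros Hv. destruct (inL_open v Hv) as (r & Hr & Hn).
  apply (Cdiff_ext_loc (fun w => 4 * wp w ^ 3 - 4) _ _ _ r); auto.
  - intros w Hwv. symmetry. apply wp_diff. auto.
  - eapply Cdiff_eq; [|apply Cdiff_minus; [apply Cdiff_scal, (Cdiff_pow wp v (wpd v) 2), wp_diff, Hv|apply Cdiff_const]].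
    rewrite INR_IZR_INZ. simpl Z.of_nat. ring.
Qed.

(** At a zero of [wpd] the continuity of its square suffices; elsewhere [derivative_sqrt_cont]
    excludes a jump of sign. *)
Lemma wpd_cont v : ~ inL v -> Ccont wpd v.
Proof.
  intros Hv. assert (Hc := Cdiff_cont _ _ _ (wpd_sq_diff v Hv)).
  destruct (classic (wpd v = 0)) as [E|E].
  - intros eps He. destruct (Hc (eps * eps)%R ltac:(nra)) as (r & Hr & H). exists r. split; auto. intros w Hwv.
    specialize (H w Hwv). rewrite E in *. replace (wpd w * wpd w - 0 * 0) with (wpd w * wpd w) in H by ring.
    replace (wpd w - 0) with (wpd w) by ring. rewrite Cmod_mult in H. assert (A1 := Cmod_ge_0 (wpd w)). nra.
  - destruct (inL_open v Hv) as (r & Hr & Hn).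
    apply (derivative_sqrt_cont wp wpd v r); auto. intros w Hwv. apply wp_diff. auto.
Qed.

(** Differentiating the square leaves a division by [2 * wpd v], hence the restriction to nonzero
    values. This is the origin of the condition on [W] in [matches_open]. *)
Lemma wpd_diff v : ~ inL v -> wpd v <> 0 -> Cdiff wpd v (6 * wp v ^ 2).
Proof.
  intros Hv Hd. apply (Cdiff_eq _ _ (12 * wp v ^ 2 * wpd v / (2 * wpd v))); [field; auto|].
  apply Cdiff_sqrt; auto using wpd_cont, wpd_sq_diff.
Qed.

Section Propagation.
Variable Dom : C -> Prop.
Variables v dv Y W : C -> C.
Hypothesis Dom_open : forall t, Dom t -> exists r, (0 < r)%R /\ forall s, (Cmod (s - t) < r)%R -> Dom s.
Hypothesis Hv : forall t, Dom t -> Cdiff v t (dv t).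
Hypothesis Hdv : forall t, Dom t -> Ccont dv t.
Hypothesis HY : forall t, Dom t -> Cdiff Y t (W t * dv t).
Hypothesis HW : forall t, Dom t -> Cdiff W t (6 * Y t ^ 2 * dv t).

(** [wp] and [wpd] composed with [v], and the pair [Y], [W], are two solutions of [y' = w v'],
    [w' = 6 y^2 v']. Equality of both components is the initial condition of a second order
    equation. *)
Definition matches (t : C) : Prop := ~ inL (v t) /\ wp (v t) = Y t /\ wpd (v t) = W t.

Lemma matches_open t0 : Dom t0 -> matches t0 -> W t0 <> 0 ->
  exists r, (0 < r)%R /\ forall t, (Cmod (t - t0) < r)%R -> matches t.
Proof.
  intros Ht0 (Hn & E1 & E2) HW0.
  assert (Hvc : Ccont v t0) by (eapply Cdiff_cont, Hv, Ht0).
  assert (Hd0 : wpd (v t0) <> 0) by now rewrite E2.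
  destruct (Dom_open t0 Ht0) as (r1 & Hr1 & D1).
  destruct (inL_open _ Hn) as (e2 & He2 & D2). destruct (Hvc e2 He2) as (r2 & Hr2 & D2').
  destruct (Ccont_neq wpd _ (wpd_cont _ Hn) Hd0) as (e3 & He3 & D3). destruct (Hvc e3 He3) as (r3 & Hr3 & D3').
  assert (Hwv : Ccont (fun t => wp (v t)) t0) by (apply Ccont_comp; auto using wp_cont).
  assert (HYc : Ccont Y t0) by (eapply Cdiff_cont, HY, Ht0).
  assert (HWc : Ccont W t0) by (eapply Cdiff_cont, HW, Ht0).
  assert (Hdc : Ccont (fun t => wpd (v t)) t0) by (apply Ccont_comp; auto using wpd_cont).
  destruct (Hdv t0 Ht0 1%R ltac:(lra)) as (r4 & Hr4 & D4).
  destruct (Hwv 1%R ltac:(lra)) as (r5 & Hr5 & D5). destruct (HYc 1%R ltac:(lra)) as (r6 & Hr6 & D6).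
  destruct (HWc 1%R ltac:(lra)) as (r7 & Hr7 & D7). destruct (Hdc 1%R ltac:(lra)) as (r8 & Hr8 & D8).
  set (K1 := (Cmod (dv t0) + 1)%R). set (K2 := (Cmod (Y t0) + 1)%R).
  assert (A1 := Cmod_ge_0 (dv t0)). assert (A2 := Cmod_ge_0 (Y t0)).
  (* [K1] bounds [dv] and [K2] bounds [Y] and [wp] along [v]. The differences satisfy [f1' = f2 dv]
     and [f2' = 6 (wp + Y) f1 dv], whose coefficients are at most [K1] and [12 K1 K2]. *)
  set (K := (K1 * (1 + 12 * K2))%R). assert (HK : (0 < K)%R) by (unfold K, K1, K2; nra).
  set (r := Rmin (/ (2 * K)) (Rmin (Rmin (Rmin r1 r2) (Rmin r3 r4)) (Rmin (Rmin r5 r6) (Rmin r7 r8)))).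
  assert (Hr : (0 < r)%R) by (unfold r; repeat apply Rmin_glb_lt; auto; apply Rinv_0_lt_compat; lra).
  assert (L0 : (r <= / (2 * K))%R) by apply Rmin_l.
  assert (Lr : (r <= Rmin (Rmin (Rmin r1 r2) (Rmin r3 r4)) (Rmin (Rmin r5 r6) (Rmin r7 r8)))%R) by apply Rmin_r.
  assert (La : (r <= Rmin (Rmin r1 r2) (Rmin r3 r4))%R) by (eapply Rle_trans; [exact Lr|apply Rmin_l]).
  assert (Lb : (r <= Rmin (Rmin r5 r6) (Rmin r7 r8))%R) by (eapply Rle_trans; [exact Lr|apply Rmin_r]).
  assert (L12 : (r <= Rmin r1 r2)%R) by (eapply Rle_trans; [exact La|apply Rmin_l]).
  assert (L34 : (r <= Rmin r3 r4)%R) by (eapply Rle_trans; [exact La|apply Rmin_r]).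
  assert (L56 : (r <= Rmin r5 r6)%R) by (eapply Rle_trans; [exact Lb|apply Rmin_l]).
  assert (L78 : (r <= Rmin r7 r8)%R) by (eapply Rle_trans; [exact Lb|apply Rmin_r]).
  assert (L1 := Rle_trans _ _ _ L12 (Rmin_l _ _)). assert (L2 := Rle_trans _ _ _ L12 (Rmin_r _ _)).
  assert (L3 := Rle_trans _ _ _ L34 (Rmin_l _ _)). assert (L4 := Rle_trans _ _ _ L34 (Rmin_r _ _)).
  assert (L5 := Rle_trans _ _ _ L56 (Rmin_l _ _)). assert (L6 := Rle_trans _ _ _ L56 (Rmin_r _ _)).
  assert (L7 := Rle_trans _ _ _ L78 (Rmin_l _ _)). assert (L8 := Rle_trans _ _ _ L78 (Rmin_r _ _)).
  clearbody r.
  set (f1 := fun t => wp (v t) - Y t). set (f2 := fun t => wpd (v t) - W t).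
  assert (Z := linear_system_zero f1 f2 (fun t => f2 t * dv t) (fun t => 6 * (wp (v t) + Y t) * f1 t * dv t) t0 r K 2
     Hr (Rlt_le _ _ HK) ltac:(lra)).
  assert (HKr : (K * r <= / 2)%R).
  { apply Rle_trans with (K * / (2 * K))%R; [apply Rmult_le_compat_l; lra|]. right. field. lra. }
  assert (F10 : f1 t0 = 0) by (unfold f1; rewrite E1; ring).
  assert (F20 : f2 t0 = 0) by (unfold f2; rewrite E2; ring).
  specialize (Z HKr F10 F20).
  exists r. split; auto. intros t Ht.
  destruct Z with (t := t) as [Z1 Z2]; auto.
  - clear t Ht. intros t Ht.
    assert (Pt : Dom t) by (apply D1; lra).
    assert (Nt : ~ inL (v t)) by (apply D2, D2'; lra).
    assert (Dt : wpd (v t) <> 0) by (apply D3, D3'; lra).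
    specialize (D4 t ltac:(lra)). specialize (D5 t ltac:(lra)). specialize (D6 t ltac:(lra)).
    specialize (D7 t ltac:(lra)). specialize (D8 t ltac:(lra)). cbv beta in D5, D8.
    assert (Bd : (Cmod (dv t) <= K1)%R).
    { assert (T := Cmod_triangle (dv t - dv t0) (dv t0)). replace (dv t - dv t0 + dv t0) with (dv t) in T by ring. unfold K1. lra. }
    assert (BY : (Cmod (Y t) <= K2)%R).
    { assert (T := Cmod_triangle (Y t - Y t0) (Y t0)). replace (Y t - Y t0 + Y t0) with (Y t) in T by ring. unfold K2. lra. }
    assert (BP : (Cmod (wp (v t)) <= K2)%R).
    { assert (T := Cmod_triangle (wp (v t) - wp (v t0)) (wp (v t0))). replace (wp (v t) - wp (v t0) + wp (v t0)) with (wp (v t)) in T by ring.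
      rewrite E1 in T at 2. unfold K2. lra. }
    assert (K1p : (1 <= K1)%R) by (unfold K1; lra). assert (K2p : (1 <= K2)%R) by (unfold K2; lra).
    repeat split.
    + unfold f1, f2. eapply Cdiff_eq; [|apply Cdiff_minus; [apply (Cdiff_comp wp v); [apply Hv; auto|apply wp_diff; auto]|apply HY; auto]]. ring.
    + unfold f1, f2. eapply Cdiff_eq; [|apply Cdiff_minus; [apply (Cdiff_comp wpd v); [apply Hv; auto|apply wpd_diff; auto]|apply HW; auto]]. ring.
    + rewrite Cmod_mult, Rmult_comm. apply Rmult_le_compat_r; [apply Cmod_ge_0|]. unfold K. nra.
    + rewrite !Cmod_mult, Cmod_R, (Rabs_pos_eq 6) by lra.
      assert (T := Cmod_triangle (wp (v t)) (Y t)). assert (A3 := Cmod_ge_0 (f1 t)). assert (A4 := Cmod_ge_0 (dv t)).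
      assert (A5 := Cmod_ge_0 (wp (v t) + Y t)).
      replace (6 * Cmod (wp (v t) + Y t) * Cmod (f1 t) * Cmod (dv t))%R with ((6 * (Cmod (wp (v t) + Y t) * Cmod (dv t))) * Cmod (f1 t))%R by ring.
      apply Rmult_le_compat_r; auto.
      assert (Cmod (wp (v t) + Y t) * Cmod (dv t) <= (2 * K2) * K1)%R by (apply Rmult_le_compat; lra).
      unfold K. nra.
    + replace (f1 t) with ((wp (v t) - wp (v t0)) + - (Y t - Y t0)) by (unfold f1; rewrite E1; ring).
      eapply Rle_trans; [apply Cmod_triangle|]. rewrite Cmod_opp. lra.
    + replace (f2 t) with ((wpd (v t) - wpd (v t0)) + - (W t - W t0)) by (unfold f2; rewrite E2; ring).
      eapply Rle_trans; [apply Cmod_triangle|]. rewrite Cmod_opp. lra.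
  - split; [apply D2, D2'; lra|]. unfold f1 in Z1. unfold f2 in Z2. split.
    + replace (wp (v t)) with (wp (v t) - Y t + Y t) by ring. rewrite Z1. ring.
    + replace (wpd (v t)) with (wpd (v t) - W t + W t) by ring. rewrite Z2. ring.
Qed.

Lemma limit_eq (f g : C -> C) t0 (Q : C -> Prop) : Ccont f t0 -> Ccont g t0 ->
  (forall d, (0 < d)%R -> exists t, (Cmod (t - t0) < d)%R /\ Q t) -> (forall t, Q t -> f t = g t) -> f t0 = g t0.
Proof.
  intros Hf Hg Hz E. apply NNPP. intros Hne. assert (Hp := Cmod_pos _ (C_sub_neq _ _ Hne)). set (e := Cmod (f t0 - g t0)) in *.
  destruct (Hf (e / 2)%R ltac:(lra)) as (d1 & Hd1 & D1). destruct (Hg (e / 2)%R ltac:(lra)) as (d2 & Hd2 & D2).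
  destruct (Hz (Rmin d1 d2)) as (t & Ht & Qt); [now apply Rmin_glb_lt|].
  specialize (D1 t (Rlt_le_trans _ _ _ Ht (Rmin_l _ _))). specialize (D2 t (Rlt_le_trans _ _ _ Ht (Rmin_r _ _))).
  rewrite (E t Qt) in D1. assert (T := Cmod_triangle (- (g t - f t0)) (g t - g t0)). rewrite Cmod_opp in T.
  replace (- (g t - f t0) + (g t - g t0)) with (f t0 - g t0) in T by ring. fold e in T. lra.
Qed.

(** [Y] stays bounded near [t0], so [v t0] is not a pole of [wp]; then both equalities pass to the
    limit by continuity. *)
Lemma matches_closed t0 : Dom t0 ->
  (forall d, (0 < d)%R -> exists t, (Cmod (t - t0) < d)%R /\ matches t) -> matches t0.
Proof.
  intros Ht0 Hz.
  assert (Hvc : Ccont v t0) by (eapply Cdiff_cont, Hv, Ht0).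
  assert (HYc : Ccont Y t0) by (eapply Cdiff_cont, HY, Ht0).
  assert (HWc : Ccont W t0) by (eapply Cdiff_cont, HW, Ht0).
  assert (Hn : ~ inL (v t0)).
  { intros Hin. destruct (wp_pole w1 w2 Hind (v t0) (Cmod (Y t0) + 1) Hin) as (e & He & Hp).
    destruct (Hvc e He) as (d1 & Hd1 & D1). destruct (HYc 1%R ltac:(lra)) as (d2 & Hd2 & D2).
    destruct (Hz (Rmin d1 d2)) as (t & Ht & Hn & E1 & _); [now apply Rmin_glb_lt|].
    specialize (D1 t (Rlt_le_trans _ _ _ Ht (Rmin_l _ _))). specialize (D2 t (Rlt_le_trans _ _ _ Ht (Rmin_r _ _))).
    assert (Hne : v t <> v t0) by (intros E; apply Hn; now rewrite E).
    specialize (Hp (v t) Hne D1). rewrite E1 in Hp.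
    assert (T := Cmod_triangle (Y t - Y t0) (Y t0)). replace (Y t - Y t0 + Y t0) with (Y t) in T by ring. lra. }
  split; auto. split.
  - apply (limit_eq (fun t => wp (v t)) Y t0 matches); auto.
    + apply Ccont_comp; auto using wp_cont.
    + intros t (_ & E & _). exact E.
  - apply (limit_eq (fun t => wpd (v t)) W t0 matches); auto.
    + apply Ccont_comp; auto using wpd_cont.
    + intros t (_ & _ & E). exact E.
Qed.

Lemma matches_segment a b : (forall s, (0 <= s <= 1)%R -> Dom (seg a b s) /\ W (seg a b s) <> 0) ->
  matches a -> matches b.
Proof.
  intros H Ha. rewrite <- (seg_1 a b). apply (real_induction (fun s => matches (seg a b s))).
  - now rewrite seg_0.
  - intros s Hs Hlt. apply matches_closed; [apply H; lra|]. intros d Hd.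
    assert (A1 := Cmod_ge_0 (b - a)).
    set (e := Rmin s (d / (Cmod (b - a) + 1))). assert (He : (0 < e)%R) by (apply Rmin_glb_lt; [lra|]; apply Rdiv_lt_0_compat; lra).
    assert (E1 : (e <= s)%R) by apply Rmin_l. assert (E2 : (e <= d / (Cmod (b - a) + 1))%R) by apply Rmin_r.
    exists (seg a b (s - e / 2)). split; [|apply Hlt; lra].
    rewrite seg_dist. replace (s - e / 2 - s)%R with (- (e / 2))%R by ring. rewrite Rabs_Ropp, Rabs_pos_eq by lra.
    apply Rmult_le_compat_r with (r := (Cmod (b - a) + 1)%R) in E2; [|lra].
    replace (d / (Cmod (b - a) + 1) * (Cmod (b - a) + 1))%R with d in E2 by (field; lra). nra.
  - intros s Hs Hle. destruct (matches_open (seg a b s)) as (r & Hr & Hr'); [apply H; lra|apply Hle; lra|apply H; lra|].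
    assert (A1 := Cmod_ge_0 (b - a)).
    exists (r / (Cmod (b - a) + 1))%R. split; [apply Rdiv_lt_0_compat; lra|]. intros x Hx _. apply Hr'.
    rewrite seg_dist, Rabs_pos_eq by lra.
    assert (Hx' : (x - s < r / (Cmod (b - a) + 1))%R) by lra.
    apply Rmult_lt_compat_r with (r := (Cmod (b - a) + 1)%R) in Hx'; [|lra].
    replace (r / (Cmod (b - a) + 1) * (Cmod (b - a) + 1))%R with r in Hx' by (field; lra). nra.
Qed.

Hypothesis HW_isolated : forall t, Dom t -> exists r, (0 < r)%R /\ forall s, s <> t -> (Cmod (s - t) < r)%R -> W s <> 0.

(* Two points of a punctured disc are joined by one or two segments avoiding the centre. *)
Lemma matches_punctured t0 r t1 t2 : (forall t, (Cmod (t - t0) < r)%R -> Dom t /\ (t <> t0 -> W t <> 0)) ->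
  (Cmod (t1 - t0) < r)%R -> (Cmod (t2 - t0) < r)%R -> t1 <> t0 -> t2 <> t0 -> matches t1 -> matches t2.
Proof.
  intros H H1 H2 N1 N2 M1.
  assert (Go : forall a b, (Cmod (a - t0) < r)%R -> (Cmod (b - t0) < r)%R ->
    (forall s, (0 <= s <= 1)%R -> seg a b s <> t0) -> matches a -> matches b).
  { intros a b Ha Hb Hs. apply matches_segment. intros s Hs'. destruct (H (seg a b s)) as [D1 D2]; [now apply seg_convex|]. auto. }
  destruct (classic (exists s, (0 <= s <= 1)%R /\ seg t1 t2 s = t0)) as [(s & Hs & E)|Hne].
  2:{ apply (Go t1 t2); auto. intros s Hs E. apply Hne. now exists s. }
  set (x := t1 - t0). assert (Hx : x <> 0) by now apply C_sub_neq.
  assert (Hs0 : (s <> 0)%R) by (intros ->; rewrite seg_0 in E; auto).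
  assert (Hs1 : (s <> 1)%R) by (intros ->; rewrite seg_1 in E; auto).
  assert (E2 : t2 - t0 = RtoC (- ((1 - s) / s)) * x).
  { unfold seg in E. unfold x. rewrite RtoC_opp, RtoC_div, RtoC_minus by auto.
    assert (Hc : RtoC s <> 0) by now apply C_RtoC_neq.
    apply (C_eq_cancel (RtoC s)); auto. rewrite <- E. field. auto. }
  set (l := ((1 - s) / s)%R) in *. assert (Hl : (0 < l)%R) by (apply Rdiv_lt_0_compat; lra).
  (* Here [t0] lies between [t1] and [t2]; the detour leaves their line at right angles. *)
  set (m := t0 + Ci * x).
  assert (Hm : (Cmod (m - t0) < r)%R).
  { unfold m. replace (t0 + Ci * x - t0) with (Ci * x) by ring. rewrite Cmod_mult, Cmod_Ci, Rmult_1_l. exact H1. }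
  assert (Key : forall p q : R, (p <> 0%R \/ q <> 0%R) -> (RtoC p + RtoC q * Ci) * x <> 0).
  { intros p q Hpq. apply Cmult_neq_0; auto. intros E0.
    assert (Ep := f_equal Re E0). assert (Eq := f_equal Im E0). unfold Re, Im, Cplus, Cmult, RtoC, Ci in Ep, Eq; simpl in Ep, Eq.
    destruct Hpq as [Hp|Hp]; apply Hp; lra. }
  apply (Go m t2); auto.
  - intros y Hy E0. apply (Key (- (y * l))%R (1 - y)%R).
    + destruct (Req_dec y 1) as [->|]; [left|right]; lra.
    + transitivity (seg m t2 y - t0); [|rewrite E0; ring].
      unfold seg, m. replace t2 with (t0 + RtoC (- l) * x) by (rewrite <- E2; ring).
      rewrite RtoC_minus, RtoC_opp, RtoC_opp, RtoC_mult. ring.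
  - apply (Go t1 m); auto. intros y Hy E0. apply (Key (1 - y)%R y).
    + destruct (Req_dec y 1) as [->|]; [right|left]; lra.
    + transitivity (seg t1 m y - t0); [|rewrite E0; ring].
      unfold seg, m. replace t1 with (t0 + x) by (unfold x; ring). rewrite RtoC_minus. ring.
Qed.

(** The induction carries a disc, not a point. At a zero of [W] some nearby point already matches;
    it transports the property to the whole punctured disc, and the centre follows by
    [matches_closed]. *)
Lemma matches_propagate a b : (forall s, (0 <= s <= 1)%R -> Dom (seg a b s)) ->
  (exists r, (0 < r)%R /\ forall t, (Cmod (t - a) < r)%R -> matches t) -> matches b.
Proof.
  intros HD Ha.
  assert (Hb : exists r, (0 < r)%R /\ forall t, (Cmod (t - b) < r)%R -> matches t).
  2:{ destruct Hb as (r & Hr & H). apply H. rewrite Cmod_sub_0; auto. }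
  rewrite <- (seg_1 a b).
  apply (real_induction (fun s => exists r, (0 < r)%R /\ forall t, (Cmod (t - seg a b s) < r)%R -> matches t)).
  - now rewrite seg_0.
  - intros s Hs Hlt. set (t0 := seg a b s). assert (Pt : Dom t0) by (apply HD; lra).
    destruct (Dom_open t0 Pt) as (r1 & Hr1 & D1). destruct (HW_isolated t0 Pt) as (r2 & Hr2 & D2).
    set (r := Rmin r1 r2). assert (Hr : (0 < r)%R) by now apply Rmin_glb_lt.
    assert (L1 : (r <= r1)%R) by apply Rmin_l. assert (L2 : (r <= r2)%R) by apply Rmin_r.
    assert (H : forall t, (Cmod (t - t0) < r)%R -> Dom t /\ (t <> t0 -> W t <> 0)).
    { intros t Ht. split; [apply D1; lra|]. intros Hne. apply D2; auto. lra. }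
    assert (A1 := Cmod_ge_0 (b - a)).
    assert (Hex : exists t1, (Cmod (t1 - t0) < r)%R /\ t1 <> t0 /\ matches t1).
    { set (e := Rmin s (r / (Cmod (b - a) + 1))). assert (He : (0 < e)%R) by (apply Rmin_glb_lt; [lra|]; apply Rdiv_lt_0_compat; lra).
      assert (E1 : (e <= s)%R) by apply Rmin_l. assert (E2 : (e <= r / (Cmod (b - a) + 1))%R) by apply Rmin_r.
      destruct (Hlt (s - e / 2)%R ltac:(lra)) as (q & Hq & Hm). set (c := seg a b (s - e / 2)) in *.
      assert (Hc : (Cmod (c - t0) < r)%R).
      { unfold c, t0. rewrite seg_dist. replace (s - e / 2 - s)%R with (- (e / 2))%R by ring. rewrite Rabs_Ropp, Rabs_pos_eq by lra.
        apply Rmult_le_compat_r with (r := (Cmod (b - a) + 1)%R) in E2; [|lra].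
        replace (r / (Cmod (b - a) + 1) * (Cmod (b - a) + 1))%R with r in E2 by (field; lra). nra. }
      destruct (classic (c = t0)) as [Ec|Nc].
      - exists (t0 + RtoC (Rmin q r / 2)). assert (Hqr : (0 < Rmin q r)%R) by now apply Rmin_glb_lt.
        assert (B1 := Rmin_l q r). assert (B2 := Rmin_r q r).
        assert (Ed : t0 + RtoC (Rmin q r / 2) - t0 = RtoC (Rmin q r / 2)) by ring.
        split; [|split].
        + rewrite Ed, Cmod_R, Rabs_pos_eq; lra.
        + intros E0. rewrite E0 in Ed. replace (t0 - t0) with (RtoC 0) in Ed by ring. apply RtoC_inj in Ed. lra.
        + apply Hm. rewrite Ec, Ed, Cmod_R, Rabs_pos_eq; lra.
      - exists c. repeat split; auto; apply Hm; rewrite Cmod_sub_0; auto. }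
    destruct Hex as (t1 & Ht1 & N1 & M1).
    assert (Hp : forall t, (Cmod (t - t0) < r)%R -> t <> t0 -> matches t).
    { intros t Ht Nt. exact (matches_punctured t0 r t1 t H Ht1 Ht N1 Nt M1). }
    exists r. split; auto. intros t Ht. destruct (classic (t = t0)) as [->|Nt]; auto.
    apply matches_closed; auto. intros d Hd.
    assert (Hdr : (0 < Rmin d r)%R) by now apply Rmin_glb_lt.
    assert (B1 := Rmin_l d r). assert (B2 := Rmin_r d r).
    assert (Ed : t0 + RtoC (Rmin d r / 2) - t0 = RtoC (Rmin d r / 2)) by ring.
    exists (t0 + RtoC (Rmin d r / 2)). split; [rewrite Ed, Cmod_R, Rabs_pos_eq; lra|]. apply Hp.
    + rewrite Ed, Cmod_R, Rabs_pos_eq; lra.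
    + intros E0. rewrite E0 in Ed. replace (t0 - t0) with (RtoC 0) in Ed by ring. apply RtoC_inj in Ed. lra.
  - intros s Hs Hle. destruct (Hle s ltac:(lra)) as (r & Hr & Hm). assert (A1 := Cmod_ge_0 (b - a)).
    exists (r / 2 / (Cmod (b - a) + 1))%R. split; [apply Rdiv_lt_0_compat; lra|]. intros x Hx _.
    exists (r / 2)%R. split; [lra|]. intros t Ht. apply Hm.
    replace (t - seg a b s) with ((t - seg a b x) + (seg a b x - seg a b s)) by ring.
    eapply Rle_lt_trans; [apply Cmod_triangle|]. rewrite seg_dist, Rabs_pos_eq by lra.
    assert (Hx' : (x - s < r / 2 / (Cmod (b - a) + 1))%R) by lra.
    apply Rmult_lt_compat_r with (r := (Cmod (b - a) + 1)%R) in Hx'; [|lra].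
    replace (r / 2 / (Cmod (b - a) + 1) * (Cmod (b - a) + 1))%R with (r / 2)%R in Hx' by (field; lra). nra.
Qed.
End Propagation.
End Weierstrass.

(** * The inverse of the Weierstrass function near its pole *)

(** The coefficients of [(1 - x)^(-1/2)]. As [(1/6)_n / (7/6)_n = 1 / (6 n + 1)], division by
    [6 n + 1] gives the hypergeometric series of the theorem. *)
Definition binom_half : fps := fun n => pochhammer (1 / 2) n / INR (fact n).
Definition hyp_coef : fps := fun n => binom_half n / (6 * INR n + 1).

Lemma INR_S_C n : RtoC (INR (S n)) = INR n + 1.
Proof. now rewrite S_INR, RtoC_plus. Qed.

Lemma INR_S_neq n : RtoC (INR n) + 1 <> 0.
Proof. rewrite <- INR_S_C. apply C_RtoC_neq, not_0_INR. lia. Qed.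

Lemma six_INR_neq n : 6 * RtoC (INR n) + 1 <> 0.
Proof. rewrite <- RtoC_mult, <- RtoC_plus. apply C_RtoC_neq. assert (H := pos_INR n). lra. Qed.

Lemma binom_half_S n : 2 * (INR n + 1) * binom_half (S n) = (2 * INR n + 1) * binom_half n.
Proof.
  unfold binom_half, pochhammer. simpl Cprod. rewrite fact_simpl, mult_INR, RtoC_mult, INR_S_C.
  assert (H := INR_S_neq n). assert (H2 := INR_fact_C n). field. auto.
Qed.

Lemma binom_half_bound n : (Cmod (binom_half n) <= 1)%R.
Proof.
  induction n as [|n IH].
  - unfold binom_half, pochhammer. simpl. replace (1 / 1) with (RtoC 1) by (field; apply C_RtoC_neq; lra).
    rewrite Cmod_1. lra.
  - assert (E := f_equal Cmod (binom_half_S n)). rewrite !Cmod_mult in E.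
    rewrite <- RtoC_mult, <- !RtoC_plus, !Cmod_R in E. assert (Hn := pos_INR n).
    rewrite !Rabs_pos_eq in E by lra. assert (H1 := Cmod_ge_0 (binom_half (S n))). nra.
Qed.

Lemma rad1_binom_half : rad1 binom_half.
Proof. apply (rad1_bounded _ 1), binom_half_bound. Qed.

Lemma rad1_hyp_coef : rad1 hyp_coef.
Proof.
  apply (rad1_bounded _ 1). intros n. unfold hyp_coef. assert (H := binom_half_bound n).
  rewrite Cmod_div by apply six_INR_neq. rewrite <- RtoC_mult, <- RtoC_plus, Cmod_R. assert (Hn := pos_INR n).
  rewrite Rabs_pos_eq by lra. apply Rmult_le_reg_r with (6 * INR n + 1)%R; [lra|].
  unfold Rdiv. rewrite Rmult_assoc, Rinv_l by lra. lra.
Qed.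

Lemma pochhammer_neq_0 (a : R) n : (0 < a)%R -> pochhammer a n <> 0.
Proof.
  intros Ha. unfold pochhammer. induction n; simpl Cprod; [apply C_RtoC_neq; lra|].
  apply Cmult_neq_0; auto. rewrite <- RtoC_plus. apply C_RtoC_neq. assert (H := pos_INR n). lra.
Qed.

Lemma C_frac (a b : R) : (b <> 0)%R -> RtoC a / RtoC b = RtoC (a / b).
Proof. intros. now rewrite RtoC_div. Qed.

Lemma pochhammer_ratio n : pochhammer (7 / 6) n = (6 * INR n + 1) * pochhammer (1 / 6) n.
Proof.
  unfold pochhammer. induction n as [|n IH]; simpl Cprod; [simpl; ring|]. rewrite IH, INR_S_C. field.
Qed.

Lemma hyp2F1_ev x : (Cmod x < 1)%R -> hyp2F1 (1 / 2) (1 / 6) (7 / 6) x = ev hyp_coef x.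
Proof.
  intros Hx. assert (H := ev_Cser _ _ rad1_hyp_coef Hx). unfold hyp2F1. apply C_lim_seq_unique.
  apply (Clim_ext (fun n => Csum (fun n => hyp_coef n * x ^ n) (n + 1))); [|now apply Clim_shift].
  intros n. rewrite Nat.add_1_r, <- sum_n_Csum. apply sum_n_ext. intros k.
  unfold hyp_coef, binom_half. rewrite pochhammer_ratio.
  assert (Hp : pochhammer (1 / 6) k <> 0).
  { replace (1 / 6) with (RtoC (1 / 6)) by (rewrite <- C_frac; auto; lra). apply pochhammer_neq_0. lra. }
  assert (H1 := six_INR_neq k). assert (H2 := INR_fact_C k). f_equal. field. auto.
Qed.

Lemma binom_half_ode : (fZ 2 * ((fZ 1 - fX) * fD binom_half) = fX * binom_half)%fps.
Proof.
  replace fX with (fmono 1) by (apply fps_ext; intros [|[|n]]; reflexivity).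
  replace (fZ 2 * ((fZ 1 - fmono 1) * fD binom_half))%fps with (fZ 2 * fD binom_half - fZ 2 * (fmono 1 * fD binom_half))%fps by ring.
  apply fps_ext. intros n. unfold fsub, fZ. rewrite !fcst_mul, !fmono_mul. unfold fD. destruct n as [|n].
  - simpl. ring.
  - replace (1 <=? S n)%nat with true by (symmetry; apply Nat.leb_le; lia).
    replace (S n - 1)%nat with n by lia. rewrite INR_S_C.
    transitivity (2 * (INR n + 1) * binom_half (S n) - 2 * INR n * binom_half n); [ring|].
    rewrite binom_half_S. ring.
Qed.

Lemma fD_const (a : fps) : fD a = fZ 0 -> a = fcst (a O).
Proof.
  intros H. apply fps_ext. intros [|n]; [reflexivity|]. apply (f_equal (fun f => f (S n))) in H.
  unfold fD, fZ, fcst in H. simpl fcst. apply (C_eq_cancel (INR (S n))); [apply C_RtoC_neq, not_0_INR; lia|]. rewrite H. ring.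
Qed.

Lemma binom_half_sq : (binom_half * binom_half * (fZ 1 - fX) = fZ 1)%fps.
Proof.
  transitivity (fcst ((binom_half * binom_half * (fZ 1 - fX))%fps O)); [apply fD_const|].
  2: { unfold fZ. f_equal. unfold fmul, fsub, fZ, fX, fcst, binom_half, pochhammer. simpl.
    field. }
  rewrite !fD_mul, fD_sub, fD_Z, fD_fX.
  transitivity (binom_half * (fZ 2 * ((fZ 1 - fX) * fD binom_half)) - fX * binom_half * binom_half)%fps; [ring|].
  rewrite binom_half_ode. ring.
Qed.

Lemma hyp_coef_ode : (fZ 6 * fD hyp_coef + hyp_coef = binom_half)%fps.
Proof.
  apply fps_ext. intros n. unfold fadd, fZ. rewrite fcst_mul. unfold fD, hyp_coef.
  assert (H := six_INR_neq n). field. auto.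
Qed.

(** This is [(1 - s^6)^(-1/2)], the derivative of [wp_inv]. With [s = z^(-1/2)] the defining formula
    of [u] reads [wp_inv s], and [dz / sqrt (4 z^3 - 4)] becomes [- ds / sqrt (1 - s^6)]. *)
Definition sqrt_kernel (s : C) : C := ev binom_half (s ^ 6).
Definition wp_inv (s : C) : C := s * ev hyp_coef (s ^ 6).

Section Disc.
Variable s : C.
Hypothesis Hs : (Cmod s < 1)%R.
Let Hs6 : (Cmod (s ^ 6) < 1)%R := pow_disc s 6 ltac:(lia) Hs.

Lemma ev_binom_sq x : (Cmod x < 1)%R -> ev binom_half x ^ 2 * (1 - x) = 1.
Proof.
  intros Hx. assert (H := f_equal (fun a => ev a x) binom_half_sq). cbv beta in H.
  rewrite !ev_mul, ev_sub, !ev_Z, ev_fX in H; auto using rad1_mul, rad1_sub, rad1_Z, rad1_fX, rad1_binom_half.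
  transitivity (ev binom_half x * ev binom_half x * (1 - x)); [ring|exact H].
Qed.

Lemma sqrt_kernel_sq : sqrt_kernel s ^ 2 * (1 - s ^ 6) = 1.
Proof. now apply ev_binom_sq. Qed.

Lemma sqrt_kernel_neq_0 : sqrt_kernel s <> 0.
Proof.
  intros E. assert (H := sqrt_kernel_sq). rewrite E in H. apply (C_RtoC_neq 1); [lra|]. rewrite <- H. ring.
Qed.

Lemma Cdiff_pow_id n : Cdiff (fun w => w ^ S n) s (INR (S n) * s ^ n).
Proof.
  eapply Cdiff_eq; [|apply (Cdiff_pow (fun w => w)), Cdiff_id]. ring.
Qed.

Lemma sqrt_kernel_diff : Cdiff sqrt_kernel s (3 * s ^ 5 * sqrt_kernel s ^ 3).
Proof.
  eapply Cdiff_eq; [|apply (Cdiff_comp (ev binom_half) (fun w => w ^ 6)); [apply Cdiff_pow_id|apply ev_diff; auto using rad1_binom_half]].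
  assert (H := f_equal (fun a => ev a (s ^ 6)) binom_half_ode). cbv beta in H.
  rewrite !ev_mul, ev_sub, ev_fD, !ev_Z, ev_fX in H;
    auto using rad1_mul, rad1_sub, rad1_Z, rad1_fX, rad1_binom_half, rad1_fD.
  assert (H2 := sqrt_kernel_sq). fold (sqrt_kernel s) in *. unfold sqrt_kernel in H2 at 1. fold (sqrt_kernel s) in *.
  set (b := ev binom_half (s ^ 6)) in *. set (d := ev (fderiv binom_half) (s ^ 6)) in *.
  change (sqrt_kernel s) with b in *.
  replace (RtoC (INR 6)) with (RtoC 6) by (apply f_equal; simpl; lra).
  destruct (classic (s = 0)) as [->|Hn]; [simpl; ring|].
  apply (C_eq_cancel (2 * (s ^ 6 * (1 - s ^ 6)))).
  - apply Cmult_neq_0; [apply C_RtoC_neq; lra|]. apply Cmult_neq_0; [now apply Cpow_nz|].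
    intros E. rewrite E in H2. apply (C_RtoC_neq 1); [lra|]. transitivity (b ^ 2 * 0); [now symmetry|ring].
  - transitivity (6 * s ^ 5 * (2 * ((1 - s ^ 6) * (s ^ 6 * d)))); [ring|]. rewrite H.
    transitivity (6 * s ^ 11 * b * (b ^ 2 * (1 - s ^ 6))); [rewrite H2|]; ring.
Qed.

Lemma wp_inv_diff : Cdiff wp_inv s (sqrt_kernel s).
Proof.
  eapply Cdiff_eq; [|apply Cdiff_mult; [apply Cdiff_id|apply (Cdiff_comp (ev hyp_coef) (fun w => w ^ 6)); [apply Cdiff_pow_id|apply ev_diff; auto using rad1_hyp_coef]]].
  assert (H := f_equal (fun a => ev a (s ^ 6)) hyp_coef_ode). cbv beta in H.
  rewrite ev_add, ev_mul, ev_fD, !ev_Z in H; auto using rad1_mul, rad1_Z, rad1_hyp_coef, rad1_fD.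
  unfold sqrt_kernel. rewrite <- H. replace (RtoC (INR 6)) with (RtoC 6) by (apply f_equal; simpl; lra). ring.
Qed.
End Disc.

Lemma sqrt_kernel_0 : sqrt_kernel 0 = 1.
Proof.
  unfold sqrt_kernel. replace (0 ^ 6) with (RtoC 0) by (simpl; ring). rewrite ev_0 by apply rad1_binom_half.
  unfold binom_half, pochhammer. simpl. field.
Qed.

Lemma sq_eq_1 (x : C) : x * x = 1 -> x = 1 \/ x = -1.
Proof.
  intros H. destruct (classic (x - 1 = 0)) as [E|E].
  - left. transitivity (x - 1 + 1); [ring|]. rewrite E. ring.
  - right. apply (C_eq_cancel (x - 1)); auto. transitivity (x * x - x); [ring|]. rewrite H. ring.
Qed.

(** The derivative is 1 or -1 at each point of the segment, and the Darboux property forbids a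
    change. *)
Lemma unit_derivative_segment (f df : C -> C) a b : a <> b ->
  (forall s, (0 <= s <= 1)%R -> Cdiff f (seg a b s) (df (seg a b s)) /\ df (seg a b s) * df (seg a b s) = 1) ->
  exists e : C, (e = 1 \/ e = -1) /\ f b - f a = e * (b - a).
Proof.
  intros Hab H. assert (Hne : b - a <> 0) by (apply C_sub_neq; auto).
  set (e := df (seg a b 0)). assert (Ee : e * e = 1) by (apply H; lra).
  exists e. split; [now apply sq_eq_1|].
  assert (Hc : forall s, (0 <= s <= 1)%R -> df (seg a b s) = e).
  { intros s Hs. destruct (H s Hs) as [_ E].
    assert (Hpm : forall x, (0 <= x <= 1)%R -> e * df (seg a b x) = 1 \/ e * df (seg a b x) = -1).
    { intros x Hx. apply sq_eq_1. destruct (H x Hx) as [_ Ex].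
      transitivity (e * e * (df (seg a b x) * df (seg a b x))); [ring|]. rewrite Ee, Ex. ring. }
    destruct (Hpm s Hs) as [E1|E1].
    - transitivity (e * e * df (seg a b s)); [rewrite Ee; ring|].
      transitivity (e * (e * df (seg a b s))); [ring|]. rewrite E1. ring.
    - exfalso. assert (H0 : (0 < s)%R).
      { destruct (Rle_lt_or_eq_dec 0 s (proj1 Hs)) as [|E0]; auto. subst s. fold e in E1. rewrite Ee in E1.
        apply (f_equal Re) in E1. simpl in E1. lra. }
      destruct (darboux (fun x => Re (e / (b - a) * f (seg a b x))) (fun x => Re (e * df (seg a b x))) 0 s H0) as (c & Hc1 & Hc2).
      + intros x Hx. replace (e * df (seg a b x)) with (e / (b - a) * (df (seg a b x) * (b - a))) by (field; auto).
        apply Cdiff_seg, H. lra.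
      + fold e. rewrite Ee. simpl. lra.
      + rewrite E1. simpl. lra.
      + destruct (Hpm c) as [Y|Y]; [lra| |]; rewrite Y in Hc2; simpl in Hc2; lra. }
  assert (T := zero_derivative (fun w => f w - e * w) a b). cbv beta in T.
  transitivity (f b - e * b - (f a - e * a) + e * (b - a)); [ring|]. rewrite T; [ring|].
  intros s Hs. eapply Cdiff_eq; [|apply Cdiff_minus; [apply (proj1 (H s Hs))|apply Cdiff_scal, Cdiff_id]].
  rewrite (Hc s Hs). ring.
Qed.

Lemma wp_inv_near_0 : exists r, (0 < r < 1)%R /\ forall s : C, (Cmod s < r)%R ->
  (Cmod (sqrt_kernel s - 1) < / 10)%R /\ (Cmod (ev hyp_coef (s ^ 6) - 1) < / 10)%R.
Proof.
  assert (H0 : (Cmod 0 < 1)%R) by (rewrite Cmod_0; lra).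
  assert (E6 : 0 ^ 6 = 0) by (simpl; ring).
  assert (C1 : Ccont sqrt_kernel 0) by (eapply Cdiff_cont, sqrt_kernel_diff, H0).
  assert (C2 : Ccont (fun s => ev hyp_coef (s ^ 6)) 0).
  { apply (Ccont_comp (ev hyp_coef) (fun s => s ^ 6)); [eapply Cdiff_cont, Cdiff_pow_id|].
    rewrite E6. eapply Cdiff_cont, ev_diff; auto using rad1_hyp_coef. }
  assert (E2 : ev hyp_coef (0 ^ 6) = 1).
  { rewrite E6, ev_0 by apply rad1_hyp_coef. unfold hyp_coef, binom_half, pochhammer. simpl. field. }
  destruct (C1 (/ 10)%R ltac:(lra)) as (r1 & Hr1 & D1). destruct (C2 (/ 10)%R ltac:(lra)) as (r2 & Hr2 & D2).
  rewrite sqrt_kernel_0 in D1. rewrite E2 in D2.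
  exists (Rmin (/ 2) (Rmin r1 r2)). split.
  - split; [repeat apply Rmin_glb_lt; lra|]. eapply Rle_lt_trans; [apply Rmin_l|lra].
  - intros s Hs. assert (A1 := Rlt_le_trans _ _ _ Hs (Rmin_r _ _)).
    assert (B1 := Rmin_l r1 r2). assert (B2 := Rmin_r r1 r2).
    split; [apply D1|apply D2]; replace (s - 0) with s by ring; lra.
Qed.

(** [wp_inv] differs from the identity by a map whose derivative is at most 1/10 in modulus. *)
Lemma wp_inv_injective r a b : (r <= 1)%R ->
  (forall s : C, (Cmod s < r)%R -> (Cmod (sqrt_kernel s - 1) < / 10)%R) ->
  (Cmod a < r)%R -> (Cmod b < r)%R -> wp_inv a = wp_inv b -> a = b.
Proof.
  intros Hr H Ha Hb E.
  assert (T := mean_value (fun s => wp_inv s - s) (fun s => sqrt_kernel s - 1) a b (/ 10) ltac:(lra)).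
  cbv beta in T. rewrite E in T. replace (wp_inv b - b - (wp_inv b - a)) with (- (b - a)) in T by ring.
  rewrite Cmod_opp in T. apply NNPP. intros Hn. assert (Hp := Cmod_pos (b - a) ltac:(apply C_sub_neq; auto)).
  assert (Cmod (b - a) <= / 10 * Cmod (b - a))%R; [|lra]. apply T.
  intros s Hs. assert (Hd : (Cmod (seg a b s) < r)%R).
  { replace (seg a b s) with (seg a b s - 0) by ring. apply seg_convex; auto;
    [replace (a - 0) with a by ring|replace (b - 0) with b by ring]; auto. }
  split; [|left; now apply H]. apply Cdiff_minus; [apply wp_inv_diff; lra|apply Cdiff_id].
Qed.

(* [k = h^(-1/2)] satisfies [k'^2 = 1 - k^6], so [wp_inv o k] has derivative [+-1]; its expansion at the
   pole forces it to be the identity. *)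
Lemma pole_uniformizer (h dh Q : C -> C) d0 rho : (0 < d0)%R -> (0 < rho)%R ->
  (forall v : C, v <> 0 -> (Cmod v < d0)%R -> Cdiff h v (dh v) /\ dh v ^ 2 = 4 * h v ^ 3 - 4 /\ Q v = v ^ 2 * h v) ->
  Ccont Q 0 -> Q 0 = 1 ->
  exists d, (0 < d)%R /\ forall v : C, v <> 0 -> (Cmod v < d)%R ->
    exists k : C, (Cmod k < rho)%R /\ k ^ 2 * h v = 1 /\ wp_inv k = v.
Proof.
  intros Hd0 Hrho H HQ HQ0. destruct wp_inv_near_0 as (r & Hr & Hnear).
  (* [ev binom_half (1 - Q v)] is [Q v ^ (-1/2)], so [k v ^ 2 = v^2 / Q v = 1 / h v]: a
     single-valued branch of [h^(-1/2)] near the pole. *)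
  set (k := fun v => v * ev binom_half (1 - Q v)).
  assert (Hb0 : Ccont (fun v => ev binom_half (1 - Q v)) 0).
  { apply (Ccont_comp (ev binom_half) (fun v => 1 - Q v)).
    - apply (Ccont_ext (fun v => 1 + (-1) * Q v)); [intros; ring|]. apply Ccont_plus; [apply Ccont_const|].
      apply Ccont_mult; [apply Ccont_const|auto].
    - eapply Cdiff_cont, ev_diff; [apply rad1_binom_half|]. rewrite HQ0, Cmod_sub_0. lra. }
  assert (Eb0 : ev binom_half (1 - Q 0) = 1).
  { rewrite HQ0. replace (1 - 1) with (RtoC 0) by ring. rewrite ev_0 by apply rad1_binom_half.
    unfold binom_half, pochhammer. simpl. field. }
  destruct (Hb0 (/ 10)%R ltac:(lra)) as (d1 & Hd1 & D1). destruct (HQ 1%R ltac:(lra)) as (d2 & Hd2 & D2).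
  cbv beta in D1. rewrite Eb0 in D1. rewrite HQ0 in D2.
  set (d := Rmin (Rmin d0 (Rmin d1 d2)) (Rmin (r / 2) (rho / 2))).
  assert (Hd : (0 < d)%R) by (unfold d; repeat apply Rmin_glb_lt; lra).
  assert (L1 : (d <= Rmin d0 (Rmin d1 d2))%R) by apply Rmin_l. assert (L2 : (d <= Rmin (r / 2) (rho / 2))%R) by apply Rmin_r.
  assert (L3 := Rle_trans _ _ _ L1 (Rmin_l _ _)). assert (L4 := Rle_trans _ _ _ L1 (Rmin_r _ _)).
  assert (L5 := Rle_trans _ _ _ L4 (Rmin_l _ _)). assert (L6 := Rle_trans _ _ _ L4 (Rmin_r _ _)).
  assert (L7 := Rle_trans _ _ _ L2 (Rmin_l _ _)). assert (L8 := Rle_trans _ _ _ L2 (Rmin_r _ _)).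
  clearbody d.
  assert (Hbeta : forall v : C, (Cmod v < d)%R -> (Cmod (ev binom_half (1 - Q v) - 1) < / 10)%R).
  { intros v Hv. apply D1. replace (v - 0) with v by ring. lra. }
  assert (HQ1 : forall v : C, (Cmod v < d)%R -> (Cmod (1 - Q v) < 1)%R).
  { intros v Hv. rewrite Cmod_sub_sym. apply D2. replace (v - 0) with v by ring. lra. }
  assert (Hclose : forall x : C, (Cmod (x - 1) < / 10)%R -> (Cmod x < 11 / 10)%R /\ x <> 0).
  { intros x Hx. split.
    - assert (T := Cmod_triangle (x - 1) 1). replace (x - 1 + 1) with x in T by ring. rewrite Cmod_1 in T. lra.
    - intros ->. replace (0 - 1) with (- RtoC 1) in Hx by ring. rewrite Cmod_opp, Cmod_1 in Hx. lra. }
  assert (Hk : forall v : C, (Cmod v < d)%R -> (Cmod (k v) <= 11 / 10 * Cmod v)%R).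
  { intros v Hv. unfold k. rewrite Cmod_mult. destruct (Hclose _ (Hbeta v Hv)) as [T _].
    assert (A1 := Cmod_ge_0 v). nra. }
  assert (Hkh : forall v : C, v <> 0 -> (Cmod v < d)%R -> k v ^ 2 * h v = 1).
  { intros v Hv0 Hv. destruct (H v Hv0) as (_ & _ & E); [lra|]. assert (T := ev_binom_sq _ (HQ1 v Hv)).
    transitivity (ev binom_half (1 - Q v) ^ 2 * (1 - (1 - Q v))); [|exact T]. unfold k. rewrite E. ring. }
  assert (Hk0 : forall v : C, v <> 0 -> (Cmod v < d)%R -> k v <> 0).
  { intros v Hv0 Hv. apply Cmult_neq_0; auto. now apply (Hclose _ (Hbeta v Hv)). }
  assert (Hkd : forall v : C, v <> 0 -> (Cmod v < d)%R -> exists l : C, Cdiff k v l /\ l * l = 1 - k v ^ 6).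
  { intros v Hv0 Hv. destruct (H v Hv0 ltac:(lra)) as (Hh & Esq & EQ).
    assert (Hnb : (0 < Rmin (Cmod v) (d - Cmod v))%R) by (apply Rmin_glb_lt; [now apply Cmod_pos|lra]).
    assert (Hloc : forall w : C, (Cmod (w - v) < Rmin (Cmod v) (d - Cmod v))%R -> w <> 0 /\ (Cmod w < d)%R).
    { intros w Hw. assert (M1 := Rlt_le_trans _ _ _ Hw (Rmin_l _ _)). assert (M2 := Rlt_le_trans _ _ _ Hw (Rmin_r _ _)). split.
      - intros ->. replace (0 - v) with (- v) in M1 by ring. rewrite Cmod_opp in M1. lra.
      - assert (T := Cmod_triangle (w - v) v). replace (w - v + v) with w in T by ring. lra. }
    assert (DQ : Cdiff Q v (2 * v * h v + v ^ 2 * dh v)).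
    { apply (Cdiff_ext_loc (fun w => w ^ 2 * h w) _ _ _ _ Hnb).
      - intros w Hw. destruct (Hloc w Hw) as [W1 W2]. symmetry. apply H; auto. lra.
      - eapply Cdiff_eq; [|apply Cdiff_mult; [apply (Cdiff_pow_id v 1)|exact Hh]].
        replace (RtoC (INR 2)) with (RtoC 2) by (apply f_equal; simpl; lra). ring. }
    assert (Db : Cdiff (fun w => ev binom_half (1 - Q w)) v
       (ev (fderiv binom_half) (1 - Q v) * (0 - (2 * v * h v + v ^ 2 * dh v)))).
    { apply (Cdiff_comp (ev binom_half) (fun w => 1 - Q w)); [apply Cdiff_minus; [apply Cdiff_const|exact DQ]|].
      apply ev_diff; auto using rad1_binom_half. }
    assert (Dk := Cdiff_mult _ _ _ _ _ (Cdiff_id v) Db). cbv beta in Dk. fold k in Dk.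
    match type of Dk with Cdiff _ _ ?x => set (l := x) in * end. exists l. split; [exact Dk|]. clearbody l.
    assert (D0 : Cdiff (fun w => k w ^ 2 * h w) v 0).
    { apply (Cdiff_ext_loc (fun _ => RtoC 1) _ _ _ _ Hnb); [|apply Cdiff_const].
      intros w Hw. destruct (Hloc w Hw) as [W1 W2]. symmetry. now apply Hkh. }
    assert (D1' := Cdiff_mult _ _ _ _ _ (Cdiff_pow k v l 1 Dk) Hh).
    assert (E0 := Cdiff_unique _ _ _ _ D1' D0).
    replace (RtoC (INR 2)) with (RtoC 2) in E0 by (apply f_equal; simpl; lra).
    assert (Ek := Hkh v Hv0 Hv). assert (Hkn := Hk0 v Hv0 Hv). set (x := k v) in *. set (y := h v) in *. set (y' := dh v) in *.
    assert (Ey : y = / x ^ 2) by (apply (C_eq_cancel (x ^ 2)); [now apply Cpow_nz|]; rewrite Ek; field; auto).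
    assert (E1 : y' * x ^ 3 = -2 * l).
    { transitivity (x * (2 * x ^ 1 * l * y + x ^ 2 * y') - 2 * l * (x ^ 2 * y)); [ring|]. rewrite E0, Ek. ring. }
    apply (C_eq_cancel 4); [apply C_RtoC_neq; lra|].
    transitivity ((-2 * l) * (-2 * l)); [ring|]. rewrite <- E1.
    transitivity (y' ^ 2 * x ^ 6); [ring|]. rewrite Esq, Ey. field. auto. }
  assert (Hsmall : forall v : C, (Cmod v < d)%R -> (Cmod (k v) < r)%R /\ (Cmod (k v) < rho)%R).
  { intros v Hv. assert (T := Hk v Hv). assert (A1 := Cmod_ge_0 v). split; lra. }
  set (th := fun v => wp_inv (k v)).
  assert (Hthd : forall v : C, v <> 0 -> (Cmod v < d)%R -> exists l : C, Cdiff th v l /\ l * l = 1).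
  { intros v Hv0 Hv. destruct (Hkd v Hv0 Hv) as (l & Dl & El). destruct (Hsmall v Hv) as [S1 _].
    exists (sqrt_kernel (k v) * l). split; [apply (Cdiff_comp wp_inv k); [exact Dl|apply wp_inv_diff; lra]|].
    transitivity (sqrt_kernel (k v) ^ 2 * (l * l)); [ring|]. rewrite El. apply sqrt_kernel_sq. lra. }
  assert (Hthd' : forall v : C, v <> 0 -> (Cmod v < d)%R -> Cdiff th v (C_derive th v) /\ C_derive th v * C_derive th v = 1).
  { intros v Hv0 Hv. destruct (Hthd v Hv0 Hv) as (l & Dl & El).
    rewrite (is_C_derive_unique th v l) by (now apply Cdiff_is_derive). auto. }
  assert (Hth : forall v : C, (Cmod v < d)%R -> (Cmod (th v - v) <= / 4 * Cmod v)%R).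
  { intros v Hv. destruct (Hnear (k v) (proj1 (Hsmall v Hv))) as [_ N2]. assert (N1 := Hbeta v Hv).
    unfold th, wp_inv. set (c := ev hyp_coef (k v ^ 6)) in *. unfold k. set (b := ev binom_half (1 - Q v)) in *.
    replace (v * b * c - v) with (((b - 1) * (c - 1) + ((b - 1) + (c - 1))) * v) by ring. rewrite Cmod_mult.
    apply Rmult_le_compat_r; [apply Cmod_ge_0|].
    assert (T1 := Cmod_triangle ((b - 1) * (c - 1)) (b - 1 + (c - 1))). rewrite Cmod_mult in T1.
    assert (T2 := Cmod_triangle (b - 1) (c - 1)). assert (A1 := Cmod_ge_0 (b - 1)). assert (A2 := Cmod_ge_0 (c - 1)). nra. }
  assert (Hhalf : forall v : C, Cmod (/ 2 * v) = (/ 2 * Cmod v)%R).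
  { intros v. rewrite Cmod_mult. f_equal. rewrite <- RtoC_inv by lra. rewrite Cmod_R, Rabs_pos_eq; lra. }
  (* From [v / 2] to [v] the derivative of [th] is a constant sign. The sign -1 would make the
     errors [th v - v] and [th w - w] differ by [Cmod v], against [Hth]. So halving keeps the error,
     while [Hth] sends its bound to 0. *)
  assert (Hstep : forall v : C, v <> 0 -> (Cmod v < d)%R -> th v - v = th (/ 2 * v) - / 2 * v).
  { intros v Hv0 Hv. assert (Hp := Cmod_pos v Hv0). set (w := / 2 * v).
    assert (Hw : (Cmod w < d)%R) by (unfold w; rewrite Hhalf; lra).
    assert (Hwv : v - w = w) by (unfold w; field; apply C_RtoC_neq; lra).
    assert (Hwn : w <> 0) by (apply Cmult_neq_0; auto; apply Cinv_neq_0, C_RtoC_neq; lra).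
    destruct (unit_derivative_segment th (C_derive th) w v) as (e & He & E).
    - intros E. apply Hwn. rewrite <- Hwv, E. ring.
    - intros s Hs. apply Hthd'.
      + unfold seg. rewrite Hwv. replace (w + s * w) with (RtoC (1 + s) * w) by (rewrite RtoC_plus; ring).
        apply Cmult_neq_0; auto. apply C_RtoC_neq. lra.
      + replace (seg w v s) with (seg w v s - 0) by ring. apply seg_convex; auto; [now replace (w - 0) with w by ring|now replace (v - 0) with v by ring].
    - destruct He as [He|He]; subst e.
      + transitivity (th v - th w + (th w - w) - (v - w)); [ring|]. rewrite E. ring.
      + exfalso. assert (T1 := Hth v Hv). assert (T2 := Hth w Hw). assert (Hww : Cmod w = (/ 2 * Cmod v)%R) by apply Hhalf.
        assert (T := Cmod_triangle (th v - v) (- (th w - w))). rewrite Cmod_opp in T.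
        replace (th v - v + - (th w - w)) with (- v) in T.
        * rewrite Cmod_opp in T. lra.
        * transitivity (th v - th w + (w - v)); [|ring]. rewrite E. transitivity (- (2 * (v - w))); [|ring].
          rewrite Hwv. unfold w. field. }
  exists d. split; auto. intros v Hv0 Hv. exists (k v). split; [now apply Hsmall|split; [now apply Hkh|]].
  change (th v = v). transitivity (th v - v + v); [ring|]. replace (th v - v) with (RtoC 0); [ring|]. symmetry.
  apply Cmod_eq_0, (iterate_to_zero _ (/ 4 * Cmod v)); [apply Cmod_ge_0|].
  assert (Hn : forall n, exists w : C, w <> 0 /\ (Cmod w <= Cmod v * (/ 2) ^ n)%R /\ th v - v = th w - w).
  { induction n as [|m (w & W1 & W2 & W3)].
    - exists v. simpl. repeat split; auto. lra.
    - assert (Hpm : ((/ 2) ^ m <= 1)%R) by (rewrite <- (pow1 m); apply pow_incr; lra).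
      assert (A1 := Cmod_ge_0 v).
      exists (/ 2 * w). repeat split.
      + apply Cmult_neq_0; auto. apply Cinv_neq_0, C_RtoC_neq; lra.
      + rewrite Hhalf. simpl. lra.
      + rewrite W3. apply Hstep; auto. nra. }
  intros n. destruct (Hn n) as (w & W1 & W2 & W3). rewrite W3.
  assert (Hpn : ((/ 2) ^ n <= 1)%R) by (rewrite <- (pow1 n); apply pow_incr; lra).
  assert (A1 := Cmod_ge_0 v). assert (T := Hth w ltac:(nra)). lra.
Qed.

(** * The duplication formula *)

Definition ddup (y : C) : C := (y ^ 6 - 20 * y ^ 3 - 8) / (4 * (y ^ 3 - 1) ^ 2).

Lemma four_neq : RtoC 4 <> 0.
Proof. apply C_RtoC_neq; lra. Qed.

Lemma dup_diff y : y ^ 3 - 1 <> 0 -> Cdiff dup y (ddup y).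
Proof.
  intros Hy. assert (H4 := four_neq). unfold dup.
  eapply Cdiff_eq; [|apply (Cdiff_div (fun y => y ^ 4 + 8 * y) (fun y => 4 * (y ^ 3 - 1)));
   [now apply Cmult_neq_0
   |apply Cdiff_plus; [apply Cdiff_pow_id|apply Cdiff_scal, Cdiff_id]
   |apply Cdiff_scal, Cdiff_minus; [apply Cdiff_pow_id|apply Cdiff_const]]].
  rewrite !INR_IZR_INZ. simpl Z.of_nat. unfold ddup. field. auto.
Qed.

(** The relation is [y'' = 6 y^2] for [dup Y] along the doubled argument, with [W^2] replaced by
    [4 (Y^3 - 1)] so that no choice of root enters. *)
Lemma ddup_diff y : y ^ 3 - 1 <> 0 -> exists l : C, Cdiff ddup y l /\
  2 * (y ^ 3 - 1) * l + 3 * y ^ 2 * ddup y = 12 * dup y ^ 2.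
Proof.
  intros Hy. assert (H4 := four_neq). unfold ddup.
  eexists; split; [apply (Cdiff_div (fun y => y ^ 6 - 20 * y ^ 3 - 8) (fun y => 4 * (y ^ 3 - 1) ^ 2));
   [apply Cmult_neq_0; auto; now apply Cpow_nz
   |apply Cdiff_minus; [apply Cdiff_minus; [apply Cdiff_pow_id|apply Cdiff_scal, Cdiff_pow_id]|apply Cdiff_const]
   |apply Cdiff_scal, (Cdiff_pow (fun y => y ^ 3 - 1) y (INR 3 * y ^ 2 - 0) 1), Cdiff_minus; [apply Cdiff_pow_id|apply Cdiff_const]]|].
  cbv beta. rewrite !INR_IZR_INZ. simpl Z.of_nat. unfold dup. field. auto.
Qed.

Lemma ddup_sq y : y ^ 3 - 1 <> 0 -> ddup y ^ 2 * (y ^ 3 - 1) = 4 * dup y ^ 3 - 4.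
Proof. intros Hy. assert (H4 := four_neq). unfold dup, ddup. field. auto. Qed.

Lemma simple_zero (f : C -> C) z l : Cdiff f z l -> l <> 0 -> f z = 0 ->
  exists r, (0 < r)%R /\ forall w, w <> z -> (Cmod (w - z) < r)%R -> f w <> 0.
Proof.
  intros (phi & Hc & <- & E) Hl Hz. destruct (Ccont_neq _ _ Hc Hl) as (r & Hr & H). exists r. split; auto.
  intros w Hw Hwr. rewrite E, Hz. intros E0. apply (Cmult_neq_0 (phi w) (w - z)).
  - now apply H.
  - now apply C_sub_neq.
  - rewrite <- E0. ring.
Qed.

Section Duplication.
Variables w1 w2 : C.
Hypothesis Hw : wp_invariants w1 w2 0 4.
Notation inL := (in_lattice w1 w2).
Notation wp := (wp w1 w2).
Notation wpd := (wpd w1 w2).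
Notation matches := (matches w1 w2).
Let Hind : R_independent w1 w2 := proj1 Hw.

Lemma matches_of_wp (v Y : C -> C) (W : C -> C) t d : Cdiff v t d -> d <> 0 -> Cdiff Y t (W t * d) -> ~ inL (v t) ->
  (exists r, (0 < r)%R /\ forall s, (Cmod (s - t) < r)%R -> wp (v s) = Y s) -> matches v Y W t.
Proof.
  intros Hv Hd HY Hn (r & Hr & H). split; auto. split; [apply H; rewrite Cmod_sub_0; auto|].
  apply (C_eq_cancel d); auto. rewrite (Cmult_comm d), (Cmult_comm d).
  apply (Cdiff_unique Y t); auto. apply (Cdiff_ext_loc (fun s => wp (v s)) _ _ _ r); auto.
  apply Cdiff_comp; auto. now apply wp_diff.
Qed.

Section Doubling.
Variable Dom : C -> Prop.
Variables v dv Y W : C -> C.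
Hypothesis Dom_open : forall t, Dom t -> exists r, (0 < r)%R /\ forall s, (Cmod (s - t) < r)%R -> Dom s.
Hypothesis Hv : forall t, Dom t -> Cdiff v t (dv t).
Hypothesis Hdv : forall t, Dom t -> Ccont dv t.
Hypothesis Hdv0 : forall t, Dom t -> dv t <> 0.
Hypothesis HY : forall t, Dom t -> Cdiff Y t (W t * dv t).
Hypothesis HW : forall t, Dom t -> Cdiff W t (6 * Y t ^ 2 * dv t).
Hypothesis HW0 : forall t, Dom t -> W t <> 0.
Hypothesis HWsq : forall t, Dom t -> W t ^ 2 = 4 * Y t ^ 3 - 4.

(** If [Y], [W] solve the system along [v], then [Y2], [W2] solve it along [2 v]; the division by 2
    in [W2] compensates [(2 v)' = 2 v']. *)
Definition v2 (t : C) : C := 2 * v t.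
Definition Y2 (t : C) : C := dup (Y t).
Definition W2 (t : C) : C := ddup (Y t) * W t / 2.

Lemma cube_neq t : Dom t -> Y t ^ 3 - 1 <> 0.
Proof.
  intros Ht E. apply (HW0 t Ht). assert (S2 := HWsq t Ht).
  replace (4 * Y t ^ 3 - 4) with (4 * (Y t ^ 3 - 1)) in S2 by ring. rewrite E in S2.
  apply NNPP. intros Hn. apply (Cpow_nz (W t) 2 Hn). rewrite S2. ring.
Qed.

Lemma v2_diff t : Dom t -> Cdiff v2 t (2 * dv t).
Proof. intros Ht. apply Cdiff_scal, Hv, Ht. Qed.

Lemma Y2_diff t : Dom t -> Cdiff Y2 t (W2 t * (2 * dv t)).
Proof.
  intros Ht. eapply Cdiff_eq; [|apply (Cdiff_comp dup Y); [apply HY, Ht|apply dup_diff, cube_neq, Ht]].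
  unfold W2. field.
Qed.

Lemma W2_diff t : Dom t -> Cdiff W2 t (6 * Y2 t ^ 2 * (2 * dv t)).
Proof.
  intros Ht. destruct (ddup_diff (Y t) (cube_neq t Ht)) as (l & Hl & E).
  apply (Cdiff_ext (fun t => / 2 * (ddup (Y t) * W t))); [intros; unfold W2; field|].
  eapply Cdiff_eq; [|apply Cdiff_scal, Cdiff_mult; [apply (Cdiff_comp ddup Y); [apply HY, Ht|exact Hl]|apply HW, Ht]].
  unfold Y2. transitivity (12 * dup (Y t) ^ 2 * dv t); [|ring]. rewrite <- E.
  transitivity ((l * W t ^ 2 + ddup (Y t) * (6 * Y t ^ 2)) * dv t / 2); [field|]. rewrite HWsq by auto. field.
Qed.

(* The numerator of [ddup] has simple roots, and [Y] is not stationary. *)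
Lemma W2_isolated t : Dom t -> exists r, (0 < r)%R /\ forall s, s <> t -> (Cmod (s - t) < r)%R -> W2 s <> 0.
Proof.
  intros Ht. set (p := fun s => Y s ^ 6 - 20 * Y s ^ 3 - 8).
  assert (Dp : Cdiff p t (6 * Y t ^ 2 * (Y t ^ 3 - 10) * (W t * dv t))).
  { eapply Cdiff_eq; [|apply Cdiff_minus; [apply Cdiff_minus; [apply Cdiff_pow, HY, Ht|apply Cdiff_scal, Cdiff_pow, HY, Ht]|apply Cdiff_const]].
    rewrite !INR_IZR_INZ. simpl Z.of_nat. ring. }
  assert (Hp : exists r, (0 < r)%R /\ forall s, s <> t -> (Cmod (s - t) < r)%R -> p s <> 0).
  { destruct (classic (p t = 0)) as [E|E].
    - apply (simple_zero p t _ Dp); auto.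
      apply Cmult_neq_0; [apply Cmult_neq_0; [apply Cmult_neq_0|]|apply Cmult_neq_0; auto].
      + apply C_RtoC_neq; lra.
      + apply Cpow_nz. intros E0. unfold p in E. rewrite E0 in E.
        apply (C_RtoC_neq 8); [lra|]. transitivity (- (0 ^ 6 - 20 * 0 ^ 3 - 8)); [ring|]. rewrite E. ring.
      + intros E0. assert (E1 : Y t ^ 3 = 10) by (transitivity (Y t ^ 3 - 10 + 10); [ring|]; rewrite E0; ring).
        unfold p in E. replace (Y t ^ 6) with (Y t ^ 3 * Y t ^ 3) in E by ring. rewrite E1 in E.
        apply (C_RtoC_neq 108); [lra|]. transitivity (- (10 * 10 - 20 * 10 - 8)); [ring|]. rewrite E. ring.
    - destruct (Ccont_neq p t (Cdiff_cont _ _ _ Dp) E) as (r & Hr & H). exists r. auto. }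
  destruct Hp as (r & Hr & H). destruct (Dom_open t Ht) as (r' & Hr' & H').
  exists (Rmin r r'). split; [now apply Rmin_glb_lt|]. intros s Hst Hs.
  assert (Hps := H s Hst (Rlt_le_trans _ _ _ Hs (Rmin_l _ _))). assert (Hds := H' s (Rlt_le_trans _ _ _ Hs (Rmin_r _ _))).
  assert (H4 := four_neq). assert (Hc := cube_neq s Hds).
  unfold W2, ddup, Cdiv. apply Cmult_neq_0; [apply Cmult_neq_0; [apply Cmult_neq_0; [exact Hps|]|auto]|].
  - apply Cinv_neq_0, Cmult_neq_0; auto. now apply Cpow_nz.
  - apply Cinv_neq_0, C_RtoC_neq; lra.
Qed.

Lemma doubled_propagate a b : (forall s, (0 <= s <= 1)%R -> Dom (seg a b s)) ->
  (exists r, (0 < r)%R /\ forall t, (Cmod (t - a) < r)%R -> matches v Y W t /\ matches v2 Y2 W2 t) ->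
  matches v Y W b /\ matches v2 Y2 W2 b.
Proof.
  intros HD (r & Hr & H). split.
  - apply (matches_propagate w1 w2 Hw Dom v dv Y W Dom_open Hv Hdv HY HW) with a; auto.
    + intros t Ht. destruct (Dom_open t Ht) as (r' & Hr' & H'). exists r'. auto.
    + exists r. split; auto. intros t Ht. now apply H.
  - apply (matches_propagate w1 w2 Hw Dom v2 (fun t => 2 * dv t) Y2 W2 Dom_open v2_diff) with a; auto.
    + intros t Ht. apply Ccont_mult; auto using Ccont_const.
    + exact Y2_diff.
    + exact W2_diff.
    + exact W2_isolated.
    + exists r. split; auto. intros t Ht. now apply H.
Qed.

Lemma doubled_of_wp t : Dom t -> ~ inL (v t) -> ~ inL (v2 t) ->
  (exists r, (0 < r)%R /\ forall s, (Cmod (s - t) < r)%R -> wp (v s) = Y s /\ wp (2 * v s) = dup (Y s)) ->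
  matches v Y W t /\ matches v2 Y2 W2 t.
Proof.
  intros Ht H1 H2 (r & Hr & H). split.
  - apply (matches_of_wp v Y W t (dv t)); auto. exists r. split; auto. intros s Hs. now apply H.
  - apply (matches_of_wp v2 Y2 W2 t (2 * dv t)); auto using v2_diff, Y2_diff.
    + apply Cmult_neq_0; auto. apply C_RtoC_neq; lra.
    + exists r. split; auto. intros s Hs. now apply H.
Qed.
End Doubling.

Lemma wp_limit : exists Q : C -> C, Ccont Q 0 /\ Q 0 = 1 /\ forall v : C, v <> 0 -> Q v = v ^ 2 * wp v.
Proof.
  destruct (wp_near_0 w1 w2 Hind) as (d & K & Hd & HK & H).
  exists (fun v : C => if Ceq_dec v 0 then RtoC 1 else v ^ 2 * wp v). split; [|split].
  - intros eps He. exists (Rmin (Rmin d 1) (eps / (K + 1))).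
    split; [repeat apply Rmin_glb_lt; try lra; apply Rdiv_lt_0_compat; lra|].
    intros w Hwd. replace (w - 0) with w in Hwd by ring.
    assert (M1 := Rlt_le_trans _ _ _ Hwd (Rmin_l _ _)). assert (M2 := Rlt_le_trans _ _ _ Hwd (Rmin_r _ _)).
    assert (M3 := Rlt_le_trans _ _ _ M1 (Rmin_l _ _)). assert (M4 := Rlt_le_trans _ _ _ M1 (Rmin_r _ _)).
    destruct (Ceq_dec 0 0) as [_|C0]; [|contradiction].
    destruct (Ceq_dec w 0) as [->|Hn]; [rewrite Cmod_sub_0; auto|].
    destruct (H w Hn M3) as [_ B]. replace (w ^ 2 * wp w - 1) with (w ^ 2 * (wp w - 1 / w ^ 2)) by (field; auto).
    rewrite Cmod_mult, Cmod_pow. assert (A0 := Cmod_pos w Hn). set (x := Cmod w) in *.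
    apply Rmult_lt_compat_r with (r := (K + 1)%R) in M2; [|lra].
    replace (eps / (K + 1) * (K + 1))%R with eps in M2 by (field; lra).
    assert (x ^ 2 * Cmod (wp w - 1 / w ^ 2) <= x ^ 2 * (K * x))%R by (apply Rmult_le_compat_l; auto; nra).
    assert (x ^ 2 * (K * x) <= x * K)%R; [|nra].
    replace (x ^ 2 * (K * x))%R with ((x * x) * (x * K))%R by ring.
    assert (0 <= x * K)%R by nra. assert (x * x <= 1)%R by nra. nra.
  - destruct (Ceq_dec 0 0); auto. contradiction.
  - intros v Hv. destruct (Ceq_dec v 0); auto. contradiction.
Qed.

(** The duplication formula without the addition theorem: near 0 both [wp v] and [dup (wp (v / 2))]
    behave like [v^(-2)] and satisfy [h'^2 = 4 h^3 - 4], so [pole_uniformizer] applies to both, and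
    injectivity of [wp_inv] identifies the two values of [k]. *)
Lemma wp_of_wp_inv : exists d, (0 < d)%R /\ forall s : C, s <> 0 -> (Cmod s < d)%R ->
  ~ inL (wp_inv s) /\ ~ inL (2 * wp_inv s) /\ wp (wp_inv s) = 1 / s ^ 2 /\ wp (2 * wp_inv s) = dup (1 / s ^ 2).
Proof.
  destruct (wp_near_0 w1 w2 Hind) as (dn & K & Hdn & _ & Hn).
  destruct wp_limit as (Q & HQ & HQ0 & EQ). destruct wp_inv_near_0 as (r & Hr & Hnear).
  destruct (wp_pole w1 w2 Hind 0 1) as (dp & Hdp & Hp); [exists 0%Z, 0%Z; unfold lattice_point; ring|].
  assert (Hhalf : forall v : C, Cmod (/ 2 * v) = (/ 2 * Cmod v)%R).
  { intros v. rewrite Cmod_mult. f_equal. rewrite <- RtoC_inv by lra. rewrite Cmod_R, Rabs_pos_eq; lra. }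
  assert (Hhn : forall v : C, v <> 0 -> / 2 * v <> 0).
  { intros v H0. apply Cmult_neq_0; auto. apply Cinv_neq_0, C_RtoC_neq; lra. }
  assert (Hcube : forall w : C, w <> 0 -> (Cmod w < dp)%R -> wp w ^ 3 - 1 <> 0).
  { intros w H0 Hwd E. assert (T := Hp w H0). replace (w - 0) with w in T by ring. specialize (T Hwd).
    assert (E3 : wp w ^ 3 = 1) by (transitivity (wp w ^ 3 - 1 + 1); [ring|]; rewrite E; ring).
    apply (f_equal Cmod) in E3. rewrite Cmod_pow, Cmod_1 in E3. set (x := Cmod (wp w)) in *. simpl in E3. nra. }
  destruct (pole_uniformizer wp wpd Q dn r) as (d1 & Hd1 & U1); auto; [lra| |].
  { intros v H0 Hv. destruct (Hn v H0 Hv) as [Hl _]. destruct (wp_diff w1 w2 Hw v Hl) as [D E]. repeat split; auto.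
    transitivity (wpd v * wpd v); [ring|exact E]. }
  (* [v^2 dup (wp (v / 2))] expressed through [Q], with numerator and denominator multiplied by a
     power of [v / 2] so that the formula extends continuously to 0. *)
  set (Q2 := fun v => Q (/ 2 * v) * (Q (/ 2 * v) ^ 3 + 8 * (/ 2 * v) ^ 6) / (Q (/ 2 * v) ^ 3 - (/ 2 * v) ^ 6)).
  assert (H20 : / 2 * 0 = 0) by ring.
  assert (HQh : Ccont (fun v => Q (/ 2 * v)) 0).
  { apply (Ccont_comp Q (fun v => / 2 * v)); [apply Ccont_mult; auto using Ccont_const, Ccont_id|]. now rewrite H20. }
  assert (Hv6 : Ccont (fun v => (/ 2 * v) ^ 6) 0).
  { eapply Cdiff_cont, (Cdiff_pow (fun v => / 2 * v) 0 _ 5), Cdiff_scal, Cdiff_id. }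
  assert (HQ3 : Ccont (fun v => Q (/ 2 * v) ^ 3) 0).
  { simpl. repeat apply Ccont_mult; auto using Ccont_const. }
  assert (Hden : Q (/ 2 * 0) ^ 3 - (/ 2 * 0) ^ 6 = 1) by (rewrite H20, HQ0; ring).
  destruct (pole_uniformizer (fun v => dup (wp (/ 2 * v))) (fun v => ddup (wp (/ 2 * v)) * (wpd (/ 2 * v) * / 2)) Q2
    (Rmin dn dp) r) as (d2 & Hd2 & U2); auto; [now apply Rmin_glb_lt|lra| | | |].
  { intros v H0 Hv. assert (B1 := Rmin_l dn dp). assert (B2 := Rmin_r dn dp). assert (B3 := Hhalf v).
    assert (B4 := Cmod_ge_0 v). assert (Hh0 := Hhn v H0).
    assert (Ev : v = 2 * (/ 2 * v)) by field. unfold Q2. rewrite (EQ _ Hh0). set (w := / 2 * v) in *.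
    destruct (Hn w Hh0 ltac:(lra)) as [Hl _]. destruct (wp_diff w1 w2 Hw w Hl) as [D E].
    assert (C3 := Hcube w Hh0 ltac:(lra)). split; [|split].
    - eapply Cdiff_eq; [|apply (Cdiff_comp dup (fun v => wp (/ 2 * v))); [apply (Cdiff_comp wp (fun v => / 2 * v));
        [apply Cdiff_scal, Cdiff_id|exact D]|apply dup_diff, C3]]. fold w. ring.
    - rewrite <- ddup_sq by auto. transitivity (ddup (wp w) ^ 2 * (wpd w * wpd w) / 4); [field|]. rewrite E. field.
    - rewrite Ev. unfold dup. assert (C4 : w ^ 6 * (wp w ^ 3 - 1) <> 0) by (apply Cmult_neq_0; auto; now apply Cpow_nz).
      assert (C5 : (w ^ 2 * wp w) ^ 3 - w ^ 6 <> 0) by (replace ((w ^ 2 * wp w) ^ 3 - w ^ 6) with (w ^ 6 * (wp w ^ 3 - 1)) by ring; auto).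
      field. auto. }
  { apply (Ccont_div (fun v => Q (/ 2 * v) * (Q (/ 2 * v) ^ 3 + 8 * (/ 2 * v) ^ 6)) (fun v => Q (/ 2 * v) ^ 3 - (/ 2 * v) ^ 6)).
    - rewrite Hden. apply C_RtoC_neq; lra.
    - apply Ccont_mult, Ccont_plus; auto. apply Ccont_mult; auto using Ccont_const.
    - apply (Ccont_ext (fun v => Q (/ 2 * v) ^ 3 + (-1) * (/ 2 * v) ^ 6)); [intros; ring|].
      apply Ccont_plus; auto. apply Ccont_mult; auto using Ccont_const. }
  { unfold Q2. rewrite Hden, H20, HQ0. field. }
  (* The division by 3 leaves room for [2 * wp_inv s], whose modulus is at most [11/5] of that of
     [s]. *)
  set (d := Rmin r (Rmin (Rmin dn dp) (Rmin d1 d2) / 3)).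
  assert (Hd : (0 < d)%R).
  { apply Rmin_glb_lt; [lra|]. apply Rdiv_lt_0_compat; [|lra]. repeat apply Rmin_glb_lt; auto. }
  assert (L1 : (d <= r)%R) by apply Rmin_l.
  assert (L2 : (d <= Rmin (Rmin dn dp) (Rmin d1 d2) / 3)%R) by apply Rmin_r.
  assert (L3 := Rmin_l (Rmin dn dp) (Rmin d1 d2)). assert (L4 := Rmin_r (Rmin dn dp) (Rmin d1 d2)).
  assert (L5 := Rmin_l dn dp). assert (L6 := Rmin_r dn dp). assert (L7 := Rmin_l d1 d2). assert (L8 := Rmin_r d1 d2).
  clearbody d. exists d. split; auto. intros s H0 Hs.
  set (v := wp_inv s). assert (A0 := Cmod_ge_0 s). destruct (Hnear s ltac:(lra)) as [_ N].
  assert (Hvs : (Cmod v <= 11 / 10 * Cmod s)%R /\ v <> 0).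
  { unfold v, wp_inv. set (c := ev hyp_coef (s ^ 6)) in *. split.
    - assert (T := Cmod_triangle (c - 1) 1). replace (c - 1 + 1) with c in T by ring. rewrite Cmod_1 in T.
      rewrite Cmod_mult. nra.
    - apply Cmult_neq_0; auto. intros E. rewrite E in N. replace (0 - 1) with (- RtoC 1) in N by ring.
      rewrite Cmod_opp, Cmod_1 in N. lra. }
  destruct Hvs as [Hvs Hv0].
  assert (Hinj : forall a b, (Cmod a < r)%R -> (Cmod b < r)%R -> wp_inv a = wp_inv b -> a = b).
  { intros a b. apply wp_inv_injective; [lra|]. intros x Hx. now apply Hnear. }
  assert (Hv2 : 2 * v <> 0) by (apply Cmult_neq_0; auto; apply C_RtoC_neq; lra).
  assert (Hm2 : Cmod (2 * v) = (2 * Cmod v)%R) by (rewrite Cmod_mult, Cmod_R, Rabs_pos_eq; lra).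
  destruct (U1 v Hv0 ltac:(lra)) as (k & K1 & K2 & K3).
  destruct (U1 (2 * v) Hv2 ltac:(lra)) as (k' & K1' & K2' & K3').
  destruct (U2 (2 * v) Hv2 ltac:(lra)) as (k'' & K1'' & K2'' & K3'').
  assert (Ek : k = s) by (apply Hinj; auto; lra). subst k.
  assert (Ek : k'' = k') by (apply Hinj; auto; rewrite K3'; auto). subst k''.
  split; [apply (Hn v Hv0); lra|split; [apply (Hn _ Hv2); lra|]].
  assert (Es : wp v = 1 / s ^ 2) by (apply (C_eq_cancel (s ^ 2)); [now apply Cpow_nz|]; rewrite K2; field; auto).
  split; [exact Es|]. rewrite <- Es.
  assert (Hk : k' ^ 2 <> 0).
  { intros E. rewrite E in K2'. apply (C_RtoC_neq 1); [lra|]. rewrite <- K2'. ring. }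
  apply (C_eq_cancel (k' ^ 2)); auto. rewrite K2', <- K2''. do 3 f_equal. field.
Qed.
End Duplication.

(** * From the initial germ to the whole half-plane *)

Lemma upper_half_plane_open t : upper_half_plane t ->
  exists r, (0 < r)%R /\ forall s, (Cmod (s - t) < r)%R -> upper_half_plane s.
Proof.
  intros Ht. exists (Im t). split; auto. intros s Hs. unfold upper_half_plane in *.
  assert (T := im_le_Cmod (s - t)). rewrite Im_minus in T. assert (T2 := Rle_abs (- (Im s - Im t))).
  rewrite Rabs_Ropp in T2. lra.
Qed.

Lemma upper_half_plane_convex a b s : (0 <= s <= 1)%R -> upper_half_plane a -> upper_half_plane b ->
  upper_half_plane (seg a b s).
Proof.
  unfold upper_half_plane. intros Hs Ha Hb.
  replace (Im (seg a b s)) with ((1 - s) * Im a + s * Im b)%R by (unfold seg, Im, Cplus, Cmult, Cminus, Copp, RtoC; simpl; ring).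
  destruct (Req_dec s 0) as [->|]; nra.
Qed.

Lemma punctured_disc_open d (v : C) : v <> 0 -> (Cmod v < d)%R ->
  exists r, (0 < r)%R /\ forall w : C, (Cmod (w - v) < r)%R -> w <> 0 /\ (Cmod w < d)%R.
Proof.
  intros Hv0 Hv. exists (Rmin (Cmod v) (d - Cmod v)). split; [apply Rmin_glb_lt; [now apply Cmod_pos|lra]|].
  intros w Hwv. assert (M1 := Rlt_le_trans _ _ _ Hwv (Rmin_l _ _)). assert (M2 := Rlt_le_trans _ _ _ Hwv (Rmin_r _ _)). split.
  - intros ->. replace (0 - v) with (- v) in M1 by ring. rewrite Cmod_opp in M1. lra.
  - assert (T := Cmod_triangle (w - v) v). replace (w - v + v) with w in T by ring. lra.
Qed.

Section Final.
Variables w1 w2 : C.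
Hypothesis Hw : wp_invariants w1 w2 0 4.
Notation inL := (in_lattice w1 w2).
Notation wp := (wp w1 w2).
Notation matches := (matches w1 w2).

(** The relations of [wp_of_wp_inv] are carried outwards along the radius through [s], starting at
    the small multiple [a] of [s]. *)
Lemma wp_inverse (s : C) : s <> 0 -> (Cmod s < 1)%R ->
  ~ inL (wp_inv s) /\ ~ inL (2 * wp_inv s) /\ wp (wp_inv s) = 1 / s ^ 2 /\ wp (2 * wp_inv s) = dup (1 / s ^ 2).
Proof.
  intros Hs0 Hs.
  set (Dom := fun s : C => s <> 0 /\ (Cmod s < 1)%R).
  set (Y := fun s : C => 1 / s ^ 2). set (W := fun s : C => -2 / (s ^ 3 * sqrt_kernel s)).
  assert (Dom_open : forall t, Dom t -> exists r, (0 < r)%R /\ forall s, (Cmod (s - t) < r)%R -> Dom s).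
  { intros v [Hv0 Hv]. now apply punctured_disc_open. }
  assert (Hnz : forall t, Dom t -> sqrt_kernel t <> 0) by (intros t [_ Ht]; now apply sqrt_kernel_neq_0).
  assert (HW0 : forall t, Dom t -> W t <> 0).
  { intros t Ht. unfold W, Cdiv. apply Cmult_neq_0; [apply C_RtoC_neq; lra|]. apply Cinv_neq_0, Cmult_neq_0; auto.
    apply Cpow_nz, Ht. }
  assert (HY : forall t, Dom t -> Cdiff Y t (W t * sqrt_kernel t)).
  { intros t Ht. assert (Hk := Hnz t Ht). destruct Ht as [Ht0 Ht].
    eapply Cdiff_eq; [|apply (Cdiff_div (fun _ => 1) (fun s => s ^ 2)); [now apply Cpow_nz|apply Cdiff_const|apply Cdiff_pow_id]].
    rewrite INR_IZR_INZ. simpl Z.of_nat. unfold W. field. auto. }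
  assert (HWsq : forall t, Dom t -> W t ^ 2 = 4 * Y t ^ 3 - 4).
  { intros t Ht. assert (Hk := Hnz t Ht). destruct Ht as [Ht0 Ht]. assert (E := sqrt_kernel_sq t Ht).
    unfold W, Y. apply (C_eq_cancel (t ^ 6 * sqrt_kernel t ^ 2)); [apply Cmult_neq_0; now apply Cpow_nz|].
    transitivity (4 * (sqrt_kernel t ^ 2 * (1 - t ^ 6))); [rewrite E|]; field; auto. }
  assert (HW : forall t, Dom t -> Cdiff W t (6 * Y t ^ 2 * sqrt_kernel t)).
  { intros t Ht. assert (Hk := Hnz t Ht). destruct Ht as [Ht0 Ht]. assert (E := sqrt_kernel_sq t Ht).
    eapply Cdiff_eq; [|apply (Cdiff_div (fun _ => -2) (fun s => s ^ 3 * sqrt_kernel s));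
      [apply Cmult_neq_0; auto; now apply Cpow_nz|apply Cdiff_const|apply Cdiff_mult; [apply Cdiff_pow_id|now apply sqrt_kernel_diff]]].
    rewrite INR_IZR_INZ. simpl Z.of_nat. unfold Y. set (b := sqrt_kernel t) in *.
    apply (C_eq_cancel (t ^ 4 * b)); [apply Cmult_neq_0; auto; now apply Cpow_nz|].
    transitivity (6 * (1 + b ^ 2 * t ^ 6)); [field; auto|].
    transitivity (6 * (b ^ 2 * (1 - t ^ 6) + b ^ 2 * t ^ 6)); [now rewrite E|]. field. auto. }
  destruct (wp_of_wp_inv w1 w2 Hw) as (d & Hd & Hsmall).
  assert (Hp := Cmod_pos s Hs0).
  set (x := (Rmin (/ 2) (d / 2))%R). assert (Hx : (0 < x)%R) by (apply Rmin_glb_lt; lra).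
  assert (X1 : (x <= / 2)%R) by apply Rmin_l. assert (X2 : (x <= d / 2)%R) by apply Rmin_r. clearbody x.
  set (a := RtoC x * s).
  assert (Ha : Cmod a = (x * Cmod s)%R) by (unfold a; rewrite Cmod_mult, Cmod_R, Rabs_pos_eq; lra).
  assert (Ha0 : a <> 0) by (apply Cmult_neq_0; auto; apply C_RtoC_neq; lra).
  destruct (doubled_propagate w1 w2 Hw Dom wp_inv sqrt_kernel Y W Dom_open) with (a := a) (b := s) as [M1 M2]; auto.
  - intros t [_ Ht]. now apply wp_inv_diff.
  - intros t [_ Ht]. eapply Cdiff_cont, sqrt_kernel_diff, Ht.
  - intros y Hy. unfold seg, a. replace (x * s + y * (s - x * s)) with (RtoC (x + y * (1 - x)) * s).
    2:{ rewrite RtoC_plus, RtoC_mult, RtoC_minus. ring. }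
    assert (0 < x + y * (1 - x) <= 1)%R by nra.
    split; [apply Cmult_neq_0; auto; apply C_RtoC_neq; lra|]. rewrite Cmod_mult, Cmod_R, Rabs_pos_eq by lra. nra.
  - assert (Had : (Cmod a < Rmin d 1)%R) by (apply Rmin_glb_lt; nra).
    assert (B1 := Rmin_l d 1). assert (B2 := Rmin_r d 1).
    destruct (punctured_disc_open _ a Ha0 Had) as (r & Hr & Hr'). exists r. split; auto. intros t Ht.
    destruct (Hr' t Ht) as [Ht0 Ht1]. assert (HDt : Dom t) by (split; auto; lra).
    destruct (Hsmall t Ht0) as (I1 & I2 & _); [lra|].
    apply (doubled_of_wp w1 w2 Hw Dom wp_inv sqrt_kernel Y W); auto.
    + intros t' [_ Ht']. now apply wp_inv_diff.
    + destruct (punctured_disc_open _ t Ht0 Ht1) as (r' & Hr1 & Hr2). exists r'. split; auto. intros y Hy.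
      destruct (Hr2 y Hy) as [Y1 Y2']. destruct (Hsmall y Y1) as (_ & _ & I3 & I4); [lra|]. auto.
  - destruct M1 as (N1 & E1 & _). destruct M2 as (N2 & E2 & _). auto.
Qed.

Lemma dzfun_cont t : upper_half_plane t -> Ccont dzfun t.
Proof.
  intros Ht. unfold dzfun. assert (HV := EV_fV_neq_0 t Ht).
  assert (C3 : Ccont (EV fE3) t) by (eapply Cdiff_cont, EV_diff; auto using rad1_fE3).
  assert (CV : Ccont (EV fV) t) by (eapply Cdiff_cont, EV_diff; auto using rad1_fV).
  assert (CN : Ccont nome t) by (eapply Cdiff_cont, Cdiff_Cexp_scal).
  apply Ccont_mult; [apply Ccont_const|].
  apply (Ccont_div (fun t => 9 * (nome t * EV fE3 t ^ 10)) (fun t => EV fV t ^ 2)); [now apply Cpow_nz| |].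
  - apply Ccont_mult; [apply Ccont_const|]. apply Ccont_mult; auto. simpl. repeat apply Ccont_mult; auto using Ccont_const.
  - simpl. repeat apply Ccont_mult; auto using Ccont_const.
Qed.

Section Continuation.
Variables e c : C.
Hypothesis He : e * e = 1.

Definition uH (t : C) : C := e * Gfun t + c.
Definition duH (t : C) : C := e * (kap * etaf t).
(** The quotient [dz / du], the value that [wp'] has to take at [uH t]. *)
Definition WH (t : C) : C := dzfun t / duH t.

Lemma e_neq_0 : e <> 0.
Proof. intros E. rewrite E in He. apply (C_RtoC_neq 1); [lra|]. rewrite <- He. ring. Qed.

Section At.
Variable t : C.
Hypothesis Ht : upper_half_plane t.

Lemma duH_neq_0 : duH t <> 0.
Proof. apply Cmult_neq_0; [apply e_neq_0|]. apply Cmult_neq_0; [apply kap_neq_0|now apply etaf_neq_0]. Qed.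

Lemma uH_diff : Cdiff uH t (duH t).
Proof.
  eapply Cdiff_eq; [|apply Cdiff_plus; [apply Cdiff_scal, Gfun_diff, Ht|apply Cdiff_const]]. unfold duH. ring.
Qed.

Lemma duH_diff : Cdiff duH t (e * (kap * (PI * Ci * EV fP3 t * etaf t))).
Proof. now apply Cdiff_scal, Cdiff_scal, etaf_diff. Qed.

Lemma duH_sq : duH t ^ 2 = (kap * etaf t) ^ 2.
Proof. unfold duH. transitivity (e * e * (kap * etaf t) ^ 2); [ring|]. rewrite He. ring. Qed.

Lemma WH_sq : WH t ^ 2 = 4 * zfun t ^ 3 - 4.
Proof.
  assert (Hd := duH_neq_0). unfold WH. apply (C_eq_cancel (duH t ^ 2)); [now apply Cpow_nz|].
  transitivity (dzfun t ^ 2); [field; auto|]. rewrite dzfun_sq, duH_sq by auto. ring.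
Qed.

Lemma WH_neq_0 : WH t <> 0.
Proof.
  intros E. assert (E2 := WH_sq). rewrite E in E2. apply (zfun_cube_neq t Ht).
  apply (C_eq_cancel 4); [apply four_neq|]. transitivity (4 * zfun t ^ 3 - 4); [ring|]. rewrite <- E2. ring.
Qed.

Lemma zfun_diff_WH : Cdiff zfun t (WH t * duH t).
Proof.
  eapply Cdiff_eq; [|now apply zfun_diff]. unfold WH. assert (Hd := duH_neq_0). field. auto.
Qed.

Lemma WH_cont : Ccont WH t.
Proof. apply Ccont_div; [apply duH_neq_0|now apply dzfun_cont|eapply Cdiff_cont, duH_diff]. Qed.
End At.

Lemma WH_diff t : upper_half_plane t -> Cdiff WH t (6 * zfun t ^ 2 * duH t).
Proof.
  intros Ht. assert (Hn := WH_neq_0 t Ht). destruct (upper_half_plane_open t Ht) as (r & Hr & H).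
  eapply Cdiff_eq; [|apply (Cdiff_sqrt WH t (12 * zfun t ^ 2 * (WH t * duH t)))]; auto using WH_cont.
  - field. auto.
  - apply (Cdiff_ext_loc (fun t => 4 * zfun t ^ 3 - 4) _ _ _ r); auto.
    + intros w Hwr. rewrite <- WH_sq by auto. ring.
    + eapply Cdiff_eq; [|apply Cdiff_minus; [apply Cdiff_scal, (Cdiff_pow zfun), zfun_diff_WH, Ht|apply Cdiff_const]].
      rewrite INR_IZR_INZ. simpl Z.of_nat. ring.
Qed.

(** [uH] is defined on the whole half-plane, which is convex, so the relations travel along the
    straight segment from [t0] to [t], whatever path the germ has followed. *)
Lemma wp_uH_propagate t0 t : upper_half_plane t0 -> upper_half_plane t ->
  (exists r, (0 < r)%R /\ forall s, (Cmod (s - t0) < r)%R -> ~ inL (uH s) /\ ~ inL (2 * uH s) /\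
     wp (uH s) = zfun s /\ wp (2 * uH s) = dup (zfun s)) ->
  ~ inL (2 * uH t) /\ wp (2 * uH t) = dup (zfun t).
Proof.
  intros Ht0 Ht (r & Hr & H).
  destruct (doubled_propagate w1 w2 Hw upper_half_plane uH duH zfun WH) with (a := t0) (b := t) as [_ (M1 & M2 & _)];
    auto using upper_half_plane_open, uH_diff, zfun_diff_WH, WH_diff, WH_neq_0, WH_sq, duH_neq_0.
  - intros s Hs. eapply Cdiff_cont, duH_diff, Hs.
  - intros s Hs. now apply upper_half_plane_convex.
  - destruct (upper_half_plane_open t0 Ht0) as (r' & Hr' & H').
    exists (Rmin r r'). split; [now apply Rmin_glb_lt|]. intros s Hs.
    assert (S1 := Rlt_le_trans _ _ _ Hs (Rmin_l _ _)). assert (S2 := Rlt_le_trans _ _ _ Hs (Rmin_r _ _)).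
    destruct (H s S1) as (N1 & N2 & _).
    apply (doubled_of_wp w1 w2 Hw upper_half_plane uH duH zfun WH);
      auto using upper_half_plane_open, uH_diff, zfun_diff_WH, WH_diff, WH_neq_0, WH_sq, duH_neq_0.
    exists (r - Cmod (s - t0))%R. split; [lra|]. intros y Hy. apply H.
    assert (T := Cmod_triangle (y - s) (s - t0)). replace (y - s + (s - t0)) with (y - t0) in T by ring. lra.
Qed.
End Continuation.

(** Where [|z| > 1] the root [r] has modulus below 1 and [f = wp_inv (r t)], whence
    [f'^2 = (kap * etaf)^2]. The quotient of [f'] by [kap * etaf] is a sign at each point and
    continuous at [t0], hence constant nearby. *)
Lemma initial_germ_affine (f : C -> C) t0 : upper_half_plane t0 -> initial_germ f t0 ->
  exists e c : C, e * e = 1 /\ exists r, (0 < r)%R /\ forall t, (Cmod (t - t0) < r)%R ->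
    f t = uH e c t /\ ~ inL (f t) /\ ~ inL (2 * f t) /\ wp (f t) = zfun t /\ wp (2 * f t) = dup (zfun t).
Proof.
  intros Ht0 (Hz0 & r & Hr). apply locally_C_ball in Hr. destruct Hr as (r1 & Hr1 & H1).
  assert (Hrc : forall t, (Cmod (t - t0) < r1)%R -> Ccont r t).
  { intros t Ht. destruct (H1 t Ht) as (C1 & _). intros eps Heps.
    specialize (C1 (fun y => Cmod (y - r t) < eps)%R). apply locally_C_ball. apply C1. apply locally_C_ball.
    exists eps. auto. }
  destruct (upper_half_plane_open t0 Ht0) as (r2 & Hr2 & H2).
  assert (Hzc : Ccont zfun t0) by (eapply Cdiff_cont, zfun_diff, Ht0).
  destruct (Hzc (Cmod (zfun t0) - 1)%R ltac:(lra)) as (r3 & Hr3 & H3).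
  set (rho := Rmin r1 (Rmin r2 r3)). assert (Hrho : (0 < rho)%R) by (repeat apply Rmin_glb_lt; auto).
  assert (Hall : forall t, (Cmod (t - t0) < rho)%R -> upper_half_plane t /\ (1 < Cmod (zfun t))%R /\ Ccont r t /\
     r t ^ 2 = / zfun t /\ f t = r t * hyp2F1 (1 / 2) (1 / 6) (7 / 6) (/ zfun t ^ 3)).
  { intros t Ht. assert (B1 : (rho <= r1)%R) by apply Rmin_l. assert (B2 : (rho <= Rmin r2 r3)%R) by apply Rmin_r.
    assert (B3 := Rmin_l r2 r3). assert (B4 := Rmin_r r2 r3).
    destruct (H1 t ltac:(lra)) as (_ & E1 & E2). repeat split; auto; [apply H2; lra| |apply Hrc; lra].
    assert (T3 := H3 t ltac:(lra)). rewrite Cmod_sub_sym in T3.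
    assert (T := Cmod_triangle (zfun t0 - zfun t) (zfun t)). replace (zfun t0 - zfun t + zfun t) with (zfun t0) in T by ring. lra. }
  clearbody rho. clear H1 H2 H3.
  assert (Hloc : forall t, (Cmod (t - t0) < rho)%R -> exists d, (0 < d)%R /\ forall s, (Cmod (s - t) < d)%R -> (Cmod (s - t0) < rho)%R).
  { intros t Ht. exists (rho - Cmod (t - t0))%R. split; [lra|]. intros s Hs.
    assert (T := Cmod_triangle (s - t) (t - t0)). replace (s - t + (t - t0)) with (s - t0) in T by ring. lra. }
  assert (Hr : forall t, (Cmod (t - t0) < rho)%R -> zfun t <> 0 /\ r t <> 0 /\ (Cmod (r t) < 1)%R /\ f t = wp_inv (r t)).
  { intros t Ht. destruct (Hall t Ht) as (Hu & Hz & Hc & Esq & Ef).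
    assert (Hzn : zfun t <> 0) by (intros E; rewrite E, Cmod_0 in Hz; lra).
    assert (Hrn : r t <> 0).
    { intros E. rewrite E in Esq. apply (Cinv_neq_0 _ Hzn). rewrite <- Esq. ring. }
    assert (Hr1' : (Cmod (r t) < 1)%R).
    { apply (f_equal Cmod) in Esq. rewrite Cmod_pow, Cmod_inv in Esq by auto.
      assert (/ Cmod (zfun t) < 1)%R by (rewrite <- Rinv_1; apply Rinv_lt_contravar; lra).
      apply Rnot_le_lt. intros Hle. nra. }
    repeat split; auto. rewrite Ef. unfold wp_inv. f_equal.
    replace (/ zfun t ^ 3) with (r t ^ 6).
    - apply hyp2F1_ev, pow_disc; auto. lia.
    - transitivity ((r t ^ 2) ^ 3); [ring|]. rewrite Esq. field. auto. }
  set (d := fun t => sqrt_kernel (r t) * (- dzfun t / zfun t ^ 2 / (2 * r t))).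
  assert (Hd : forall t, (Cmod (t - t0) < rho)%R -> Cdiff f t (d t) /\ d t * d t = (kap * etaf t) ^ 2).
  { intros t Ht. destruct (Hall t Ht) as (Hu & Hz & Hc & Esq & Ef). destruct (Hr t Ht) as (Hzn & Hrn & Hr1' & Ew).
    destruct (Hloc t Ht) as (dl & Hdl & Hdl'). split.
    - apply (Cdiff_ext_loc (fun s => wp_inv (r s)) _ _ _ dl); auto.
      + intros s Hs. symmetry. apply Hr. auto.
      + apply Cdiff_comp; [|now apply wp_inv_diff]. apply Cdiff_sqrt; auto.
        apply (Cdiff_ext_loc (fun s => / zfun s) _ _ _ dl); auto.
        * intros s Hs. destruct (Hall s (Hdl' s Hs)) as (_ & _ & _ & E & _). rewrite <- E. ring.
        * eapply Cdiff_eq; [|apply (Cdiff_comp (fun w => / w) zfun); [now apply zfun_diff|now apply Cdiff_inv]]. field. auto.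
    - assert (K1 := sqrt_kernel_sq _ Hr1'). assert (K2 := dzfun_sq t Hu). assert (K3 := zfun_cube_neq t Hu).
      unfold d. set (b := sqrt_kernel (r t)) in *. set (x := r t) in *. set (z := zfun t) in *.
      assert (Ex6 : x ^ 6 = / z ^ 3) by (transitivity ((x ^ 2) ^ 3); [ring|]; rewrite Esq; field; auto).
      rewrite Ex6 in K1.
      apply (C_eq_cancel (4 * x ^ 2 * z ^ 4)).
      { apply Cmult_neq_0; [apply Cmult_neq_0; [apply four_neq|]|]; now apply Cpow_nz. }
      transitivity (b ^ 2 * dzfun t ^ 2); [field; auto|]. rewrite K2, Esq.
      transitivity (4 * z ^ 3 * (b ^ 2 * (1 - / z ^ 3)) * (kap * etaf t) ^ 2); [field; auto|]. rewrite K1. field. auto. }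
  assert (Hkn : forall t, upper_half_plane t -> kap * etaf t <> 0).
  { intros t Ht. apply Cmult_neq_0; [apply kap_neq_0|now apply etaf_neq_0]. }
  assert (Ht00 : (Cmod (t0 - t0) < rho)%R) by (rewrite Cmod_sub_0; auto).
  assert (Hdc : Ccont d t0).
  { apply (derivative_sqrt_cont f d t0 rho); auto.
    - intros t Ht. now apply Hd.
    - apply (Ccont_ext_loc (fun t => (kap * etaf t) ^ 2) _ _ rho); auto.
      + intros t Ht. symmetry. now apply Hd.
      + eapply Cdiff_cont, (Cdiff_pow (fun t => kap * etaf t) t0 _ 1), Cdiff_scal, etaf_diff, Ht0.
    - intros E. assert (E2 := proj2 (Hd t0 Ht00)). rewrite E in E2. apply (Cpow_nz _ 2 (Hkn t0 Ht0)). rewrite <- E2. ring. }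
  set (q := fun t => d t / (kap * etaf t)).
  assert (Hqc : Ccont q t0).
  { apply Ccont_div; auto. eapply Cdiff_cont, Cdiff_scal, etaf_diff, Ht0. }
  assert (Hq2 : forall t, (Cmod (t - t0) < rho)%R -> q t * q t = 1).
  { intros t Ht. destruct (Hall t Ht) as (Hu & _). assert (E2 := proj2 (Hd t Ht)). assert (Hk := Hkn t Hu). unfold q.
    set (y := kap * etaf t) in *. clearbody y. transitivity (d t * d t / y ^ 2); [field; auto|]. rewrite E2. field. auto. }
  destruct (Hqc 1%R ltac:(lra)) as (r4 & Hr4 & H4).
  set (e := q t0) in *.
  assert (Hqe : forall t, (Cmod (t - t0) < Rmin rho r4)%R -> q t = e).
  { intros t Ht. assert (S1 := Rlt_le_trans _ _ _ Ht (Rmin_l _ _)). assert (S2 := Rlt_le_trans _ _ _ Ht (Rmin_r _ _)).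
    specialize (H4 t S2). fold e in H4.
    destruct (sq_eq_1 _ (Hq2 t S1)) as [E1|E1]; destruct (sq_eq_1 _ (Hq2 t0 Ht00)) as [E0|E0]; fold e in E0; rewrite E1, E0 in *; auto; exfalso.
    - replace (1 - -1) with (RtoC 2) in H4 by ring. rewrite Cmod_R, Rabs_pos_eq in H4; lra.
    - replace (-1 - 1) with (- RtoC 2) in H4 by ring. rewrite Cmod_opp, Cmod_R, Rabs_pos_eq in H4; lra. }
  exists e, (f t0 - e * Gfun t0). split; [now apply Hq2|].
  exists (Rmin rho r4). split; [now apply Rmin_glb_lt|]. intros t Ht.
  assert (S1 := Rlt_le_trans _ _ _ Ht (Rmin_l _ _)).
  split.
  - unfold uH. assert (T := zero_derivative (fun t => f t - e * Gfun t) t0 t). cbv beta in T. rewrite <- T; [ring|].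
    intros s Hs. assert (Hseg : (Cmod (seg t0 t s - t0) < Rmin rho r4)%R).
    { apply seg_convex; auto. rewrite Cmod_sub_0. now apply Rmin_glb_lt. }
    assert (Hs1 := Rlt_le_trans _ _ _ Hseg (Rmin_l _ _)). destruct (Hall _ Hs1) as (Hu & _).
    eapply Cdiff_eq; [|apply Cdiff_minus; [apply (Hd _ Hs1)|apply Cdiff_scal, Gfun_diff, Hu]].
    rewrite <- (Hqe _ Hseg). unfold q. assert (Hk := Hkn _ Hu).
    set (y := kap * etaf (seg t0 t s)) in *. clearbody y. field. auto.
  - destruct (Hr t S1) as (Hzn & Hrn & Hr1' & Ew). rewrite Ew.
    destruct (wp_inverse (r t) Hrn Hr1') as (I1 & I2 & I3 & I4).
    destruct (Hall t S1) as (_ & _ & _ & Esq & _). rewrite Esq in I3, I4.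
    replace (1 / / zfun t) with (zfun t) in I3, I4 by (field; auto). auto.
Qed.

Lemma C_derive_ball (f g : C -> C) (t : C) (r : R) :
  (forall w, (Cmod (w - t) < r)%R -> Cdiff f w (g w)) -> forall w, (Cmod (w - t) < r)%R -> C_derive f w = g w.
Proof. intros H w Hwr. apply is_C_derive_unique, Cdiff_is_derive. auto. Qed.

Lemma Cdiff_ball (f g h : C -> C) (t : C) (r : R) :
  (forall w, (Cmod (w - t) < r)%R -> f w = g w) -> (forall w, (Cmod (w - t) < r)%R -> Cdiff g w (h w)) ->
  forall w, (Cmod (w - t) < r)%R -> Cdiff f w (h w).
Proof.
  intros E H w Hwr. apply (Cdiff_ext_loc g _ _ _ (r - Cmod (w - t))%R); [lra| |auto].
  intros s Hs. symmetry. apply E.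
  assert (T := Cmod_triangle (s - w) (w - t)). replace (s - w + (w - t)) with (s - t) in T by ring. lra.
Qed.

(** The bracket is homogeneous of degree -2 in [f] and insensitive to constants, so [e * e = 1]
    removes both [e] and [c]. *)
Lemma affine_Gfun_schwarz (u : C -> C) (e c tau : C) : e * e = 1 -> upper_half_plane tau ->
  locally tau (fun w => u w = e * Gfun w + c) ->
  C_derive u tau <> 0 /\ schwarz u tau = -2 * dup (zfun tau).
Proof.
  intros He Htau Hu. apply locally_C_ball in Hu. destruct Hu as (r1 & Hr1 & H1).
  destruct (upper_half_plane_open tau Htau) as (r2 & Hr2 & H2).
  set (r := Rmin r1 r2). assert (Hr : (0 < r)%R) by now apply Rmin_glb_lt.
  assert (R1 : (r <= r1)%R) by apply Rmin_l. assert (R2 : (r <= r2)%R) by apply Rmin_r. clearbody r.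
  assert (Hup : forall w, (Cmod (w - tau) < r)%R -> upper_half_plane w) by (intros; apply H2; lra).
  assert (D1 : forall w, (Cmod (w - tau) < r)%R -> Cdiff u w (duH e w)).
  { apply (Cdiff_ball u (uH e c)); [intros; apply H1; lra|]. intros w Hwr. apply uH_diff; auto. }
  assert (E1 := C_derive_ball _ _ _ _ D1).
  assert (D2 : forall w, (Cmod (w - tau) < r)%R -> Cdiff (C_derive u) w (e * (kap * (PI * Ci * EV fP3 w * etaf w)))).
  { apply (Cdiff_ball _ (duH e)); auto. intros w Hwr. apply duH_diff; auto. }
  assert (E2 := C_derive_ball _ _ _ _ D2).
  assert (D3 : forall w, (Cmod (w - tau) < r)%R -> Cdiff (C_derive (C_derive u)) w (e * (kap * d2etaf w))).
  { apply (Cdiff_ball _ (fun w => e * (kap * (PI * Ci * EV fP3 w * etaf w)))); auto.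
    intros w Hwr. apply Cdiff_scal, Cdiff_scal, detaf_diff. auto. }
  assert (E3 := C_derive_ball _ _ _ _ D3).
  assert (H0 : (Cmod (tau - tau) < r)%R) by (rewrite Cmod_sub_0; auto).
  split; [rewrite E1 by auto; now apply duH_neq_0|].
  unfold schwarz. rewrite E1, E2, E3 by auto. rewrite <- schwarz_value by auto.
  assert (Hk := kap_neq_0). assert (Hf := etaf_neq_0 tau Htau). assert (Hen := e_neq_0 e He).
  unfold duH. set (y := PI * Ci * EV fP3 tau * etaf tau). set (y2 := d2etaf tau). set (x := etaf tau) in *.
  transitivity (y2 / (e * e * (kap ^ 2 * x ^ 3)) - 3 / 2 * (y ^ 2 / (e * e * (kap ^ 2 * x ^ 4)))); [field; auto|].
  rewrite He. field. auto.
Qed.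
End Final.

Theorem mainTheorem2 (w1 w2 : C) (Hw : wp_invariants w1 w2 0 4)
  (u : C -> C) (tau : C) (Hu : u_germ u tau) :
  C_derive u tau <> 0 /\
  ~ in_lattice w1 w2 (2 * u tau) /\
  schwarz u tau = - 2 * wp w1 w2 (2 * u tau).
Proof.
  destruct Hu as (gamma & F & Hg & HH & Hcont & Hinit & Hend & Hloc).
  assert (U0 : unit_interval 0) by (unfold unit_interval; lra). assert (U1 : unit_interval 1) by (unfold unit_interval; lra).
  destruct (initial_germ_affine w1 w2 Hw (F 0%R) (gamma 0%R) (HH _ U0) Hinit) as (e & c & He & r & Hr & H).
  assert (HG : locally (gamma 1%R) (fun w => F 1%R w = e * Gfun w + c)).
  { apply (germ_is_affine_Gfun gamma F e c); auto. apply locally_C_ball. exists r. split; auto. intros w Hwr. now apply H. }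
  rewrite Hend in HG. assert (Htau : upper_half_plane tau) by (rewrite <- Hend; now apply HH).
  assert (Hu : locally tau (fun w => u w = e * Gfun w + c)).
  { apply locally_C_ball in HG. apply locally_C_ball in Hloc. apply locally_C_ball.
    destruct HG as (r1 & Hr1 & G1). destruct Hloc as (r2 & Hr2 & G2).
    exists (Rmin r1 r2). split; [now apply Rmin_glb_lt|]. intros w Hwr.
    rewrite (G2 w (Rlt_le_trans _ _ _ Hwr (Rmin_r _ _))). apply G1, (Rlt_le_trans _ _ _ Hwr (Rmin_l _ _)). }
  destruct (affine_Gfun_schwarz u e c tau He Htau Hu) as [S1 S2].
  assert (Eu : u tau = uH e c tau).
  { apply locally_C_ball in Hu. destruct Hu as (r1 & Hr1 & G1). apply G1. rewrite Cmod_sub_0. auto. }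
  destruct (wp_uH_propagate w1 w2 Hw e c He (gamma 0%R) tau (HH _ U0) Htau) as [P1 P2].
  { exists r. split; auto. intros s Hs. destruct (H s Hs) as (E & I1 & I2 & I3 & I4). rewrite <- E. auto. }
  rewrite Eu. repeat split; auto. rewrite S2, P2. ring.
Qed.
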